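(* Let $d\ge 2$ and let $(\rho_1,p_1)$, $(\rho_2,p_2)$ be solutions of the relativistic pressureless Euler-Poisson equation, i.e. for $i=1,2$ $$\begin{cases}\partial_t\rho_i+\mathrm{div}(\rho_i v(p_i))=0, & \rho_i(0,\cdot)=\rho_i^0,\\ \partial_t p_i+v(p_i)D_xp_i=-\nabla V\ast\rho_i, & p_i(0,\cdot)=p_i^0.\end{cases}$$ Suppose that $(\rho_2,p_2)\in L^\infty([0,T];L^a(\mathbb{T}^d))\times L^\infty([0,T];W^{1,\infty}(\mathbb{T}^d))$ for some $a>d$. Let $$\mathcal{E}(t)=2\int_{\mathbb{T}^d}\eta(p_1(t,x)\,|\,p_2(t,x))\,\rho_1(t,x)\,dx+\int_{\mathbb{T}^d}\big(V\ast(\rho_1-\rho_2)\big)(t,x)\,(\rho_1-\rho_2)(t,x)\,dx .$$ Then $$\begin{aligned}\frac{d}{dt}\mathcal{E}(t)=\;&2\int_{\mathbb{T}^d}v(p_2)\cdot\nabla V\ast(\rho_1-\rho_2)\,(\rho_1-\rho_2)\,dx\\&-2\int_{\mathbb{T}^d}\rho_1\,(v(p_1)-v(p_2))\cdot\big((p_1-p_2)D_x(v(p_2))\big)\,dx\\&+2\int_{\mathbb{T}^d}\rho_1\,\nabla V\ast\rho_2\cdot\Big(\nabla^2\mathscr{K}(p_2)(p_1-p_2)-\big(\nabla\mathscr{K}(p_1)-\nabla\mathscr{K}(p_2)\big)\Big)\,dx.\end{aligned}$$ Consequently, there is some $C=C\big(a,d,\|p_2\|_{L^\infty([0,T];W^{1,\infty})},\|\rho_2\|_{L^\infty([0,T];L^a)}\big)>0$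 such that $$\mathcal{E}(t)\le e^{Ct}\,\mathcal{E}(0)\qquad\text{for all }t\in[0,T].$$
   Context: $\mathbb{T}^d$ is the $d$-dimensional flat torus of unit volume, $d\ge2$. $V$ is the periodic repulsive Coulomb interaction: the unique solution of $-\Delta V=\delta_0-1$ on $\mathbb{T}^d$ with $\int_{\mathbb{T}^d}V\,dx=0$. Convolution is in the space variable. The relativistic velocity is $v(P)=P/\sqrt{1+|P|^2}$ for $P\in\mathbb{R}^d$, and $\mathscr{K}(P)=\sqrt{1+|P|^2}$ (so $\nabla\mathscr{K}=v$); $\nabla^2\mathscr{K}$ is the Hessian of $\mathscr K$. For $P,p\in\mathbb{R}^d$, $$\eta(P|p)=\mathscr{K}(P)-\mathscr{K}(p)-\nabla\mathscr{K}(p)\cdot(P-p).$$ The unknowns are a time-dependent probability density $\rho(t,\cdot)$ on $\mathbb{T}^d$ and a time-dependent momentum field $p(t,\cdot):\mathbb{T}^d\to\mathbb{R}^d$. Jacobian convention: for a vector field $w$, $(D_xw)_{ij}=\partial_{x_i}w^j$; a vector written to the left of $D_xw$ multiplies it as a row vector, so that $v(p)D_xp=(v(p)\cdot\nabla)p$. $D_x(v(p))$ is the Jacobian, in this convention, of the composed field $x\mapsto v(p(t,x))$.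
   Formalization: In the second term of the identity, D_x(v(p_2)) is replaced by its transpose, since the printed formula is false under the stated convention; ''solutions'' have p_i Lipschitz in (t,x) and ρ_i weak, and the identity for dE/dt holds for almost every t, E being Lipschitz. *)

(* Defs.v *)
From HB Require Import structures.
From mathcomp Require Import all_boot all_order all_algebra.
From mathcomp Require Import all_classical all_reals all_analysis ess_sup_inf.

Set Implicit Arguments.
Unset Strict Implicit.
Unset Printing Implicit Defensive.

Import Order.TTheory GRing.Theory Num.Theory.
Import numFieldNormedType.Exports.

Local Open Scope classical_set_scope.
Local Open Scope ring_scope.

(** A function on the torus R^d / Z^d is a Z^d-periodic function on
    'rV[R]_d.  It is integrated over a fundamental cell, against the d-fold
    product of the uniform probability on [0, 1].  That product lives on
    d-tuples, the carrier of the library's product sigma-algebra; [pt]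
    identifies tuples with row vectors. *)

Definition consp (R : realType) (n : nat)
    (z : measurableTypeR R * n.-tuple (measurableTypeR R)) :
  n.+1.-tuple (measurableTypeR R) := cons_tuple z.1 z.2.

Lemma measurable_consp (R : realType) (n : nat) :
  measurable_fun setT (@consp R n).
Proof. exact: measurable_cons. Qed.

HB.instance Definition _ (R : realType) (n : nat) :=
  isMeasurableFun.Build _ _ _ _ _ (@measurable_consp R n).

Definition uniform01 (R : realType) : probability (measurableTypeR R) R :=
  uniform_prob (@ltr01 R).

Fixpoint torus (R : realType) (d : nat) :
    probability (d.-tuple (measurableTypeR R)) R :=
  match d with
  | 0%N => \d_ [tuple]
  | n.+1 => distribution (uniform01 R \x torus R n)%E (@consp R n)
  end.

Section Torus.
Context {R : realType} {d : nat}.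
Local Notation vec := 'rV[R]_d.
Local Notation cell := (d.-tuple (measurableTypeR R)).

Definition pt (y : cell) : vec := \row_i tnth y i.

Definition evec (i : 'I_d) : vec := delta_mx 0 i.

Definition periodic (V : Type) (f : vec -> V) : Prop :=
  forall i x, f (x + evec i) = f x.

Definition tint (f : vec -> R) : R := \int[torus R d]_y f (pt y).

Definition tintegrable (f : vec -> R) : Prop :=
  (torus R d).-integrable setT (fun y => (f (pt y))%:E).

Definition conv (f g : vec -> R) (x : vec) : R :=
  tint (fun y => f (x - y) * g y).

Definition convv (F : vec -> vec) (g : vec -> R) (x : vec) : vec :=
  \row_j conv (fun y => F y 0 j) g x.

Definition dotv (u w : vec) : R := \sum_i u 0 i * w 0 i.

Definition partial (i : 'I_d) (f : vec -> R) (x : vec) : R :=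
  'D_(evec i) f x.

Definition grad (f : vec -> R) (x : vec) : vec := \row_i partial i f x.

Definition laplacian (f : vec -> R) (x : vec) : R :=
  \sum_i partial i (partial i f) x.

Definition hessian (f : vec -> R) (x : vec) : 'M[R]_d :=
  \matrix_(i, j) partial i (partial j f) x.

Definition smooth (f : vec -> R) : Prop :=
  forall s : seq 'I_d, let g := foldr partial f s in
    continuous g /\ (forall i x, derivable g x (evec i)).

Definition test_function (f : vec -> R) : Prop := periodic f /\ smooth f.

(* Distributional form of - Delta V = delta_0 - 1; it determines V almost
   everywhere. *)
Definition coulomb_potential (V : vec -> R) : Prop :=
  [/\ periodic V, tintegrable V, tint V = 0 &
      forall f, test_function f ->
        - tint (fun x => V x * laplacian f x) = f 0 - tint f].

Definition weak_gradient (V : vec -> R) (G : vec -> vec) : Prop :=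
  [/\ periodic G, (forall j, tintegrable (fun x => G x 0 j)) &
      forall j f, test_function f ->
        tint (fun x => V x * partial j f x) =
        - tint (fun x => G x 0 j * f x)].

Definition kinetic (P : vec) : R := Num.sqrt (1 + dotv P P).

Definition vel (P : vec) : vec := (Num.sqrt (1 + dotv P P))^-1 *: P.

Definition eta (P p : vec) : R :=
  kinetic P - kinetic p - dotv (grad kinetic p) (P - p).

(** [G] is the gradient of the interaction potential.  The momentum is in
    W^{1,oo} of space-time (it is Lipschitz), so it is differentiable almost
    everywhere by Rademacher's theorem and its pointwise derivatives are its
    weak ones; the momentum equation holds almost everywhere.  The density is
    only a measurable probability density, and the continuity equation holds
    in the sense of distributions, for the representative that is weakly
    continuous in time.  The library's Jacobian satisfies
    ('J w x) i j = d_i w^j, so that v *m 'J w x = (v . nabla) w. *)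
Record EP_solution (G : vec -> vec) (T : R)
    (rho0 : vec -> R) (p0 : vec -> vec)
    (rho : R -> vec -> R) (p : R -> vec -> vec) : Prop := {
  EP_rho_periodic : forall t, t \in `[0, T] -> periodic (rho t);
  EP_rho_measurable : measurable_fun (`[0, T] `*` setT)
    (fun z : measurableTypeR R * cell => rho z.1 (pt z.2));
  EP_rho_ge0 : forall t x, t \in `[0, T] -> 0 <= rho t x;
  EP_rho_mass : forall t, t \in `[0, T] ->
    (\int[torus R d]_y (rho t (pt y))%:E = 1)%E;
  EP_p_periodic : forall t, t \in `[0, T] -> periodic (p t);
  EP_p_lipschitz :
    [lipschitz p z.1 z.2 | z in (`[0, T] `*` setT : set (R * vec))];
  EP_continuity : forall f, test_function f -> forall t, t \in `[0, T] ->
    tint (fun x => rho t x * f x) = tint (fun x => rho 0 x * f x)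
      + \int[lebesgue_measure]_(s in `[0, t])
          tint (fun x => rho s x * dotv (vel (p s x)) (grad f x));
  EP_momentum : {ae (lebesgue_measure \x torus R d)%E,
    forall z : measurableTypeR R * cell, let t := z.1 in let x := pt z.2 in
    t \in `]0, T[ ->
    differentiable (fun w : R * vec => p w.1 w.2) (t, x) /\
    'D_1 (p ^~ x) t + vel (p t x) *m 'J (p t) x = - convv G (rho t) x};
  EP_rho_init : {ae torus R d, forall y, rho 0 (pt y) = rho0 (pt y)};
  EP_p_init : forall x, p 0 x = p0 x
}.

Definition La_norm (a : R) (f : vec -> R) : \bar R :=
  Lnorm (torus R d) a%:E (fun y => (f (pt y))%:E).

(* 'J is the weak derivative for Lipschitz fields only *)
Definition W1oo_norm (w : vec -> vec) : \bar R :=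
  maxe (Lnorm (torus R d) +oo%E (fun y => `|w (pt y)|%:E))
       (Lnorm (torus R d) +oo%E (fun y => `|'J w (pt y)|%:E)).

(* L^oo in time of a space norm N, extended by zero outside [0, T] *)
Definition Loo_time (T : R) (N : R -> \bar R) : \bar R :=
  ess_sup lebesgue_measure (N \_ `[0, T]).

Definition energy (V : vec -> R) (rho1 rho2 : R -> vec -> R)
    (p1 p2 : R -> vec -> vec) (t : R) : R :=
  let mu x := rho1 t x - rho2 t x in
  2 * tint (fun x => eta (p1 t x) (p2 t x) * rho1 t x)
  + tint (fun x => conv V mu x * mu x).

(* In the second term the Jacobian (d_j (v(p_2))^i)_{ij} is the transpose of
   'J, which is what differentiating the energy yields: the integrand is
   (p_1 - p_2) . ((v(p_1) - v(p_2)) . nabla) v(p_2).  With 'J itself the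
   identity fails, since 'J (vel \o p2 t) x need not be symmetric. *)
Definition energy_rate (G : vec -> vec) (rho1 rho2 : R -> vec -> R)
    (p1 p2 : R -> vec -> vec) (t : R) : R :=
  let mu x := rho1 t x - rho2 t x in
  2 * tint (fun x => dotv (vel (p2 t x)) (convv G mu x) * mu x)
  - 2 * tint (fun x => rho1 t x *
      dotv (vel (p1 t x) - vel (p2 t x))
           ((p1 t x - p2 t x) *m ('J (vel \o p2 t) x)^T))
  + 2 * tint (fun x => rho1 t x *
      dotv (convv G (rho2 t) x)
           ((p1 t x - p2 t x) *m hessian kinetic (p2 t x)
            - (grad kinetic (p1 t x) - grad kinetic (p2 t x)))).

End Torus.

(* Main.v *)
(** The densities solve the continuity equation only weakly, so the energy is
    differentiated after testing against trigonometric polynomials: with the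
    kernels K_n(x) = prod_i c_n cos^(2n)(pi x_i), both K_n * Phi and K_n * V are
    finite sums of products, the product rule in time applies, and n tends to
    infinity. The force is bounded because the momentum equation expresses it by
    derivatives of the Lipschitz field p.

    Gronwall's inequality then follows from three estimates. Writing
    m = rho_1 - rho_2 = - laplacian u (up to the mean, with u = V * m), the first
    term is a stress tensor integrated against the gradient of v(p_2), hence
    bounded by the integral of |grad u|^2, which is the potential energy of m. The
    second and third terms are quadratic in p_1 - p_2 and controlled by
    eta(p_1 | p_2), because |p_2| is bounded. The third one also needs a bound of
    grad V * rho_2 in terms of the L^a norm of rho_2, a > d; it comes from
    K_n - K_(n+1) being, to leading order, a multiple of the Laplacian of K_(n+1). *)

Require Import Defs.
From HB Require Import structures.
From mathcomp Require Import all_boot all_order all_algebra.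
From mathcomp Require Import all_classical all_reals all_analysis.
From mathcomp Require Import measurable_realfun ess_sup_inf.
From mathcomp Require Import ring lra.

Set Implicit Arguments.
Unset Strict Implicit.
Unset Printing Implicit Defensive.

Import Order.TTheory GRing.Theory Num.Theory.
Import numFieldNormedType.Exports.

Local Open Scope classical_set_scope.
Local Open Scope ring_scope.

(** * Integrals of real functions *)

(** Since the densities are merely integrable, [grad V * rho] is defined only almost everywhere. The
    bound of the force read off from the momentum equation depends on the solutions, so it may
    justify limits but must not enter the constant. The quantitative bound for [rho_2] therefore has
    another source: an inequality bounding the force by a constant plus half of any bound already
    known, which is then iterated. Of the potential only the distributional Poisson equation is
    available. All information on it is obtained by testing that equation with trigonometric
    polynomials; no estimate of a Green function occurs. The relativistic [eta] grows only linearly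
    in its first argument, so it does not dominate [|p_1 - p_2|^2] uniformly. What saves the
    quadratic terms is that differences of velocities decay like the inverse of the energy of [p_1],
    which restores the missing factor. Derivatives almost everywhere are handled as limits of the
    sequence of difference quotients with steps [1 / (n + 1)]. Clamped upper limits of these are
    measurable and bounded everywhere, whereas the Jacobian of [v(p_2)] in the statement is not
    known to be measurable. *)

Section real_integral.
Context d (T : measurableType d) (R : realType).
Variable mu : {measure set T -> \bar R}.
Implicit Types (D : set T) (f g h : T -> R).

Import HBNNSimple.

(* No measurability is assumed: the integral of a nonnegative function is a
   supremum over the simple functions below it, and these may be cut off on a
   null set. *)
Lemma ae_nnintegral_le (f g : T -> \bar R) :
  (forall x, 0 <= f x)%E -> (forall x, 0 <= g x)%E ->
  {ae mu, forall x, f x = g x} ->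
  (\int[mu]_x f x <= \int[mu]_x g x)%E.
Proof.
move=> f0 g0 [N [mN N0 fgN]].
rewrite !ge0_integralTE//; apply: ge_ereal_sup => _ [h /= hf <-].
have mC := measurableC mN.
have pE x : proj_nnsfun h mC x = h x * \1_(~` N) x by [].
apply: ereal_sup_ubound; exists (proj_nnsfun h mC) => [x|].
  have [xN|xN] := pselect (N x).
    by rewrite pE indicE memNset ?mulr0// => /(_ xN).
  rewrite pE indicE mem_set ?mulr1//.
  have -> : g x = f x by apply: contrapT => fgx; apply: xN; apply: fgN => /esym.
  exact: hf.
rewrite -!integralT_nnsfun; apply: ge0_ae_eq_integral => //.
- by apply/measurable_EFinP.
- by apply/measurable_EFinP.
- by move=> x _; rewrite lee_fin.
- by move=> x _; rewrite lee_fin.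
exists N; split => // x xN; apply: contrapT => nNx; apply: xN => _.
rewrite -[LHS]/((h x * \1_(~` N) x)%:E) indicE mem_set ?mulr1//.
Qed.

Lemma ae_eq_integralT (f g : T -> \bar R) :
  {ae mu, forall x, f x = g x} -> (\int[mu]_x f x = \int[mu]_x g x)%E.
Proof.
move=> fg.
have H (u v : T -> \bar R) : (forall x, 0 <= u x)%E -> (forall x, 0 <= v x)%E ->
    {ae mu, forall x, u x = v x} -> (\int[mu]_x u x = \int[mu]_x v x)%E.
  move=> u0 v0 uv; apply/eqP; rewrite eq_le !ae_nnintegral_le//.
  by apply: filterS uv => x ->.
rewrite integralE [RHS]integralE; congr (_ - _)%E; apply: H => //;
  apply: filterS fg => x fgx.
- by rewrite !funeposE fgx.
- by rewrite !funenegE fgx.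
Qed.

Lemma ae_eq_RintegralT f g : {ae mu, forall x, f x = g x} ->
  \int[mu]_x f x = \int[mu]_x g x.
Proof.
move=> fg; congr fine; apply: ae_eq_integralT.
by apply: filterS fg => x ->.
Qed.

Lemma integrableMbdd D f h (c : R) : measurable D ->
  mu.-integrable D (EFin \o f) -> measurable_fun D h ->
  (forall x, D x -> `|h x| <= c) -> mu.-integrable D (EFin \o (fun x => h x * f x)).
Proof.
move=> mD fi mh hc.
apply: (@le_integrable _ _ _ _ _ mD _ (fun x => c%:E * (EFin \o f) x)%E).
- apply/measurable_EFinP; apply: measurable_funM => //.
  exact/measurable_EFinP/(measurable_int _ fi).
- move=> x Dx /=; rewrite lee_fin !normrM ler_wpM2r//.
  exact: le_trans (hc _ Dx) (ler_norm _).
- exact: integrableZl.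
Qed.

Lemma le_Rintegral_norm D f g : measurable D ->
  mu.-integrable D (EFin \o f) -> mu.-integrable D (EFin \o g) ->
  (forall x, D x -> `|f x| <= g x) ->
  `|\int[mu]_(x in D) f x| <= \int[mu]_(x in D) g x.
Proof.
move=> mD fi gi fg; apply: le_trans (le_normr_Rintegral mD fi) _.
by apply: le_Rintegral => //; exact: integrable_norm.
Qed.

Lemma Rintegral_sum D (I : Type) (s : seq I) (F : I -> T -> R) : measurable D ->
  (forall i, mu.-integrable D (EFin \o F i)) ->
  mu.-integrable D (EFin \o (fun x => \sum_(i <- s) F i x)) /\
  \int[mu]_(x in D) (\sum_(i <- s) F i x) = \sum_(i <- s) \int[mu]_(x in D) F i x.
Proof.
move=> mD Fi; elim: s => [|i s [IH1 IH2]].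
  split; last by under eq_Rintegral do rewrite big_nil; rewrite big_nil Rintegral_cst// mul0r.
  apply: (eq_integrable mD _ _ _ (integrable0 mu D)) => x _ /=; by rewrite big_nil.
split.
  apply: (eq_integrable mD _ _ _ (integrableD mD (Fi i) IH1)) => x _ /=.
  by rewrite big_cons EFinD.
by under eq_Rintegral do rewrite big_cons; rewrite RintegralD// IH2 big_cons.
Qed.

Lemma Rdominated_convergence D (f_ : nat -> T -> R) f g : measurable D ->
  (forall n, measurable_fun D (f_ n)) -> measurable_fun D f ->
  {ae mu, forall x, D x -> f_ ^~ x @ \oo --> f x} ->
  mu.-integrable D (EFin \o g) ->
  (forall n x, D x -> `|f_ n x| <= g x) ->
  mu.-integrable D (EFin \o f) /\
  (fun n => \int[mu]_(x in D) f_ n x) @ \oo --> \int[mu]_(x in D) f x.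
Proof.
move=> mD mf_ mf ff gi fg.
have [fi _ H] := @dominated_convergence _ _ _ mu D mD (fun n => EFin \o f_ n)
  (EFin \o f) (EFin \o g) (fun n => (measurable_EFinP _ _).2 (mf_ n)) ((measurable_EFinP _ _).2 mf)
  ltac:(by apply: filterS ff => x fx Dx; apply/cvg_EFin;
    [exact: nearW|exact: fx])
  gi ltac:(by apply: aeW => x n Dx /=; rewrite lee_fin fg).
split=> //.
have f_i n : mu.-integrable D (EFin \o f_ n).
  apply: (le_integrable mD _ _ gi); first exact/measurable_EFinP.
  by move=> x Dx /=; rewrite lee_fin (le_trans (fg n x Dx))// ler_norm.
have := H; rewrite -(fineK (integrable_fin_num mD fi)).
by move/fine_cvg.
Qed.

End real_integral.

(** By Tonelli the measures of the sections of a null set integrate to zero, hence vanish almost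
    everywhere. This passes from properties valid almost everywhere in space-time to almost every
    time. *)
Lemma ae_prod_slice d1 d2 (T1 : measurableType d1) (T2 : measurableType d2)
  (R : realType) (m1 : {sigma_finite_measure set T1 -> \bar R})
  (m2 : {sigma_finite_measure set T2 -> \bar R}) (P : T1 * T2 -> Prop) :
  {ae (m1 \x m2)%E, forall z, P z} -> {ae m1, forall x, {ae m2, forall y, P (x, y)}}.
Proof.
move=> [N [mN N0 PN]].
have : {ae m1, forall x, (m2 (xsection N x) = 0)%E}.
  have mm := measurable_fun_xsection m2 mN.
  have [+ _] := @ae_eq_integral_abs _ _ _ m1 setT measurableT _ mm.
  move=> /(_ _)/wrap[].
    rewrite -N0 /= /product_measure1; apply: eq_integral => x _ /=.
    by rewrite gee0_abs.
  by apply: filterS => x; apply.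
apply: filterS => x xN0; exists (xsection N x); split => //.
  exact: measurable_xsection.
by move=> y /= nP; rewrite /xsection/= inE; apply: PN.
Qed.

Section fubini_real.
Context d1 d2 (T1 : measurableType d1) (T2 : measurableType d2) (R : realType).
Variables (m1 : {sigma_finite_measure set T1 -> \bar R})
          (m2 : {sigma_finite_measure set T2 -> \bar R}).
Implicit Types f : T1 * T2 -> R.

(** No integrability is assumed: Tonelli applies to the positive and the negative part separately,
    and [fine] keeps measurability where the difference is infinite. *)
Lemma measurable_Rfubini f : measurable_fun setT f ->
  measurable_fun setT (fun x => \int[m2]_y f (x, y)).
Proof.
move=> mf; have mEf : measurable_fun setT (EFin \o f) by apply/measurable_EFinP.
rewrite -[fun _ => _]/(fine \o (fun x => \int[m2]_y (f (x, y))%:E)%E).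
apply: (@measurableT_comp _ _ _ _ _ _ (@fine R)) => //.
rewrite [X in measurable_fun _ X](_ : _ =
  (fun x => \int[m2]_y ((EFin \o f)^\+ (x, y)) - \int[m2]_y ((EFin \o f)^\- (x, y)))%E).
  apply: emeasurable_funB.
    apply: (@measurable_fun_fubini_tonelli_F _ _ T1 T2 R m2 ((EFin \o f)^\+)%E) => //.
    exact: measurable_funepos.
  apply: (@measurable_fun_fubini_tonelli_F _ _ T1 T2 R m2 ((EFin \o f)^\-)%E) => //.
  exact: measurable_funeneg.
apply/funext => x; rewrite [LHS]integralE; congr (_ - _)%E;
  by apply: eq_integral => y _; rewrite ?funeposE ?funenegE.
Qed.

Lemma Rfubini_integrable f : measurable_fun setT f ->
  (forall x, m2.-integrable setT (EFin \o (fun y => f (x, y)))) ->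
  m1.-integrable setT (EFin \o (fun x => \int[m2]_y `|f (x, y)|)) ->
  (m1 \x m2)%E.-integrable setT (EFin \o f).
Proof.
move=> mf fi fii; apply/integrable12ltyP; first exact/measurable_EFinP.
move/integrableP: fii => [_]; apply: le_lt_trans; apply: ge0_le_integral => //.
- by move=> x _; apply: integral_ge0.
- apply: (@measurable_fun_fubini_tonelli_F _ _ T1 T2 R m2 (fun z => (`|(EFin \o f) z|)%E)) => //.
  by apply: measurableT_comp => //; apply/measurable_EFinP.
- apply: measurableT_comp => //; apply/measurable_EFinP.
  by apply: measurable_Rfubini (fun z => `|f z|) _; exact: measurableT_comp.
move=> x _ /=.
rewrite ger0_norm; last by apply: Rintegral_ge0.
rewrite fineK//; apply: integrable_fin_num => //.
exact: (integrable_norm (fi x)).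
Qed.

Lemma Rfubini f : (m1 \x m2)%E.-integrable setT (EFin \o f) ->
  [/\ {ae m1, forall x, m2.-integrable setT (EFin \o (fun y => f (x, y)))},
      {ae m2, forall y, m1.-integrable setT (EFin \o (fun x => f (x, y)))},
      m1.-integrable setT (EFin \o (fun x => \int[m2]_y f (x, y))),
      m2.-integrable setT (EFin \o (fun y => \int[m1]_x f (x, y))) &
      \int[m1]_x \int[m2]_y f (x, y) = \int[m2]_y \int[m1]_x f (x, y)].
Proof.
move=> fi.
have mf : measurable_fun setT f.
  apply/measurable_EFinP. exact: (measurable_int _ fi).
have a1 := ae_integrable1 fi; have a2 := ae_integrable2 fi.
(* [fine] is guaranteed to agree with the extended integral only where the slice is integrable, that
   is almost everywhere. *)
have e1 : {ae m1, forall x, (\int[m2]_y f (x, y))%:E = (\int[m2]_y (f (x, y))%:E)%E}.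
  apply: filterS a1 => x xi; rewrite fineK//; exact: integrable_fin_num.
have e2 : {ae m2, forall y, (\int[m1]_x f (x, y))%:E = (\int[m1]_x (f (x, y))%:E)%E}.
  apply: filterS a2 => x xi; rewrite fineK//; exact: integrable_fin_num.
have i1 := integrable_fubini_F fi.
have mEf : measurable_fun setT (EFin \o f) by exact: (measurable_int _ fi).
have mG := measurable_fubini_G fi.
have i2 : m2.-integrable setT (fubini_G m1 (EFin \o f)).
  apply/integrableP; split => //.
  apply: le_lt_trans ((integrable21ltyP _ _ mEf).1 fi).
  apply: ge0_le_integral => //.
  - exact: measurableT_comp.
  - apply: (@measurable_fun_fubini_tonelli_G _ _ T1 T2 R m1 (fun z => (`|(EFin \o f) z|)%E)) => //.
    exact: measurableT_comp.
  - move=> y _; apply: le_abse_integral => //.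
    by apply/measurable_EFinP; exact: measurableT_comp.
have m1F : measurable_fun setT (fun x => \int[m2]_y f (x, y)) by exact: measurable_Rfubini.
have m2F : measurable_fun setT (fun y => \int[m1]_x f (x, y)).
  rewrite -[fun y => _]/(fine \o fubini_G m1 (EFin \o f)).
  exact: (@measurableT_comp _ _ _ _ _ _ (@fine R)).
split => //.
- apply/integrableP; split; first exact/measurable_EFinP.
  move/integrableP: i1 => [_]; apply: le_lt_trans.
  rewrite le_eqVlt; apply/orP; left; apply/eqP; apply: ae_eq_integralT.
  by apply: filterS e1 => x e; congr (`|_|)%E.
- apply/integrableP; split; first exact/measurable_EFinP.
  move/integrableP: i2 => [_]; apply: le_lt_trans.
  rewrite le_eqVlt; apply/orP; left; apply/eqP; apply: ae_eq_integralT.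
  by apply: filterS e2 => x e; congr (`|_|)%E.
by congr fine; rewrite (ae_eq_integralT e1) (ae_eq_integralT e2); exact: Fubini fi.
Qed.

End fubini_real.

(** * Reflections and products on the torus *)

Section lebesgue_reflection.
Context (R : realType).
Local Notation leb := (@lebesgue_measure R).

(** By uniqueness of Lebesgue measure it is enough to compare half-open intervals; reflection only
    moves the closed end from the right to the left. *)
Lemma lebesgue_measure_reflect (c : R) (A : set R) : measurable A ->
  pushforward leb (fun s : measurableTypeR R => (c - s : measurableTypeR R)) A = leb A.
Proof.
move=> mA; apply/esym.
have mc : measurable_fun setT (fun s : measurableTypeR R => (c - s : measurableTypeR R)).
  exact: measurable_funB.
apply: (lebesgue_measure_unique (mu := pushforward leb (fun s : measurableTypeR R => (c - s : measurableTypeR R)))) => //= _ [[a b]] _ <-.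
rewrite /pushforward.
have -> : (fun s : R => c - s) @^-1` `]a, b]%classic = `[c - b, c - a[%classic.
  by apply/seteqP; split => x /=; rewrite !in_itv/= => /andP[? ?]; apply/andP; split; lra.
rewrite !lebesgue_measure_itv /= !lte_fin.
have -> : (c - b < c - a) = (a < b) by apply/idP/idP => ?; lra.
by case: ifPn => // _; rewrite -!EFinD; congr _%:E; lra.
Qed.

Lemma integral_reflect (c : R) (D : set R) (f : R -> \bar R) : measurable D ->
  measurable_fun setT f -> (forall x, 0 <= f x)%E ->
  (\int[leb]_(s in (fun s => c - s)%R @^-1` D) f (c - s)%R = \int[leb]_(s in D) f s)%E.
Proof.
move=> mD mf f0.
have mc : measurable_fun setT (fun s : measurableTypeR R => (c - s : measurableTypeR R)).
  exact: measurable_funB.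
rewrite -[LHS](@ge0_integral_pushforward _ _ _ _ R _ mc leb D f)//.
- by apply: eq_measure_integral => A mA _; exact: lebesgue_measure_reflect.
- exact: measurable_funTS.
Qed.

(* Split at the fractional part r of c: the reflected unit interval is
   [0, r] together with ]r - 1, 0], and the latter moves to [r, 1[ by periodicity. *)
Lemma uniform01_reflect (c : R) (f : R -> \bar R) :
  measurable_fun setT f -> (forall x, 0 <= f x)%E ->
  (forall x, f (x + 1)%R = f x) ->
  (\int[uniform01 R]_s f (c - s)%R = \int[uniform01 R]_s f s)%E.
Proof.
move=> mf f0 fp.
have fz (k : int) x : f (x + k%:~R) = f x.
  have fn (m : nat) y : f (y + m%:R) = f y.
    by elim: m y => [|m IH] y; rewrite ?addr0// -natr1 addrA fp.
  case: k => m; first exact: fn.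
  by rewrite NegzE mulrNz -[LHS](fn m.+1) subrK.
pose r := c - (Num.floor c)%:~R.
have r0 : 0 <= r by rewrite subr_ge0 Num.Theory.ge_floor.
have r1 : r < 1 by rewrite ltrBlDl; have := lt_succ_floor c; rewrite intrD.
have cr s : f (c - s) = f (r - s).
  by rewrite -(fz (Num.floor c) (r - s)) /r; congr f; ring.
have mfr b : measurable_fun setT (fun s : R => f (b - s)).
  apply: (measurableT_comp mf); exact: measurable_funB.
rewrite /uniform01 (integral_uniform ltr01 (mfr c) (fun x => f0 _)).
rewrite (integral_uniform ltr01 mf f0).
congr (_ * _)%E.
under eq_integral do rewrite cr.
have E : `[0, 1]%classic = `[0, r]%classic `|` `]r, 1]%classic :> set R.
  apply/seteqP; split => x /=; rewrite !in_itv/=.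
    by move=> /andP[? ?]; case: (leP x r) => ?; [left|right]; apply/andP; split; lra.
  by case=> /andP[? ?]; apply/andP; split; lra.
have E' : `[0, 1]%classic = `[0, r[%classic `|` `[r, 1]%classic :> set R.
  apply/seteqP; split => x /=; rewrite !in_itv/=.
    by move=> /andP[? ?]; case: (ltP x r) => ?; [left|right]; apply/andP; split; lra.
  by case=> /andP[? ?]; apply/andP; split; lra.
rewrite {1}E E' !ge0_integral_setU//=.
- congr (_ + _)%E.
    rewrite integral_itv_bndo_bndc; last exact: measurable_funTS.
    rewrite -(@integral_reflect r `[0, r]%classic f)//.
    have -> // : (fun s : R => r - s) @^-1` `[0, r]%classic = `[0, r]%classic.
    by apply/seteqP; split => x /=; rewrite !in_itv/= => /andP[? ?]; apply/andP; split; lra.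
  rewrite -[RHS]integral_itv_bndo_bndc; last exact: measurable_funTS.
  rewrite -(@integral_reflect (1 + r) `[r, 1[%classic f)//.
  have -> : (fun s : R => 1 + r - s) @^-1` `[r, 1[%classic = `]r, 1]%classic.
    by apply/seteqP; split => x /=; rewrite !in_itv/= => /andP[? ?]; apply/andP; split; lra.
  by apply: eq_integral => s _; rewrite -(fp (r - s)); congr f; ring.
- exact: measurable_funTS.
- apply/disj_setPS => x [/=]; rewrite !in_itv/= => /andP[? ?] /andP[? ?]; lra.
- exact: (measurable_funTS (mfr r)).
- apply/disj_setPS => x [/=]; rewrite !in_itv/= => /andP[? ?] /andP[? ?]; lra.
Qed.

End lebesgue_reflection.

Section torus_measure.
Context (R : realType).
Local Notation cell n := (n.-tuple (measurableTypeR R)).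

Lemma integral_torusS (n : nat) (F : cell n.+1 -> \bar R) :
  measurable_fun setT F -> (forall y, 0 <= F y)%E ->
  (\int[torus R n.+1]_y F y =
   \int[uniform01 R]_s \int[torus R n]_y F (cons_tuple s y))%E.
Proof.
move=> mF F0 /=.
rewrite (@ge0_integral_pushforward _ _ _ _ R (@consp R n) _ (uniform01 R \x torus R n)%E setT F)//.
rewrite preimage_setT fubini_tonelli1//=.
by apply: measurableT_comp.
Qed.

Lemma measurable_cons_tuple (n : nat) (s : R) :
  measurable_fun setT (fun y : cell n => cons_tuple s y : cell n.+1).
Proof. exact: measurable_cons. Qed.

(** Tonelli, one coordinate at a time. It reduces the integrals of the product kernels to integrals
    over the unit interval. *)
Lemma integral_torus_prod (n : nat) (g : 'I_n -> R -> R) :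
  (forall i, measurable_fun setT (g i)) -> (forall i s, 0 <= g i s) ->
  (\int[torus R n]_y (\prod_(i < n) g i (tnth y i))%:E =
   \prod_(i < n) \int[uniform01 R]_s (g i s)%:E)%E.
Proof.
elim: n g => [|n IH] g mg g0.
  under eq_integral do rewrite big_ord0.
  by rewrite big_ord0 integral_cst//= diracT mule1.
have mpr : measurable_fun setT (fun y : cell n.+1 => (\prod_(i < n.+1) g i (tnth y i))%:E).
  apply/measurable_EFinP; apply: measurable_prod => i _.
  by apply: (measurableT_comp (mg i)); exact: measurable_tnth.
rewrite integral_torusS//; last by move=> y; rewrite lee_fin prodr_ge0.
have E s (y : cell n) : \prod_(i < n.+1) g i (tnth (cons_tuple s y) i) =
    g ord0 s * \prod_(i < n) g (lift ord0 i) (tnth y i).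
  by rewrite big_ord_recl; congr (_ * _); apply: eq_bigr => i _; rewrite tnthS.
under eq_integral => s _.
  under eq_integral => y _ do rewrite E EFinM.
  rewrite ge0_integralZl//; last 3 first.
  - apply/measurable_EFinP; apply: measurable_prod => i _.
    by apply: (measurableT_comp (mg _)); exact: measurable_tnth.
  - by move=> y _; rewrite lee_fin prodr_ge0.
  - by rewrite lee_fin.
  rewrite (IH (fun i => g (lift ord0 i)))//.
  over.
rewrite ge0_integralZr//; last 3 first.
- by apply/measurable_EFinP; exact: mg.
- by move=> s _; rewrite lee_fin.
- by apply: prode_ge0 => i _; apply: integral_ge0 => s _; rewrite lee_fin.
by rewrite big_ord_recl.
Qed.

(** The reflected point may leave the unit cell. It is not reduced modulo 1, because the functions
    integrated are periodic. *)
Definition rtuple (n : nat) (v : 'I_n -> R) (y : cell n) : cell n :=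
  [tuple v i - tnth y i | i < n].

Lemma measurable_rtuple n (v : 'I_n -> R) : measurable_fun setT (rtuple v).
Proof.
apply/measurable_fun_tnthP => i.
rewrite (_ : _ \o _ = (fun y : cell n => v i - tnth y i)).
  by apply: measurable_funB => //; exact: measurable_tnth.
by apply/funext => y /=; rewrite tnth_mktuple.
Qed.

(** Induction on the dimension: [uniform01_reflect] treats the head coordinate, the induction
    hypothesis the tail. Periodicity is phrased as invariance when a single coordinate grows by 1, a
    form that restricts to slices. *)
Lemma integral_torus_reflect (n : nat) (v : 'I_n -> R) (F : cell n -> \bar R) :
  measurable_fun setT F -> (forall y, 0 <= F y)%E ->
  (forall i (y y' : cell n), (forall j, j != i -> tnth y' j = tnth y j) ->
     tnth y' i = tnth y i + 1 -> F y' = F y) ->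
  (\int[torus R n]_y F (rtuple v y) = \int[torus R n]_y F y)%E.
Proof.
elim: n v F => [|n IH] v F mF F0 Fp.
  by apply: eq_integral => y _; rewrite (tuple0 (rtuple v y)) (tuple0 y).
have mFr : measurable_fun setT (F \o rtuple v).
  by apply: measurableT_comp => //; exact: measurable_rtuple.
rewrite -[LHS]/(\int[torus R n.+1]_y ((F \o rtuple v) y))%E.
rewrite (integral_torusS mFr (fun y => F0 _)) (integral_torusS mF F0).
have consE s (y : cell n) :
    rtuple v (cons_tuple s y) = cons_tuple (v ord0 - s) (rtuple (v \o lift ord0) y).
  apply: eq_from_tnth => i; rewrite tnth_mktuple.
  have [j ->|->] := unliftP ord0 i; first by rewrite !tnthS tnth_mktuple.
  by rewrite !tnth0.
have mFc s : measurable_fun setT (fun y : cell n => F (cons_tuple s y)).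
  by apply: (measurableT_comp mF); exact: measurable_cons_tuple.
have slice s : (\int[torus R n]_y (F \o rtuple v) (cons_tuple s y) =
    \int[torus R n]_y F (cons_tuple (v ord0 - s)%R y))%E.
  rewrite -[RHS](IH (v \o lift ord0)).
  - by apply: eq_integral => y _ /=; rewrite -consE.
  - exact: mFc.
  - by move=> y; exact: F0.
  move=> i y y' h1 h2; apply: (Fp (lift ord0 i)); last by rewrite !tnthS.
  move=> j; have [k ->|->] := unliftP ord0 j; last by rewrite !tnth0.
  by rewrite (inj_eq lift_inj) !tnthS; exact: h1.
under eq_integral => s _ do rewrite slice.
rewrite (@uniform01_reflect _ (v ord0) (fun s => \int[torus R n]_y F (cons_tuple s y)))%E//.
- apply: (@measurable_fun_fubini_tonelli_F _ _ (measurableTypeR R) (cell n) R (torus R n)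
    (fun z => F (cons_tuple z.1 z.2))) => //.
  by apply: (measurableT_comp mF); exact: measurable_consp.
- by move=> s; apply: integral_ge0.
move=> s; apply: eq_integral => y _; apply: (Fp ord0); last by rewrite !tnth0.
by move=> j; have [k ->|->] := unliftP ord0 j; rewrite ?eqxx// !tnthS.
Qed.

End torus_measure.

(** * Periodic functions, their integrals and convolutions *)

Section torus_functions.
Context {R : realType} {d : nat}.
Local Notation vec := 'rV[R]_d.
Local Notation cell := (d.-tuple (measurableTypeR R)).
Local Notation mu := (torus R d).
Local Notation tperiodic := Defs.periodic.
Local Notation conv := Defs.conv.
Implicit Types (f g h : vec -> R) (x v : vec) (c : R).

Definition tmeasurable f := measurable_fun setT (f \o @pt R d).

(** Integrability concerns the unit cell only; periodicity is included because a convolution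
    evaluates the function outside the cell. *)
Definition L1 f := tperiodic f /\ tintegrable f.

Lemma tintegrable_measurable f : tintegrable f -> tmeasurable f.
Proof. by move=> fi; apply/measurable_EFinP; exact: (measurable_int _ fi). Qed.

Lemma measurable_pt_coord i : measurable_fun setT (fun y : cell => pt y 0 i).
Proof.
by under eq_fun do rewrite mxE; exact: measurable_tnth.
Qed.

Lemma ptK x : pt [tuple x 0 i | i < d] = x.
Proof. by apply/rowP => i; rewrite mxE tnth_mktuple. Qed.

(** Measurability on the torus means measurability after [pt]. As [pt] is onto ([ptK]), a
    coordinatewise measurable map into row vectors factors through tuples. *)
Lemma measurable_pt_comp dd (T : measurableType dd) (F : T -> vec) f :
  tmeasurable f -> (forall i, measurable_fun setT (fun z => F z 0 i)) ->
  measurable_fun setT (f \o F).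
Proof.
move=> mf mF.
rewrite (_ : f \o F = (f \o @pt R d) \o (fun z => [tuple F z 0 i | i < d])).
  apply: measurableT_comp => //; apply/measurable_fun_tnthP => i.
  rewrite (_ : _ \o _ = (fun z => F z 0 i)); first exact: mF.
  by apply/funext => z /=; rewrite tnth_mktuple.
by apply/funext => z /=; rewrite ptK.
Qed.

Lemma tmeasurable_reflect f x : tmeasurable f -> tmeasurable (fun y => f (x - y)).
Proof.
move=> mf; apply: (measurable_pt_comp mf (F := fun y => x - pt y)) => i.
under eq_fun do rewrite !mxE.
by apply: measurable_funB => //; exact: measurable_tnth.
Qed.

Lemma tmeasurable_shift f x : tmeasurable f -> tmeasurable (fun y => f (y + x)).
Proof.
move=> mf; apply: (measurable_pt_comp mf (F := fun y => pt y + x)) => i.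
under eq_fun do rewrite !mxE.
by apply: measurable_funD => //; exact: measurable_tnth.
Qed.

Lemma tmeasurableM f g : tmeasurable f -> tmeasurable g -> tmeasurable (fun x => f x * g x).
Proof. by move=> mf mg; exact: measurable_funM. Qed.

Lemma tmeasurableB f g : tmeasurable f -> tmeasurable g -> tmeasurable (fun x => f x - g x).
Proof. by move=> mf mg; exact: measurable_funB. Qed.

Lemma tmeasurable_norm f : tmeasurable f -> tmeasurable (fun x => `|f x|).
Proof. by move=> mf; exact: measurableT_comp. Qed.

Lemma tmeasurable_cst c : tmeasurable (fun=> c).
Proof. exact: measurable_cst. Qed.

Lemma tmeasurable_sum (I : Type) (s : seq I) (F : I -> vec -> R) :
  (forall i, tmeasurable (F i)) -> tmeasurable (fun x => \sum_(i <- s) F i x).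
Proof. by move=> mF; apply: measurable_sum => i; exact: mF. Qed.

Lemma eq_tint f g : f =1 g -> tint f = tint g.
Proof. by move=> fg; apply: eq_Rintegral => y _; exact: fg. Qed.

Lemma ae_eq_tint f g : {ae mu, forall y, f (pt y) = g (pt y)} -> tint f = tint g.
Proof. exact: ae_eq_RintegralT. Qed.

Lemma eq_tintegrable f g : f =1 g -> tintegrable f -> tintegrable g.
Proof. by move=> /funext ->. Qed.

Lemma tintegrable_cst c : tintegrable (fun _ : vec => c).
Proof. exact: finite_measure_integrable_cst. Qed.

Lemma tint_cst c : tint (fun _ : vec => c) = c.
Proof. by rewrite /tint Rintegral_cst//= (_ : mu setT = 1%E) ?mulr1//; exact: probability_setT. Qed.

Lemma tintegrableD f g : tintegrable f -> tintegrable g -> tintegrable (fun x => f x + g x).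
Proof. by move=> fi gi; apply: (eq_integrable measurableT _ _ _ (integrableD measurableT fi gi)). Qed.

Lemma tintegrableB f g : tintegrable f -> tintegrable g -> tintegrable (fun x => f x - g x).
Proof. by move=> fi gi; apply: (eq_integrable measurableT _ _ _ (integrableB measurableT fi gi)). Qed.

Lemma tintegrableZ c f : tintegrable f -> tintegrable (fun x => c * f x).
Proof. by move=> fi; apply: (eq_integrable measurableT _ _ _ (integrableZl measurableT c fi)). Qed.

Lemma tintegrable_norm f : tintegrable f -> tintegrable (fun x => `|f x|).
Proof. by move=> fi; exact: (integrable_norm fi). Qed.

Lemma tintegrableM_ae f h c : tintegrable f -> tmeasurable h ->
  {ae mu, forall y, `|h (pt y)| <= c} -> tintegrable (fun x => h x * f x).
Proof.
move=> fi mh hc; have mf := tintegrable_measurable fi.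
have [+ ioo] := (integrableP _ _ _ (tintegrableZ c (tintegrable_norm fi))).
move=> _; apply/integrableP; split; first exact/measurable_EFinP/measurable_funM.
apply: le_lt_trans ioo; apply: ae_ge0_le_integral => //.
- by apply: measurableT_comp => //; exact/measurable_EFinP/measurable_funM.
- apply: measurableT_comp => //; apply/measurable_EFinP; apply: measurable_funM => //.
  exact: measurableT_comp.
apply: filterS hc => y hc _ /=; rewrite lee_fin !normrM normr_id ler_wpM2r//.
exact: le_trans (ler_norm _).
Qed.

Lemma tintegrableM f h c : tintegrable f -> tmeasurable h ->
  (forall x, `|h x| <= c) -> tintegrable (fun x => h x * f x).
Proof. by move=> fi mh hc; apply: (tintegrableM_ae (c := c)) => //; exact: aeW. Qed.

Lemma tintegrable_bdd f c : tmeasurable f -> (forall x, `|f x| <= c) -> tintegrable f.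
Proof.
move=> mf fc; apply: (@eq_tintegrable (fun x => f x * 1)) => [x|]; first by rewrite mulr1.
by apply: (tintegrableM (c := c)) => //; exact: tintegrable_cst.
Qed.

Lemma tintegrable_le f g : tmeasurable f -> tintegrable g ->
  (forall x, `|f x| <= g x) -> tintegrable f.
Proof.
move=> mf gi fg; apply: (le_integrable measurableT _ _ gi); first exact/measurable_EFinP.
by move=> x _ /=; rewrite lee_fin (le_trans (fg _))// ler_norm.
Qed.

Lemma tintD f g : tintegrable f -> tintegrable g ->
  tint (fun x => f x + g x) = tint f + tint g.
Proof. by move=> fi gi; exact: RintegralD. Qed.

Lemma tintB f g : tintegrable f -> tintegrable g ->
  tint (fun x => f x - g x) = tint f - tint g.
Proof. by move=> fi gi; exact: RintegralB. Qed.

Lemma tintZ c f : tintegrable f -> tint (fun x => c * f x) = c * tint f.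
Proof. by move=> fi; exact: RintegralZl. Qed.

Lemma tintegrable_sum (I : Type) (s : seq I) (F : I -> vec -> R) :
  (forall i, tintegrable (F i)) -> tintegrable (fun x => \sum_(i <- s) F i x).
Proof. by move=> Fi; have [] := Rintegral_sum s measurableT Fi. Qed.

Lemma tint_sum (I : Type) (s : seq I) (F : I -> vec -> R) :
  (forall i, tintegrable (F i)) -> tint (fun x => \sum_(i <- s) F i x) = \sum_(i <- s) tint (F i).
Proof. by move=> Fi; have [] := Rintegral_sum s measurableT Fi. Qed.

Lemma tint_ge0 f : (forall x, 0 <= f x) -> 0 <= tint f.
Proof. by move=> f0; apply: Rintegral_ge0. Qed.

Lemma le_tint f g : tintegrable f -> tintegrable g -> (forall x, f x <= g x) ->
  tint f <= tint g.
Proof. by move=> fi gi fg; apply: le_Rintegral. Qed.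

Lemma ae_le_tint f g : tintegrable f -> tintegrable g ->
  {ae mu, forall y, f (pt y) <= g (pt y)} -> tint f <= tint g.
Proof.
move=> fi gi fg.
have mf := tintegrable_measurable fi; have mg := tintegrable_measurable gi.
(* The minimum equals [f] almost everywhere and lies below [g] everywhere. *)
rewrite (@ae_eq_tint f (fun x => Num.min (f x) (g x))).
  apply: le_tint => // [|x]; last by rewrite ge_min lexx orbT.
  apply: (tintegrable_le (g := fun x => `|f x| + `|g x|)).
  - exact: measurable_minr.
  - by apply: tintegrableD; exact: tintegrable_norm.
  by move=> x; rewrite /Num.min; case: ifP => _; rewrite ?lerDl ?lerDr.
by apply: filterS fg => y fg; rewrite min_l.
Qed.

Lemma ae_norm_tint_le f g : tintegrable f -> tintegrable g ->
  {ae mu, forall y, `|f (pt y)| <= g (pt y)} -> `|tint f| <= tint g.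
Proof.
move=> fi gi fg; apply: (le_trans (le_normr_Rintegral measurableT fi)).
by apply: (@ae_le_tint (fun x => `|f x|)) => //; exact: tintegrable_norm.
Qed.

Lemma norm_tint_le f g : tintegrable f -> tintegrable g ->
  (forall x, `|f x| <= g x) -> `|tint f| <= tint g.
Proof. by move=> fi gi fg; apply: ae_norm_tint_le => //; exact: aeW. Qed.

Lemma periodicM f g : tperiodic f -> tperiodic g -> tperiodic (fun x => f x * g x).
Proof. by move=> pf pg i x; rewrite pf pg. Qed.

Lemma periodic_reflect f x : tperiodic f -> tperiodic (fun y => f (x - y)).
Proof.
move=> pf i y; rewrite -(pf i (x - (y + evec i))); congr f.
by rewrite opprD addrA subrK.
Qed.

Lemma reflect_integral (g : vec -> \bar R) x : measurable_fun setT (g \o @pt R d) ->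
  (forall y, 0 <= g y)%E -> tperiodic g ->
  (\int[mu]_y g (x - pt y)%R = \int[mu]_y g (pt y))%E.
Proof.
move=> mg g0 pg.
have E y : x - pt y = pt (rtuple (x 0) y :> cell).
  by apply/rowP => i; rewrite !mxE tnth_mktuple.
under eq_integral do rewrite E.
apply: (@integral_torus_reflect R d (x 0) (g \o @pt R d)) => //.
  by move=> y; exact: g0.
move=> i y y' h1 h2 /=; rewrite -(pg i (pt y)); congr g.
apply/rowP => j; rewrite !mxE /=; have [->|ji] := eqVneq j i; first by rewrite h2.
by rewrite h1// addr0.
Qed.

Lemma tint_reflect f x : tmeasurable f -> tperiodic f -> tint (fun y => f (x - y)) = tint f.
Proof.
move=> mf pf; congr fine; rewrite integralE [RHS]integralE; congr (_ - _)%E.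
  transitivity (\int[mu]_y (EFin \o f)^\+%E (x - pt y)%R)%E.
    by apply: eq_integral => y _; rewrite !funeposE.
  rewrite (@reflect_integral (EFin \o f)^\+%E x)//.
  - by apply: eq_integral => y _; rewrite !funeposE.
  - rewrite (_ : _ \o _ = (EFin \o (f \o @pt R d))^\+%E); last first.
      by apply/funext => y /=; rewrite !funeposE.
    by apply: measurable_funepos; exact/measurable_EFinP.
  - by move=> i y; rewrite !funeposE /= pf.
transitivity (\int[mu]_y (EFin \o f)^\-%E (x - pt y)%R)%E.
  by apply: eq_integral => y _; rewrite !funenegE.
rewrite (@reflect_integral (EFin \o f)^\-%E x)//.
- by apply: eq_integral => y _; rewrite !funenegE.
- rewrite (_ : _ \o _ = (EFin \o (f \o @pt R d))^\-%E); last first.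
      by apply/funext => y /=; rewrite !funenegE.
    by apply: measurable_funeneg; exact/measurable_EFinP.
- by move=> i y; rewrite !funenegE /= pf.
Qed.

Lemma tintegrable_reflect f x : L1 f -> tintegrable (fun y => f (x - y)).
Proof.
move=> [pf fi]; have mf := tintegrable_measurable fi.
apply/integrableP; split; first by apply/measurable_EFinP; exact: (tmeasurable_reflect x mf).
have [_] := integrableP _ _ _ fi.
rewrite -(@reflect_integral (fun y => `|(f y)%:E|)%E x)//.
- by apply: measurableT_comp => //; exact/measurable_EFinP.
- by move=> i y; rewrite pf.
Qed.

Lemma L1_reflect f x : L1 f -> L1 (fun y => f (x - y)).
Proof. by move=> Lf; split; [apply: periodic_reflect; case: Lf|exact: tintegrable_reflect]. Qed.

(** A translation is a composite of two reflections, so only reflection invariance has to be proved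
    from the measure. *)
Lemma L1_shift f x : L1 f -> L1 (fun y => f (y + x)).
Proof.
move=> Lf; rewrite (_ : (fun y => _) = (fun y => (fun z => f (x - z)) (0 - y))).
  exact: (@L1_reflect (fun z => f (x - z)) 0 (L1_reflect x Lf)).
by apply/funext => y; rewrite sub0r opprK addrC.
Qed.

Lemma tint_shift f x : tmeasurable f -> tperiodic f -> tint (fun y => f (y + x)) = tint f.
Proof.
move=> mf pf; rewrite (_ : (fun y => _) = (fun y => (fun z => f (x - z)) (0 - y))).
  rewrite (@tint_reflect (fun z => f (x - z))) ?tint_reflect//.
    exact: tmeasurable_reflect.
  exact: periodic_reflect.
by apply/funext => y; rewrite sub0r opprK addrC.
Qed.

Lemma L1_measurable f : L1 f -> tmeasurable f.
Proof. by case=> _; exact: tintegrable_measurable. Qed.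

Lemma tfubini (F : vec -> vec -> R) :
  (mu \x mu)%E.-integrable setT (EFin \o (fun z : cell * cell => F (pt z.1) (pt z.2))) ->
  [/\ {ae mu, forall y : cell, tintegrable (F (pt y))},
      {ae mu, forall y : cell, tintegrable (F ^~ (pt y))},
      tintegrable (fun x => tint (F x)),
      tintegrable (fun y => tint (F ^~ y)) &
      tint (fun x => tint (F x)) = tint (fun y => tint (F ^~ y))].
Proof. exact: Rfubini. Qed.

Lemma measurable_conv_integrand f g : tmeasurable f -> tmeasurable g ->
  measurable_fun setT (fun z : cell * cell => f (pt z.2 - pt z.1) * g (pt z.1)).
Proof.
move=> mf mg; apply: measurable_funM.
  apply: (measurable_pt_comp mf (F := fun z : cell * cell => pt z.2 - pt z.1)) => i.
  under eq_fun do rewrite !mxE.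
  apply: measurable_funB.
    by apply: (measurableT_comp (measurable_tnth i)); exact: measurable_snd.
  by apply: (measurableT_comp (measurable_tnth i)); exact: measurable_fst.
apply: (measurable_pt_comp mg (F := fun z : cell * cell => pt z.1)) => i.
under eq_fun do rewrite !mxE.
by apply: (measurableT_comp (measurable_tnth i)); exact: measurable_fst.
Qed.

(** For fixed [y] the integral over [x] is the norm of [f] times [|g y|], by translation
    invariance. *)
Lemma conv_integrable f g : L1 f -> L1 g ->
  (mu \x mu)%E.-integrable setT
    (EFin \o (fun z : cell * cell => f (pt z.2 - pt z.1) * g (pt z.1))).
Proof.
move=> Lf Lg; have mf := L1_measurable Lf; have mg := L1_measurable Lg.
apply: Rfubini_integrable.
- exact: measurable_conv_integrand.
- move=> y /=.
  apply: (@eq_tintegrable (fun x => g (pt y) * f (x + (- pt y)))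
    (fun x => f (x - pt y) * g (pt y))) => [x|].
    by rewrite mulrC.
  by apply: tintegrableZ; case: (L1_shift (- pt y) Lf).
apply: (@eq_tintegrable (fun y => tint (fun x => `|f x|) * `|g y|)
  (fun y => tint (fun x => `|f (x - y) * g y|))) => [y|]; last first.
  by apply: tintegrableZ; apply: tintegrable_norm; case: Lg.
rewrite -(@tint_shift (fun x => `|f x|) (- y)).
- rewrite mulrC -tintZ.
    by apply: eq_tint => x; rewrite normrM mulrC.
  by apply: (tintegrable_norm (f := fun x => f (x - y))); case: (L1_shift (- y) Lf).
- exact: tmeasurable_norm.
- by move=> i x; case: Lf => ->.
Qed.

Lemma conv_periodic f g : tperiodic f -> tperiodic (conv f g).
Proof.
move=> pf i x; apply: eq_tint => y; congr (_ * _).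
by rewrite addrAC pf.
Qed.

(** The convolution integral is known to converge at almost every point only; elsewhere [conv] is
    whatever [fine] returns. The second clause records where its value is meaningful. *)
Lemma L1_conv f g : L1 f -> L1 g ->
  [/\ L1 (conv f g), {ae mu, forall z : cell, tintegrable (fun y => f (pt z - y) * g y)} &
     tint (conv f g) = tint f * tint g].
Proof.
move=> Lf Lg; have mf := L1_measurable Lf; have mg := L1_measurable Lg.
have [_ H2 _ H4 H5] := tfubini (F := fun y x => f (x - y) * g y) (conv_integrable Lf Lg).
split; [by split; [apply: conv_periodic; case: Lf|exact: H4]|exact: H2|].
rewrite /Defs.conv -[LHS]H5 -[RHS]tintZ; last by case: Lg.
apply: eq_tint => y.
rewrite -(tint_shift (- y) mf Lf.1).
rewrite [LHS](@eq_tint _ (fun x => g y * f (x - y))); last by move=> x; rewrite mulrC.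
rewrite tintZ; first by rewrite mulrC.
by case: (L1_shift (- y) Lf).
Qed.

Lemma tint_norm_conv_le f g : L1 f -> L1 g ->
  tint (fun x => `|conv f g x|) <= tint (fun x => `|f x|) * tint (fun x => `|g x|).
Proof.
move=> Lf Lg.
have Lnf : L1 (fun x => `|f x|).
  by split; [move=> i x; rewrite (Lf.1 i x)|apply: tintegrable_norm; case: Lf].
have Lng : L1 (fun x => `|g x|).
  by split; [move=> i x; rewrite (Lg.1 i x)|apply: tintegrable_norm; case: Lg].
have [[_ c1] a1 _] := L1_conv Lf Lg; have [[_ c2] a2 <-] := L1_conv Lnf Lng.
apply: ae_le_tint => //; first exact: tintegrable_norm.
apply: filterS2 a1 a2 => x i1 i2; apply: norm_tint_le => // y.
by rewrite normrM.
Qed.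

Lemma tconvC f g x : tperiodic f -> tperiodic g -> tmeasurable f -> tmeasurable g ->
  conv f g x = conv g f x.
Proof.
move=> pf pg mf mg; rewrite /Defs.conv -(@tint_reflect (fun y => f (x - y) * g y) x).
- by apply: eq_tint => y; rewrite opprB addrC subrK mulrC.
- by apply: tmeasurableM; [exact: tmeasurable_reflect|].
- by apply: periodicM => //; exact: periodic_reflect.
Qed.

Section bounded_kernel.
Variables (k : vec -> R) (c : R).
Hypotheses (pk : tperiodic k) (mk : tmeasurable k) (kc : forall x, `|k x| <= c).

Lemma L1_bounded : L1 k.
Proof. by split => //; exact: tintegrable_bdd kc. Qed.

Lemma conv_bounded_integrable f x : L1 f -> tintegrable (fun y => k (x - y) * f y).
Proof. by case=> _ fi; apply: tintegrableM fi (tmeasurable_reflect x mk) (fun y => kc _). Qed.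

Lemma conv_bounded_norm f x : L1 f -> `|conv k f x| <= c * tint (fun y => `|f y|).
Proof.
move=> Lf; rewrite -tintZ; last by apply: tintegrable_norm; case: Lf.
apply: norm_tint_le; first exact: conv_bounded_integrable.
  by apply: tintegrableZ; apply: tintegrable_norm; case: Lf.
by move=> y; rewrite normrM ler_wpM2r.
Qed.

(** As [k] is bounded, the double integral converges absolutely for each [x]. The identity thus
    holds at every point, although [conv f g] is meaningful only almost everywhere. *)
Lemma conv_assoc f g x : L1 f -> L1 g ->
  conv k (conv f g) x = conv (conv k f) g x.
Proof.
move=> Lf Lg; have mf := L1_measurable Lf; have mg := L1_measurable Lg.
have I : (mu \x mu)%E.-integrable setT (EFin \o (fun z : cell * cell =>
    k (x - pt z.2) * (f (pt z.2 - pt z.1) * g (pt z.1)))).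
  apply: (integrableMbdd (c := c)) (conv_integrable Lf Lg) _ _ => //.
  apply: (measurable_pt_comp mk (F := fun z : cell * cell => x - pt z.2)) => i.
  under eq_fun do rewrite !mxE.
  apply: measurable_funB => //.
  by apply: (measurableT_comp (measurable_tnth i)); exact: measurable_snd.
have [_ _ _ _ E] := tfubini (F := fun y z => k (x - z) * (f (z - y) * g y)) I.
have [_ ai _] := L1_conv Lf Lg.
transitivity (tint (fun z => tint (fun y => k (x - z) * (f (z - y) * g y)))).
  apply: ae_eq_tint; apply: filterS ai => z fi.
  by rewrite -tintZ.
rewrite -E; apply: eq_tint => y.
rewrite -[conv k f (x - y)](@tint_shift (fun w => k (x - y - w) * f w) (- y)).
- rewrite mulrC -tintZ.
    by apply: eq_tint => z; rewrite opprB addrA subrK; ring.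
  apply: (@eq_tintegrable (fun z => k (x - z) * f (z - y))) => [z|].
    by rewrite opprB addrA subrK.
  by apply: conv_bounded_integrable; exact: (L1_shift (- y)).
- by apply: tmeasurableM; [exact: tmeasurable_reflect|].
- by apply: periodicM; [exact: periodic_reflect|case: Lf].
Qed.

Lemma conv_adjoint f g : L1 f -> L1 g ->
  tint (fun x => conv k f x * g x) = tint (fun y => f y * conv (fun z => k (- z)) g y).
Proof.
move=> Lf Lg; have mf := L1_measurable Lf; have mg := L1_measurable Lg.
have mF : measurable_fun setT (fun z : cell * cell => k (pt z.1 - pt z.2) * f (pt z.2) * g (pt z.1)).
  apply: measurable_funM; last first.
    apply: (measurable_pt_comp mg (F := fun z : cell * cell => pt z.1)) => i.
    under eq_fun do rewrite !mxE.
    by apply: (measurableT_comp (measurable_tnth i)); exact: measurable_fst.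
  apply: measurable_funM; last first.
    apply: (measurable_pt_comp mf (F := fun z : cell * cell => pt z.2)) => i.
    under eq_fun do rewrite !mxE.
    by apply: (measurableT_comp (measurable_tnth i)); exact: measurable_snd.
  apply: (measurable_pt_comp mk (F := fun z : cell * cell => pt z.1 - pt z.2)) => i.
  under eq_fun do rewrite !mxE.
  apply: measurable_funB.
    by apply: (measurableT_comp (measurable_tnth i)); exact: measurable_fst.
  by apply: (measurableT_comp (measurable_tnth i)); exact: measurable_snd.
have I : (mu \x mu)%E.-integrable setT (EFin \o (fun z : cell * cell =>
    k (pt z.1 - pt z.2) * f (pt z.2) * g (pt z.1))).
  apply: Rfubini_integrable => //.
  - move=> x /=; apply: (@eq_tintegrable (fun y => g (pt x) * (k (pt x - y) * f y))
      (fun y => k (pt x - y) * f y * g (pt x))) => [y|]; first by rewrite mulrC.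
    by apply: tintegrableZ; exact: conv_bounded_integrable.
  apply: (@tintegrable_le (fun x => tint (fun y => `|k (x - y) * f y * g x|))
     (fun x => (c * tint (fun y => `|f y|)) * `|g x|)).
  - exact: (measurable_Rfubini mu (measurableT_comp (@normr_measurable R setT) mF)).
  - by apply: tintegrableZ; apply: tintegrable_norm; case: Lg.
  move=> x; rewrite ger0_norm; last by apply: tint_ge0.
  have ci := conv_bounded_integrable x Lf.
  rewrite (@eq_tint _ (fun y => `|g x| * `|k (x - y) * f y|)); last first.
    by move=> y; rewrite normrM mulrC.
  rewrite tintZ; last exact: tintegrable_norm.
  rewrite mulrC ler_wpM2r// -tintZ; last by apply: tintegrable_norm; case: Lf.
  apply: le_tint; [exact: tintegrable_norm| |].
    by apply: tintegrableZ; apply: tintegrable_norm; case: Lf.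
  by move=> y; rewrite normrM ler_wpM2r.
have [_ _ _ _ E] := tfubini (F := fun x y => k (x - y) * f y * g x) I.
transitivity (tint (fun x => tint (fun y => k (x - y) * f y * g x))).
  apply: eq_tint => x; rewrite mulrC -tintZ; last exact: conv_bounded_integrable.
  by apply: eq_tint => y; rewrite mulrC.
rewrite E; apply: eq_tint => y.
rewrite -tintZ.
  by apply: eq_tint => x /=; rewrite opprB; ring.
apply: (@eq_tintegrable (fun x => k (x - y) * g x)) => [x|]; first by rewrite opprB.
case: Lg => _ gi; apply: tintegrableM gi _ (fun x => kc _).
exact: (tmeasurable_shift (- y)).
Qed.

End bounded_kernel.

End torus_functions.

(** * Measurability of limits and of continuous functions *)

Section limits.
Context (R : realType).

(* The pointwise limit need not be measurable; it agrees almost everywhere with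
   a measurable function obeying the same bound. *)
Lemma ae_cvg_measurable dd (T : measurableType dd) (m : {measure set T -> \bar R})
    (f_ : nat -> T -> R) (f : T -> R) (c : R) : 0 <= c ->
  (forall n, measurable_fun setT (f_ n)) -> (forall n x, `|f_ n x| <= c) ->
  {ae m, forall x, f_ ^~ x @ \oo --> f x} ->
  exists g : T -> R, [/\ measurable_fun setT g, (forall x, `|g x| <= c) &
    {ae m, forall x, g x = f x}].
Proof.
move=> c0 mf fc ff.
pose h x := limn_esup (fun n => (f_ n x)%:E).
exists (fun x => Num.max (- c) (Num.min c (fine (h x)))); split.
- apply: measurable_maxr => //; apply: measurable_minr => //.
  apply: (measurableT_comp (@fine_measurable R setT measurableT)) => //.
  by apply: measurable_fun_limn_esup => n; exact/measurable_EFinP.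
- by move=> x; rewrite ler_norml le_max lexx /= ge_max ge_min lexx /= andbT; lra.
apply: filterS ff => x fx.
have -> : h x = (f x)%:E.
  have : EFin \o (f_ ^~ x) @ \oo --> (f x)%:E by exact: cvg_comp fx _.
  by move=> /cvg_limn_einf_sup[].
have fxc : `|f x| <= c.
  have nfx : (fun n => `|f_ n x|) @ \oo --> `|f x| by exact: cvg_norm.
  rewrite -(cvg_lim _ nfx)//; apply: limr_le; first by apply/cvg_ex; exists `|f x|.
  by apply: nearW => n; exact: fc.
move: fxc; rewrite ler_norml => /andP[? ?] /=.
by rewrite min_r// max_r.
Qed.

Lemma Rdominated_convergenceT dd (T : measurableType dd) (m : {finite_measure set T -> \bar R})
    (f_ : nat -> T -> R) (f : T -> R) (c : R) : 0 <= c ->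
  (forall n, measurable_fun setT (f_ n)) -> (forall n x, `|f_ n x| <= c) ->
  {ae m, forall x, f_ ^~ x @ \oo --> f x} ->
  (fun n => \int[m]_x f_ n x) @ \oo --> \int[m]_x f x.
Proof.
move=> c0 mf fc ff; have [g [mg gc gf]] := ae_cvg_measurable c0 mf fc ff.
rewrite -(ae_eq_RintegralT gf).
have ff' : {ae m, forall x, setT x -> f_ ^~ x @ \oo --> g x}.
  by apply: filterS2 ff gf => x fx gx _; rewrite gx.
have ic : m.-integrable setT (EFin \o cst c) by exact: finite_measure_integrable_cst.
by have [] := Rdominated_convergence measurableT mf mg ff' ic (fun n x _ => fc n x).
Qed.

(** The sigma-algebra is the product one, so an open set has to be exhibited as a countable union of
    measurable sets: the boxes with rational ends that it contains, enumerated by [unpickle]. *)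
Lemma measurable_continuous d (F : R * 'rV[R]_d -> R) : continuous F ->
  measurable_fun setT (fun z : measurableTypeR R * d.-tuple (measurableTypeR R) => F (z.1, pt z.2)).
Proof.
move=> cF; apply: (measurability _ (RGenOInfty.measurableE R)) => //= _ [_ [a ->] <-].
rewrite setTI.
pose I := ((rat * rat) * {ffun 'I_d -> rat * rat})%type.
pose inb (b : rat * rat) (s : R) := (ratr b.1 < s) && (s < ratr b.2).
pose box (b : I) : set (R * 'rV[R]_d) :=
  [set w : R * 'rV[R]_d | inb b.1 w.1 /\ forall i, inb (b.2 i) (w.2 0 i)].
pose U := F @^-1` `]a, +oo[%classic.
have oU : open U by apply: open_comp => // z _; exact: cF.
pose e : measurableTypeR R * d.-tuple (measurableTypeR R) -> R * 'rV[R]_d := fun z => (z.1, pt z.2).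
have mbox b : measurable (e @^-1` box b).
  have -> : e @^-1` box b = [set z | inb b.1 z.1] `&` \bigcap_(i in setT) [set z | inb (b.2 i) (tnth z.2 i)].
    apply/seteqP; split => z [h1 h2]; split=> // i; first by move=> _; have := h2 i; rewrite /= mxE.
    by have := h2 i Logic.I; rewrite /= mxE.
  have minb q (f : measurableTypeR R * d.-tuple (measurableTypeR R) -> R) : measurable_fun setT f -> measurable [set z | inb q (f z)].
    move=> mf; have -> : [set z | inb q (f z)] = f @^-1` `]ratr q.1, ratr q.2[%classic.
      by apply/seteqP; split => z /=; rewrite in_itv.
    by rewrite -[_ @^-1` _]setTI; apply: mf.
  apply: measurableI; first by apply: minb; exact: measurable_fst.
  apply: fin_bigcap_measurable => [|i _]; first exact: finite_finset.
  apply: minb; apply: (measurableT_comp (measurable_tnth i)); exact: measurable_snd.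
have -> : (fun z : measurableTypeR R * d.-tuple (measurableTypeR R) => F (z.1, pt z.2)) @^-1` `]a, +oo[%classic =
   \bigcup_n (if unpickle n is Some b then (if `[< box b `<=` U >] then e @^-1` box b else set0) else set0).
  apply/seteqP; split => z /=; last first.
    case=> n _; case: (unpickle n) => [b|//].
    by case: asboolP => // bU /bU.
  move=> Uz; have /nbhs_ballP[r /= r0 rU] : nbhs (e z) U by apply: open_nbhs_nbhs; split.
  have ex (s : R) : exists q : rat * rat, inb q s /\ forall u, inb q u -> `|s - u| < r.
    have [q1] := @rat_in_itvoo R (s - r) s ltac:(by rewrite ltrBlDr ltrDl).
    have [q2] := @rat_in_itvoo R s (s + r) ltac:(by rewrite ltrDl).
    rewrite !in_itv /= => /andP[h1 h2] /andP[h3 h4]; exists (q1, q2); split.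
      by rewrite /inb /= h4 h1.
    by move=> u /andP[/= ? ?]; rewrite ltr_norml; apply/andP; split; lra.
  have [q0 [h0 h0']] := ex z.1.
  have [q hq] := choice (fun i => ex (tnth z.2 i)).
  pose b : I := (q0, [ffun i => q i]).
  exists (pickle b); first exact: Logic.I.
  rewrite pickleK; case: asboolP => [_|[]]; last first.
    move=> w [w1 w2]; apply: rU; split => /=; first exact: h0'.
    split => // i j; rewrite (ord1 i) /ball /= mxE; apply: (hq j).2.
    by have := w2 j; rewrite /= ffunE.
  by split=> //= i; rewrite ffunE mxE; exact: (hq i).1.
apply: bigcupT_measurable => n; case: (unpickle n) => [b|]; last exact: measurable0.
by case: ifP => _; [exact: mbox|exact: measurable0].
Qed.

Lemma tmeasurable_continuous d (f : 'rV[R]_d -> R) : continuous f -> tmeasurable f.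
Proof.
move=> cf; have cF : continuous (fun w : R * 'rV[R]_d => f w.2).
  by move=> w; apply: continuous_comp; [exact: cvg_snd|exact: cf].
have := measurable_continuous cF => mF.
have mp : measurable_fun setT (fun y : d.-tuple (measurableTypeR R) => ((0 : R), y)).
  exact: measurable_fun_pair.
exact: (measurableT_comp mF mp).
Qed.

End limits.

(** * Directional derivatives of real functions *)

Section derivatives.
Context {R : realType} {d : nat}.
Local Notation vec := 'rV[R]_d.

Lemma is_derive_compR (V : normedModType R) (f : V -> R) (g : R -> R) x v (dg : R) :
  differentiable f x -> is_derive (f x) 1 g dg ->
  is_derive x v (g \o f) (dg * 'D_v f x).
Proof.
move=> df [dg1 dg2].
have dg' : differentiable g (f x) by apply/derivable1_diffP.
have dgf := differentiable_comp df dg'.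
apply: DeriveDef; first exact: diff_derivable.
rewrite (deriveE _ dgf) (diff_comp df dg') /= (deriveE v df) deriv1E// derive1E dg2.
by rewrite /GRing.scale /= mulrC.
Qed.

Lemma is_derive_coord j x (v : vec) : is_derive x v (fun y : vec => y 0 j) (v 0 j).
Proof.
have dc := @differentiable_coord R 1 d x 0 j.
apply: DeriveDef; first exact: diff_derivable.
apply/cvg_lim => //.
apply: (@cvg_trans _ (v 0 j @[_ --> (0 : R)^'])); last exact: cvg_cst.
apply: near_eq_cvg; near=> h => /=.
rewrite !mxE addrK /GRing.scale /= mulKf//.
by near: h; exact: nbhs_dnbhs_neq.
Unshelve. all: by end_near. Qed.

Lemma is_deriveD_fun (V : normedModType R) (f g : V -> R) x v (df dg : R) :
  is_derive x v f df -> is_derive x v g dg ->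
  is_derive x v (fun y => f y + g y) (df + dg).
Proof. by move=> h1 h2; exact: is_deriveD. Qed.

Lemma is_deriveM_fun (V : normedModType R) (f g : V -> R) x v (df dg : R) :
  is_derive x v f df -> is_derive x v g dg ->
  is_derive x v (fun y => f y * g y) (f x * dg + g x * df).
Proof. by move=> h1 h2; exact: is_deriveM. Qed.

End derivatives.

(** * Trigonometric polynomials *)

Section trig.
Context {R : realType} {d : nat}.
Local Notation vec := 'rV[R]_d.
Local Notation tperiodic := Defs.periodic.
Implicit Types (f g : vec -> R) (x v : vec) (c : R).

(* Trigonometric polynomials. Convolution with one of them is a finite sum of
   products, so no derivative is ever taken under an integral sign. *)
Inductive tp : (vec -> R) -> Prop :=
| tp_cst c : tp (fun=> c)
| tp_cos i : tp (fun x => cos (2 * pi * x 0 i))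
| tp_sin i : tp (fun x => sin (2 * pi * x 0 i))
| tp_add f g : tp f -> tp g -> tp (fun x => f x + g x)
| tp_mul f g : tp f -> tp g -> tp (fun x => f x * g x).

Lemma eq_tp f g : f =1 g -> tp f -> tp g.
Proof. by move=> /funext ->. Qed.

Lemma tpZ c f : tp f -> tp (fun x => c * f x).
Proof. by move=> tf; apply: tp_mul => //; exact: tp_cst. Qed.

Lemma tpN f : tp f -> tp (fun x => - f x).
Proof. by move=> /(tpZ (-1)); apply: eq_tp => x; rewrite mulN1r. Qed.

Lemma tpB f g : tp f -> tp g -> tp (fun x => f x - g x).
Proof. by move=> tf /tpN; exact: tp_add. Qed.

Lemma tp_sum (I : eqType) (s : seq I) (F : I -> vec -> R) :
  (forall i, i \in s -> tp (F i)) -> tp (fun x => \sum_(i <- s) F i x).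
Proof.
elim: s => [_|i s IH H].
  by apply: eq_tp (tp_cst 0) => x; rewrite big_nil.
apply: (@eq_tp (fun x => F i x + \sum_(j <- s) F j x)) => [x|]; first by rewrite big_cons.
apply: tp_add; first by apply: H; rewrite mem_head.
by apply: IH => j js; apply: H; rewrite in_cons js orbT.
Qed.

Lemma tp_prod (I : eqType) (s : seq I) (F : I -> vec -> R) :
  (forall i, i \in s -> tp (F i)) -> tp (fun x => \prod_(i <- s) F i x).
Proof.
elim: s => [_|i s IH H].
  by apply: eq_tp (tp_cst 1) => x; rewrite big_nil.
apply: (@eq_tp (fun x => F i x * \prod_(j <- s) F j x)) => [x|]; first by rewrite big_cons.
apply: tp_mul; first by apply: H; rewrite mem_head.
by apply: IH => j js; apply: H; rewrite in_cons js orbT.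
Qed.

Lemma tp_exp f n : tp f -> tp (fun x => f x ^+ n).
Proof.
move=> tf; elim: n => [|n IH]; first by apply: eq_tp (tp_cst 1) => x; rewrite expr0.
by apply: (@eq_tp (fun x => f x * f x ^+ n)) => [x|]; [rewrite exprS|exact: tp_mul].
Qed.

Lemma tp_differentiable f x : tp f -> differentiable f x.
Proof.
move=> tf; elim: tf x => {f} [c|i|i|f g _ IHf _ IHg|f g _ IHf _ IHg] x.
- exact: differentiable_cst.
- have dl : differentiable (fun y : vec => 2 * pi * y 0 i) x.
    by apply: (@differentiableZ _ _ _ (fun y : vec => y 0 i)); exact: differentiable_coord.
  apply: (differentiable_comp dl); apply/derivable1_diffP; exact: derivable_cos.
- have dl : differentiable (fun y : vec => 2 * pi * y 0 i) x.
    by apply: (@differentiableZ _ _ _ (fun y : vec => y 0 i)); exact: differentiable_coord.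
  apply: (differentiable_comp dl); apply/derivable1_diffP; exact: derivable_sin.
- exact: differentiableD.
- exact: differentiableM.
Qed.

Lemma tp_derivable f x v : tp f -> derivable f x v.
Proof. by move=> tf; apply: diff_derivable; exact: tp_differentiable. Qed.

Lemma tp_is_derive f x v : tp f -> is_derive x v f ('D_v f x).
Proof. by move=> tf; apply/derivableP; exact: tp_derivable. Qed.

Lemma tp_continuous f : tp f -> continuous f.
Proof. by move=> tf x; apply: differentiable_continuous; exact: tp_differentiable. Qed.

Lemma tp_measurable f : tp f -> tmeasurable f.
Proof. by move=> tf; apply: tmeasurable_continuous; exact: tp_continuous. Qed.

Lemma partialD f g i x : tp f -> tp g ->
  partial i (fun y => f y + g y) x = partial i f x + partial i g x.
Proof.
move=> tf tg; apply: derive_val.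
exact: is_deriveD_fun (tp_is_derive x (evec i) tf) (tp_is_derive x (evec i) tg).
Qed.

Lemma partialM f g i x : tp f -> tp g ->
  partial i (fun y => f y * g y) x = f x * partial i g x + g x * partial i f x.
Proof.
move=> tf tg; apply: derive_val.
exact: is_deriveM_fun (tp_is_derive x (evec i) tf) (tp_is_derive x (evec i) tg).
Qed.

Lemma partial_cst c i x : partial i (fun _ : vec => c) x = 0.
Proof. exact: derive_cst. Qed.

Lemma partialZ c f i x : tp f -> partial i (fun y => c * f y) x = c * partial i f x.
Proof. by move=> tf; rewrite partialM ?partial_cst ?mulr0 ?addr0//; exact: tp_cst. Qed.

Lemma partial_sum (I : eqType) (s : seq I) (F : I -> vec -> R) i x :
  (forall j, j \in s -> tp (F j)) ->
  partial i (fun y => \sum_(j <- s) F j y) x = \sum_(j <- s) partial i (F j) x.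
Proof.
elim: s => [_|j s IH H].
  by under eq_fun do rewrite big_nil; rewrite big_nil partial_cst.
under eq_fun do rewrite big_cons.
rewrite partialD ?IH ?big_cons//.
- by move=> k ks; apply: H; rewrite in_cons ks orbT.
- by apply: H; rewrite mem_head.
- by apply: tp_sum => k ks; apply: H; rewrite in_cons ks orbT.
Qed.

Lemma partial_comp_coord (u : R -> R) (du : R) i j x :
  is_derive (x 0 j) 1 u du ->
  partial i (fun y : vec => u (y 0 j)) x = du * (j == i)%:R.
Proof.
move=> hu; have [_ H] := is_derive_compR (f := fun y : vec => y 0 j) (evec i)
  (@differentiable_coord R 1 d x 0 j) hu.
rewrite /partial [LHS]H; congr (_ * _).
by have [_ ->] := @is_derive_coord R d j x (evec i); rewrite mxE eqxx.
Qed.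

Lemma is_derive_cos2pi (s : R) : is_derive s 1 (fun s => cos (2 * pi * s)) (- (2 * pi) * sin (2 * pi * s)).
Proof. by apply: is_derive_eq; rewrite /GRing.scale /=; ring. Qed.

Lemma is_derive_sin2pi (s : R) : is_derive s 1 (fun s => sin (2 * pi * s)) (2 * pi * cos (2 * pi * s)).
Proof. by apply: is_derive_eq; rewrite /GRing.scale /=; ring. Qed.

Lemma tp_partial f i : tp f -> tp (partial i f).
Proof.
move=> tf; elim: tf => {f} [c|j|j|f g tf IHf tg IHg|f g tf IHf tg IHg].
- by apply: eq_tp (tp_cst 0) => x; rewrite partial_cst.
- apply: (@eq_tp (fun x => - (2 * pi) * (j == i)%:R * sin (2 * pi * x 0 j))) => [x|].
    by rewrite (partial_comp_coord _ (is_derive_cos2pi _)) mulrAC.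
  by apply: tpZ; exact: tp_sin.
- apply: (@eq_tp (fun x => 2 * pi * (j == i)%:R * cos (2 * pi * x 0 j))) => [x|].
    by rewrite (partial_comp_coord _ (is_derive_sin2pi _)) mulrAC.
  by apply: tpZ; exact: tp_cos.
- apply: (@eq_tp (fun x => partial i f x + partial i g x)) => [x|].
    by rewrite partialD.
  exact: tp_add.
- apply: (@eq_tp (fun x => f x * partial i g x + g x * partial i f x)) => [x|].
    by rewrite partialM.
  by apply: tp_add; exact: tp_mul.
Qed.

Lemma tp_smooth f : tp f -> smooth f.
Proof.
move=> tf s /=; have : tp (foldr partial f s).
  by elim: s => //= i s IH; exact: tp_partial.
move=> tg; split; first exact: tp_continuous.
by move=> i x; exact: tp_derivable.
Qed.

Lemma tp_periodic f : tp f -> tperiodic f.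
Proof.
have c2 : cos (2 * pi) = 1 :> R by rewrite mulr_natl cos2pi.
have s2 : sin (2 * pi) = 0 :> R by rewrite mulr_natl sin2pi.
move=> tf; elim: tf => {f} [//|j|j|f g _ IHf _ IHg|f g _ IHf _ IHg] i x /=.
- rewrite !mxE /=; case: (j == i) => /=; last by rewrite addr0.
  by rewrite mulrDr mulr1 cosD c2 s2; ring.
- rewrite !mxE /=; case: (j == i) => /=; last by rewrite addr0.
  by rewrite mulrDr mulr1 sinD c2 s2; ring.
- by rewrite IHf IHg.
- by rewrite IHf IHg.
Qed.

Lemma tp_test f : tp f -> test_function f.
Proof. by move=> tf; split; [exact: tp_periodic|exact: tp_smooth]. Qed.

Lemma tp_bounded f : tp f -> exists2 c, 0 <= c & forall x, `|f x| <= c.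
Proof.
elim => {f} [c|j|j|f g _ [a a0 fa] _ [b b0 gb]|f g _ [a a0 fa] _ [b b0 gb]].
- by exists `|c|.
- by exists 1 => // x; rewrite ler_norml cos_geN1 cos_le1.
- by exists 1 => // x; rewrite ler_norml sin_geN1 sin_le1.
- exists (a + b); first exact: addr_ge0.
  by move=> x; rewrite (le_trans (ler_normD _ _))// lerD.
- exists (a * b); first exact: mulr_ge0.
  by move=> x; rewrite normrM ler_pM.
Qed.

Lemma tp_integrable f : tp f -> tintegrable f.
Proof.
by move=> tf; have [c _ fc] := tp_bounded tf; apply: tintegrable_bdd fc; exact: tp_measurable.
Qed.

Lemma tp_L1 f : tp f -> L1 f.
Proof. by move=> tf; split; [exact: tp_periodic|exact: tp_integrable]. Qed.

(* The addition formulas make every translation-invariant kernel with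
   trigonometric profile degenerate. *)
Lemma tp_addition f : tp f -> exists (I : finType) (a b : I -> vec -> R),
  [/\ (forall l, tp (a l)), (forall l, tp (b l)) &
  forall x y, f (x + y) = \sum_l a l x * b l y].
Proof.
elim => {f} [c|j|j|f g _ [I [a [b [ta tb E]]]] _ [I' [a' [b' [ta' tb' E']]]]
  |f g _ [I [a [b [ta tb E]]]] _ [I' [a' [b' [ta' tb' E']]]]].
- exists unit, (fun _ _ => c), (fun _ _ => 1); split; try by move=> _; exact: tp_cst.
  by move=> x y; rewrite (big_pred1 tt) ?mulr1// => -[].
- exists bool, (fun l x => if l then cos (2 * pi * x 0 j) else - sin (2 * pi * x 0 j)),
    (fun l x => if l then cos (2 * pi * x 0 j) else sin (2 * pi * x 0 j)); split.
  + by case; [exact: tp_cos|apply: tpN; exact: tp_sin].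
  + by case; [exact: tp_cos|exact: tp_sin].
  by move=> x y; rewrite big_bool /= mxE mulrDr cosD; ring.
- exists bool, (fun l x => if l then sin (2 * pi * x 0 j) else cos (2 * pi * x 0 j)),
    (fun l x => if l then cos (2 * pi * x 0 j) else sin (2 * pi * x 0 j)); split.
  + by case; [exact: tp_sin|exact: tp_cos].
  + by case; [exact: tp_cos|exact: tp_sin].
  by move=> x y; rewrite big_bool /= mxE mulrDr sinD; ring.
- exists (I + I')%type, (fun l => match l with inl k => a k | inr k => a' k end),
    (fun l => match l with inl k => b k | inr k => b' k end); split.
  + by case.
  + by case.
  by move=> x y; rewrite big_sumType /= E E'.
- exists (I * I')%type, (fun l x => a l.1 x * a' l.2 x), (fun l x => b l.1 x * b' l.2 x); split.
  + by move=> l; exact: tp_mul.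
  + by move=> l; exact: tp_mul.
  move=> x y; rewrite E E' big_distrlr /= pair_big /=.
  by apply: eq_bigr => l _; ring.
Qed.

Lemma tp_shift f v : tp f -> tp (fun x => f (x + v)).
Proof.
elim => {f} [c|j|j|f g _ IHf _ IHg|f g _ IHf _ IHg].
- exact: tp_cst.
- apply: (@eq_tp (fun x => cos (2 * pi * v 0 j) * cos (2 * pi * x 0 j) - sin (2 * pi * v 0 j) * sin (2 * pi * x 0 j))) => [x|].
    by rewrite (_ : (x + v) 0 j = x 0 j + v 0 j) ?mxE// (mulrDr (2 * pi) (x 0 j)) cosD; ring.
  by apply: tpB; apply: tpZ; [exact: tp_cos|exact: tp_sin].
- apply: (@eq_tp (fun x => cos (2 * pi * v 0 j) * sin (2 * pi * x 0 j) + sin (2 * pi * v 0 j) * cos (2 * pi * x 0 j))) => [x|].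
    by rewrite (_ : (x + v) 0 j = x 0 j + v 0 j) ?mxE// (mulrDr (2 * pi) (x 0 j)) sinD; ring.
  by apply: tp_add; apply: tpZ; [exact: tp_sin|exact: tp_cos].
- exact: tp_add.
- exact: tp_mul.
Qed.

Lemma tp_opp f : tp f -> tp (fun x => f (- x)).
Proof.
elim => {f} [c|j|j|f g _ IHf _ IHg|f g _ IHf _ IHg].
- exact: tp_cst.
- by apply: eq_tp (tp_cos j) => x; rewrite mxE mulrN cosN.
- by apply: eq_tp (tpN (tp_sin j)) => x; rewrite mxE mulrN sinN.
- exact: tp_add.
- exact: tp_mul.
Qed.

Lemma tp_reflect f v : tp f -> tp (fun x => f (v - x)).
Proof.
move=> /(tp_shift v) /tp_opp; apply: eq_tp => x; by rewrite addrC.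
Qed.

Lemma partial_shift f v i x : partial i (fun y => f (y + v)) x = partial i f (x + v).
Proof.
have E : (fun h : R => h^-1 *: (((fun y => f (y + v)) \o shift x) (h *: evec i) - f (x + v))) =
    (fun h => h^-1 *: ((f \o shift (x + v)) (h *: evec i) - f (x + v))).
  by apply/funext => h /=; rewrite addrA.
by rewrite /partial /derive E.
Qed.

End trig.

(** * The mollifier *)

Section unit_interval.
Context (R : realType).
Local Notation U := (uniform01 R).
Implicit Types (f g : R -> R) (n : nat) (c : R).

Definition ui f := \int[U]_s f s.

Definition bmeas f := measurable_fun setT f /\ exists c, forall s, `|f s| <= c.

Lemma bmeas_integrable f : bmeas f -> U.-integrable setT (EFin \o f).
Proof.
move=> [mf [c fc]]; apply: measurable_bounded_integrable => //.
  by apply: (le_lt_trans (probability_le1 _ _)) => //; exact: ltry.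
by exists c; split; [exact: num_real|move=> M cM s _; apply: le_trans (fc s) (ltW cM)].
Qed.

Lemma bmeasM f g : bmeas f -> bmeas g -> bmeas (fun s => f s * g s).
Proof.
move=> [mf [a fa]] [mg [b gb]]; split; first exact: measurable_funM.
by exists (a * b) => s; rewrite normrM ler_pM.
Qed.

Lemma bmeasD f g : bmeas f -> bmeas g -> bmeas (fun s => f s + g s).
Proof.
move=> [mf [a fa]] [mg [b gb]]; split; first exact: measurable_funD.
by exists (a + b) => s; rewrite (le_trans (ler_normD _ _))// lerD.
Qed.

Lemma bmeas_cst c : bmeas (fun=> c).
Proof. by split; [exact: measurable_cst|exists `|c|]. Qed.

Lemma bmeasZ c f : bmeas f -> bmeas (fun s => c * f s).
Proof. by move=> bf; apply: bmeasM => //; exact: bmeas_cst. Qed.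

Lemma bmeasB f g : bmeas f -> bmeas g -> bmeas (fun s => f s - g s).
Proof.
move=> bf bg; rewrite (_ : (fun _ => _) = (fun s => f s + (-1) * g s)).
  by apply: bmeasD => //; exact: bmeasZ.
by apply/funext => s; rewrite mulN1r.
Qed.

Lemma bmeas_norm f : bmeas f -> bmeas (fun s => `|f s|).
Proof.
move=> [mf [a fa]]; split; first exact: measurableT_comp.
by exists a => s; rewrite normr_id.
Qed.

Lemma bmeas_exp f n : bmeas f -> bmeas (fun s => f s ^+ n).
Proof.
move=> bf; elim: n => [|n IH].
  by rewrite (_ : (fun _ => _) = (fun=> 1)); [exact: bmeas_cst|apply/funext => s; rewrite expr0].
rewrite (_ : (fun _ => _) = (fun s => f s * f s ^+ n)); first exact: bmeasM.
by apply/funext => s; rewrite exprS.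
Qed.

Lemma bmeas_cos c : bmeas (fun s => cos (c * s)).
Proof.
split.
  by apply: continuous_measurable_fun => s; apply: continuous_comp; [exact: mulrl_continuous|exact: continuous_cos].
by exists 1 => s; rewrite ler_norml cos_geN1 cos_le1.
Qed.

Lemma bmeas_sin c : bmeas (fun s => sin (c * s)).
Proof.
split.
  by apply: continuous_measurable_fun => s; apply: continuous_comp; [exact: mulrl_continuous|exact: continuous_sin].
by exists 1 => s; rewrite ler_norml sin_geN1 sin_le1.
Qed.

Lemma uiD f g : bmeas f -> bmeas g -> ui (fun s => f s + g s) = ui f + ui g.
Proof. by move=> bf bg; apply: RintegralD => //; exact: bmeas_integrable. Qed.

Lemma uiB f g : bmeas f -> bmeas g -> ui (fun s => f s - g s) = ui f - ui g.
Proof. by move=> bf bg; apply: RintegralB => //; exact: bmeas_integrable. Qed.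

Lemma uiZ c f : bmeas f -> ui (fun s => c * f s) = c * ui f.
Proof. by move=> bf; apply: RintegralZl => //; exact: bmeas_integrable. Qed.

Lemma ui_cst c : ui (fun=> c) = c.
Proof. by rewrite /ui Rintegral_cst//= (_ : U setT = 1%E) ?mulr1//; exact: probability_setT. Qed.

Lemma le_ui f g : bmeas f -> bmeas g -> (forall s, f s <= g s) -> ui f <= ui g.
Proof. by move=> bf bg fg; apply: le_Rintegral => //; exact: bmeas_integrable. Qed.

Lemma eq_ui f g : f =1 g -> ui f = ui g.
Proof. by move=> /funext ->. Qed.

Lemma ui_lebesgue f : bmeas f -> ui f = \int[lebesgue_measure]_(s in `[0, 1]) f s.
Proof.
move=> bf; have [mf [c fc]] := bf.
have c0 : 0 <= c by exact: le_trans (fc 0).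
have i01 g : bmeas g -> lebesgue_measure.-integrable `[0, 1]%classic (EFin \o g).
  move=> [mg [b gb]]; apply: measurable_bounded_integrable => //.
  - by rewrite /= lebesgue_measure_itv /= lte_fin ltr01 -EFinD ltry.
  - exact: measurable_funTS.
  by exists b; split; [exact: num_real|move=> M bM s _; apply: le_trans (gb s) (ltW bM)].
have H : ui (fun s => f s + c) = \int[lebesgue_measure]_(s in `[0, 1]) (f s + c).
  congr fine; rewrite /uniform01 integral_uniform//=.
  - by rewrite subr0 invr1 mul1e.
  - by apply/measurable_EFinP; apply: measurable_funD.
  - by move=> s; rewrite lee_fin; have := fc s; rewrite ler_norml => /andP[? ?]; lra.
have bc := bmeas_cst c.
move: H; rewrite (uiD bf bc) ui_cst RintegralD//; [|exact: i01|exact: (i01 _ bc)].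
rewrite Rintegral_cst//= lebesgue_measure_itv /= lte_fin ltr01 -EFinD /= subr0 mulr1.
by move=> /addIr.
Qed.

Lemma is_deriveW (f g : R -> R) (s df dg : R) :
  is_derive s 1 f df -> f =1 g -> df = dg -> is_derive s 1 g dg.
Proof. by move=> h /funext <- <-. Qed.

Lemma is_derive_cstR (c s : R) : is_derive s 1 (fun _ : R => c) (0 : R).
Proof. exact: is_derive_cst. Qed.

Lemma ui_derivative (F f : R -> R) : (forall s : R, is_derive s 1 F (f s)) ->
  continuous f -> bmeas f -> F 1 = F 0 -> ui f = 0.
Proof.
move=> dF cf bf F01; rewrite ui_lebesgue// /Rintegral.
have cF : continuous F.
  by move=> s; apply: differentiable_continuous; apply/derivable1_diffP; have [] := dF s.
rewrite (@continuous_FTC2 _ f F 0 1)//.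
- by rewrite F01 subee.
- exact: continuous_subspaceT.
- split.
  + by move=> s _; have [] := dF s.
  + exact: (cvg_at_right_filter (cF 0)).
  + exact: (cvg_at_left_filter (cF 1)).
- by move=> s _; rewrite derive1E; have [_ ->] := dF s.
Qed.

(* cs s = cos^2 (pi s). *)
Definition cs (s : R) := (1 + cos (2 * pi * s)) / 2.

Lemma cs_ge0 s : 0 <= cs s.
Proof. by rewrite /cs divr_ge0//; have := cos_geN1 (2 * pi * s); lra. Qed.

Lemma cs_le1 s : cs s <= 1.
Proof. by rewrite /cs; have := cos_le1 (2 * pi * s); lra. Qed.

Lemma bmeas_cs : bmeas cs.
Proof.
have := bmeasZ 2^-1 (bmeasD (bmeas_cst 1) (bmeas_cos (2 * pi))).
by rewrite (_ : (fun _ => _) = cs)//; apply/funext => s; rewrite /cs mulrC.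
Qed.

Lemma sin2_cs (s : R) : sin (2 * pi * s) ^+ 2 = 4 * cs s * (1 - cs s).
Proof. by rewrite sin2cos2 /cs; field. Qed.

Lemma cos_cs (s : R) : cos (2 * pi * s) = 2 * cs s - 1.
Proof. by rewrite /cs; field. Qed.

Lemma is_derive_cs (s : R) : is_derive s 1 cs (- pi * sin (2 * pi * s)).
Proof.
have h : is_derive s 1 (fun s => 1 + cos (2 * pi * s)) (0 + - (2 * pi) * sin (2 * pi * s)).
  by apply: is_deriveD_fun; exact: is_derive_cos2pi.
apply: (is_deriveW (is_deriveM_fun h (is_derive_cstR (2^-1) s))) => [t //|].
by field.
Qed.

Lemma is_derive_csX n (s : R) : is_derive s 1 (fun s => cs s ^+ n.+1) (n.+1%:R * cs s ^+ n * (- pi * sin (2 * pi * s))).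
Proof.
have h := is_derive_cs s.
apply: (is_deriveW (@is_deriveX _ _ cs n.+1 s 1 _ h)) => [t|].
  by elim: (n.+1) => [|m IH]; rewrite ?expr0// !exprS -IH.
by rewrite /GRing.scale.
Qed.

(** For [n = 0] the exponent [n.-1] is harmless because of the factor [n]. *)
Lemma is_derive_csX0 n (s : R) : is_derive s 1 (fun s => cs s ^+ n) (n%:R * cs s ^+ n.-1 * (- pi * sin (2 * pi * s))).
Proof.
case: n => [|n]; last exact: is_derive_csX.
rewrite mul0r mul0r (_ : (fun _ => _) = cst 1); first exact: is_derive_cst.
by apply/funext => t; rewrite expr0.
Qed.

Definition In n := ui (fun s => cs s ^+ n).

(** Wallis recursion: the derivative of [cs s ^+ n * sin (2 * pi * s)] is [pi] times the combination
    [f], and the derivative of a periodic function has integral zero. *)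
Lemma InS n : (2 * n%:R + 2) * In n.+1 = (2 * n%:R + 1) * In n.
Proof.
pose f (s : R) := (4 * n%:R + 4) * cs s ^+ n.+1 - (4 * n%:R + 2) * cs s ^+ n.
have bX m := bmeas_exp m bmeas_cs.
have fE s : f s = cs s ^+ n * (2 * cos (2 * pi * s)) - n%:R * cs s ^+ n.-1 * sin (2 * pi * s) ^+ 2.
  rewrite sin2_cs cos_cs /f exprS.
  have -> : n%:R * cs s ^+ n.-1 * (4 * cs s * (1 - cs s)) = n%:R * cs s ^+ n * (4 * (1 - cs s)).
    by case: (n) => [|m]; rewrite ?mul0r//= exprS; ring.
  by ring.
have : ui (fun s => pi * f s) = 0.
  apply: (@ui_derivative (fun s => cs s ^+ n * sin (2 * pi * s))).
  - move=> s; apply: (is_deriveW (is_deriveM_fun (is_derive_csX0 n s) (is_derive_sin2pi s))) => [t //|].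
    by rewrite fE; ring.
  - move=> s; apply: differentiable_continuous; apply/derivable1_diffP.
    have H (t : R) : pi * ((4 * n%:R + 4) * cs t ^+ n.+1 + (- (4 * n%:R + 2)) * cs t ^+ n) = pi * f t.
      by rewrite /f mulNr.
    by have [] := is_deriveW (is_deriveM_fun (is_derive_cstR pi s) (is_deriveD_fun
       (is_deriveM_fun (is_derive_cstR (4 * n%:R + 4) s) (is_derive_csX n s))
       (is_deriveM_fun (is_derive_cstR (- (4 * n%:R + 2)) s) (is_derive_csX0 n s)))) H erefl.
  - by apply: bmeasZ; apply: bmeasB; exact: bmeasZ.
  by rewrite mulr1 mulr0 sin0 mulr_natl sin2pi !mulr0.
have bf : bmeas f by apply: bmeasB; exact: bmeasZ.
rewrite uiZ// => /eqP; rewrite mulf_eq0 gt_eqF ?pi_gt0//= /f uiB; try exact: bmeasZ.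
rewrite !uiZ// subr_eq0 => /eqP E.
by move: E; rewrite -/(In n) -/(In n.+1) => E; lra.
Qed.

Lemma In0 : In 0 = 1.
Proof. by rewrite /In (eq_ui (g := fun=> 1)) ?ui_cst// => s; rewrite expr0. Qed.

Lemma In_gt0 n : 0 < In n.
Proof.
elim: n => [|n IH]; first by rewrite In0.
have n0 : (0 : R) <= n%:R by [].
have : 0 < (2 * n%:R + 2) * In n.+1 by rewrite InS mulr_gt0//; lra.
by rewrite pmulr_rgt0//; lra.
Qed.

(** The quantity [4 n I_n^2] equals 1 at [n = 1] and does not decrease, since
    [(2m + 1)^2 >= 4 m (m + 1)]. Its use is the bound of order [sqrt n] on the kernels. *)
Lemma In_lower n : 1 <= 4 * n.+1%:R * In n.+1 ^+ 2.
Proof.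
elim: n => [|n IH].
  have := InS 0; rewrite In0 /= => E; have -> : In 1 = 1 / 2 by lra.
  by lra.
have E := InS n.+1; set m : R := n.+1%:R in IH E *.
have m0 : 0 < m by rewrite ltr0n.
have -> : In n.+2 = (2 * m + 1) / (2 * m + 2) * In n.+1.
  by apply: (mulfI (_ : 2 * m + 2 != 0)); rewrite ?E; [|field]; lra.
have -> : n.+2%:R = m + 1 :> R by rewrite /m -natr1.
rewrite exprMn mulrA.
apply: (le_trans IH); rewrite ler_wpM2r ?sqr_ge0//.
rewrite expr_div_n mulrA ler_pdivlMr ?exprn_gt0//; last by lra.
by nra.
Qed.

(* The kernels kap n are even probability densities on the circle, and
   kap''_n = 4 pi^2 n^2 (kap_{n-1} - kap_n) exactly. *)
Definition kap n (s : R) := cs s ^+ n / In n.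

Lemma kap_ge0 n s : 0 <= kap n s.
Proof. by rewrite divr_ge0 ?exprn_ge0 ?cs_ge0// ltW ?In_gt0. Qed.

Lemma bmeas_kap n : bmeas (kap n).
Proof.
have := bmeasZ (In n)^-1 (bmeas_exp n bmeas_cs).
by rewrite (_ : (fun _ => _) = kap n)//; apply/funext => s; rewrite mulrC.
Qed.

Lemma ui_kap n : ui (kap n) = 1.
Proof.
rewrite (eq_ui (g := fun s => (In n)^-1 * cs s ^+ n)); last by move=> s; rewrite mulrC.
by rewrite uiZ ?mulVf ?gt_eqF ?In_gt0//; exact: bmeas_exp bmeas_cs.
Qed.

Lemma kap_le n s : kap n.+1 s <= 2 * Num.sqrt n.+1%:R.
Proof.
have I0 := In_gt0 n.+1.
rewrite /kap ler_pdivrMr// (le_trans (exprn_ile1 _ (cs_ge0 s) (cs_le1 s)))//.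
rewrite -(@ler_pXn2r _ 2)// ?nnegrE ?mulr_ge0 ?sqrtr_ge0 ?(ltW I0)//.
by rewrite !exprMn sqr_sqrtr ?ler0n// expr1n; have := In_lower n; lra.
Qed.

Lemma InE n : In n.+1 = (2 * n%:R + 1) / (2 * n%:R + 2) * In n.
Proof.
have n0 : (0 : R) <= n%:R by [].
by apply: (mulfI (_ : 2 * n%:R + 2 != 0 :> R)); rewrite ?InS; [|field]; lra.
Qed.

Lemma kap_cs n s : kap n s * cs s = (2 * n%:R + 1) / (2 * n%:R + 2) * kap n.+1 s.
Proof.
have n0 : (0 : R) <= n%:R by [].
have I0 := In_gt0 n.
rewrite /kap exprS InE; field.
by rewrite gt_eqF//=; apply/andP; split; lra.
Qed.

(** [1 - cs s] is [sin^2 (pi s)], comparable to the squared distance from [s] to the integers. That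
    its mean is of order [1 / n] expresses the concentration of [kap n] at 0. *)
Lemma ui_kap_sin n : ui (fun s => kap n s * (1 - cs s)) = (2 * n%:R + 2)^-1.
Proof.
have n0 : (0 : R) <= n%:R by [].
have bk := bmeas_kap n; have bk1 := bmeas_kap n.+1.
rewrite (eq_ui (g := fun s => kap n s - (2 * n%:R + 1) / (2 * n%:R + 2) * kap n.+1 s)); last first.
  by move=> s; rewrite mulrBr mulr1 kap_cs.
rewrite uiB//; last exact: bmeasZ.
by rewrite uiZ// !ui_kap; field; lra.
Qed.

Lemma kap_sub n s : kap n s - kap n.+1 s =
  kap n s * ((2 * n%:R + 2) * (1 - cs s) - 1) / (2 * n%:R + 1).
Proof.
have n0 : (0 : R) <= n%:R by [].
have E : kap n.+1 s = kap n s * cs s * (2 * n%:R + 2) / (2 * n%:R + 1).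
  by rewrite kap_cs; field; apply/andP; split; lra.
by rewrite E; field; lra.
Qed.

(** In [kap_sub] the modulus of [(2n + 2) (1 - cs s) - 1] is at most the sum of the two terms, each
    of mean 1 under [kap n]. *)
Lemma ui_kap_sub n : ui (fun s => `|kap n s - kap n.+1 s|) <= 2 / (2 * n%:R + 1).
Proof.
have n0 : (0 : R) <= n%:R by [].
have bk := bmeas_kap n; have bk1 := bmeas_kap n.+1.
have bs : bmeas (fun s => kap n s * (1 - cs s)).
  by apply: bmeasM => //; apply: bmeasB; [exact: bmeas_cst|exact: bmeas_cs].
have -> : 2 / (2 * n%:R + 1) = ui (fun s => (2 * n%:R + 2) / (2 * n%:R + 1) * (kap n s * (1 - cs s)) +
    (2 * n%:R + 1)^-1 * kap n s).
  rewrite uiD; [|exact: bmeasZ|exact: bmeasZ].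
  by rewrite !uiZ// ui_kap ui_kap_sin; field; apply/andP; split; lra.
apply: le_ui.
- by apply: bmeas_norm; exact: bmeasB.
- by apply: bmeasD; exact: bmeasZ.
have p1 : 0 <= 2 * n%:R + 1 :> R by lra.
move=> s; rewrite kap_sub normrM normfV (ger0_norm p1).
rewrite normrM (ger0_norm (kap_ge0 n s)).
have -> : (2 * n%:R + 2) / (2 * n%:R + 1) * (kap n s * (1 - cs s)) + (2 * n%:R + 1)^-1 * kap n s
   = kap n s * ((2 * n%:R + 2) * (1 - cs s) + 1) / (2 * n%:R + 1) by field; lra.
rewrite ler_pM2r ?invr_gt0; last by lra.
rewrite ler_wpM2l ?kap_ge0//.
have p : 0 <= (2 * n%:R + 2) * (1 - cs s) by rewrite mulr_ge0//; have := cs_le1 s; lra.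
by rewrite ler_norml; lra.
Qed.

(** The derivative of [kap n.+1], not of [kap n]: the shift avoids a predecessor in the exponent. *)
Definition dkap n (s : R) := - (2 * pi * n.+1%:R / In n.+1) * (cs s ^+ n * (sin (2 * pi * s) / 2)).

Lemma is_derive_kap n (s : R) : is_derive s 1 (kap n.+1) (dkap n s).
Proof.
apply: (is_deriveW (is_deriveM_fun (is_derive_csX n s) (is_derive_cstR ((In n.+1)^-1) s))) => [t //|].
by rewrite /dkap; field; rewrite gt_eqF ?In_gt0.
Qed.

Lemma bmeas_dkap n : bmeas (dkap n).
Proof.
apply: bmeasZ; apply: bmeasM; first exact: bmeas_exp bmeas_cs.
by apply: bmeasM; [exact: bmeas_sin|exact: bmeas_cst].
Qed.

Lemma is_derive_dkap n (s : R) :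
  is_derive s 1 (dkap n) (4 * pi ^+ 2 * n.+1%:R ^+ 2 * (kap n s - kap n.+1 s)).
Proof.
have n0 : (0 : R) <= n%:R by [].
have I0 := In_gt0 n.
apply: (is_deriveW (is_deriveM_fun (is_derive_cstR (- (2 * pi * n.+1%:R / In n.+1)) s)
  (is_deriveM_fun (is_derive_csX0 n s) (is_deriveM_fun (is_derive_sin2pi s) (is_derive_cstR (2^-1) s))))) => [t //|].
rewrite kap_sub !mulr0 !addr0 add0r.
have -> : sin (2 * pi * s) / 2 * (n%:R * cs s ^+ n.-1 * (- pi * sin (2 * pi * s))) =
   - pi / 2 * n%:R * cs s ^+ n.-1 * sin (2 * pi * s) ^+ 2 by field.
rewrite sin2_cs cos_cs.
have -> : - pi / 2 * n%:R * cs s ^+ n.-1 * (4 * cs s * (1 - cs s)) = - 2 * pi * n%:R * cs s ^+ n * (1 - cs s).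
  by case: (n) => [|m]; rewrite ?mulr0 ?mul0r//= exprS; field.
rewrite /kap InE -natr1; field.
by rewrite gt_eqF//=; apply/andP; split; lra.
Qed.

(** [|sin (2 pi s)|] is twice the geometric mean of [1 - cs s] and [cs s]. The weight [u] of the
    arithmetic-geometric inequality is left free in order to balance the two terms after
    integration. *)
Lemma norm_sin2pi_le (s u : R) : 0 < u -> `|sin (2 * pi * s)| / 2 <= (u * (1 - cs s) + u^-1 * cs s) / 2.
Proof.
move=> u0; rewrite ler_pM2r ?invr_gt0//.
have h1 := cs_ge0 s; have h2 := cs_le1 s.
have p0 : 0 <= u * (1 - cs s) + u^-1 * cs s.
  by rewrite addr_ge0// mulr_ge0 ?invr_ge0 ?subr_ge0// ltW.
rewrite -(@ler_pXn2r _ 2)// ?nnegrE// real_normK ?num_real// sin2_cs.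
have E : (u * (1 - cs s) + u^-1 * cs s) ^+ 2 - 4 * cs s * (1 - cs s) = (u * (1 - cs s) - u^-1 * cs s) ^+ 2.
  by field; rewrite gt_eqF.
by rewrite -subr_ge0 E sqr_ge0.
Qed.

Lemma ui_dkap n : ui (fun s => `|dkap n s|) <= 2 * pi * Num.sqrt n.+1%:R.
Proof.
have n0 : (0 : R) <= n%:R by [].
have p0 : (0 : R) < pi by exact: pi_gt0.
set q := Num.sqrt n.+1%:R; have q0 : 0 < q by rewrite sqrtr_gt0 ltr0n.
have qq : n%:R + 1 = q * q by rewrite natr1 -expr2 sqr_sqrtr ?ler0n.
have I0 := In_gt0 n; have I1 := In_gt0 n.+1.
have bk := bmeas_kap n; have bk1 := bmeas_kap n.+1.
have bs : bmeas (fun s => kap n s * (1 - cs s)).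
  by apply: bmeasM => //; apply: bmeasB; [exact: bmeas_cst|exact: bmeas_cs].
(* Coefficients of the bound [norm_sin2pi_le] with weight [q = sqrt (n + 1)]. As [1 - cs] has mean
   [1 / (2n + 2)] under [kap n], this weight makes the two terms of the same order. *)
pose c1 := 2 * pi * n.+1%:R * ((2 * n%:R + 2) / (2 * n%:R + 1)) * q / 2.
pose c2 := 2 * pi * n.+1%:R * q^-1 / 2.
apply: (@le_trans _ _ (ui (fun s => c1 * (kap n s * (1 - cs s)) + c2 * kap n.+1 s))); last first.
  rewrite uiD; [|exact: bmeasZ|exact: bmeasZ].
  rewrite !uiZ// ui_kap ui_kap_sin /c1 /c2 -natr1.
  have n1 : 0 < n%:R + 1 :> R by lra.
  have n2 : 0 < 2 * n%:R + 1 :> R by lra.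
  have n3 : 0 < 2 * n%:R + 2 :> R by lra.
  apply: (@le_trans _ _ (pi * q * ((n%:R + 1) / (2 * n%:R + 1) + (n%:R + 1) / (q * q)))).
    rewrite le_eqVlt; apply/orP; left; apply/eqP.
    by field; rewrite !gt_eqF.
  rewrite -qq divff ?gt_eqF//.
  have -> : 2 * pi * q = pi * q * (1 + 1) by ring.
  have pq : 0 <= pi * q by rewrite mulr_ge0 ?ltW.
  by apply: ler_wpM2l => //; rewrite lerD2r ler_pdivrMr//; lra.
apply: le_ui.
- by apply: bmeas_norm; exact: bmeas_dkap.
- by apply: bmeasD; exact: bmeasZ.
have c0 : 0 <= 2 * pi * n.+1%:R / In n.+1 by rewrite divr_ge0 ?mulr_ge0 ?ler0n ?ltW.
move=> s; rewrite /dkap normrM normrN (ger0_norm c0).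
rewrite normrM (ger0_norm (exprn_ge0 _ (cs_ge0 s))) normrM normfV (ger0_norm (ler0n _ 2)).
have h := norm_sin2pi_le s q0.
apply: (@le_trans _ _ (2 * pi * n.+1%:R / In n.+1 * (cs s ^+ n * ((q * (1 - cs s) + q^-1 * cs s) / 2)))).
  rewrite ler_wpM2l//.
  by rewrite ler_wpM2l// exprn_ge0 ?cs_ge0.
rewrite le_eqVlt; apply/orP; left; apply/eqP.
rewrite /c1 /c2 /kap exprS InE; field.
by rewrite !gt_eqF//=; apply/andP; split; lra.
Qed.

(** [1 - u^(n+1)] is [1 - u] times a geometric sum of [n + 1] terms, each at least [u^n]. *)
Lemma exprM_sub1_le (u : R) n : 0 <= u <= 1 -> u ^+ n * (1 - u) <= (n.+1%:R)^-1.
Proof.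
move=> /andP[u0 u1].
have H m : (m.+1)%:R * u ^+ m * (1 - u) <= 1 - u ^+ m.+1.
  elim: m => [|m IH]; first by rewrite expr0 expr1; lra.
  have := ler_wpM2l u0 IH; rewrite -(natr1 m.+1) !exprS.
  have p : u * u ^+ m <= 1 by rewrite -exprS exprn_ile1.
  have : 0 <= (1 - u) * (1 - u * u ^+ m) by rewrite mulr_ge0 ?subr_ge0.
  by lra.
rewrite -[leRHS]mul1r ler_pdivlMr ?ltr0n//.
rewrite mulrC mulrA; apply: (le_trans (H n)).
by rewrite gerBl exprn_ge0.
Qed.

(** The square of [cs^n * sin (2 pi s) / 2] is [cs^(2n+1) * (1 - cs)], at most [1 / (2n + 2)] by
    [exprM_sub1_le]; [In_lower] compares this with the normalization [In n.+1]. *)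
Lemma dkap_le n s : `|dkap n s| <= 4 * pi * n.+1%:R.
Proof.
have p0 : (0 : R) < pi by exact: pi_gt0.
have I1 := In_gt0 n.+1.
have h1 := cs_ge0 s; have h2 := cs_le1 s.
have c0 : 0 <= 2 * pi * n.+1%:R / In n.+1 by rewrite divr_ge0 ?mulr_ge0 ?ler0n ?ltW.
rewrite /dkap normrM normrN (ger0_norm c0).
have H : `|cs s ^+ n * (sin (2 * pi * s) / 2)| <= 2 * In n.+1.
  rewrite -(@ler_pXn2r _ 2)// ?nnegrE ?mulr_ge0 ?(ltW I1)// real_normK ?num_real//.
  rewrite exprMn (exprMn _ (sin (2 * pi * s))) sin2_cs.
  have -> : (cs s ^+ n) ^+ 2 * (4 * cs s * (1 - cs s) * 2^-1 ^+ 2) = cs s ^+ (2 * n).+1 * (1 - cs s).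
    by rewrite [in RHS]exprS (mulnC 2) exprM; field.
  apply: (le_trans (exprM_sub1_le _ _)); first by rewrite h1 h2.
  have := In_lower n; rewrite exprMn => h.
  have k0 : (0 : R) < n.+1%:R by rewrite ltr0n.
  have -> : (2 * n).+2%:R = 2 * n.+1%:R :> R by rewrite -natrM mulnS.
  rewrite invfM ler_pdivrMr//; nra.
apply: (le_trans (ler_wpM2l c0 H)).
by rewrite le_eqVlt; apply/orP; left; apply/eqP; field; rewrite gt_eqF.
Qed.

End unit_interval.

(** * The product kernel on the torus *)

Section kernel.
Context {R : realType} {d : nat}.
Local Notation vec := 'rV[R]_d.
Local Notation cell := (d.-tuple (measurableTypeR R)).
Local Notation mu := (torus R d).
Local Notation tperiodic := Defs.periodic.
Local Notation conv := Defs.conv.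
Implicit Types (f g q : vec -> R) (x y v : vec) (c : R) (n : nat).

Lemma tmeasurable_coord (u : R -> R) i : measurable_fun setT u -> tmeasurable (fun x : vec => u (x 0 i)).
Proof. by move=> mu'; apply: (measurableT_comp mu'); exact: measurable_pt_coord. Qed.

Lemma tint_prod (u : 'I_d -> R -> R) : (forall i, bmeas (u i)) -> (forall i s, 0 <= u i s) ->
  tint (fun x : vec => \prod_i u i (x 0 i)) = \prod_i ui (u i).
Proof.
move=> bu u0; rewrite /tint /Rintegral.
under eq_integral => y _ do under eq_bigr => i _ do rewrite mxE.
rewrite (@integral_torus_prod R d u) => [|i|//]; last by case: (bu i).
rewrite (eq_bigr (fun i => (ui (u i))%:E)); first by rewrite prodEFin.
move=> i _; rewrite /ui /Rintegral fineK//.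
by apply: integrable_fin_num => //; exact: (bmeas_integrable (bu i)).
Qed.

Definition K n x : R := \prod_i kap n (x 0 i).

Lemma tp_cs i : tp (fun x : vec => cs (x 0 i)).
Proof.
apply: (@eq_tp R d (fun x => 2^-1 * (1 + cos (2 * pi * x 0 i)))) => [x|].
  by rewrite /cs mulrC.
by apply: tpZ; apply: tp_add; [exact: tp_cst|exact: tp_cos].
Qed.

Lemma tp_kap n i : tp (fun x : vec => kap n (x 0 i)).
Proof.
apply: (@eq_tp R d (fun x => (In R n)^-1 * cs (x 0 i) ^+ n)) => [x|]; first by rewrite mulrC.
by apply: tpZ; apply: tp_exp; exact: tp_cs.
Qed.

Lemma tp_K n : tp (K n).
Proof. by apply: tp_prod => i _; exact: tp_kap. Qed.

Lemma K_ge0 n x : 0 <= K n x.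
Proof. by apply: prodr_ge0 => i _; exact: kap_ge0. Qed.

Lemma tint_K n : tint (K n) = 1.
Proof.
rewrite (@tint_prod (fun=> kap n)) => [|i|i s]; [|exact: bmeas_kap|exact: kap_ge0].
by rewrite big1// => i _; exact: ui_kap.
Qed.

Lemma cs_even (s : R) : cs (- s) = cs s.
Proof. by rewrite /cs mulrN cosN. Qed.

Lemma K_even n x : K n (- x) = K n x.
Proof. by apply: eq_bigr => i _; rewrite /kap mxE cs_even. Qed.

Lemma tint_K_sin n i : tint (fun x => K n x * (1 - cs (x 0 i))) = (2 * n%:R + 2)^-1.
Proof.
have b1 : bmeas (fun s : R => kap n s * (1 - cs s)).
  by apply: bmeasM; [exact: bmeas_kap|apply: bmeasB; [exact: bmeas_cst|exact: bmeas_cs]].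
pose u (j : 'I_d) := if j == i then (fun s : R => kap n s * (1 - cs s)) else kap n.
rewrite (@eq_tint _ _ _ (fun x => \prod_j u j (x 0 j))); last first.
  move=> x; rewrite /K (bigD1 i)//= [RHS](bigD1 i)//= /u eqxx mulrAC; congr (_ * _).
  by apply: eq_bigr => j /negPf ->.
rewrite tint_prod.
- rewrite (bigD1 i)//= {1}/u eqxx ui_kap_sin big1 ?mulr1// => j /negPf ji.
  by rewrite /u ji ui_kap.
- by move=> j; rewrite /u; case: ifP => _ //; exact: bmeas_kap.
- move=> j s; rewrite /u; case: ifP => _; last exact: kap_ge0.
  by rewrite mulr_ge0 ?kap_ge0 ?subr_ge0 ?cs_le1.
Qed.

Lemma periodic_int (V : Type) (f : vec -> V) x v : tperiodic f ->
  (forall i, exists k : int, v 0 i = k%:~R) -> f (x + v) = f x.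
Proof.
move=> pf /choice[k vk].
have pn (m : nat) i y : f (y + m%:R *: evec i) = f y.
  elim: m => [|m IH]; first by rewrite scale0r addr0.
  by rewrite -natr1 scalerDl scale1r addrA pf.
have pz (m : int) i y : f (y + m%:~R *: evec i) = f y.
  case: m => m; first exact: pn.
  by rewrite NegzE mulrNz scaleNr -[LHS](pn m.+1 i) subrK.
have -> : v = \sum_i (k i)%:~R *: evec i.
  by rewrite [LHS]row_sum_delta; apply: eq_bigr => i _; rewrite vk.
elim: (index_enum _) x => [|i s IH] x; first by rewrite big_nil addr0.
by rewrite big_cons addrA IH pz.
Qed.

Lemma cs_small (s e : R) : 0 < e -> e <= `|s| -> `|s| <= 2^-1 -> cs s <= cs e.
Proof.
move=> e0 es s2.
have -> : cs s = cs `|s| by case: (ger0P s) => // _; rewrite cs_even.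
have p0 : (0 : R) < pi by exact: pi_gt0.
rewrite /cs ler_pM2r// lerD2l leNgt; apply/negP.
rewrite ltr_cos.
- by rewrite ltr_pM2l ?mulr_gt0//; lra.
- by rewrite in_itv /=; nra.
- by rewrite in_itv /=; nra.
Qed.

Lemma cs_lt1 (e : R) : 0 < e -> e <= 2^-1 -> cs e < 1.
Proof.
move=> e0 e2; have p0 : (0 : R) < pi by exact: pi_gt0.
suff : cos (2 * pi * e) < cos 0 by rewrite cos0 /cs; lra.
by rewrite ltr_cos ?in_itv/= ?lexx ?pi_ge0//; nra.
Qed.

Lemma periodic_cont_bound f x c (e : R) : tperiodic f -> (forall y, `|f y| <= c) ->
  {for x, continuous f} -> 0 < e ->
  exists2 B, 0 <= B & forall y, `|f (x - y) - f x| <= e + B * \sum_i (1 - cs (y 0 i)).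
Proof.
move=> pf fc cf e0.
have c0 : 0 <= c by exact: le_trans (fc 0).
have /nbhs_ballP[r /= r0 rP] : \forall z \near x, `|f x - f z| < e.
  by move/cvgrPdist_lt : cf; apply.
pose s := Num.min (r / 2) 2^-1.
have s0 : 0 < s by rewrite lt_min; apply/andP; split; lra.
have s2 : s <= 2^-1 by rewrite /s ge_min lexx orbT.
have sr : s < r by rewrite /s gt_min; apply/orP; left; lra.
have d0 : 0 < 1 - cs s by rewrite subr_gt0; exact: cs_lt1.
exists (2 * c / (1 - cs s)) => [|y].
  by rewrite divr_ge0 ?mulr_ge0 ?(ltW d0).
(* Nearest lattice point: [z] represents [y] modulo the lattice with coordinates in [[-1/2, 1/2]],
   where [cs] decreases with the modulus. *)
pose k i := Num.floor (y 0 i + 2^-1).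
pose z : vec := \row_i (y 0 i - (k i)%:~R).
have zy : f (x - y) = f (x - z).
  have -> : x - y = (x - z) + (\row_i (- k i)%:~R).
    by apply/rowP => i; rewrite !mxE mulrNz; ring.
  by apply: periodic_int => // i; exists (- k i); rewrite mxE.
have csz i : cs (y 0 i) = cs (z 0 i).
  have h : tperiodic (fun w : vec => cs (w 0 i)) by apply: tp_periodic; exact: tp_cs.
  rewrite -(periodic_int y (v := \row_j (- k j)%:~R) h).
    by rewrite !mxE mulrNz.
  by move=> j; exists (- k j); rewrite mxE.
have z2 i : `|z 0 i| <= 2^-1.
  rewrite mxE ler_norml.
  have h1 := Num.Theory.ge_floor (y 0 i + 2^-1); have h2 := lt_succ_floor (y 0 i + 2^-1).
  by rewrite -/(k i) intrD in h1 h2; apply/andP; split; lra.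
have p0 : 0 <= \sum_i (1 - cs (y 0 i)) by apply: sumr_ge0 => i _; rewrite subr_ge0 cs_le1.
rewrite zy; have [|] := boolP [forall i, `|z 0 i| < s].
  move=> /forallP zs; apply: (@le_trans _ _ e); last first.
    by rewrite lerDl mulr_ge0// divr_ge0 ?mulr_ge0 ?(ltW d0).
  rewrite distrC ltW//; apply: rP; split => // i j; rewrite (ord1 i).
  rewrite /ball /= !mxE opprB addrCA subrr addr0.
  by apply: lt_trans sr; have := zs j; rewrite mxE.
rewrite negb_forall => /existsP[i]; rewrite -leNgt => zs.
apply: (@le_trans _ _ (2 * c)).
  by apply: (le_trans (ler_normB _ _)); have := fc (x - z); have := fc x; lra.
apply: (@le_trans _ _ (2 * c / (1 - cs s) * \sum_i (1 - cs (y 0 i)))); last by rewrite lerDr ltW.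
rewrite mulrAC ler_pdivlMr// ler_wpM2l ?mulr_ge0//.
apply: (@le_trans _ _ (1 - cs (y 0 i))); last first.
  by rewrite (bigD1 i)//= lerDl sumr_ge0// => j _; rewrite subr_ge0 cs_le1.
by rewrite lerD2l lerN2 csz cs_small.
Qed.

Lemma conv_K_cvg f x c : tperiodic f -> tmeasurable f -> (forall y, `|f y| <= c) ->
  {for x, continuous f} -> (fun n => conv (K n) f x) @ \oo --> f x.
Proof.
move=> pf mf fc cf; apply/cvgrPdist_le => e e0.
have e2 : 0 < e / 2 by rewrite divr_gt0.
have [B B0 HB] := periodic_cont_bound pf fc cf e2.
have fi := tintegrable_bdd mf fc.
have H n : `|f x - conv (K n) f x| <= e / 2 + B * d%:R / (2 * n%:R + 2).
  have iK := tp_integrable (tp_K n).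
  have mK := tp_measurable (tp_K n).
  rewrite (tconvC x (tp_periodic (tp_K n)) pf mK mf).
  have i1 : tintegrable (fun y => f (x - y) * K n y).
    by apply: tintegrableM iK (tmeasurable_reflect x mf) (fun y => fc _).
  have i2 : tintegrable (fun y => f x * K n y) by exact: tintegrableZ.
  have iS i : tintegrable (fun y => K n y * (1 - cs (y 0 i))).
    apply: tp_integrable; apply: tp_mul; first exact: tp_K.
    by apply: tpB; [exact: tp_cst|exact: tp_cs].
  have -> : f x - conv f (K n) x = tint (fun y => f x * K n y - f (x - y) * K n y).
    by rewrite tintB// tintZ// tint_K mulr1.
  have -> : e / 2 + B * d%:R / (2 * n%:R + 2) =
      tint (fun y => e / 2 * K n y + B * \sum_i (K n y * (1 - cs (y 0 i)))).
    rewrite tintD ?tintZ ?tint_K ?mulr1//.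
    - rewrite tint_sum//; under eq_bigr do rewrite tint_K_sin.
      by rewrite sumr_const card_ord -[(2 * n%:R + 2)^-1 *+ d]mulr_natl mulrA.
    - exact: tintegrable_sum.
    - exact: tintegrableZ.
    - by apply: tintegrableZ; exact: tintegrable_sum.
  apply: norm_tint_le.
  - exact: tintegrableB.
  - apply: tintegrableD; first exact: tintegrableZ.
    by apply: tintegrableZ; exact: tintegrable_sum.
  move=> y; rewrite -mulrBl normrM (ger0_norm (K_ge0 n y)) distrC -mulr_sumr mulrCA mulrC [leRHS](_ : _ = K n y * (e / 2 + B * \sum_i (1 - cs (y 0 i)))); last by ring.
  by rewrite ler_wpM2l ?K_ge0.
near=> n.
apply: (le_trans (H n)).
have : B * d%:R / (2 * n%:R + 2) <= e / 2; last by lra.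
have n2 : (0 : R) < 2 * n%:R + 2 by have : (0 : R) <= n%:R by []; lra.
rewrite ler_pdivrMr//.
have : B * d%:R / e <= n%:R by near: n; exact: nbhs_infty_ger.
by rewrite ler_pdivrMr//; nra.
Unshelve. all: by end_near. Qed.

Lemma partial_indep f i x : (forall y h, f (y + h *: evec i) = f y) -> partial i f x = 0.
Proof.
move=> fi; rewrite /partial /derive.
have -> : (fun h : R => h^-1 *: ((f \o shift x) (h *: evec i) - f x)) = cst 0.
  by apply/funext => h /=; rewrite (addrC (h *: _) x) fi subrr scaler0.
exact: lim_cst.
Qed.

Definition K' n j x : R := \prod_(i | i != j) kap n (x 0 i).

Lemma KE n j x : K n x = kap n (x 0 j) * K' n j x.
Proof. by rewrite /K (bigD1 j). Qed.

Lemma tp_K' n j : tp (K' n j).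
Proof.
apply: (@eq_tp R d (fun x => \prod_(i <- [seq i <- index_enum 'I_d | i != j]) kap n (x 0 i))).
  by move=> x; rewrite big_filter.
by apply: tp_prod => i _; exact: tp_kap.
Qed.

Lemma partial_K' n j x : partial j (K' n j) x = 0.
Proof.
apply: partial_indep => y h; apply: eq_bigr => i ij.
by rewrite !mxE (negPf ij) mulr0 addr0.
Qed.

Lemma tp_dkap n j : tp (fun x : vec => dkap n (x 0 j)).
Proof.
apply: tpZ; apply: tp_mul; first by apply: tp_exp; exact: tp_cs.
by apply: tp_mul; [exact: tp_sin|exact: tp_cst].
Qed.

Lemma partial_K n j x : partial j (K n.+1) x = dkap n (x 0 j) * K' n.+1 j x.
Proof.
have -> : K n.+1 = (fun y => kap n.+1 (y 0 j) * K' n.+1 j y) by apply/funext => y; exact: KE.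
rewrite partialM ?partial_K' ?mulr0 ?add0r; [|exact: tp_kap|exact: tp_K'].
by rewrite (partial_comp_coord _ (is_derive_kap n (x 0 j))) eqxx mulr1 mulrC.
Qed.

Lemma partial2_K n j x : partial j (partial j (K n.+1)) x =
  4 * pi ^+ 2 * n.+1%:R ^+ 2 * ((kap n (x 0 j) - kap n.+1 (x 0 j)) * K' n.+1 j x).
Proof.
have -> : partial j (K n.+1) = (fun y => dkap n (y 0 j) * K' n.+1 j y).
  by apply/funext => y; exact: partial_K.
rewrite partialM ?partial_K' ?mulr0 ?add0r; [|exact: tp_dkap|exact: tp_K'].
rewrite (partial_comp_coord _ (is_derive_dkap n (x 0 j))) eqxx mulr1; ring.
Qed.

Lemma tint_norm_partial_K n j :
  tint (fun x => `|partial j (K n.+1) x|) <= 2 * pi * Num.sqrt n.+1%:R.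
Proof.
pose u i := if i == j then (fun s : R => `|dkap n s|) else kap n.+1.
rewrite (@eq_tint _ _ _ (fun x => \prod_i u i (x 0 i))); last first.
  move=> x; rewrite partial_K normrM (bigD1 j)//= {1}/u eqxx; congr (_ * _).
  rewrite ger0_norm; last by apply: prodr_ge0 => i _; exact: kap_ge0.
  by apply: eq_bigr => i /negPf ij; rewrite /u ij.
rewrite tint_prod.
- rewrite (bigD1 j)//= {1}/u eqxx big1 ?mulr1; first exact: ui_dkap.
  by move=> i /negPf ij; rewrite /u ij ui_kap.
- move=> i; rewrite /u; case: ifP => _; last exact: bmeas_kap.
  by apply: bmeas_norm; exact: bmeas_dkap.
- by move=> i s; rewrite /u; case: ifP => _ //; exact: kap_ge0.
Qed.

Lemma norm_partial_K_le n j x :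
  `|partial j (K n.+1) x| <= 4 * pi * n.+1%:R * (2 * Num.sqrt n.+1%:R) ^+ d.-1.
Proof.
rewrite partial_K normrM ler_pM//; first exact: dkap_le.
rewrite ger0_norm; last by apply: prodr_ge0 => i _; exact: kap_ge0.
apply: (@le_trans _ _ (\prod_(i | i != j) (2 * Num.sqrt n.+1%:R))).
  by apply: ler_prod => i _; rewrite kap_ge0 kap_le.
by rewrite prodr_const cardC1 card_ord.
Qed.

(** Each factor [kap n] is written as [e + kap n.+1] and the product expanded over the sets [J] of
    coordinates that carry [e]. The empty set gives [K n.+1], the singletons give the multiple of
    the Laplacian by [partial2_K], and the sets with at least two elements form the remainder, of
    order [1 / n^2] because [e] has L1 norm of order [1 / n]. *)
Lemma tint_norm_K_sub_lap n :
  tint (fun x => `|K n x - K n.+1 x - (4 * pi ^+ 2 * n.+1%:R ^+ 2)^-1 * laplacian (K n.+1) x|)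
  <= 4 ^+ d.+1 / n.+1%:R ^+ 2.
Proof.
have p0 : (0 : R) < pi by exact: pi_gt0.
have N0 : (0 : R) < n.+1%:R by rewrite ltr0n.
pose e (s : R) := kap n s - kap n.+1 s.
pose F (J : {set 'I_d}) x := \prod_i (if i \in J then e (x 0 i) else kap n.+1 (x 0 i)).
pose u (J : {set 'I_d}) (i : 'I_d) : R -> R := if i \in J then (fun s : R => `|e s|) else kap n.+1.
have E x : K n x - K n.+1 x - (4 * pi ^+ 2 * n.+1%:R ^+ 2)^-1 * laplacian (K n.+1) x =
    \sum_(J : {set 'I_d} | (1 < #|J|)%N) F J x.
  have -> : K n x = \sum_(J : {set 'I_d}) F J x.
    transitivity (\prod_i (e (x 0 i) + kap n.+1 (x 0 i))); last exact: bigA_distr.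
    by apply: eq_bigr => i _; rewrite /e subrK.
  have -> : laplacian (K n.+1) x = 4 * pi ^+ 2 * n.+1%:R ^+ 2 * \sum_i F (finset.set1 i) x.
    rewrite mulr_sumr; apply: eq_bigr => i _; rewrite partial2_K; congr (_ * _).
    rewrite /F (bigD1 i)//= inE eqxx; congr (_ * _); apply: eq_bigr => j ji.
    by rewrite inE (negPf ji).
  have -> : K n.+1 x = F finset.set0 x by apply: eq_bigr => i _; rewrite inE.
  rewrite mulKf; last by rewrite gt_eqF// !mulr_gt0// exprn_gt0.
  have -> : \sum_i F (finset.set1 i) x = \sum_(J : {set 'I_d} | #|J| == 1%N) F J x.
    rewrite [RHS](_ : _ = \sum_(J in [set finset.set1 i | i in 'I_d]%SET) F J x).
      by rewrite big_imset//= => i j _ _; exact: set1_inj.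
    apply: eq_bigl => J; apply/cards1P/imsetP => [[i ->]|[i _ ->]]; by exists i.
  rewrite (bigD1 finset.set0)//= [F _ x + _]addrC addrK.
  rewrite (bigID (fun J : {set 'I_d} => #|J| == 1%N))/=.
  rewrite (eq_bigl (fun J : {set 'I_d} => #|J| == 1%N)); last first.
    by move=> J; rewrite -cards_eq0; case: #|J| => [|[|m]].
  rewrite addrAC subrr add0r; apply: eq_bigl => J.
  by rewrite -cards_eq0; case: #|J| => [|[|m]].
pose ep := ui (fun s => `|e s|).
have be : bmeas e by apply: bmeasB; exact: bmeas_kap.
have bu J i : bmeas (u J i).
  by rewrite /u; case: ifP => _; [exact: bmeas_norm|exact: bmeas_kap].
have u0 J i s : 0 <= u J i s by rewrite /u; case: ifP => _ //; exact: kap_ge0.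
have tu J : tint (fun x : vec => \prod_i u J i (x 0 i)) = ep ^+ #|J|.
  rewrite tint_prod// (bigID (mem J))/= [X in _ * X]big1 ?mulr1; last first.
    by move=> i /negPf iJ; rewrite /u iJ ui_kap.
  rewrite (eq_bigr (fun=> ep)); last by move=> i iJ; rewrite /u iJ.
  by rewrite prodr_const.
have iu J : tintegrable (fun x : vec => \prod_i u J i (x 0 i)).
  have bi i : exists c, forall s, `|u J i s| <= c by case: (bu J i).
  have [c uc] := choice bi.
  apply: (@tintegrable_bdd R d _ (\prod_i c i)).
    by apply: measurable_prod => i _; apply: tmeasurable_coord; case: (bu J i).
  by move=> x; rewrite normr_prod; apply: ler_prod => i _; rewrite normr_ge0 uc.
pose G (x : vec) : R := \sum_(J <- [seq J : {set 'I_d} <- index_enum {set 'I_d} | (1 < #|J|)%N]) \prod_i u J i (x 0 i).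
apply: (@le_trans _ R (tint G)).
  apply: le_tint.
  - apply: tintegrable_norm; apply: tp_integrable; apply: tpB; first by apply: tpB; exact: tp_K.
    apply: tpZ; apply: tp_sum => i _; do 2! apply: tp_partial; exact: tp_K.
  - exact: tintegrable_sum.
  move=> x; rewrite E /G big_filter; apply: (le_trans (ler_norm_sum _ _ _)).
  apply: ler_sum => J _; rewrite /F normr_prod; apply: ler_prod => i _.
  rewrite normr_ge0 /= /u; case: ifP => _ //; by rewrite ger0_norm// kap_ge0.
rewrite /G tint_sum// big_filter (eq_bigr (fun J : {set 'I_d} => ep ^+ #|J|)); last by move=> J _; exact: tu.
have n0 : (0 : R) <= n%:R by [].
have ep0 : 0 <= ep by apply: Rintegral_ge0.
have epn : ep <= 2 / n.+1%:R.
  apply: (le_trans (ui_kap_sub R n)).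
  have N1E : n.+1%:R = n%:R + 1 :> R by rewrite natr1.
  by rewrite ler_pM2l// N1E lef_pV2 ?posrE; lra.
have ep2 : ep <= 2.
  apply: (le_trans epn); rewrite ler_pdivrMr//.
  by have : (1 : R) <= n.+1%:R; [rewrite ler1n|lra].
(* Two factors are bounded by [2 / (n + 1)], the at most [d] others by 2; there are at most [2 ^ d]
   sets, which gives the constant [4 ^ (d + 1)]. *)
apply: (@le_trans _ _ (\sum_(J : {set 'I_d} | (1 < #|J|)%N) (2 / n.+1%:R) ^+ 2 * 2 ^+ d)).
  apply: ler_sum => J J1.
  rewrite -(subnKC J1) exprD ler_pM ?exprn_ge0//.
    by rewrite lerXn2r// nnegrE.
  apply: (@le_trans _ _ (2 ^+ (#|J| - 2))); first by rewrite lerXn2r// nnegrE.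
  rewrite ler_weXn2l//; first by rewrite ler1n.
  by rewrite (leq_trans (leq_subr _ _))// (leq_trans (max_card _))// card_ord.
apply: (@le_trans _ _ (\sum_(J : {set 'I_d}) (2 / n.+1%:R) ^+ 2 * 2 ^+ d)).
  rewrite [leRHS](bigID (fun J : {set 'I_d} => (1 < #|J|)%N))/= lerDl.
  by apply: sumr_ge0 => J _; apply: mulr_ge0; apply: exprn_ge0 => //; exact: divr_ge0.
have card2 : #|{set 'I_d}| = (2 ^ d)%N.
  transitivity #|powerset [set: 'I_d]%SET|; last by rewrite card_powerset cardsT card_ord.
  by apply: eq_card => J; rewrite !inE finset.subsetT.
rewrite sumr_const card2.
rewrite -[X in X <= _]mulr_natl natrX le_eqVlt; apply/orP; left; apply/eqP.
have -> : 4 = 2 * 2 :> R by ring.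
rewrite [(2 * 2) ^+ _]exprMn ![2 ^+ d.+1]exprS expr_div_n.
by set N : R := n.+1%:R in N0 *; field; rewrite gt_eqF.
Qed.

End kernel.

(** * Density of trigonometric polynomials *)

Section step_polynomial.
Context {R : realType}.
Implicit Types (w : R) (n : nat).

Lemma bernoulli_ge w n : 0 <= w <= 1 -> 1 - n%:R * w <= (1 - w) ^+ n.
Proof.
move=> /andP[w0 w1]; elim: n => [|n IH]; first by rewrite mul0r subr0 expr0.
have n0 : (0 : R) <= n%:R by [].
have := ler_wpM2l (_ : 0 <= 1 - w) IH; rewrite subr_ge0 => /(_ w1).
by rewrite exprS -natr1; nra.
Qed.

Lemma bernoulli_le w n : 0 <= w <= 1 -> (1 - w) ^+ n * (1 + n%:R * w) <= 1.
Proof.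
move=> /andP[w0 w1]; elim: n => [|n IH]; first by rewrite expr0 mul0r addr0 mulr1.
have n0 : (0 : R) <= n%:R by [].
have p : 0 <= (1 - w) ^+ n by rewrite exprn_ge0// subr_ge0.
rewrite exprS -natr1.
have : (1 - w) * (1 + (n%:R + 1) * w) <= 1 + n%:R * w by nra.
move=> /(ler_wpM2l p); lra.
Qed.

(* Approximates the indicator of the positive reals on [-1, 1] by
   polynomials with values in [0, 1]. *)
Definition stepp n (u : R) := (1 - ((1 - u) / 2) ^+ n) ^+ (2 ^ n).

Lemma stepp01 n u : -1 <= u <= 1 -> 0 <= stepp n u <= 1.
Proof.
move=> /andP[u0 u1].
have h0 : 0 <= (1 - u) / 2 by lra.
have h1 : (1 - u) / 2 <= 1 by lra.
have := exprn_ile1 n h0 h1; have := exprn_ge0 n h0 => a b.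
rewrite /stepp exprn_ge0 ?exprn_ile1//; lra.
Qed.

(** With [w = ((1 - u) / 2)^n] and exponent [2^n], the product [2^n * w] is [(1 - u)^n]. For [u > 0]
    it tends to 0 and Bernoulli's inequality gives the limit 1; for [u < 0] it tends to infinity and
    the reverse bound gives the limit 0. This is the device of the Brosowski-Deutsch proof of the
    Stone-Weierstrass theorem. *)
Lemma stepp_cvg u : -1 <= u <= 1 -> u != 0 -> (fun n => stepp n u) @ \oo --> (if 0 < u then 1 else 0 : R).
Proof.
move=> /andP[u0 u1] un0.
have h0 : 0 <= (1 - u) / 2 by lra.
have h1 : (1 - u) / 2 <= 1 by lra.
have w01 n : 0 <= ((1 - u) / 2) ^+ n <= 1 by rewrite exprn_ge0// exprn_ile1.
have E n : (2 ^ n)%:R * ((1 - u) / 2) ^+ n = (1 - u) ^+ n.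
  by rewrite natrX expr_div_n mulrC divfK// expf_neq0.
have s01 n : 0 <= stepp n u <= 1 by apply: stepp01; rewrite u0 u1.
have [up|] := ltP 0 u.
  apply: (@squeeze_cvgr _ _ _ _ (fun n => 1 - (1 - u) ^+ n) (fun=> 1)).
  - apply: nearW => n; have /andP[_ ->] := s01 n; rewrite andbT -E.
    exact: bernoulli_ge.
  - rewrite -[X in _ --> X]subr0; apply: cvgB; first exact: cvg_cst.
    by apply: cvg_expr; rewrite ger0_norm; lra.
  - exact: cvg_cst.
rewrite le_eqVlt (negPf un0)/= => un.
have p n : 0 < 1 + (1 - u) ^+ n by rewrite ltr_pwDl// exprn_ge0; lra.
apply: (@squeeze_cvgr _ _ _ _ (fun=> 0) (fun n => ((1 - u)^-1) ^+ n)).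
- apply: nearW => n; have /andP[-> _] := s01 n; rewrite /=.
  have := bernoulli_le (2 ^ n) (w01 n); rewrite E -/(stepp n u) => H.
  have q : 0 < (1 - u) ^+ n by rewrite exprn_gt0//; lra.
  rewrite exprVn -[leRHS]mul1r ler_pdivlMr//.
  have /andP[s0 _] := s01 n; nra.
- exact: cvg_cst.
- apply: cvg_expr; rewrite ger0_norm ?invr_ge0; last by lra.
  by rewrite invf_lt1; lra.
Qed.

End step_polynomial.

Section density.
Context {R : realType} {d : nat}.
Local Notation vec := 'rV[R]_d.
Local Notation cell := (d.-tuple (measurableTypeR R)).
Local Notation mu := (torus R d).
Local Notation tperiodic := Defs.periodic.
Local Notation conv := Defs.conv.
Implicit Types (f g q : vec -> R) (x y v : vec) (n : nat).

(** A condition on one coordinate defines a product set, whose measure is that of its base in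
    [[0, 1]]. *)
Lemma ae_coord (i : 'I_d) (P : R -> Prop) (N : set R) : measurable N ->
  lebesgue_measure (N `&` `[0, 1]) = 0%E -> (forall s, ~ N s -> P s) ->
  {ae mu, forall y : cell, P (tnth y i)}.
Proof.
move=> mN N0 NP; exists [set y | N (tnth y i)]; split.
- by rewrite -[X in measurable X]setTI; exact: (@measurable_tnth _ _ d i measurableT).
- pose u (j : 'I_d) : R -> R := if j == i then \1_N else cst 1.
  have mu' j : measurable_fun setT (u j).
    by rewrite /u; case: ifP => _; [exact: measurable_indic|exact: measurable_cst].
  have u0 j s : 0 <= u j s by rewrite /u; case: ifP => _ //=; rewrite indicE.
  have mAi : measurable [set y : cell | N (tnth y i)].
    by rewrite -[X in measurable X]setTI; exact: (@measurable_tnth _ _ d i measurableT).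
  transitivity (\int[mu]_y (\prod_j u j (tnth y j))%:E)%E.
    transitivity (\int[mu]_y (\1_[set y : cell | N (tnth y i)] y)%:E)%E.
      by rewrite integral_indic// setIT.
    apply: eq_integral => y _.
    rewrite (bigD1 i)//= {1}/u eqxx big1 ?mulr1 ?indicE//=.
    by move=> j /negPf ji; rewrite /u ji.
  rewrite integral_torus_prod// (bigD1 i)//= {1}/u eqxx.
  rewrite /uniform01 integral_uniform//.
  - suff -> : (\int[lebesgue_measure]_(x in `[0%R, 1%R]) (\1_N x)%:E = 0 :> \bar R)%E by rewrite mule0 mul0e.
    by rewrite integral_indic//; exact: N0.
  - by apply/measurable_EFinP; exact: measurable_indic.
by move=> y /= nP; apply: contrapT => nN; apply: nP; exact: NP.
Qed.

(** The bounds [0 <= q x <= 1] make the class stable under products of the approximants, hence under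
    intersections. *)
Definition approx (A : set cell) := measurable A /\ forall e : R, 0 < e ->
  exists q : vec -> R, [/\ tp q, (forall x, 0 <= q x <= 1) &
    \int[mu]_y `|\1_A y - q (pt y)| < e].

Lemma approx_limit (A : set cell) (q_ : nat -> vec -> R) : measurable A ->
  (forall n, tp (q_ n)) -> (forall n x, 0 <= q_ n x <= 1) ->
  {ae mu, forall y : cell, (fun n => q_ n (pt y)) @ \oo --> (\1_A y : R)} -> approx A.
Proof.
move=> mA tq q01 qA; split => // e e0.
have : (fun n => \int[mu]_y `|\1_A y - q_ n (pt y)|) @ \oo --> (\int[mu]_y (0 : R)).
  apply: (@Rdominated_convergenceT _ _ _ mu _ (fun=> 0) 1) => //.
  - move=> n; apply: measurableT_comp => //; apply: measurable_funB; first exact: measurable_indic.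
    exact: (tp_measurable (tq n)).
  - move=> n y; rewrite normr_id; have /andP[? ?] := q01 n (pt y).
    by rewrite indicE; case: (_ \in _); rewrite ler_norml; apply/andP; split => //=; lra.
  apply: filterS qA => y qy; rewrite -(normr0 R) -(subrr (\1_A y)).
  by apply: cvg_norm; apply: cvgB => //; exact: cvg_cst.
rewrite Rintegral_cst//= mul0r => /cvgrPdist_lt/(_ _ e0)[N _ /(_ N (leqnn N))].
rewrite sub0r normrN ger0_norm => [H|]; last by apply: Rintegral_ge0.
by exists (q_ N).
Qed.

Lemma approx_indic_integrable (A : set cell) q c : measurable A -> tp q ->
  mu.-integrable setT (EFin \o (fun y : cell => `|c * \1_A y - q (pt y)|)).
Proof.
move=> mA tq; apply: (@integrable_norm _ _ _ mu setT (fun y : cell => c * \1_A y - q (pt y))).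
have [b b0 qb] := tp_bounded tq.
apply: measurable_bounded_integrable => //.
- by apply: (le_lt_trans (probability_le1 _ _)) => //; exact: ltry.
- apply: measurable_funB; last exact: (tp_measurable tq).
  by apply: measurable_funM => //; exact: measurable_indic.
exists (`|c| + b); split; [exact: num_real|move=> M bM y _].
apply: le_trans (ltW bM); apply: (le_trans (ler_normB _ _)); apply: lerD => //.
rewrite normrM -[leRHS]mulr1 ler_wpM2l// indicE; case: (_ \in _) => /=.
  by rewrite normr1.
by rewrite normr0.
Qed.

Lemma approx_setC (A : set cell) : approx A -> approx (~` A).
Proof.
move=> [mA H]; split; first exact: measurableC.
move=> e /H[q [tq q01 qe]]; exists (fun x => 1 - q x); split.
- by apply: tpB => //; exact: tp_cst.
- by move=> x; have /andP[? ?] := q01 x; apply/andP; split; lra.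
rewrite (_ : \int[mu]_y _ = \int[mu]_y `|\1_A y - q (pt y)|)//.
apply: eq_Rintegral => y _; rewrite -normrN; congr `|_|.
rewrite !indicE; have [yA|yA] := pselect (A y).
  by rewrite (mem_set yA) memNset//=; ring.
by rewrite (memNset yA) mem_set//=; ring.
Qed.

Lemma approx_setI (A B : set cell) : approx A -> approx B -> approx (A `&` B).
Proof.
move=> [mA HA] [mB HB]; split; first exact: measurableI.
move=> e e0; have e2 : 0 < e / 2 by rewrite divr_gt0.
have [q [tq q01 qe]] := HA _ e2; have [r [tr r01 re]] := HB _ e2.
exists (fun x => q x * r x); split.
- exact: tp_mul.
- move=> x; have /andP[? ?] := q01 x; have /andP[? ?] := r01 x.
  by apply/andP; split; [exact: mulr_ge0|exact: mulr_ile1].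
have iA := approx_indic_integrable 1 mA tq.
have iB := approx_indic_integrable 1 mB tr.
have iAB := approx_indic_integrable 1 (measurableI _ _ mA mB) (tp_mul tq tr).
have E (C : set cell) (s : vec -> R) : (fun y : cell => `|1 * \1_C y - s (pt y)|) = (fun y : cell => `|\1_C y - s (pt y)|).
  by apply/funext => y; rewrite mul1r.
rewrite E in iA; rewrite E in iB.
rewrite (E (A `&` B) (fun x => q x * r x)) in iAB.
apply: (@le_lt_trans _ _ (\int[mu]_y (`|\1_A y - q (pt y)| + `|\1_B y - r (pt y)|))); last first.
  by rewrite RintegralD//; lra.
apply: le_Rintegral => //.
  by apply: (eq_integrable measurableT _ _ _ (integrableD measurableT iA iB)) => y _.
move=> y _; rewrite indicI /=.
have -> : \1_A y * \1_B y - q (pt y) * r (pt y) = (\1_A y - q (pt y)) * \1_B y + q (pt y) * (\1_B y - r (pt y)) by ring.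
apply: (le_trans (ler_normD _ _)); rewrite !normrM; apply: lerD.
  rewrite -[leRHS]mulr1 ler_wpM2l// indicE; case: (_ \in _) => /=; by rewrite ?normr1 ?normr0.
have /andP[? ?] := q01 (pt y).
by rewrite -[leRHS]mul1r ler_wpM2r// ger0_norm.
Qed.

Lemma approx_set0 : approx set0.
Proof.
apply: (@approx_limit _ (fun _ _ => 0)) => //.
- by move=> n; exact: tp_cst.
- by move=> n x; rewrite lexx ler01.
by apply: aeW => y; rewrite indic0; exact: cvg_cst.
Qed.

(** Finite unions come from complements and intersections; dominated convergence passes to the
    countable union. *)
Lemma approx_bigcup (F : nat -> set cell) : (forall n, approx (F n)) -> approx (\bigcup_n F n).
Proof.
move=> aF.
pose U n := \big[setU/set0]_(i < n) F i.
have aU n : approx (U n).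
  rewrite /U; elim: n => [|n IH]; first by rewrite big_ord0; exact: approx_set0.
  rewrite big_ord_recr /= -[_ `|` _]setCK setCU; apply: approx_setC.
  by apply: approx_setI; exact: approx_setC.
have mU : measurable (\bigcup_n F n) by apply: bigcupT_measurable => n; case: (aF n).
split => // e e0; have e2 : 0 < e / 2 by rewrite divr_gt0.
have : (fun n => \int[mu]_y `|\1_(\bigcup_n F n) y - \1_(U n) y|) @ \oo --> (\int[mu]_y (0 : R)).
  apply: (@Rdominated_convergenceT _ _ _ mu _ (fun=> 0) 1) => //.
  - move=> n; apply: measurableT_comp => //; apply: measurable_funB; first exact: measurable_indic.
    by apply: measurable_indic; case: (aU n).
  - move=> n y; rewrite normr_id !indicE.
    by case: (_ \in _); case: (_ \in _); rewrite /= ?subrr ?subr0 ?sub0r ?normrN ?normr0 ?normr1.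
  apply: aeW => y; apply: cvg_near_cst.
  have [[n _ Fn]|nF] := pselect ((\bigcup_n F n) y).
    near=> m; rewrite !indicE !mem_set ?subrr ?normr0//; last by exists n.
    rewrite /U -bigcup_mkord; exists n => //=.
    by near: m; exact: nbhs_infty_gt.
  near=> m; rewrite !indicE !memNset ?subrr ?normr0// /U -bigcup_mkord.
  by move=> [k _ Fk]; apply: nF; exists k.
rewrite Rintegral_cst//= mul0r => /cvgrPdist_lt/(_ _ e2)[N _ /(_ N (leqnn N))].
rewrite sub0r normrN ger0_norm => [H|]; last by apply: Rintegral_ge0.
have [mUN HN] := aU N; have [q [tq q01 qe]] := HN _ e2.
exists q; split => //.
have i1 : mu.-integrable setT (EFin \o (fun y : cell => `|\1_(U N) y - q (pt y)|)).
  have := approx_indic_integrable 1 mUN tq.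
  by apply: eq_integrable => // y _ /=; rewrite mul1r.
have i2 : mu.-integrable setT (EFin \o (fun y : cell => `|\1_(\bigcup_n F n) y - q (pt y)|)).
  have := approx_indic_integrable 1 mU tq.
  by apply: eq_integrable => // y _ /=; rewrite mul1r.
have i3 : mu.-integrable setT (EFin \o (fun y : cell => `|\1_(\bigcup_n F n) y - \1_(U N) y|)).
  apply: (@integrable_norm _ _ _ mu setT (fun y : cell => \1_(\bigcup_n F n) y - \1_(U N) y)).
  by apply: (eq_integrable measurableT _ _ _ (integrableB measurableT (integrable_indic mu mU) (integrable_indic mu mUN))) => y _.
apply: (@le_lt_trans _ _ (\int[mu]_y (`|\1_(\bigcup_n F n) y - \1_(U N) y| + `|\1_(U N) y - q (pt y)|))); last first.
  by rewrite RintegralD//; lra.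
apply: le_Rintegral => //.
  by apply: (eq_integrable measurableT _ _ _ (integrableD measurableT i3 i1)) => y _.
by move=> y _; exact: ler_distD.
Unshelve. all: by end_near. Qed.

(** For [a] in [[0, 1]], the function [sin (pi (s - a)) sin (pi s)] has the sign of [s - a] on the
    open unit interval. As a product of two sines of half frequency it is a trigonometric polynomial
    of period 1, and [stepp] turns its sign into the indicator. The points 0, 1 and [a] are
    negligible. *)
Lemma approx_ray i (a : R) : approx [set y | a < tnth y i].
Proof.
have mA : measurable [set y : cell | a < tnth y i].
  rewrite (_ : [set y | _] = (fun y : cell => tnth y i) @^-1` `]a, +oo[%classic).
    by rewrite -[X in measurable X]setTI; apply: measurable_tnth.
  by apply/seteqP; split => y /=; rewrite in_itv /= andbT.
have null (N : set R) : measurable N -> N `&` `[0, 1] `<=` [set 0; 1; a] ->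
    lebesgue_measure (N `&` `[0, 1]) = 0%E.
  move=> mN sN; apply: countable_lebesgue_measure0.
  by apply: (sub_countable (subset_card_le sN)); exact: finite_set_countable.
have indE (y : cell) : \1_[set y : cell | a < tnth y i] y = if a < tnth y i then 1 else 0 :> R.
  rewrite indicE; case: (ltP a (tnth y i)) => h; first by rewrite mem_set.
  by rewrite memNset//= => h'; move: (lt_le_trans h' h); rewrite ltxx.
have mC : measurable (~` `[0, 1]%classic : set R) by exact: measurableC.
have nC : lebesgue_measure (~` `[0, 1]%classic `&` `[0, 1]%classic : set R) = 0%E.
  by rewrite setICl measure0.
have cC (s : R) : ~ (~` `[0, 1]%classic) s -> 0 <= s <= 1.
  by move=> /contrapT /=; rewrite in_itv.
have [a0|a0] := ltP a 0.
  apply: (@approx_limit _ (fun _ _ => 1)) => //.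
  - by move=> n; exact: tp_cst.
  - by move=> n x; rewrite lexx ler01.
  have := @ae_coord i (fun s => a < s) _ mC nC.
  move=> /(_ _)/wrap[s /cC /andP[s0 _]|]; first exact: lt_le_trans a0 s0.
  by apply: filterS => y h; rewrite indE h; exact: cvg_cst.
have [a1|a1] := ltP 1 a.
  apply: (@approx_limit _ (fun _ _ => 0)) => //.
  - by move=> n; exact: tp_cst.
  - by move=> n x; rewrite lexx ler01.
  have := @ae_coord i (fun s => s < a) _ mC nC.
  move=> /(_ _)/wrap[s /cC /andP[_ s0]|]; first exact: le_lt_trans s0 a1.
  by apply: filterS => y h; rewrite indE ltNge (ltW h) /=; exact: cvg_cst.
have p0 : (0 : R) < pi by exact: pi_gt0.
pose w (s : R) := (cos (pi * a) - cos (2 * pi * s - pi * a)) / 2.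
have wE s : w s = sin (pi * (s - a)) * sin (pi * s).
  have -> : w s = (cos (pi * (s - a) - pi * s) - cos (pi * (s - a) + pi * s)) / 2.
    have -> : pi * (s - a) - pi * s = - (pi * a) by ring.
    by rewrite cosN; congr ((_ - cos _) / _); ring.
  by rewrite cosB cosD; field.
have tw : tp (fun x : vec => w (x 0 i)).
  apply: (@eq_tp R d (fun x => 2^-1 * cos (pi * a) - 2^-1 * (cos (pi * a) * cos (2 * pi * x 0 i) + sin (pi * a) * sin (2 * pi * x 0 i)))) => [x|].
    by rewrite /w cosB; field.
  apply: tpB; first exact: tp_cst.
  apply: tpZ; apply: tp_add; apply: tpZ; [exact: tp_cos|exact: tp_sin].
have w1 s : -1 <= w s <= 1.
  have := cos_geN1 (pi * a); have := cos_le1 (pi * a).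
  have := cos_geN1 (2 * pi * s - pi * a); have := cos_le1 (2 * pi * s - pi * a).
  by move=> *; rewrite /w; apply/andP; split; lra.
have sinp (s : R) : 0 < s -> s < 1 -> 0 < sin (pi * s).
  move=> s0 s1; apply: sin_gt0_pi; rewrite mulr_gt0//=.
  by rewrite -[ltRHS]mulr1 ltr_pM2l.
apply: (@approx_limit _ (fun n x => stepp n (w (x 0 i)))) => //.
- by move=> n; apply: tp_exp; apply: tpB; [exact: tp_cst|apply: tp_exp];
    apply: (@eq_tp R d (fun x => 2^-1 * (1 - w (x 0 i)))) => [x|]; [rewrite mulrC|
      apply: tpZ; apply: tpB => //; exact: tp_cst].
- by move=> n x; exact: stepp01.
have := @ae_coord i (fun s => w s != 0 /\ (0 < w s) = (a < s)) (~` `[0, 1]%classic `|` [set 0; 1; a]).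
move=> /(_ _ _ _)/wrap[||s|].
- by apply: measurableU => //; do 2! apply: measurableU => //.
- apply: null; last first.
    by move=> s [[ns|h]] s01 //; case: ns.
  by apply: measurableU => //; do 2! apply: measurableU => //.
- move=> /not_orP[/cC /andP[s0 s1] /not_orP[/not_orP[/eqP n0 /eqP n1] /eqP na]].
  have sp : 0 < sin (pi * s) by apply: sinp; rewrite lt_neqAle ?s0 ?s1 ?andbT// eq_sym.
  have [as_|sa] := ltP a s.
    have q : 0 < w s by rewrite wE mulr_gt0// sinp//; lra.
    by rewrite q gt_eqF.
  have sa' : s < a by rewrite lt_neqAle na.
  have q : w s < 0.
    rewrite wE nmulr_rlt0//.
    have -> : pi * (s - a) = - (pi * (a - s)) by ring.
    rewrite sinN oppr_lt0; apply: sinp; lra.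
  by rewrite lt_eqF// ltNge (ltW q).
apply: filterS => y [h1 h2]; rewrite indE -h2 /=.
by rewrite mxE; exact: stepp_cvg.
Qed.

(** The approximable sets form a sigma-algebra containing the coordinate rays, and these generate
    the product sigma-algebra: the identity is measurable from the one to the other. *)
Lemma approx_measurable (A : set cell) : measurable A -> approx A.
Proof.
move=> mA.
have mid : @measurable_fun _ _ (g_sigma_algebraType approx) cell setT id.
  apply/measurable_fun_tnthP => i.
  apply: (measurability _ (RGenOInfty.measurableE R)) => //= _ [_ [a ->] <-].
  rewrite setTI; apply: sub_sigma_algebra.
  have := approx_ray i a; congr approx.
  by apply/seteqP; split => y /=; rewrite in_itv /= andbT.
have := mid measurableT A mA; rewrite setTI preimage_id => H.
suff : <<s approx >> `<=` approx by apply.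
apply: smallest_sub => //; split.
- exact: approx_set0.
- by move=> B aB; rewrite setTD; exact: approx_setC.
- by move=> F aF; exact: approx_bigcup.
Qed.

Lemma tp_dense_sum (s : seq R) (A : R -> set cell) (e : R) : (forall r, measurable (A r)) -> 0 < e ->
  exists2 q, tp q & \int[mu]_y `|\sum_(r <- s) r * \1_(A r) y - q (pt y)| < e.
Proof.
move=> mA; elim: s e => [|r s IH] e e0.
  exists (fun=> 0); first exact: tp_cst.
  under eq_Rintegral do rewrite big_nil subrr normr0.
  by rewrite Rintegral_cst// mul0r.
have e2 : 0 < e / 2 by rewrite divr_gt0.
have [q tq qe] := IH _ e2.
have r0 : 0 < `|r| + 1 by rewrite ltr_wpDl.
have [_ /(_ _ (divr_gt0 e2 r0))[p [tp' _ pe]]] := approx_measurable (mA r).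
exists (fun x => r * p x + q x); first by apply: tp_add => //; exact: tpZ.
have i1 : mu.-integrable setT (EFin \o (fun y : cell => \1_(A r) y - p (pt y))).
  by apply: (eq_integrable measurableT _ _ _ (integrableB measurableT (integrable_indic mu (mA r)) (tp_integrable tp'))) => y _.
have i2 : mu.-integrable setT (EFin \o (fun y : cell => \sum_(r <- s) r * \1_(A r) y - q (pt y))).
  have [h _] := Rintegral_sum (mu := mu) s measurableT (F := fun r (y : cell) => r * \1_(A r) y)
    (fun r => integrableZl measurableT r (integrable_indic mu (mA r))).
  by apply: (eq_integrable measurableT _ _ _ (integrableB measurableT h (tp_integrable tq))) => y _.
have n1 := integrable_norm i1; have n2 := integrable_norm i2.
have n3 : mu.-integrable setT (EFin \o (fun y : cell => `|r| * `|\1_(A r) y - p (pt y)|)).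
  exact: (integrableZl measurableT `|r| n1).
apply: (@le_lt_trans _ _ (\int[mu]_y (`|r| * `|\1_(A r) y - p (pt y)| + `|\sum_(r <- s) r * \1_(A r) y - q (pt y)|))).
  apply: le_Rintegral => //.
  - apply: integrable_norm.
    apply: (eq_integrable measurableT _ _ _ (integrableD measurableT (integrableZl measurableT r i1) i2)) => y _ /=.
    by rewrite -EFinM -EFinD big_cons; congr _%:E; ring.
  - by apply: (eq_integrable measurableT _ _ _ (integrableD measurableT n3 n2)) => y _.
  move=> y _; rewrite big_cons.
  have -> : r * \1_(A r) y + \sum_(j <- s) j * \1_(A j) y - (r * p (pt y) + q (pt y)) =
    r * (\1_(A r) y - p (pt y)) + (\sum_(j <- s) j * \1_(A j) y - q (pt y)) by ring.
  by rewrite (le_trans (ler_normD _ _))// normrM.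
rewrite RintegralD// RintegralZl//.
suff : `|r| * \int[mu]_y `|\1_(A r) y - p (pt y)| < e / 2 by lra.
apply: (@le_lt_trans _ _ ((`|r|) * (e / 2 / (`|r| + 1)))).
  by rewrite ler_wpM2l// ltW.
rewrite mulrA ltr_pdivrMr// mulrDr mulr1 [e / 2 * _]mulrC.
by rewrite ltrDl.
Qed.

Import HBSimple.

Lemma tp_dense f (e : R) : tintegrable f -> 0 < e ->
  exists2 q, tp q & tint (fun x => `|f x - q x|) < e.
Proof.
move=> fi e0; have e2 : 0 < e / 2 by rewrite divr_gt0.
have [g_ [gi _ gf]] := approximation_sfun_integrable measurableT fi.
have [n /= gn] : exists n, (\int[mu]_y `|(f (pt y))%:E - (g_ n y)%:E| < (e / 2)%:E)%E.
  have : nbhs (0 : \bar R)%E [set x : \bar R | (x < (e / 2)%:E)%E].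
    by apply: open_nbhs_nbhs; split; [exact: open_ereal_lt_ereal|rewrite /= lte_fin].
  by move=> /gf[N _ /(_ N (leqnn N))]; exists N.
pose A r := g_ n @^-1` [set r].
have mA r : measurable (A r) by exact: measurable_sfunP.
pose s : seq R := finmap.enum_fset (fset_set (range (g_ n))).
have gE (y : cell) : g_ n y = \sum_(r <- s) r * \1_(A r) y.
  rewrite [LHS]fimfunE fsbig_finite//=.
have [q tq qe] := tp_dense_sum s mA e2.
exists q => //.
have i1 : mu.-integrable setT (EFin \o (fun y : cell => f (pt y) - g_ n y)).
  by apply: (eq_integrable measurableT _ _ _ (integrableB measurableT fi (gi n))) => y _.
have i2 : mu.-integrable setT (EFin \o (fun y : cell => g_ n y - q (pt y))).
  by apply: (eq_integrable measurableT _ _ _ (integrableB measurableT (gi n) (tp_integrable tq))) => y _.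
have n1 := integrable_norm i1; have n2 := integrable_norm i2.
apply: (@le_lt_trans _ _ (\int[mu]_y (`|f (pt y) - g_ n y| + `|g_ n y - q (pt y)|))).
  apply: le_Rintegral => //.
  - by apply: (tintegrable_norm (f := fun x => f x - q x)); apply: tintegrableB => //; exact: tp_integrable.
  - by apply: (eq_integrable measurableT _ _ _ (integrableD measurableT n1 n2)) => y _.
  by move=> y _; exact: ler_distD.
rewrite RintegralD//.
have : \int[mu]_y `|g_ n y - q (pt y)| < e / 2.
  by under eq_Rintegral do rewrite gE.
suff : \int[mu]_y `|f (pt y) - g_ n y| < e / 2 by lra.
rewrite -lte_fin fineK//; exact: integrable_fin_num.
Qed.

Lemma conv_subr k f g x : tintegrable (fun y => k (x - y) * f y) -> tintegrable (fun y => k (x - y) * g y) ->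
  conv k (fun y => f y - g y) x = conv k f x - conv k g x.
Proof. by move=> i1 i2; rewrite /Defs.conv -tintB//; apply: eq_tint => y; rewrite mulrBr. Qed.

Lemma tp_conv_integrable k f x : tp k -> L1 f -> tintegrable (fun y => k (x - y) * f y).
Proof.
move=> tk Lf; have [c _ kc] := tp_bounded tk.
exact: (conv_bounded_integrable (tp_measurable tk) kc x Lf).
Qed.

Lemma L1B f g : L1 f -> L1 g -> L1 (fun x => f x - g x).
Proof.
move=> [pf fi] [pg gi]; split; last exact: tintegrableB.
by move=> i x; rewrite pf pg.
Qed.

Lemma L1_conv_tp k f : tp k -> L1 f -> L1 (conv k f).
Proof. by move=> tk Lf; have [] := L1_conv (tp_L1 tk) Lf. Qed.

(** Convolution with [K n] contracts the L1 norm, so [f] may be replaced by a nearby trigonometric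
    polynomial, for which the convergence is pointwise and dominated. *)
Lemma conv_K_L1 f : L1 f -> (fun n => tint (fun x => `|conv (K n) f x - f x|)) @ \oo --> (0 : R).
Proof.
move=> Lf; apply/cvgrPdist_lt => e e0.
have e3 : 0 < e / 3 by rewrite divr_gt0.
have [q tq qe] := tp_dense Lf.2 e3.
have Lq := tp_L1 tq; have [c c0 qc] := tp_bounded tq.
have Lfq := L1B Lf Lq.
have H : (fun n => \int[mu]_y `|conv (K n) q (pt y) - q (pt y)|) @ \oo --> \int[mu]_y (0 : R).
  apply: (@Rdominated_convergenceT _ _ _ mu _ (fun=> 0) (c + c)).
  - by rewrite addr_ge0.
  - move=> n; apply: measurableT_comp => //; apply: measurable_funB; last exact: tp_measurable.
    by apply: L1_measurable; exact: L1_conv_tp (tp_K n) Lq.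
  - move=> n y; rewrite normr_id; apply: (le_trans (ler_normB _ _)); apply: lerD => //.
    rewrite tconvC; try exact: tp_measurable; try exact: tp_periodic; try (exact: tp_measurable (tp_K n)); try exact: tp_periodic (tp_K n).
    have := conv_bounded_norm (tp_measurable tq) qc (pt y) (tp_L1 (tp_K n)).
    rewrite (@eq_tint _ _ (fun z => `|K n z|) (K n)); first by rewrite tint_K mulr1.
    by move=> z; rewrite ger0_norm// K_ge0.
  apply: aeW => y; rewrite -(normr0 R) -(subrr (q (pt y))); apply: cvg_norm; apply: cvgB; last exact: cvg_cst.
  by apply: (conv_K_cvg (tp_periodic tq) (tp_measurable tq) qc); exact: tp_continuous.
rewrite [X in _ --> X](tint_cst (d := d) 0) in H; move/cvgrPdist_lt : H => /(_ _ e3); apply: filterS => n.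
rewrite !sub0r !normrN => Hn.
rewrite ger0_norm; last exact: tint_ge0.
rewrite ger0_norm in Hn; last by apply: Rintegral_ge0.
have i1 : tintegrable (fun x => `|conv (K n) (fun y => f y - q y) x|).
  by apply: tintegrable_norm; case: (L1_conv_tp (tp_K n) Lfq).
have i2 : tintegrable (fun x => `|conv (K n) q x - q x|).
  by apply: tintegrable_norm; case: (L1B (L1_conv_tp (tp_K n) Lq) Lq).
have i3 : tintegrable (fun x => `|f x - q x|) by apply: tintegrable_norm; case: Lfq.
apply: (@le_lt_trans _ _ (tint (fun x => (`|conv (K n) (fun y => f y - q y) x| + `|conv (K n) q x - q x|) + `|f x - q x|))).
  apply: le_tint.
  - by apply: tintegrable_norm; case: (L1B (L1_conv_tp (tp_K n) Lf) Lf).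
  - by apply: tintegrableD => //; exact: tintegrableD.
  move=> x; rewrite conv_subr; try (exact: tp_conv_integrable (tp_K n) _).
  rewrite (distrC (f x)).
  have -> : conv (K n) f x - f x = ((conv (K n) f x - conv (K n) q x) + (conv (K n) q x - q x)) + (q x - f x) by ring.
  by apply: (le_trans (ler_normD _ _)); rewrite lerD2r ler_normD.
rewrite tintD//; last exact: tintegrableD.
rewrite tintD//.
have : tint (fun x => `|conv (K n) (fun y => f y - q y) x|) <= tint (fun x => `|f x - q x|).
  apply: (le_trans (tint_norm_conv_le (tp_L1 (tp_K n)) Lfq)).
  rewrite (@eq_tint _ _ (fun z => `|K n z|) (K n)); first by rewrite tint_K mul1r.
  by move=> z; rewrite ger0_norm// K_ge0.
have Hn' : tint (fun x => `|conv (K n) q x - q x|) < e / 3 by exact: Hn.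
by move: qe Hn'; lra.
Qed.

(** [K n] is even, hence self-adjoint: it is moved from the bounded function onto [f], where it
    converges in the mean. *)
Lemma conv_K_weak f g (B : R) : L1 g -> {ae mu, forall y : cell, `|g (pt y)| <= B} -> L1 f ->
  (fun n => tint (fun x => conv (K n) g x * f x)) @ \oo --> tint (fun x => g x * f x).
Proof.
move=> Lg gB Lf; have mg := L1_measurable Lg.
have E n : tint (fun x => conv (K n) g x * f x) = tint (fun x => g x * conv (K n) f x).
  have [c _ kc] := tp_bounded (tp_K (R := R) (d := d) n).
  rewrite (conv_adjoint (tp_measurable (tp_K n)) kc Lg Lf).
  by under [fun z => K n (- z)]eq_fun do rewrite K_even.
under eq_fun do rewrite E.
apply/cvgrPdist_le => e e0.
have B1 : 0 < `|B| + 1 by rewrite ltr_wpDl.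
have := conv_K_L1 Lf => /cvgrPdist_lt /(_ _ (divr_gt0 e0 B1)); apply: filterS => n.
rewrite sub0r normrN ger0_norm => [Hn|]; last exact: tint_ge0.
have L1' := L1B (L1_conv_tp (tp_K n) Lf) Lf.
have i1 h : L1 h -> tintegrable (fun x => g x * h x) by move=> [_ hi]; exact: tintegrableM_ae gB.
rewrite -tintB; [|exact: i1|exact: i1 (L1_conv_tp (tp_K n) Lf)].
rewrite -normrN -mulN1r -tintZ; last first.
  by apply: tintegrableB; [exact: i1|exact: i1 (L1_conv_tp (tp_K n) Lf)].
rewrite (@eq_tint _ _ _ (fun x => g x * (conv (K n) f x - f x))); last by move=> x; ring.
apply: (@le_trans _ _ (tint (fun x => (`|B| + 1) * `|conv (K n) f x - f x|))).
  apply: ae_norm_tint_le; first exact: i1.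
    by apply: tintegrableZ; apply: tintegrable_norm; case: L1'.
  apply: filterS gB => y gy; rewrite normrM ler_wpM2r//.
  by apply: (le_trans gy); apply: (le_trans (ler_norm B)); rewrite lerDl.
rewrite tintZ; last by apply: tintegrable_norm; case: L1'.
by rewrite -ler_pdivlMl// mulrC ltW.
Qed.

(** The excess [h] of [|f|] over [B] is at most [|conv (K n) f - f|] for every [n], so its integral
    vanishes. In this way bounds proved for trigonometric polynomials return to the limit. *)
Lemma conv_K_bound f (B : R) : L1 f -> (forall n x, `|conv (K n) f x| <= B) ->
  {ae mu, forall y : cell, `|f (pt y)| <= B}.
Proof.
move=> Lf fB; have mf := L1_measurable Lf.
pose h x := Num.max 0 (`|f x| - B).
have mh : tmeasurable h.
  apply: measurable_maxr => //; apply: measurable_funB => //; exact: tmeasurable_norm.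
have h0 x : 0 <= h x by rewrite le_max lexx.
have hle n x : h x <= `|conv (K n) f x - f x|.
  rewrite /h ge_max normr_ge0 /= lerBlDr distrC.
  have := fB n x; have := ler_distD (conv (K n) f x) (f x) 0.
  by rewrite !subr0; lra.
have ih : tintegrable h.
  apply: (tintegrable_le (g := fun x => `|conv (K 0) f x - f x|)) => //.
    by apply: tintegrable_norm; case: (L1B (L1_conv_tp (tp_K 0) Lf) Lf).
  by move=> x; rewrite ger0_norm.
have th : tint h = 0.
  apply/eqP; rewrite eq_le tint_ge0// andbT.
  have := conv_K_L1 Lf => H; rewrite -(cvg_lim _ H)//.
  apply: limr_ge; first by apply/cvg_ex; exists 0.
  apply: nearW => n; apply: le_tint => //.
  by apply: tintegrable_norm; case: (L1B (L1_conv_tp (tp_K n) Lf) Lf).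
have : (\int[mu]_y `|(h (pt y))%:E| = 0)%E.
  rewrite -[RHS](congr1 EFin th) /tint /Rintegral fineK; last exact: integrable_fin_num.
  by apply: eq_integral => y _; rewrite gee0_abs// lee_fin.
move/(ae_eq_integral_abs _ measurableT) => /(_ _)/wrap[|]; first exact/measurable_EFinP.
apply: filterS => y /(_ Logic.I) [] /eqP; rewrite eq_le /h ge_max subr_le0.
by move=> /andP[/andP[]].
Qed.

End density.

(** * Lipschitz functions of time and Gronwall's inequality *)

Section difference_quotient.
Context {R : realType}.

Lemma harmonicS_dnbhs : (fun n : nat => (n.+1%:R : R)^-1) @ \oo --> (0 : R)^'.
Proof.
move=> A [e /= e0 eA]; have := @cvg_harmonic R => /cvgrPdist_lt /(_ _ e0).
apply: filterS => n /= ne; exact: eA.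
Qed.

(** Only the steps [1 / (n + 1)] are used: for a sequence of quotients, measurability and dominated
    convergence are at hand. *)
Definition dq {V W : lmodType R} (f : V -> W) (v x : V) (n : nat) : W :=
  n.+1%:R *: (f (x + n.+1%:R^-1 *: v) - f x).

Lemma dq_cvg (V W : normedModType R) (f : V -> W) (v x : V) :
  derivable f x v -> dq f v x @ \oo --> 'D_v f x.
Proof.
move=> df; have := cvg_comp _ _ harmonicS_dnbhs df; apply: cvg_trans; apply: near_eq_cvg.
by apply: nearW => n /=; rewrite /dq invrK [X in f X]addrC.
Qed.

Lemma dq_cvg_is_derive (V W : normedModType R) (f : V -> W) (v x : V) df :
  is_derive x v f df -> dq f v x @ \oo --> df.
Proof. by move=> [dfx <-]; exact: dq_cvg. Qed.

End difference_quotient.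

(** * Primitives of bounded functions *)

Section primitives.
Context {R : realType}.
Local Notation leb := (@lebesgue_measure R).
Implicit Types (T : R) (f g b : R -> R).

(** Projection on [[0, T]] when [0 <= T]. Composition with it extends a function of time to the
    whole line with the same Lipschitz constant. *)
Definition clip T (t : R) := Num.max 0 (Num.min T t).

Lemma clip_in T t : 0 <= T -> clip T t \in `[0, T].
Proof.
move=> T0; rewrite in_itv /= /clip le_max lexx /= ge_max T0 /=.
by rewrite ge_min lexx.
Qed.

Lemma clip_id T t : t \in `[0, T] -> clip T t = t.
Proof. by rewrite in_itv /= /clip => /andP[t0 tT]; rewrite min_r// max_r. Qed.

Lemma clip_lip T s t : `|clip T s - clip T t| <= `|s - t|.
Proof.
have H1 (a b : R) : `|Num.min T a - Num.min T b| <= `|a - b|.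
  rewrite ler_norml; case: (lerP T a) => ?; case: (lerP T b) => ?;
    case: (ger0P (a - b)) => ?; apply/andP; split; lra.
apply: le_trans (H1 s t).
set a := Num.min T s; set b := Num.min T t.
by rewrite /clip ler_norml; case: (lerP 0 a) => ?; case: (lerP 0 b) => ?;
    case: (ger0P (a - b)) => ?; apply/andP; split; lra.
Qed.

Definition lip T f (c : R) :=
  forall s t, s \in `[0, T] -> t \in `[0, T] -> `|f s - f t| <= c * `|s - t|.

Lemma lip_clip T f c s t : 0 <= T -> 0 <= c -> lip T f c ->
  `|f (clip T s) - f (clip T t)| <= c * `|s - t|.
Proof.
move=> T0 c0 fc; apply: (le_trans (fc _ _ (clip_in _ T0) (clip_in _ T0))).
by rewrite ler_wpM2l// clip_lip.
Qed.

Lemma lipschitz_bound_continuous (V W : normedModType R) (h : V -> W) c :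
  (forall s t, `|h s - h t| <= c * `|s - t|) -> continuous h.
Proof.
move=> fc x; apply/cvgrPdist_lt => e e0.
have c1 : 0 < `|c| + 1 by rewrite ltr_wpDl.
near=> y; apply: (le_lt_trans (fc _ _)).
apply: (@le_lt_trans _ _ ((`|c| + 1) * `|x - y|)).
  by rewrite ler_wpM2r// (le_trans (ler_norm c))// lerDl.
rewrite -ltr_pdivlMl// mulrC; near: y.
by apply: (@cvgr_dist_lt _ _ _ (nbhs x) _ id x) => //; rewrite divr_gt0.
Unshelve. all: by end_near. Qed.

Lemma lip_clip_continuous T f c : 0 <= T -> 0 <= c -> lip T f c -> continuous (f \o clip T).
Proof. by move=> T0 c0 fc; apply: (@lipschitz_bound_continuous _ _ _ c) => s t; exact: lip_clip. Qed.

Lemma lip_measurable T f c : 0 <= T -> 0 <= c -> lip T f c -> measurable_fun `[0, T] f.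
Proof.
move=> T0 c0 fc; apply: (@eq_measurable_fun _ _ _ _ _ (f \o clip T)).
  by move=> x; rewrite inE/= => xT /=; rewrite clip_id// in_itv.
apply: measurable_funTS; apply: continuous_measurable_fun; exact: lip_clip_continuous fc.
Qed.

Lemma lip_bounded T f c : 0 <= T -> 0 <= c -> lip T f c ->
  forall s, s \in `[0, T] -> `|f s| <= `|f 0| + c * T.
Proof.
move=> T0 c0 fc s sT; have o0 : 0 \in `[0, T] by rewrite in_itv/= lexx.
have := fc s 0 sT o0; have : c * `|s - 0| <= c * T.
  rewrite ler_wpM2l// subr0; move: sT; rewrite in_itv/= => /andP[s0 ?]; by rewrite ger0_norm.
have := ler_normD (f s - f 0) (f 0); rewrite subrK; lra.
Qed.

Lemma ae_neq (x : R) : {ae leb, forall s : R, s != x}.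
Proof.
exists [set x]; split => //; first exact: lebesgue_measure_set1.
by move=> s /= /negP; rewrite negbK => /eqP.
Qed.

Lemma ae_eq_RintegralD dd (X : measurableType dd) (m : {measure set X -> \bar R})
    (D : set X) (f g : X -> R) : {ae m, forall x, D x -> f x = g x} ->
  \int[m]_(x in D) f x = \int[m]_(x in D) g x.
Proof.
move=> fg; rewrite (Rintegral_mkcond m D f) (Rintegral_mkcond m D g).
apply: (@ae_eq_RintegralT _ _ _ m); apply: filterS fg => x fgx.
by rewrite !patchE; case: ifPn => // xD; apply: fgx; rewrite inE in xD.
Qed.

Lemma Rdominated_convergenceD dd (X : measurableType dd) (m : {measure set X -> \bar R})
    (D : set X) (f_ : nat -> X -> R) (f : X -> R) (c : R) : measurable D -> (m D < +oo)%E -> 0 <= c ->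
  (forall n, measurable_fun D (f_ n)) -> (forall n x, D x -> `|f_ n x| <= c) ->
  {ae m, forall x, D x -> f_ ^~ x @ \oo --> f x} ->
  (fun n => \int[m]_(x in D) f_ n x) @ \oo --> \int[m]_(x in D) f x.
Proof.
move=> mD mDoo c0 mf fc ff.
have mf' n : measurable_fun setT (f_ n \_ D) by apply/(measurable_restrict _ _ measurableT) => //; rewrite setTI.
have fc' n x : `|(f_ n \_ D) x| <= c.
  by rewrite patchE; case: ifPn => [|_]; [rewrite inE => /fc|rewrite normr0].
have ff' : {ae m, forall x, (fun n => (f_ n \_ D) x) @ \oo --> (f \_ D) x}.
  apply: filterS ff => x fx; rewrite patchE; case: ifPn => xD.
    move: (xD); rewrite inE => /fx; apply: cvg_trans; apply: near_eq_cvg; apply: nearW => n.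
    by rewrite patchE xD.
  rewrite (_ : (fun n => _) = fun=> point) ; first exact: cvg_cst.
  by apply/funext => n; rewrite patchE (negbTE xD).
have [g [mg gc gf]] := ae_cvg_measurable c0 mf' fc' ff'.
have -> : \int[m]_(x in D) f x = \int[m]_(x in D) g x.
  apply: ae_eq_RintegralD; apply: filterS gf => x -> Dx.
  by rewrite patchE mem_set.
have gg : {ae m, forall x, D x -> f_ ^~ x @ \oo --> g x}.
  by apply: filterS2 ff gf => x fx -> Dx; rewrite patchE mem_set//; exact: fx.
have ic : m.-integrable D (EFin \o cst c).
  apply/integrableP; split; first by apply/measurable_EFinP; exact: measurable_cst.
  rewrite (eq_integral (cst `|c|%:E))// integral_cst//=.
  by rewrite lte_mul_pinfty// lee_fin.
by have [] := Rdominated_convergence mD mf (measurable_funTS mg) gg ic fc.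
Qed.

Lemma continuous_integrable (g : R -> R) (a b : R) : continuous g -> leb.-integrable `[a, b] (EFin \o g).
Proof.
move=> cg; apply: continuous_compact_integrable; first exact: segment_compact.
exact: continuous_subspaceT.
Qed.

Lemma is_derive_integral (g : R -> R) (a x : R) : continuous g -> a < x ->
  is_derive x 1 (fun x => \int[leb]_(s in `[a, x]) g s) (g x).
Proof.
move=> cg ax; have x1 : x < x + 1 by rewrite ltrDl.
have [d1 d2] := continuous_FTC1_closed x1 (continuous_integrable a (x + 1) cg) ax (cg x).
by apply: DeriveDef; [exact: d1|rewrite -derive1E d2].
Qed.

Lemma FTC2_R (f F : R -> R) (a b : R) : a <= b -> continuous f ->
  (forall x, a <= x <= b -> is_derive x 1 F (f x)) ->
  \int[leb]_(x in `[a, b]) f x = F b - F a.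
Proof.
rewrite le_eqVlt => /predU1P[-> cf dF|ab cf dF].
  by rewrite set_itv1 Rintegral_set1 subrr.
have cF x : a <= x <= b -> {for x, continuous F}.
  move=> xab; apply: differentiable_continuous; apply/derivable1_diffP.
  by have [] := dF x xab.
rewrite /Rintegral (@continuous_FTC2 _ f F)//.
- exact: continuous_subspaceT.
- split.
  + move=> x; rewrite in_itv/= => /andP[ax xb].
    by have [|] := dF x _; first by rewrite !ltW.
  + by apply: cvg_at_right_filter; apply: cF; rewrite lexx ltW.
  + by apply: cvg_at_left_filter; apply: cF; rewrite lexx ltW.
- move=> x; rewrite in_itv/= => /andP[ax xb]; rewrite derive1E.
  by have [|_ ->] := dF x _; first by rewrite !ltW.
Qed.

(** With a primitive [G] of [g], the integral of the quotients of [g] is the difference of the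
    quotients of [G] at the two ends. *)
Lemma steklov (g : R -> R) (t : R) : continuous g -> 0 <= t ->
  (fun n => \int[leb]_(s in `[0, t]) dq g 1 s n) @ \oo --> g t - g 0.
Proof.
move=> cg t0.
(* The primitive starts at -1 so that it is differentiable at 0 as well. *)
pose G x := \int[leb]_(s in `[-1, x]) g s.
have dG (x : R) : -1 < x -> is_derive x 1 G (g x) by move=> x1; exact: is_derive_integral.
have sh h : continuous (fun s : R => g (s + h)).
  move=> s; apply: (@continuous_comp _ _ _ (fun s => s + h) g); last exact: cg.
  by apply: cvgD => //; exact: cvg_cst.
have Gh h : 0 <= h -> \int[leb]_(s in `[0, t]) g (s + h) = G (t + h) - G (0 + h).
  move=> h0; apply: (@FTC2_R _ (fun x => G (x + h))) => // x /andP[x0 xt].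
  have xh : -1 < x + h by lra.
  have [d1 d2] := dG _ xh.
  have dsh : is_derive x 1 (fun s : R => s + h) (1 : R).
    by apply: is_deriveW (is_deriveD (is_derive_id x 1) (is_derive_cstR h x)) _ _; rewrite ?addr0.
  have := @is_derive1_comp R G (fun s => s + h) x _ _ (dG _ xh) dsh.
  by move=> H; apply: is_deriveW H _ _; rewrite ?mulr1.
have E n : \int[leb]_(s in `[0, t]) dq g 1 s n = dq G 1 t n - dq G 1 0 n.
  rewrite /dq /GRing.scale /=; set h := _^-1.
  have h0 : 0 <= h by rewrite invr_ge0.
  have iB : leb.-integrable `[0, t] (EFin \o (fun s => g (s + h) - g s)).
    apply: continuous_integrable => s; apply: cvgB; [exact: sh|exact: cg].
  under eq_Rintegral do rewrite mulr1.
  rewrite RintegralZl// RintegralB//; [|exact: continuous_integrable..].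
  rewrite Gh// (_ : \int[leb]_(s in `[0, t]) g s = G t - G 0).
    by rewrite !mulr1; ring.
  by have := Gh 0 (lexx _); rewrite !addr0 => <-; apply: eq_Rintegral => s _; rewrite addr0.
under eq_fun do rewrite E.
by apply: cvgB; apply: dq_cvg_is_derive; apply: dG; lra.
Qed.

(** [steklov] computes the limit of the integrated quotients; dominated convergence, with the
    Lipschitz constant as the bound, identifies it with the integral of [b]. *)
Lemma lip_FTC T f c (b : R -> R) : 0 < T -> 0 <= c -> lip T f c ->
  {ae leb, forall s, s \in `]0, T[ -> dq f 1 s @ \oo --> b s} ->
  forall t, t \in `[0, T] -> f t = f 0 + \int[leb]_(s in `[0, t]) b s.
Proof.
move=> T0 c0 fc fb t tT; have T0' := ltW T0; move: (tT); rewrite in_itv/= => /andP[t0 tT'].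
have cg := lip_clip_continuous T0' c0 fc; set g := _ \o _ in cg.
have cvg1 := steklov cg t0.
have cvg2 : (fun n => \int[leb]_(s in `[0, t]) dq g 1 s n) @ \oo --> \int[leb]_(s in `[0, t]) b s.
  apply: (@Rdominated_convergenceD _ _ leb _ (fun n s => dq g 1 s n) b c) => //.
  - by rewrite /= lebesgue_measure_itv; case: ifP => _ //; rewrite -EFinD ltry.
  - move=> n; apply: measurable_funTS; apply: continuous_measurable_fun => s.
    rewrite /dq /GRing.scale /=; apply: cvgM; first exact: cvg_cst.
    apply: cvgB; last exact: cg.
    apply: (@continuous_comp _ _ _ (fun s : R => s + _) g); last exact: cg.
    by apply: cvgD => //; exact: cvg_cst.
  - move=> n s _; rewrite /dq /GRing.scale /= mulr1 normrM ger0_norm//.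
    rewrite -ler_pdivlMl ?ltr0n//; apply: (le_trans (lip_clip _ _ T0' c0 fc)).
    by rewrite addrC addKr ger0_norm ?invr_ge0// mulrC.
  have aeF := ae_filter_ringOfSetsType leb.
  apply: filterS3 fb (ae_neq 0) (ae_neq t) => s fbs s0 st; rewrite /= in_itv/= => /andP[s0' st'].
  have sT : s \in `]0, T[.
    by rewrite in_itv/= lt_neqAle eq_sym s0 s0' /= (lt_le_trans _ tT')// lt_neqAle st.
  apply: cvg_trans (fbs sT); apply: near_eq_cvg.
  move: sT; rewrite in_itv/= => /andP[s_gt0 sT].
  have := @cvg_harmonic R => /cvgrPdist_lt /(_ (T - s)); rewrite subr_gt0 => /(_ sT).
  apply: filterS => n /=; rewrite sub0r normrN ger0_norm ?invr_ge0// => ns.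
  have e1 : clip T s = s by rewrite clip_id// in_itv/= s0' ltW.
  have e2 : clip T (s + n.+1%:R^-1) = s + n.+1%:R^-1.
    by rewrite clip_id// in_itv/= addr_ge0 ?invr_ge0//= addrC -lerBrDr ltW.
  by rewrite /dq /GRing.scale /= /g /= mulr1 e1 e2.
have : g t - g 0 = \int[leb]_(s in `[0, t]) b s by apply: cvg_unique cvg1 cvg2; exact: Rhausdorff.
by rewrite /g /= !clip_id// ?in_itv/= ?lexx// => <-; rewrite addrC subrK.
Qed.

(** The rate is carried as data together with its bound and measurability. Sums, products and limits
    of such functions can then be formed without choosing derivatives. *)
Definition prim T f b := [/\ measurable_fun `[0, T] b,
  (exists2 c, 0 <= c & forall s, s \in `[0, T] -> `|b s| <= c) &
  forall t, t \in `[0, T] -> f t = f 0 + \int[leb]_(s in `[0, t]) b s].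

Lemma bounded_integrable_itv T b c : measurable_fun `[0, T] b ->
  (forall s, s \in `[0, T] -> `|b s| <= c) -> leb.-integrable `[0, T] (EFin \o b).
Proof.
move=> mb bc; apply: (@le_integrable _ _ _ leb _ _ _ (EFin \o cst c)) => //.
- exact/measurable_EFinP.
- by move=> s sT /=; rewrite lee_fin (le_trans (bc s sT))// ler_norm.
- apply/integrableP; split; first by apply/measurable_EFinP; exact: measurable_cst.
  rewrite (eq_integral (cst `|c|%:E))// integral_cst//=.
  by rewrite lte_mul_pinfty// ?lee_fin// lebesgue_measure_itv; case: ifP => _ //; rewrite -EFinD ltry.
Qed.

Lemma prim_integrable T f b t : prim T f b -> t \in `[0, T] -> leb.-integrable `[0, t] (EFin \o b).
Proof.
move=> [mb [c c0 bc] _] tT; have := bounded_integrable_itv mb bc.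
apply: integrableS => //; apply: subset_itvl; by move: tT; rewrite in_itv/= => /andP[].
Qed.

Lemma prim_sub T f b s t : prim T f b -> 0 <= s -> s <= t -> t <= T ->
  f t - f s = \int[leb]_(u in `]s, t]) b u.
Proof.
move=> pb s0 st tT; have [_ _ fb] := pb.
rewrite (fb t) ?(fb s) ?in_itv/= ?s0 ?tT ?(le_trans s0 st) ?(le_trans st tT)//.
rewrite opprD addrACA subrr add0r (@Rintegral_itvB _ b (BLeft 0) (BRight t) s)//.
by apply: prim_integrable pb _; rewrite in_itv/= (le_trans s0 st).
Qed.

Lemma prim_lip T f b : prim T f b -> exists2 c, 0 <= c & lip T f c.
Proof.
move=> pb; have [mb [c c0 bc] _] := pb; exists c => // s t.
wlog st : s t / t <= s.
  by move=> H sT tT; case: (leP t s) => [ts|/ltW st]; [exact: H|rewrite distrC (distrC s); exact: H].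
rewrite !in_itv/= => /andP[s0 sT] /andP[t0 tT].
rewrite (prim_sub pb)// (@ger0_norm _ (s - t)) ?subr_ge0//.
have sub : `]t, s] `<=` `[0, T].
  move=> u; rewrite /= !in_itv/= => /andP[u1 u2]; apply/andP; split; first exact: le_trans (ltW u1).
  exact: le_trans u2 sT.
have ib : leb.-integrable `]t, s] (EFin \o b).
  by apply: integrableS (bounded_integrable_itv mb bc).
have ic : leb.-integrable `]t, s] (EFin \o cst c).
  apply: (@integrableS _ _ _ leb `[0, T]) => //.
  by apply: (bounded_integrable_itv (c := c)) => [|u _ /=]; [exact: measurable_cst|rewrite ger0_norm].
apply: (le_trans (le_Rintegral_norm _ ib ic _)) => //; first by move=> u /sub/bc.
rewrite Rintegral_cst//= lebesgue_measure_itv/=; case: ifP => [_|]; first by rewrite -EFinD.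
by rewrite lte_fin => _; rewrite mulr0 mulr_ge0// subr_ge0.
Qed.

(** Lebesgue's differentiation theorem, applied to [b] extended by zero outside [[0, T]]. *)
Lemma prim_derive T f b : prim T f b ->
  {ae leb, forall s, s \in `]0, T[ -> is_derive s 1 f (b s)}.
Proof.
move=> pb; have [mb [c c0 bc] fb] := pb.
pose b' := b \_ `[0, T].
have mb' : measurable_fun setT b' by apply/(measurable_restrict _ _ measurableT) => //; rewrite setTI.
have b'c s : `|b' s| <= c.
  by rewrite /b' patchE; case: ifPn => [|_]; [rewrite inE/= => /bc|rewrite normr0].
have bT : leb.-integrable setT (EFin \o b').
  rewrite /b' -restrict_EFin; apply/(@integrable_mkcond _ _ _ leb `[0, T]) => //.
  exact: bounded_integrable_itv mb bc.
have li := open_integrable_locally openT bT.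
have aeF := ae_filter_ringOfSetsType leb.
have bt y : leb.-integrable [set` Interval (BLeft 0) (BRight y)] (EFin \o b') by apply: integrableS bT.
have := @FTC1 R b' (BLeft 0) bt li; apply: filterS => s /= H; rewrite in_itv/= => /andP[s0 sT].
have [|d1 d2] := H; first by rewrite lte_fin.
have dF : is_derive s 1 (fun t => f 0 + \int[leb]_(u in `[0, t]) b' u) (b s).
  have -> : b s = 0 + b' s by rewrite add0r /b' patchE mem_set//= in_itv/= !ltW.
  apply: (is_deriveD_fun (is_derive_cstR (f 0) s)).
  by apply: DeriveDef; [exact: d1|rewrite -derive1E d2].
apply: near_eq_is_derive dF.
near=> t.
have tT : t \in `[0, T].
  by apply: subset_itv_oo_cc; near: t; apply: near_in_itvoo; rewrite in_itv/= s0 sT.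
rewrite (fb t)//; congr (_ + _); apply: eq_Rintegral => u; rewrite inE/= in_itv/= => /andP[u0 ut].
rewrite /b' patchE mem_set//= in_itv/= u0 (le_trans ut)//.
by move: tT; rewrite in_itv/= => /andP[].
Unshelve. all: by end_near. Qed.

Lemma prim_measurable T f b : 0 < T -> prim T f b -> measurable_fun `[0, T] f.
Proof. by move=> T0 pf; have [c c0 fc] := prim_lip pf; exact: lip_measurable (ltW T0) c0 fc. Qed.

Lemma prim_bounded T f b : 0 < T -> prim T f b ->
  exists2 c, 0 <= c & forall s, s \in `[0, T] -> `|f s| <= c.
Proof.
move=> T0 pf; have [c c0 fc] := prim_lip pf; exists (`|f 0| + c * T).
  by rewrite addr_ge0// mulr_ge0// ltW.
exact: lip_bounded (ltW T0) c0 fc.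
Qed.

(** The product is Lipschitz and, by the product rule, its quotients converge at almost every time;
    [lip_FTC] then integrates the limit. *)
Lemma primM T f g b e : 0 < T -> prim T f b -> prim T g e ->
  prim T (fun t => f t * g t) (fun t => f t * e t + g t * b t).
Proof.
move=> T0 pf pg.
have mf := prim_measurable T0 pf; have mg := prim_measurable T0 pg.
have [cf cf0 fc] := prim_bounded T0 pf; have [cg cg0 gc] := prim_bounded T0 pg.
have [mb [cb cb0 bc] _] := pf; have [me [ce ce0 ec] _] := pg.
split.
- by apply: measurable_funD; apply: measurable_funM.
- exists (cf * ce + cg * cb); first by rewrite addr_ge0// mulr_ge0.
  move=> s sT; apply: (le_trans (ler_normD _ _)); rewrite !normrM.
  by apply: lerD; apply: ler_pM => //; [exact: fc|exact: ec|exact: gc|exact: bc].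
- have [lf lf0 fl] := prim_lip pf; have [lg lg0 gl] := prim_lip pg.
  apply: (@lip_FTC _ _ (cf * lg + cg * lf)) => //; first by rewrite addr_ge0// mulr_ge0.
    move=> s t sT tT.
    rewrite (_ : f s * g s - f t * g t = f s * (g s - g t) + g t * (f s - f t)); last by ring.
    apply: (le_trans (ler_normD _ _)); rewrite !normrM mulrDl -!mulrA.
    by apply: lerD; apply: ler_pM => //; [exact: fc|exact: gl|exact: gc|exact: fl].
  have aeF := ae_filter_ringOfSetsType leb.
  apply: filterS2 (prim_derive pf) (prim_derive pg) => s df dg sT.
  by apply: dq_cvg_is_derive; apply: is_deriveM_fun; [exact: df|exact: dg].
Qed.

Lemma prim_cst T c : prim T (fun=> c) (fun=> 0).
Proof.
split; first exact: measurable_cst.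
- by exists 0 => // s _; rewrite normr0.
- by move=> t tT; rewrite Rintegral_cst// mul0r addr0.
Qed.

Lemma primD T f g b e : prim T f b -> prim T g e ->
  prim T (fun t => f t + g t) (fun t => b t + e t).
Proof.
move=> pf pg; have [mb [cb cb0 bc] fb] := pf; have [me [ce ce0 ec] ge] := pg.
split; first exact: measurable_funD.
- exists (cb + ce); first by rewrite addr_ge0.
  by move=> s sT; apply: (le_trans (ler_normD _ _)); apply: lerD; [exact: bc|exact: ec].
- move=> t tT; rewrite RintegralD//; [|exact: prim_integrable pf tT|exact: prim_integrable pg tT].
  by rewrite (fb t)// (ge t)// addrACA.
Qed.

Lemma primZ T f b c : prim T f b -> prim T (fun t => c * f t) (fun t => c * b t).
Proof.
move=> pf; have [mb [cb cb0 bc] fb] := pf.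
split; first exact: measurable_funM.
- exists (`|c| * cb); first by rewrite mulr_ge0.
  by move=> s sT; rewrite normrM ler_wpM2l// bc.
- move=> t tT; rewrite RintegralZl//; last exact: prim_integrable pf tT.
  by rewrite (fb t)// mulrDr.
Qed.

Lemma prim_sum T (I : Type) (s : seq I) (f b : I -> R -> R) : (forall i, prim T (f i) (b i)) ->
  prim T (fun t => \sum_(i <- s) f i t) (fun t => \sum_(i <- s) b i t).
Proof.
move=> fb; elim: s => [|i s IH].
  under eq_fun do rewrite big_nil; under [X in prim _ _ X]eq_fun do rewrite big_nil.
  exact: prim_cst.
under eq_fun do rewrite big_cons; under [X in prim _ _ X]eq_fun do rewrite big_cons.
exact: primD.
Qed.

Lemma eq_prim T f g b e : prim T f b -> (forall s, s \in `[0, T] -> f s = g s) ->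
  (forall s, s \in `[0, T] -> b s = e s) -> prim T g e.
Proof.
move=> [mb [c c0 bc] fb] fg be; split.
- by apply: eq_measurable_fun mb => s; rewrite inE/= => /be.
- by exists c => // s sT; rewrite -be//; exact: bc.
- move=> t tT; move: (tT); rewrite in_itv/= => /andP[t0 tT'].
  rewrite -fg// fb// -fg ?in_itv/= ?lexx ?(le_trans t0)//; congr (_ + _).
  apply: eq_Rintegral => s; rewrite inE/= in_itv/= => /andP[s0 st].
  by apply: be; rewrite in_itv/= s0 (le_trans st).
Qed.

Lemma ae_Rintegral_le0 T f : measurable_fun `[0, T] f ->
  {ae leb, forall s, s \in `]0, T[ -> f s <= 0} ->
  forall t, t \in `[0, T] -> \int[leb]_(s in `[0, t]) f s <= 0.
Proof.
move=> mf f0 t; rewrite in_itv/= => /andP[t0 tT].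
have -> : \int[leb]_(s in `[0, t]) f s = \int[leb]_(s in `[0, t]) Num.min 0 (f s).
  apply: ae_eq_RintegralD; have aeF := ae_filter_ringOfSetsType leb.
  apply: filterS3 f0 (ae_neq 0) (ae_neq T) => s fs s0 sT; rewrite /= in_itv/= => /andP[s0' st'].
  rewrite min_r// fs// in_itv/= lt_neqAle eq_sym s0 s0' /= lt_neqAle sT.
  exact: le_trans st' tT.
rewrite /Rintegral; apply: fine_le0.
have h0 s : 0 <= - Num.min 0 (f s) by rewrite oppr_ge0 ge_min lexx.
under eq_integral do rewrite -[Num.min _ _]opprK EFinN.
by rewrite integral_ge0N ?oppe_le0 ?integral_ge0// => s _; rewrite lee_fin.
Qed.

Lemma prim_expR T c : prim T (fun t => expR (c * t)) (fun t => c * expR (c * t)).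
Proof.
have d (t : R) : is_derive t 1 (fun t : R => expR (c * t)) (c * expR (c * t)).
  have h : is_derive t 1 (fun t : R => c * t) c.
    by apply: is_deriveW (is_deriveZ c (is_derive_id t (1:R))) _ _ => //; rewrite /GRing.scale /= mulr1.
  by apply: is_deriveW (is_derive1_comp (is_derive_expR _) h) _ _ => //; rewrite mulrC.
have cnt : continuous (fun t => c * expR (c * t)).
  move=> t; apply: cvgM; first exact: cvg_cst.
  suff : {for t, continuous (fun t : R => expR (c * t))} by [].
  by apply: differentiable_continuous; apply/derivable1_diffP; have [] := d t.
split.
- by apply: measurable_funTS; exact: continuous_measurable_fun.
- exists (`|c| * expR (`|c| * T)); first by rewrite mulr_ge0// expR_ge0.
  move=> s; rewrite in_itv/= => /andP[s0 sT]; rewrite normrM ler_wpM2l// ger0_norm ?expR_ge0//.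
  rewrite ler_expR; apply: (le_trans (ler_norm _)); rewrite normrM (ger0_norm s0).
  by rewrite ler_wpM2l.
- move=> t; rewrite in_itv/= => /andP[t0 tT].
  by rewrite (FTC2_R t0 cnt (F := fun t => expR (c * t)))// addrC subrK.
Qed.

(** Integrating factor: the product with [expR (- c * t)] has a rate that is nonpositive almost
    everywhere. *)
Lemma gronwall T f b c : 0 < T -> prim T f b ->
  {ae leb, forall s, s \in `]0, T[ -> b s <= c * f s} ->
  forall t, t \in `[0, T] -> f t <= expR (c * t) * f 0.
Proof.
move=> T0 pf bf t tT.
have pe := prim_expR T (- c).
have [mg _ H] := primM T0 pe pf.
have := H _ tT; rewrite mulr0 expR0 mul1r => e1.
suff : expR (- c * t) * f t <= f 0.
  by rewrite mulNr expRN -ler_pdivlMl ?invr_gt0 ?expR_gt0// invrK.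
rewrite e1 gerDl; apply: (ae_Rintegral_le0 mg) tT.
have aeF := ae_filter_ringOfSetsType leb.
apply: filterS bf => s bs sT; have := bs sT; have := expR_gt0 (- c * s).
by nra.
Qed.

End primitives.

(** * The mollified potential *)

Section trig_convolution.
Context {R : realType} {d : nat}.
Local Notation vec := 'rV[R]_d.
Local Notation cell := (d.-tuple (measurableTypeR R)).
Local Notation mu := (torus R d).
Local Notation tperiodic := Defs.periodic.
Local Notation conv := Defs.conv.
Implicit Types (k f g : vec -> R).

(** Separation of variables: the density enters a convolution only through finitely many moments,
    the coefficients of fixed trigonometric polynomials. *)
Lemma tp_convE k : tp k -> exists (I : finType) (a b : I -> vec -> R),
  [/\ (forall l, tp (a l)), (forall l, tp (b l)),
      (forall x y, k (x - y) = \sum_l a l x * b l y) &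
      forall f x, L1 f -> conv k f x = \sum_l tint (fun y => b l y * f y) * a l x].
Proof.
move=> tk; have [I [a [b [ta tb kE]]]] := tp_addition tk.
have tb' l : tp (fun y => b l (- y)) by exact: tp_opp.
have kE' x y : k (x - y) = \sum_l a l x * b l (- y) by rewrite kE.
exists I, a, (fun l y => b l (- y)); split => // f x Lf.
have ib l : tintegrable (fun y => b l (- y) * f y).
  have [c _ bc] := tp_bounded (tb' l); exact: tintegrableM Lf.2 (tp_measurable (tb' l)) bc.
rewrite [LHS](@eq_tint _ _ _ (fun y => \sum_l a l x * (b l (- y) * f y))).
  rewrite tint_sum => [|l]; last exact: tintegrableZ.
  by apply: eq_bigr => l _; rewrite tintZ// mulrC.
by move=> y; rewrite kE' mulr_suml; apply: eq_bigr => l _; rewrite mulrA.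
Qed.

Lemma tp_conv k f : tp k -> L1 f -> tp (conv k f).
Proof.
move=> tk Lf; have [I [a [b [ta _ _ kf]]]] := tp_convE tk.
apply: (@eq_tp _ _ (fun x => \sum_(l <- index_enum I) tint (fun y => b l y * f y) * a l x)).
  by move=> x; rewrite kf.
by apply: tp_sum => l _; exact: tpZ.
Qed.

Lemma partial_conv k f j x : tp k -> L1 f ->
  partial j (conv k f) x = conv (partial j k) f x.
Proof.
move=> tk Lf; have [I [a [b [ta tb kE kf]]]] := tp_convE tk.
rewrite (_ : conv k f = fun x => \sum_(l <- index_enum I) tint (fun y => b l y * f y) * a l x); last first.
  by apply/funext => z; rewrite kf.
rewrite partial_sum => [|l _]; last exact: tpZ.
have kE' y : partial j k (x - y) = \sum_l partial j (a l) x * b l y.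
  rewrite -partial_shift (_ : (fun z => k (z - y)) = fun z => \sum_(l <- index_enum I) b l y * a l z).
    rewrite partial_sum => [|l _]; last exact: tpZ.
    by apply: eq_bigr => l _; rewrite partialZ// mulrC.
  by apply/funext => z; rewrite kE; apply: eq_bigr => l _; rewrite mulrC.
have ib l : tintegrable (fun y => b l y * f y).
  have [c _ bc] := tp_bounded (tb l); exact: tintegrableM Lf.2 (tp_measurable (tb l)) bc.
rewrite [RHS](@eq_tint _ _ _ (fun y => \sum_l partial j (a l) x * (b l y * f y))).
  rewrite tint_sum => [|l]; last exact: tintegrableZ.
  by apply: eq_bigr => l _; rewrite tintZ// partialZ// mulrC.
by move=> y; rewrite kE' mulr_suml; apply: eq_bigr => l _; rewrite mulrA.
Qed.

Lemma partial_opp k j x : tp k -> partial j (fun z => k (- z)) x = - partial j k (- x).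
Proof.
move=> tk; elim: tk => [c|i|i|f g tf IHf tg IHg|f g tf IHf tg IHg].
- by rewrite !partial_cst oppr0.
- rewrite (_ : (fun z => _) = fun z : vec => cos (2 * pi * z 0 i)).
    rewrite (partial_comp_coord _ (is_derive_cos2pi _)) (partial_comp_coord _ (is_derive_cos2pi _)).
    by rewrite mxE mulrN sinN; ring.
  by apply/funext => z; rewrite mxE mulrN cosN.
- rewrite (_ : (fun z => _) = fun z : vec => -1 * sin (2 * pi * z 0 i)).
    rewrite partialZ; last exact: tp_sin.
    rewrite (partial_comp_coord _ (is_derive_sin2pi _)) (partial_comp_coord _ (is_derive_sin2pi _)).
    by rewrite mxE mulrN cosN; ring.
  by apply/funext => z; rewrite mxE mulrN sinN mulN1r.
- by rewrite partialD; try exact: tp_opp; rewrite // IHf IHg partialD// opprD.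
- by rewrite partialM; try exact: tp_opp; rewrite // IHf IHg partialM//; ring.
Qed.

Lemma partial_reflect k j x y : tp k -> partial j (fun z => k (x - z)) y = - partial j k (x - y).
Proof.
move=> tk.
rewrite (_ : (fun z => k (x - z)) = fun z => (fun w => k (x + w)) (- z)) //.
rewrite (@partial_opp (fun w => k (x + w))).
  by under [fun w => _]eq_fun do rewrite addrC; rewrite partial_shift addrC.
by apply: eq_tp (tp_shift x tk) => w; rewrite addrC.
Qed.

Lemma tp_laplacian k : tp k -> tp (laplacian k).
Proof. by move=> tk; apply: tp_sum => j _; do 2 apply: tp_partial. Qed.

Lemma eq_laplacian f g x : f =1 g -> laplacian f x = laplacian g x.
Proof. by move=> /funext ->. Qed.

Lemma laplacian_reflect k x y : tp k -> laplacian (fun z => k (x - z)) y = laplacian k (x - y).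
Proof.
move=> tk; apply: eq_bigr => j _.
rewrite (_ : partial j (fun z => k (x - z)) = fun z => -1 * partial j k (x - z)); last first.
  by apply/funext => z; rewrite partial_reflect// mulN1r.
by rewrite partialZ ?partial_reflect ?mulN1r ?opprK//; [exact: tp_partial|apply: tp_reflect; exact: tp_partial].
Qed.

Lemma laplacian_shift k x y : laplacian (fun z => k (z + x)) y = laplacian k (y + x).
Proof.
apply: eq_bigr => j _; rewrite (_ : partial j (fun z => k (z + x)) = fun z => partial j k (z + x)) ?partial_shift//.
by apply/funext => z; rewrite partial_shift.
Qed.

Lemma laplacianB f g x : tp f -> tp g -> laplacian (fun z => f z - g z) x = laplacian f x - laplacian g x.
Proof.
move=> tf tg; rewrite /laplacian -sumrB; apply: eq_bigr => j _.
have H (u w : vec -> R) : tp u -> tp w -> partial j (fun z => u z - w z) = fun z => partial j u z - partial j w z.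
  move=> tu tw; apply/funext => z.
  rewrite (_ : (fun z => u z - w z) = fun z => u z + -1 * w z); last by apply/funext => v; rewrite mulN1r.
  by rewrite partialD ?partialZ ?mulN1r//; exact: tpZ.
by rewrite H// H//; exact: tp_partial.
Qed.

Lemma laplacian_conv k f x : tp k -> L1 f -> laplacian (conv k f) x = conv (laplacian k) f x.
Proof.
move=> tk Lf.
rewrite /laplacian [RHS](@eq_tint _ _ _ (fun y => \sum_j partial j (partial j k) (x - y) * f y)); last first.
  by move=> y; rewrite mulr_suml.
have tpk j : tp (partial j (partial j k)) by do 2 apply: tp_partial.
rewrite tint_sum => [|j]; last exact: tp_conv_integrable.
apply: eq_bigr => j _.
rewrite (_ : partial j (conv k f) = conv (partial j k) f) ?partial_conv//; first exact: tp_partial.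
by apply/funext => z; rewrite partial_conv.
Qed.

(** * The Coulomb potential tested with trigonometric polynomials *)

Section potential.
Variables (V : vec -> R) (G : vec -> vec).
Hypotheses (hV : coulomb_potential V) (hG : weak_gradient V G).

Lemma L1_V : L1 V. Proof. by case: hV. Qed.

Definition Gj j x := G x 0 j.

Lemma L1_G j : L1 (Gj j).
Proof. by case: hG => pG iG _; split; [move=> i x; rewrite /Gj pG|exact: iG]. Qed.

(** The weak gradient is tested with the function [k (x - y)] of [y]; the sign due to the reflection
    cancels that of the integration by parts. *)
Lemma conv_partial_V k j x : tp k -> conv (partial j k) V x = conv k (Gj j) x.
Proof.
move=> tk; have [_ _ H] := hG; have := H j _ (tp_test (tp_reflect x tk)).
rewrite (@eq_tint _ _ _ (fun y => -1 * (partial j k (x - y) * V y))); last first.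
  by move=> y; rewrite partial_reflect//; ring.
rewrite tintZ; last by apply: tp_conv_integrable (tp_partial _ tk) L1_V.
rewrite mulN1r => /oppr_inj; rewrite {1}/Defs.conv => ->.
by apply: eq_tint => y; rewrite mulrC.
Qed.

(** The Poisson equation tested with [k (x - y)] as a function of [y], whose value at the origin is
    [k x]. *)
Lemma laplacian_conv_V k x : tp k -> laplacian (conv k V) x = tint k - k x.
Proof.
move=> tk; have [_ _ _ H] := hV; have := H _ (tp_test (tp_reflect x tk)).
rewrite subr0 tint_reflect; [|exact: tp_measurable|exact: tp_periodic].
move=> /(congr1 -%R); rewrite opprK opprB => <-.
rewrite laplacian_conv//; last exact: L1_V.
by apply: eq_tint => y; rewrite laplacian_reflect// mulrC.
Qed.

(** The mollified potential: a trigonometric polynomial with [- laplacian (W n) = K n - 1], for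
    which calculus is classical. *)
Definition W n := conv (K n) V.

Lemma tp_W n : tp (W n).
Proof. by apply: tp_conv L1_V; exact: tp_K. Qed.

Lemma tint_W n : tint (W n) = 0.
Proof.
have [_ _] := L1_conv (tp_L1 (tp_K n)) L1_V.
by rewrite /W => ->; case: hV => _ _ -> _; rewrite mulr0.
Qed.

Lemma laplacian_W n x : laplacian (W n) x = 1 - K n x.
Proof. by rewrite laplacian_conv_V ?tint_K//; exact: tp_K. Qed.

Lemma partial_W n j x : partial j (W n) x = conv (K n) (Gj j) x.
Proof. by rewrite partial_conv ?conv_partial_V//; [exact: tp_K|exact: tp_K|exact: L1_V]. Qed.

(* The odd part of W n is harmonic, hence constant: test it against V. *)
Lemma W_even n x : W n (- x) = W n x.
Proof.
have tW := tp_W n; have tW' := tp_opp tW.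
pose S x := W n x - W n (- x).
have tS : tp S by exact: tpB.
have lS y : laplacian S y = 0.
  rewrite laplacianB// laplacian_W.
  rewrite (@eq_laplacian (fun z => W n (- z)) (fun z => W n (0 - z))); last by move=> z; rewrite sub0r.
  by rewrite laplacian_reflect// sub0r laplacian_W K_even subrr.
have [_ _ _ H] := hV; have := H _ (tp_test (tp_shift x tS)).
rewrite (@eq_tint _ _ _ (fun=> 0)); last by move=> y; rewrite laplacian_shift lS mulr0.
rewrite tint_cst oppr0 add0r tint_shift; [|exact: tp_measurable|exact: tp_periodic].
have -> : tint S = 0.
  rewrite tintB; [|exact: tp_integrable..].
  rewrite (@eq_tint _ _ (fun x => W n (- x)) (fun x => W n (0 - x))); last by move=> y; rewrite sub0r.
  by rewrite tint_reflect ?subrr//; [exact: tp_measurable|exact: tp_periodic].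
by rewrite subr0 => /esym/eqP; rewrite subr_eq0 => /eqP.
Qed.

(** Expresses the mollified force of any integrable density as its convolution with one
    trigonometric polynomial, at every point and not only almost everywhere. *)
Lemma conv_KG n j f x : L1 f -> conv (K n) (conv (Gj j) f) x = conv (partial j (W n)) f x.
Proof.
move=> Lf; have [c _ kc] := tp_bounded (tp_K (R := R) (d := d) n).
rewrite (conv_assoc (tp_periodic (tp_K n)) (tp_measurable (tp_K n)) kc x (L1_G j) Lf).
by congr (Defs.conv _ _ _); apply/funext => y; rewrite partial_W.
Qed.

Lemma conv_KV n f x : L1 f -> conv (K n) (conv V f) x = conv (W n) f x.
Proof.
move=> Lf; have [c _ kc] := tp_bounded (tp_K (R := R) (d := d) n).
by rewrite (conv_assoc (tp_periodic (tp_K n)) (tp_measurable (tp_K n)) kc x L1_V Lf).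
Qed.

End potential.
End trig_convolution.

(** * Lipschitz functions of time and space *)

Section clamped_limsup.
Context {R : realType}.

(* The clamped limsup is measurable and bounded by construction, and is the limit
   wherever there is one of modulus at most c. *)
Definition clsup (c : R) (u : nat -> R) : R :=
  Num.max (- c) (Num.min c (fine (limn_esup (fun n => (u n)%:E)))).

Lemma clsup_bound c u : 0 <= c -> `|clsup c u| <= c.
Proof. by move=> c0; rewrite ler_norml le_max lexx /= ge_max ge_min lexx /= andbT; lra. Qed.

Lemma clsup_cvg c u l : (forall n, `|u n| <= c) -> u @ \oo --> l -> clsup c u = l.
Proof.
move=> uc ul; rewrite /clsup.
have -> : limn_esup (fun n => (u n)%:E) = l%:E.
  have : EFin \o u @ \oo --> l%:E by exact: cvg_comp ul _.
  by move=> /cvg_limn_einf_sup[].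
have lc : `|l| <= c.
  have nu : (fun n => `|u n|) @ \oo --> `|l| by exact: cvg_norm.
  rewrite -(cvg_lim _ nu)//; apply: limr_le; first by apply/cvg_ex; exists `|l|.
  exact: nearW.
by move: lc; rewrite ler_norml => /andP[? ?] /=; rewrite min_r// max_r.
Qed.

Lemma measurable_clsup dd (X : measurableType dd) c (u : nat -> X -> R) :
  (forall n, measurable_fun setT (u n)) -> measurable_fun setT (fun x => clsup c (u ^~ x)).
Proof.
move=> mu'; apply: measurable_maxr => //; apply: measurable_minr => //.
apply: (measurableT_comp (@fine_measurable R setT measurableT)) => //.
by apply: measurable_fun_limn_esup => n; exact/measurable_EFinP.
Qed.

End clamped_limsup.

Section space_time.
Context {R : realType} {d : nat}.
Local Notation vec := 'rV[R]_d.
Local Notation cell := (d.-tuple (measurableTypeR R)).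
Local Notation mu := (torus R d).
Local Notation leb := (@lebesgue_measure R).
Local Notation tperiodic := Defs.periodic.
Local Notation conv := Defs.conv.
Implicit Types (T L c : R) (k f g : vec -> R) (Phi h : R -> vec -> R).

Lemma norm_coord_le (x : vec) i : `|x 0 i| <= `|x|.
Proof. by rewrite [leRHS]mx_normrE; apply: (le_bigmax _ (fun ij : 'I_1 * 'I_d => `|x ij.1 ij.2|) (0, i)). Qed.

Lemma norm_le_coord (x : vec) c : 0 <= c -> (forall i, `|x 0 i| <= c) -> `|x| <= c.
Proof.
move=> c0 xc; rewrite [leLHS]mx_normrE; apply: bigmax_le => // -[i j] _ /=.
by rewrite (ord1 i).
Qed.

Lemma norm_evec j : `|evec j : vec| = 1.
Proof.
apply/eqP; rewrite eq_le norm_le_coord//=; last first.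
  by move=> i; rewrite mxE eqxx/=; case: (i == j); rewrite ?normr1 ?normr0.
by have := norm_coord_le (evec j) j; rewrite mxE !eqxx normr1.
Qed.

(** By a translation the difference quotients of [conv k f] fall on [f], where they are bounded by
    [L]; dominated convergence identifies their limit. *)
Lemma partial_conv_dq k f g j x L : tp k -> L1 f -> 0 <= L -> (forall y z, `|f y - f z| <= L * `|y - z|) ->
  {ae mu, forall y : cell, dq f (evec j) (pt y) @ \oo --> g (pt y)} ->
  partial j (conv k f) x = conv k g x.
Proof.
move=> tk Lf L0 fL fg; have tc := tp_conv tk Lf; have [c c0 kc] := tp_bounded tk.
have cv1 : dq (conv k f) (evec j) x @ \oo --> partial j (conv k f) x.
  by apply: dq_cvg; exact: tp_derivable.
have E n : dq (conv k f) (evec j) x n = tint (fun y => k (x - y) * dq f (evec j) y n).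
  rewrite /dq; set v := _ *: evec j.
  have -> : conv k f (x + v) = tint (fun y => k (x - y) * f (y + v)).
    rewrite -[RHS](@tint_shift _ _ _ (- v)).
    - by apply: eq_tint => y /=; rewrite opprB addrA subrK.
    - by apply: tmeasurableM; [apply: tp_measurable; exact: tp_reflect|exact: L1_measurable (L1_shift v Lf)].
    - by apply: periodicM; [apply: tp_periodic; exact: tp_reflect|exact: (L1_shift v Lf).1].
  have i1 := tp_conv_integrable x tk Lf.
  have i2 := tp_conv_integrable x tk (L1_shift v Lf).
  rewrite /Defs.conv -tintB// /GRing.scale /= -tintZ; last exact: tintegrableB.
  by apply: eq_tint => y; rewrite /GRing.scale /=; ring.
rewrite (eq_cvg _ _ E) in cv1.
have cv2 : (fun n => tint (fun y => k (x - y) * dq f (evec j) y n)) @ \oo --> conv k g x.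
  apply: (@Rdominated_convergenceT _ _ _ mu (fun n y => k (x - pt y) * dq f (evec j) (pt y) n) _ (c * L)).
  - exact: mulr_ge0.
  - move=> n; have mk : tmeasurable (fun y => k (x - y)) by apply: tp_measurable; exact: tp_reflect.
    apply: measurable_funM mk _; apply: measurable_funM; first exact: measurable_cst.
    by apply: measurable_funB; [exact: L1_measurable (L1_shift _ Lf)|exact: L1_measurable Lf].
  - move=> n y; rewrite normrM ler_pM// /dq /GRing.scale /= normrM ger0_norm//.
    rewrite -ler_pdivlMl ?ltr0n//; apply: (le_trans (fL _ _)).
    by rewrite addrC addKr normrZ norm_evec mulr1 ger0_norm ?invr_ge0// mulrC.
  - by apply: filterS fg => y gy; apply: cvgM => //; exact: cvg_cst.
by apply: cvg_unique cv1 cv2; exact: Rhausdorff.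
Qed.

(** [partial_conv_dq] at the point 0, for the kernel [q (- y)]. *)
Lemma partial_ibp q f g j L : tp q -> L1 f -> 0 <= L -> (forall y z, `|f y - f z| <= L * `|y - z|) ->
  {ae mu, forall y : cell, dq f (evec j) (pt y) @ \oo --> g (pt y)} ->
  tint (fun x => partial j q x * f x) = - tint (fun x => q x * g x).
Proof.
move=> tq Lf L0 fL fg.
have := partial_conv_dq 0 (tp_opp tq) Lf L0 fL fg.
rewrite partial_conv//; last exact: tp_opp.
rewrite /Defs.conv.
under eq_tint do rewrite partial_opp// sub0r opprK mulNr -mulN1r.
under [X in _ = X -> _]eq_tint do rewrite sub0r opprK.
rewrite tintZ; last first.
  have [c _ pc] := tp_bounded (tp_partial j tq).
  exact: tintegrableM Lf.2 (tp_measurable (tp_partial j tq)) pc.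
by rewrite mulN1r => <-; rewrite opprK.
Qed.

(* Space-time measurability on [0, T]. *)
Definition tmeas T h := measurable_fun (`[0, T] `*` setT)
  (fun z : measurableTypeR R * cell => h z.1 (pt z.2)).

Definition tbdd T h c := forall s x, s \in `[0, T] -> `|h s x| <= c.

Lemma tmeas_slice T h t : tmeas T h -> t \in `[0, T] -> tmeasurable (h t).
Proof.
move=> mh tT.
apply: (measurable_comp (F := `[0, T] `*` setT) _ _ mh (g := fun y : cell => (t, y))).
- by apply: measurableX.
- by move=> _ [y _ <-] /=.
- exact: measurable_pair1.
Qed.

Lemma tmeasM T h1 h2 : tmeas T h1 -> tmeas T h2 -> tmeas T (fun s x => h1 s x * h2 s x).
Proof. by move=> m1 m2; exact: measurable_funM. Qed.

Lemma tmeasB T h1 h2 : tmeas T h1 -> tmeas T h2 -> tmeas T (fun s x => h1 s x - h2 s x).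
Proof. by move=> m1 m2; exact: measurable_funB. Qed.

Lemma tmeas_static T f : tmeasurable f -> tmeas T (fun=> f).
Proof.
move=> mf; rewrite /tmeas; apply: measurable_funTS.
exact: (measurableT_comp mf measurable_snd).
Qed.

Lemma measurable_tint_slice T h : tmeas T h -> measurable_fun `[0, T] (fun s => tint (h s)).
Proof.
move=> mh; pose D : set (measurableTypeR R * cell) := `[0, T] `*` setT.
have mD : measurable D by exact: measurableX.
pose H := (fun z : measurableTypeR R * cell => h z.1 (pt z.2)) \_ D.
have mH : measurable_fun setT H by apply/(measurable_restrict _ mD measurableT); rewrite setTI.
apply: (@eq_measurable_fun _ _ _ _ _ (fun s => \int[mu]_y H (s, y))).
  move=> s; rewrite inE/= => sT; apply: eq_Rintegral => y _.
  by rewrite /H patchE mem_set.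
by apply: measurable_funTS; exact: (measurable_Rfubini mu mH).
Qed.

(* Lipschitz in space-time, periodic in space. *)
Definition stl T L Phi := [/\ 0 <= L, forall t, t \in `[0, T] -> tperiodic (Phi t) &
  forall s t x y, s \in `[0, T] -> t \in `[0, T] ->
    `|Phi s x - Phi t y| <= L * (`|s - t| + `|x - y|)].

Lemma vec_reduce x : exists2 v : vec, `|x - v| <= 1 & forall i, exists m : int, v 0 i = m%:~R.
Proof.
exists (\row_i (Num.floor (x 0 i))%:~R); last by move=> i; exists (Num.floor (x 0 i)); rewrite mxE.
apply: norm_le_coord => // i; rewrite !mxE.
have := floor_itv (x 0 i); rewrite intrD ler_norml => /andP[? ?].
by apply/andP; split; lra.
Qed.

Lemma stl_bounded T L Phi : 0 < T -> stl T L Phi -> exists2 c, 0 <= c & tbdd T Phi c.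
Proof.
move=> T0 [L0 pP PL]; exists (`|Phi 0 0| + L * (T + 1)).
  by rewrite addr_ge0// mulr_ge0// addr_ge0// ltW.
move=> s x sT; have [v xv vi] := vec_reduce x.
have -> : Phi s x = Phi s (x - v).
  by rewrite -[in LHS](subrK v x); apply: periodic_int => //; exact: pP.
have o0 : 0 \in `[0, T] by rewrite in_itv/= lexx ltW.
have := PL s 0 (x - v) 0 sT o0; rewrite !subr0.
have : L * (`|s| + `|x - v|) <= L * (T + 1).
  rewrite ler_wpM2l// lerD//; move: sT; rewrite in_itv/= => /andP[s0 ?]; by rewrite ger0_norm.
by have := ler_normD (Phi s (x - v) - Phi 0 0) (Phi 0 0); rewrite subrK; lra.
Qed.

Lemma stl_clip_continuous T L Phi : 0 < T -> stl T L Phi ->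
  continuous (fun z : R * vec => Phi (clip T z.1) z.2).
Proof.
move=> T0 [L0 pP PL]; apply: (@lipschitz_bound_continuous _ _ _ _ (L * 2)) => z w.
apply: (le_trans (PL _ _ _ _ (clip_in _ (ltW T0)) (clip_in _ (ltW T0)))).
rewrite -mulrA ler_wpM2l//.
have h1 : `|z.1 - w.1| <= `|z - w| by rewrite [leRHS]prod_normE le_max lexx.
have h2 : `|z.2 - w.2| <= `|z - w| by rewrite [leRHS]prod_normE le_max lexx orbT.
by have := clip_lip T z.1 w.1; lra.
Qed.

Lemma stl_tmeas T L Phi : 0 < T -> stl T L Phi -> tmeas T Phi.
Proof.
move=> T0 sP; have := measurable_continuous (stl_clip_continuous T0 sP) => m.
apply: (@eq_measurable_fun _ _ _ _ _ (fun z : measurableTypeR R * cell => Phi (clip T z.1) (pt z.2))).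
  by move=> z; rewrite inE/= => -[zT _]; rewrite clip_id.
exact: measurable_funTS.
Qed.

Lemma stl_L1 T L Phi t : 0 < T -> stl T L Phi -> t \in `[0, T] -> L1 (Phi t).
Proof.
move=> T0 sP tT; have [c c0 Pc] := stl_bounded T0 sP; have [_ pP _] := sP.
apply: (@L1_bounded _ _ _ c) => //; first exact: pP.
  by apply: tmeas_slice tT; exact: stl_tmeas sP.
by move=> x; exact: Pc.
Qed.

Lemma stl_lip T L Phi t : stl T L Phi -> t \in `[0, T] -> forall x y, `|Phi t x - Phi t y| <= L * `|x - y|.
Proof. by move=> [L0 _ PL] tT x y; have := PL t t x y tT tT; rewrite subrr normr0 add0r. Qed.

(* Everywhere defined, measurable, bounded versions of the partial derivatives;
   clipping keeps the difference quotients in time inside [0, T]. *)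
Definition dt_ T L Phi s x := clsup L (dq (fun t => Phi (clip T t) x) 1 s).
Definition dx_ L Phi j s x := clsup L (dq (Phi s) (evec j) x).

Lemma dq_time_bound T L Phi s x n : 0 < T -> stl T L Phi ->
  `|dq (fun t => Phi (clip T t) x) 1 s n| <= L.
Proof.
move=> T0 [L0 _ PL]; rewrite /dq /GRing.scale /= mulr1 normrM ger0_norm// -ler_pdivlMl ?ltr0n//.
apply: (le_trans (PL _ _ _ _ (clip_in _ (ltW T0)) (clip_in _ (ltW T0)))).
rewrite subrr normr0 addr0 mulrC ler_wpM2r//; apply: (le_trans (clip_lip _ _ _)).
by rewrite addrC addKr ger0_norm ?invr_ge0.
Qed.

Lemma dq_space_bound T L Phi j s x n : s \in `[0, T] -> stl T L Phi ->
  `|dq (Phi s) (evec j) x n| <= L.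
Proof.
move=> sT sP; rewrite /dq /GRing.scale /= normrM ger0_norm// -ler_pdivlMl ?ltr0n//.
apply: (le_trans (stl_lip sP sT _ _)).
by rewrite addrC addKr normrZ norm_evec mulr1 ger0_norm ?invr_ge0// mulrC.
Qed.

Lemma dt_tmeas T L Phi : 0 < T -> stl T L Phi -> tmeas T (dt_ T L Phi).
Proof.
move=> T0 sP; apply: measurable_funTS; apply: measurable_clsup => n.
apply: measurable_funM; first exact: measurable_cst.
have cP := stl_clip_continuous T0 sP.
apply: (@measurable_continuous _ _ (fun z => Phi (clip T (z.1 + n.+1%:R^-1 *: 1)) z.2 - Phi (clip T z.1) z.2)).
move=> z; apply: cvgB; last exact: cP.
apply: (@continuous_comp _ _ _ (fun z : R * vec => (z.1 + n.+1%:R^-1 *: (1 : R), z.2)) (fun z => Phi (clip T z.1) z.2)); last exact: cP.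
apply: (@lipschitz_bound_continuous _ _ _ _ 1) => a b.
by rewrite mul1r !prod_normE /= opprD addrACA subrr addr0.
Qed.

Lemma dx_tmeas T L Phi j : 0 < T -> stl T L Phi -> tmeas T (dx_ L Phi j).
Proof.
move=> T0 sP.
apply: (@eq_measurable_fun _ _ _ _ _ (fun z : measurableTypeR R * cell =>
   clsup L (dq (Phi (clip T z.1)) (evec j) (pt z.2)))).
  by move=> z; rewrite inE/= => -[zT _]; rewrite clip_id.
apply: measurable_funTS; apply: measurable_clsup => n.
apply: measurable_funM; first exact: measurable_cst.
have cP := stl_clip_continuous T0 sP.
apply: (@measurable_continuous _ _ (fun z => Phi (clip T z.1) (z.2 + n.+1%:R^-1 *: evec j) - Phi (clip T z.1) z.2)).
move=> z; apply: cvgB; last exact: cP.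
apply: (@continuous_comp _ _ _ (fun z : R * vec => (z.1, z.2 + n.+1%:R^-1 *: evec j)) (fun z => Phi (clip T z.1) z.2)); last exact: cP.
apply: (@lipschitz_bound_continuous _ _ _ _ 1) => a b.
by rewrite mul1r !prod_normE /= opprD addrACA subrr addr0.
Qed.

Lemma dx_periodic T L Phi j s : stl T L Phi -> s \in `[0, T] -> tperiodic (dx_ L Phi j s).
Proof.
move=> [_ pP _] sT i x; rewrite /dx_; congr clsup; apply/funext => n.
by rewrite /dq addrAC !pP.
Qed.

Lemma dx_L1 T L Phi j s : 0 < T -> stl T L Phi -> s \in `[0, T] -> L1 (dx_ L Phi j s).
Proof.
move=> T0 sP sT; apply: (@L1_bounded _ _ _ L); first exact: dx_periodic sP sT.
  exact: tmeas_slice (dx_tmeas j T0 sP) sT.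
by move=> x; apply: clsup_bound; case: sP.
Qed.

(** [dt] and [dx] are pointwise limits in whatever form the chain rule produces them; [dt_] and
    [dx_] supply the measurable versions. *)
Definition aediff T Phi (dt : R -> vec -> R) (dx : 'I_d -> R -> vec -> R) :=
  {ae (leb \x mu)%E, forall z : measurableTypeR R * cell, z.1 \in `]0, T[ ->
    (dq (fun t => Phi t (pt z.2)) 1 z.1 @ \oo --> dt z.1 (pt z.2)) /\
    forall j, dq (Phi z.1) (evec j) (pt z.2) @ \oo --> dx j z.1 (pt z.2)}.

Lemma dq_clip_cvg T (f : R -> R) (s l : R) : s \in `]0, T[ -> dq f (1 : R) s @ \oo --> l ->
  dq (f \o clip T) (1 : R) s @ \oo --> l.
Proof.
rewrite in_itv/= => /andP[s0 sT] fl.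
apply: cvg_trans fl; apply: near_eq_cvg.
have := @cvg_harmonic R => /cvgrPdist_lt /(_ (T - s)); rewrite subr_gt0 => /(_ sT).
apply: filterS => n /=; rewrite sub0r normrN ger0_norm ?invr_ge0// => ns.
have e1 : clip T s = s by rewrite clip_id// in_itv/= !ltW.
have e2 : clip T (s + n.+1%:R^-1) = s + n.+1%:R^-1.
  by rewrite clip_id// in_itv/= addr_ge0 ?invr_ge0 ?(ltW s0)//= addrC -lerBrDr ltW.
by rewrite /dq /GRing.scale /= mulr1 e1 e2.
Qed.

Lemma aediff_dt T L Phi dt dx : 0 < T -> stl T L Phi -> aediff T Phi dt dx ->
  {ae (leb \x mu)%E, forall z : measurableTypeR R * cell, z.1 \in `]0, T[ ->
    dt_ T L Phi z.1 (pt z.2) = dt z.1 (pt z.2) /\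
    forall j, dx_ L Phi j z.1 (pt z.2) = dx j z.1 (pt z.2)}.
Proof.
move=> T0 sP; apply: filterS => z H zT; have [H1 H2] := H zT; split => [|j].
  apply: clsup_cvg => [n|]; first exact: dq_time_bound sP.
  exact: (dq_clip_cvg zT H1).
apply: clsup_cvg => [n|]; last exact: H2.
by apply: dq_space_bound sP; exact: subset_itv_oo_cc zT.
Qed.

End space_time.

Lemma lipschitz_bound (R : realType) (V W : normedModType R) (f : V -> W) (A : set V) :
  [lipschitz f x | x in A] ->
  exists2 k : R, 0 <= k & forall x y, A x -> A y -> `|f x - f y| <= k * `|x - y|.
Proof.
move=> [M [Mr H]]; exists (Num.max 0 (M + 1)); first by rewrite le_max lexx.
have MM : M < Num.max 0 (M + 1) by rewrite lt_max ltrDl ltr01 orbT.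
by move=> x y Ax Ay; have := H _ MM (x, y); apply; split.
Qed.

Lemma bound_lipschitz (R : realType) (f : R -> R) (A : set R) (k : R) :
  (forall x y, A x -> A y -> `|f x - f y| <= k * `|x - y|) -> [lipschitz f x | x in A].
Proof.
move=> H; exists k; split; first exact: num_real.
move=> M kM [x y] [/= Ax Ay]; apply: (le_trans (H _ _ Ax Ay)).
by rewrite ler_wpM2r// ltW.
Qed.

(** * Evolution of trigonometric moments *)

Section weak_evolution.
Context {R : realType} {d : nat}.
Local Notation vec := 'rV[R]_d.
Local Notation cell := (d.-tuple (measurableTypeR R)).
Local Notation mu := (torus R d).
Local Notation leb := (@lebesgue_measure R).
Local Notation tperiodic := Defs.periodic.
Local Notation conv := Defs.conv.
Implicit Types (T L c : R) (k : vec -> R) (f g Phi h : R -> vec -> R) (F : R -> (vec -> R) -> R).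

(** Dominated convergence in the integrated identity. It is the device by which the mollification is
    removed, at the end, from functions of time. *)
Lemma prim_limit T (f_ b_ : nat -> R -> R) (f b : R -> R) (c : R) : 0 <= c ->
  (forall n, prim T (f_ n) (b_ n)) ->
  (forall n s, s \in `[0, T] -> `|b_ n s| <= c) ->
  (forall t, t \in `[0, T] -> f_ ^~ t @ \oo --> f t) ->
  {ae leb, forall s, s \in `]0, T[ -> b_ ^~ s @ \oo --> b s} ->
  measurable_fun `[0, T] b -> (forall s, s \in `[0, T] -> `|b s| <= c) -> prim T f b.
Proof.
move=> c0 pn bnc fn bn mb bc; split => //; first by exists c.
move=> t tT; move: (tT); rewrite in_itv/= => /andP[t0 tT'].
have sub : `[0, t] `<=` `[0, T] by apply: subset_itvl.
have o0 : 0 \in `[0, T] by rewrite in_itv/= lexx (le_trans t0).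
have cv1 : (fun n => f_ n t - f_ n 0) @ \oo --> f t - f 0.
  by apply: cvgB; exact: fn.
have cv2 : (fun n => f_ n t - f_ n 0) @ \oo --> \int[leb]_(s in `[0, t]) b s.
  have E n : f_ n t - f_ n 0 = \int[leb]_(s in `[0, t]) b_ n s.
    by have [_ _ H] := pn n; rewrite (H t)// addrC addKr.
  rewrite (eq_cvg _ _ E).
  apply: (@Rdominated_convergenceD _ _ _ leb `[0, t] b_ b c) => //.
  - by rewrite /= lebesgue_measure_itv; case: ifP => _ //; rewrite -EFinD ltry.
  - by move=> n; have [mbn _ _] := pn n; apply: measurable_funS mbn.
  - by move=> n s /sub sT; exact: bnc.
  - have aeF := ae_filter_ringOfSetsType leb.
    apply: filterS3 bn (ae_neq 0) (ae_neq T) => s bs s0 sT /= ; rewrite in_itv/= => /andP[s0' st].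
    by apply: bs; rewrite in_itv/= lt_neqAle eq_sym s0 s0' /= lt_neqAle sT (le_trans st).
have : f t - f 0 = \int[leb]_(s in `[0, t]) b s by apply: cvg_unique cv1 cv2; exact: Rhausdorff.
by move=> <-; rewrite addrC subrK.
Qed.

(* The trigonometric moments of f are absolutely continuous in time, with rate F
   linear in the test function. *)
Definition wevol T f F := [/\ forall t, t \in `[0, T] -> L1 (f t),
  forall k, tp k -> prim T (fun t => tint (fun x => k x * f t x)) (fun s => F s k) &
  forall s, s \in `[0, T] -> forall (I : finType) (c : I -> R) (a : I -> vec -> R),
    (forall l, tp (a l)) -> F s (fun x => \sum_l c l * a l x) = \sum_l c l * F s (a l)].

(** With [k (x - y)] a finite sum of products, the pairing is a finite sum of products of moments,
    to which [primM] applies term by term. The reflected kernel in the second term is the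
    adjoint. *)
Lemma wevol_pairing T f g F E k : 0 < T -> wevol T f F -> wevol T g E -> tp k ->
  prim T (fun t => tint (fun x => conv k (g t) x * f t x))
         (fun s => F s (conv k (g s)) + E s (conv (fun z => k (- z)) (f s))).
Proof.
move=> T0 [Lf pf lf] [Lg pg lg] tk; have [I [a [b [ta tb kE kC]]]] := tp_convE tk.
have iM (q : vec -> R) (u : vec -> R) : tp q -> L1 u -> tintegrable (fun x => q x * u x).
  move=> tq Lu; have [c _ qc] := tp_bounded tq; exact: tintegrableM Lu.2 (tp_measurable tq) qc.
apply: (@eq_prim _ T (fun t => \sum_l tint (fun y => b l y * g t y) * tint (fun x => a l x * f t x)) _
  (fun s => \sum_l (tint (fun y => b l y * g s y) * F s (a l) + tint (fun x => a l x * f s x) * E s (b l)))).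
- by apply: prim_sum => l; apply: primM => //; [exact: pg|exact: pf].
- move=> s sT; rewrite [RHS](@eq_tint _ _ _ (fun x => \sum_l tint (fun y => b l y * g s y) * (a l x * f s x))).
    rewrite tint_sum => [|l]; last by apply: tintegrableZ; apply: iM => //; exact: Lf.
    by apply: eq_bigr => l _; rewrite tintZ//; apply: iM => //; exact: Lf.
  by move=> x; rewrite kC ?mulr_suml; [apply: eq_bigr => l _; rewrite mulrA|exact: Lg].
- move=> s sT; rewrite big_split /=; congr (_ + _).
    rewrite -lf//; congr (F s _); apply/funext => x; rewrite kC//; exact: Lg.
  rewrite -lg//; congr (E s _); apply/funext => y; rewrite /Defs.conv.
  rewrite [RHS](@eq_tint _ _ _ (fun x => \sum_l b l y * (a l x * f s x))).
    rewrite tint_sum => [|l]; last by apply: tintegrableZ; apply: iM => //; exact: Lf.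
    by apply: eq_bigr => l _; rewrite tintZ 1?mulrC//; apply: iM => //; exact: Lf.
  by move=> x; rewrite opprB kE mulr_suml; apply: eq_bigr => l _; ring.
Qed.

Lemma stl_ae_cvg T L Phi dt dx : 0 < T -> stl T L Phi -> aediff T Phi dt dx ->
  {ae leb, forall s, s \in `]0, T[ -> {ae mu, forall y : cell,
     [/\ dq (fun t => Phi (clip T t) (pt y)) 1 s @ \oo --> dt_ T L Phi s (pt y),
      forall j, dq (Phi s) (evec j) (pt y) @ \oo --> dx_ L Phi j s (pt y),
      dt_ T L Phi s (pt y) = dt s (pt y) & forall j, dx_ L Phi j s (pt y) = dx j s (pt y)]}}.
Proof.
move=> T0 sP aP.
have H : {ae (leb \x mu)%E, forall z : measurableTypeR R * cell, z.1 \in `]0, T[ ->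
   [/\ dq (fun t => Phi (clip T t) (pt z.2)) 1 z.1 @ \oo --> dt_ T L Phi z.1 (pt z.2),
      forall j, dq (Phi z.1) (evec j) (pt z.2) @ \oo --> dx_ L Phi j z.1 (pt z.2),
      dt_ T L Phi z.1 (pt z.2) = dt z.1 (pt z.2) & forall j, dx_ L Phi j z.1 (pt z.2) = dx j z.1 (pt z.2)]}.
  apply: filterS2 aP (aediff_dt T0 sP aP) => z H1 H2 zT.
  have [h1 h2] := H1 zT; have [e1 e2] := H2 zT; split => //.
  - by rewrite e1; exact: (dq_clip_cvg zT h1).
  - by move=> j; rewrite e2.
move: (ae_prod_slice H); apply: filterS.
by move=> s Hs sT; apply: filterS Hs => y; exact.
Qed.

(** A Lipschitz test field is treated on the same footing as a density: its moments evolve with rate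
    [dt_], by dominated convergence of the quotients in time. *)
Lemma wevol_stl T L Phi dt dx : 0 < T -> stl T L Phi -> aediff T Phi dt dx ->
  wevol T Phi (fun s k => tint (fun x => k x * dt_ T L Phi s x)).
Proof.
move=> T0 sP aP; have [L0 _ PL] := sP.
have mdt s : s \in `[0, T] -> tmeasurable (dt_ T L Phi s) by move=> sT; exact: tmeas_slice (dt_tmeas T0 sP) sT.
have dtL s x : `|dt_ T L Phi s x| <= L by exact: clsup_bound.
have iM (q : vec -> R) s : tp q -> s \in `[0, T] -> tintegrable (fun x => q x * dt_ T L Phi s x).
  move=> tq sT; have [c c0 qc] := tp_bounded tq; apply: (@tintegrable_bdd _ _ _ (c * L)).
    by apply: tmeasurableM; [exact: tp_measurable|exact: mdt].
  by move=> x; rewrite normrM ler_pM.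
split.
- by move=> t tT; exact: stl_L1 sP tT.
- move=> k tk; have [c c0 kc] := tp_bounded tk.
  have iP s : tintegrable (fun x => k x * Phi (clip T s) x).
    have [c' c'0 Pc] := stl_bounded T0 sP; apply: (@tintegrable_bdd _ _ _ (c * c')).
      apply: tmeasurableM; first exact: tp_measurable.
      by apply: tmeas_slice (clip_in s (ltW T0)); exact: stl_tmeas sP.
    by move=> x; rewrite normrM ler_pM// Pc// clip_in// ltW.
  split.
  + apply: (@measurable_tint_slice _ _ _ (fun s x => k x * dt_ T L Phi s x)).
    by apply: tmeasM; [apply: tmeas_static; exact: tp_measurable|exact: dt_tmeas].
  + exists (c * L); first exact: mulr_ge0.
    move=> s sT; rewrite -[leRHS](@tint_cst _ d); apply: norm_tint_le; [exact: iM|exact: tintegrable_cst|].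
    by move=> x; rewrite normrM ler_pM.
  + move=> t tT.
    pose g s := tint (fun x => k x * Phi (clip T s) x).
    have gl : lip T g (c * L).
      move=> s u sT uT; rewrite /g -tintB// -[leRHS](@tint_cst _ d).
      apply: norm_tint_le; [exact: tintegrableB|exact: tintegrable_cst|].
      move=> x; rewrite -mulrBr normrM -mulrA ler_pM//.
      apply: (le_trans (PL _ _ _ _ (clip_in _ (ltW T0)) (clip_in _ (ltW T0)))).
      by rewrite subrr normr0 addr0 ler_wpM2l// clip_lip.
    have gE s : s \in `[0, T] -> tint (fun x => k x * Phi s x) = g s by move=> sT; rewrite /g clip_id.
    have o0 : 0 \in `[0, T] by rewrite in_itv/= lexx ltW.
    rewrite (gE t)// (gE 0)//.
    apply: (lip_FTC T0 _ gl) tT; first exact: mulr_ge0.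
    apply: filterS (stl_ae_cvg T0 sP aP); first exact: (ae_filter_ringOfSetsType leb).
    move=> s Hs sT; have E n : dq g 1 s n = tint (fun x => k x * dq (fun t => Phi (clip T t) x) 1 s n).
      rewrite /dq /GRing.scale /= /g -tintB// -tintZ; last exact: tintegrableB.
      by apply: eq_tint => x; rewrite /GRing.scale /=; ring.
    rewrite (eq_cvg _ _ E).
    apply: (@Rdominated_convergenceT _ _ _ mu (fun n y => k (pt y) * dq (fun t => Phi (clip T t) (pt y)) 1 s n) _ (c * L)).
    * exact: mulr_ge0.
    * move=> n; apply: measurable_funM (tp_measurable tk) _; apply: measurable_funM; first exact: measurable_cst.
      by apply: measurable_funB; apply: tmeas_slice (stl_tmeas T0 sP) (clip_in _ (ltW T0)).
    * by move=> n y; rewrite normrM ler_pM// (dq_time_bound _ _ _ T0 sP).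
    * by apply: filterS (Hs sT) => y [h _ _ _]; apply: cvgM => //; exact: cvg_cst.
- move=> s sT I c a ta; rewrite (@eq_tint _ _ _ (fun x => \sum_l c l * (a l x * dt_ T L Phi s x))).
    rewrite tint_sum => [|l]; last by apply: tintegrableZ; exact: iM.
    by apply: eq_bigr => l _; rewrite tintZ//; exact: iM.
  by move=> x; rewrite mulr_suml; apply: eq_bigr => l _; rewrite mulrA.
Qed.

End weak_evolution.

(** * The relativistic kinetic energy *)

Section directional.
Context {R : realType}.

Lemma is_derive_line (V : normedModType R) (f : V -> R) x v df :
  is_derive x v f df <-> is_derive (0 : R) 1 (fun h : R => f (h *: v + x)) df.
Proof.
have E : (fun h : R => h^-1 *: (((fun h : R => f (h *: v + x)) \o shift 0) (h *: 1) - f (0 *: v + x))) =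
         (fun h : R => h^-1 *: ((f \o shift x) (h *: v) - f x)).
  by apply/funext => h /=; rewrite addr0 scale0r add0r /GRing.scale /= mulr1.
split => -[d1 d2].
- by apply: DeriveDef; rewrite /derivable /derive E.
- by apply: DeriveDef; rewrite /derivable /derive -E.
Qed.

Lemma is_derive_comp_dir (V : normedModType R) (f : V -> R) (g : R -> R) x v (df dg : R) :
  is_derive x v f df -> is_derive (f x) 1 g dg -> is_derive x v (fun y => g (f y)) (dg * df).
Proof.
move=> /is_derive_line hf hg; apply/is_derive_line.
have hg' : is_derive ((fun h : R => f (h *: v + x)) 0) 1 g dg by rewrite scale0r add0r.
exact: (@is_derive1_comp R g (fun h : R => f (h *: v + x)) 0 _ _ hg' hf).
Qed.

Lemma is_derive_cst_dir (V : normedModType R) (c : R) (x v : V) : is_derive x v (fun=> c) (0 : R).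
Proof. by apply/is_derive_line; exact: is_derive_cstR. Qed.

Lemma is_derive_sum_fun (V : normedModType R) (I : Type) (s : seq I) (f : I -> V -> R) x v (df : I -> R) :
  (forall i, is_derive x v (f i) (df i)) ->
  is_derive x v (fun y => \sum_(i <- s) f i y) (\sum_(i <- s) df i).
Proof.
move=> H; elim: s => [|i s IH].
  under eq_fun do rewrite big_nil; rewrite big_nil; exact: is_derive_cst_dir.
under eq_fun do rewrite big_cons; rewrite big_cons; exact: is_deriveD_fun.
Qed.

Lemma is_derive_eq (V : normedModType R) (f g : V -> R) x v df dg :
  is_derive x v f df -> f =1 g -> df = dg -> is_derive x v g dg.
Proof. by move=> h /funext <- <-. Qed.

End directional.

Section kinematics.
Context {R : realType} {d : nat}.
Local Notation vec := 'rV[R]_d.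
Local Notation eta := Defs.eta.
Implicit Types (u w P Q p q : vec).

Lemma vecBE u w i : (u - w) 0 i = u 0 i - w 0 i. Proof. by rewrite !mxE. Qed.
Lemma vecDE u w i : (u + w) 0 i = u 0 i + w 0 i. Proof. by rewrite !mxE. Qed.
Lemma vecZE c u i : (c *: u) 0 i = c * u 0 i. Proof. by rewrite !mxE. Qed.

Lemma dotvC u w : dotv u w = dotv w u.
Proof. by apply: eq_bigr => i _; rewrite mulrC. Qed.

Lemma dotvDr u w q : dotv u (w + q) = dotv u w + dotv u q.
Proof. by rewrite /dotv -big_split; apply: eq_bigr => i _; rewrite mxE mulrDr. Qed.

Lemma dotvZr u c w : dotv u (c *: w) = c * dotv u w.
Proof. by rewrite /dotv mulr_sumr; apply: eq_bigr => i _; rewrite mxE mulrCA. Qed.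

Lemma dotvNr u w : dotv u (- w) = - dotv u w.
Proof. by rewrite -scaleN1r dotvZr mulN1r. Qed.

Lemma dotvBr u w q : dotv u (w - q) = dotv u w - dotv u q.
Proof. by rewrite dotvDr dotvNr. Qed.

Lemma dotvDl u w q : dotv (u + w) q = dotv u q + dotv w q.
Proof. by rewrite dotvC dotvDr !(dotvC q). Qed.

Lemma dotvBl u w q : dotv (u - w) q = dotv u q - dotv w q.
Proof. by rewrite dotvC dotvBr !(dotvC q). Qed.

Lemma dotvZl c u w : dotv (c *: u) w = c * dotv u w.
Proof. by rewrite dotvC dotvZr dotvC. Qed.

Lemma dotvNl u w : dotv (- u) w = - dotv u w.
Proof. by rewrite dotvC dotvNr dotvC. Qed.

Lemma dotv_ge0 u : 0 <= dotv u u.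
Proof. by apply: sumr_ge0 => i _; rewrite -expr2 sqr_ge0. Qed.

Lemma sqr_coord_le u i : u 0 i ^+ 2 <= dotv u u.
Proof.
rewrite /dotv (bigD1 i)//= expr2 lerDl; apply: sumr_ge0 => j _.
by rewrite -expr2 sqr_ge0.
Qed.

Lemma dotv_CS u w : dotv u w ^+ 2 <= dotv u u * dotv w w.
Proof.
set a := dotv u u; set b := dotv u w; set c := dotv w w.
have c0 : 0 <= c by exact: dotv_ge0.
have := dotv_ge0 (c *: u - b *: w).
rewrite !(dotvBl, dotvBr, dotvZl, dotvZr) -/a -/c (dotvC w u) -/b => H.
have [c_gt0|] := ltP 0 c; first by nra.
move=> c_le0; have c_eq0 : c = 0 by apply/eqP; rewrite eq_le c_le0 c0.
have w0 i : w 0 i = 0.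
  have := sqr_coord_le w i; rewrite -/c c_eq0 => H'.
  by apply/eqP; rewrite -sqrf_eq0 eq_le H' sqr_ge0.
have -> : b = 0 by rewrite /b /dotv big1// => i _; rewrite w0 mulr0.
by rewrite c_eq0 mulr0 expr0n.
Qed.

Lemma kinetic_sqr P : kinetic P ^+ 2 = 1 + dotv P P.
Proof. by rewrite /kinetic sqr_sqrtr// addr_ge0// dotv_ge0. Qed.

Lemma kinetic_ge1 P : 1 <= kinetic P.
Proof. by rewrite -[leLHS]sqrtr1 /kinetic ler_wsqrtr// lerDl dotv_ge0. Qed.

Lemma kinetic_gt0 P : 0 < kinetic P.
Proof. exact: lt_le_trans (kinetic_ge1 P). Qed.

Lemma velE P i : vel P 0 i = P 0 i / kinetic P.
Proof. by rewrite /vel mxE mulrC. Qed.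

Lemma vel_coord_le P i : `|vel P 0 i| <= 1.
Proof.
rewrite velE normrM normfV (ger0_norm (ltW (kinetic_gt0 P))) ler_pdivrMr ?kinetic_gt0// mul1r.
rewrite -(@ler_pXn2r _ 2)// ?nnegrE//; last exact/ltW/kinetic_gt0.
by rewrite kinetic_sqr real_normK ?num_real//; have := sqr_coord_le P i; lra.
Qed.

(** Cauchy-Schwarz for the vectors [(1, P)] and [(1, Q)], whose lengths are the kinetic energies.
    Through [etaE] it is the sign of [eta]. *)
Lemma dotv_kinetic_le P Q : 1 + dotv P Q <= kinetic P * kinetic Q.
Proof.
have g0 := kinetic_gt0 P; have g1 := kinetic_gt0 Q.
have [s0|s0] := lerP (1 + dotv P Q) 0; first by rewrite (le_trans s0)// mulr_ge0 ?ltW.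
rewrite -(@ler_pXn2r _ 2)// ?nnegrE; [|exact: ltW|by rewrite mulr_ge0 ?(ltW g0) ?(ltW g1)].
rewrite exprMn !kinetic_sqr; have CS := dotv_CS P Q.
have := dotv_ge0 (P - Q); rewrite !(dotvBl, dotvBr) (dotvC Q P); nra.
Qed.

(** Reverse triangle inequality for the lengths of [(1, P)] and [(1, Q)]. *)
Lemma sqr_kineticB_le P Q : (kinetic P - kinetic Q) ^+ 2 <= dotv (P - Q) (P - Q).
Proof.
have := dotv_kinetic_le P Q; have := kinetic_sqr P; have := kinetic_sqr Q.
rewrite !(dotvBl, dotvBr) (dotvC Q P); nra.
Qed.

(** [|u|] is the maximum norm of row vectors, while [dotv] is Euclidean; hence the factor [d] here
    and in the Lipschitz constants below. *)
Lemma dotv_norm_le u w : `|dotv u w| <= d%:R * (`|u| * `|w|).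
Proof.
apply: (le_trans (ler_norm_sum _ _ _)).
apply: (@le_trans _ _ (\sum_(i < d) `|u| * `|w|)).
  by apply: ler_sum => i _; rewrite normrM ler_pM// norm_coord_le.
by rewrite sumr_const card_ord mulr_natl.
Qed.

Lemma kinetic_lip P Q : `|kinetic P - kinetic Q| <= d%:R * `|P - Q|.
Proof.
rewrite -(@ler_pXn2r _ 2)// ?nnegrE ?mulr_ge0//.
rewrite real_normK ?num_real//; apply: (le_trans (sqr_kineticB_le _ _)).
apply: (le_trans (ler_norm _)); apply: (le_trans (dotv_norm_le _ _)).
rewrite exprMn -expr2 ler_wpM2r ?sqr_ge0//.
by rewrite -natrX ler_nat; case: (d) => // n; rewrite expnS expn1 leq_pmulr.
Qed.

Lemma ikinetic_lip P Q : `|(kinetic P)^-1 - (kinetic Q)^-1| <= d%:R * `|P - Q|.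
Proof.
have g0 := kinetic_gt0 P; have g1 := kinetic_gt0 Q.
have -> : (kinetic P)^-1 - (kinetic Q)^-1 = (kinetic Q - kinetic P) / (kinetic P * kinetic Q).
  by field; rewrite !gt_eqF.
rewrite normrM distrC; apply: (le_trans _ (kinetic_lip P Q)).
rewrite ler_piMr// normfV invf_le1 ?normr_gt0 ?mulf_neq0 ?gt_eqF//.
by rewrite ger0_norm ?mulr_ge0 ?(ltW g0) ?(ltW g1)// -[leLHS]mulr1 ler_pM// kinetic_ge1.
Qed.

Lemma vel_coord_lip P Q i : `|vel P 0 i - vel Q 0 i| <= (1 + d%:R) * `|P - Q|.
Proof.
have g0 := kinetic_gt0 P; have g1 := kinetic_gt0 Q.
have -> : vel P 0 i - vel Q 0 i = (P - Q) 0 i / kinetic P + vel Q 0 i * ((kinetic Q - kinetic P) / kinetic P).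
  by rewrite !velE !vecBE; field; rewrite !gt_eqF.
have iP : `|(kinetic P)^-1| <= 1.
  by rewrite ger0_norm ?invr_ge0 ?(ltW g0)// invf_le1// kinetic_ge1.
apply: (le_trans (ler_normD _ _)); rewrite [leRHS]mulrDl mul1r; apply: lerD.
  by rewrite normrM -[leRHS]mulr1 ler_pM// norm_coord_le.
rewrite normrM -[leRHS]mul1r ler_pM ?vel_coord_le//.
by rewrite normrM -[leRHS]mulr1 ler_pM// distrC kinetic_lip.
Qed.

Lemma is_derive_kinetic (V : normedModType R) (f : V -> vec) x v (a : vec) :
  (forall i, is_derive x v (fun y => f y 0 i) (a 0 i)) ->
  is_derive x v (fun y => kinetic (f y)) (dotv (vel (f x)) a).
Proof.
move=> fa.
have h1 : is_derive x v (fun y => 1 + dotv (f y) (f y)) (\sum_i (f x 0 i * a 0 i + f x 0 i * a 0 i)).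
  have h2 : is_derive x v (fun y => dotv (f y) (f y)) (\sum_i (f x 0 i * a 0 i + f x 0 i * a 0 i)).
    by apply: is_derive_sum_fun => i; apply: is_deriveM_fun.
  rewrite -[X in is_derive _ _ _ X]add0r; exact: is_deriveD_fun (is_derive_cst_dir _ _ _) h2.
have p0 : 0 < 1 + dotv (f x) (f x) by rewrite ltr_wpDr// dotv_ge0.
have h3 := is_derive_comp_dir h1 (is_derive1_sqrt p0).
apply: is_derive_eq h3 _ _ => //; rewrite -/(kinetic (f x)) /dotv !mulr_sumr.
apply: eq_bigr => i _; rewrite velE; field.
by rewrite gt_eqF// kinetic_gt0.
Qed.

Lemma is_derive_ikinetic (V : normedModType R) (f : V -> vec) x v (a : vec) :
  (forall i, is_derive x v (fun y => f y 0 i) (a 0 i)) ->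
  is_derive x v (fun y => (kinetic (f y))^-1) (- dotv (f x) a / kinetic (f x) ^+ 3).
Proof.
move=> fa; have g0 := kinetic_gt0 (f x); have g1 : kinetic (f x) != 0 by rewrite gt_eqF.
have h := is_derive_kinetic fa.
have hi : is_derive (kinetic (f x)) 1 (fun y : R => y^-1) (- (kinetic (f x)) ^- 2).
  have := @is_deriveV R id (kinetic (f x)) 1 1 g1 (is_derive_id (kinetic (f x)) (1 : R)).
  by move=> H; apply: is_derive_eq H _ _ => //; rewrite /GRing.scale /= mulr1.
have h3 := is_derive_comp_dir h hi.
apply: is_derive_eq h3 _ _ => //.
rewrite (_ : vel (f x) = (kinetic (f x))^-1 *: f x)// dotvZl; field.
exact: g1.
Qed.

(* The Hessian of the kinetic energy at p, applied to b. *)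
Definition Hv p (b : vec) : vec := (kinetic p)^-1 *: b - (dotv p b / kinetic p ^+ 3) *: p.

Lemma is_derive_vel (V : normedModType R) (f : V -> vec) x v (a : vec) j :
  (forall i, is_derive x v (fun y => f y 0 i) (a 0 i)) ->
  is_derive x v (fun y => vel (f y) 0 j) (Hv (f x) a 0 j).
Proof.
move=> fa; have h := is_deriveM_fun (fa j) (is_derive_ikinetic fa).
apply: is_derive_eq h _ _ => [y|]; first by rewrite velE.
by rewrite vecBE !vecZE; ring.
Qed.

Lemma dotv_evec u i : dotv u (evec i) = u 0 i.
Proof.
rewrite /dotv (bigD1 i)//= big1 => [|j /negPf ji]; first by rewrite mxE !eqxx mulr1 addr0.
by rewrite mxE ji andbF mulr0.
Qed.

Lemma grad_kinetic P : grad kinetic P = vel P.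
Proof.
apply/rowP => i; rewrite mxE /partial.
have := @is_derive_kinetic vec id P (evec i) (evec i) (fun j => is_derive_coord j P (evec i)).
by move=> [_ ->]; rewrite dotv_evec.
Qed.

Lemma mul_hessian_kinetic P u : u *m hessian kinetic P = Hv P u.
Proof.
apply/rowP => j; rewrite mxE.
transitivity (\sum_i u 0 i * Hv P (evec i) 0 j).
  apply: eq_bigr => i _; congr (_ * _); rewrite mxE /partial.
  rewrite (_ : (fun x => 'D_(evec j) kinetic x) = fun x => vel x 0 j); last first.
    by apply/funext => x; rewrite -grad_kinetic mxE.
  by have [_ ->] := @is_derive_vel vec id P (evec i) (evec i) j (fun k => is_derive_coord k P (evec i)).
rewrite /Hv !mxE.
have -> : dotv P u = \sum_i u 0 i * dotv P (evec i).
  by apply: eq_bigr => i _; rewrite dotv_evec mulrC.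
have -> : u 0 j = \sum_i u 0 i * (evec i : vec) 0 j.
  rewrite (bigD1 j)//= big1 => [|k /negPf kj]; first by rewrite mxE !eqxx mulr1 addr0.
  by rewrite mxE eq_sym kj andbF mulr0.
rewrite !mulr_suml mulr_sumr -sumrB; apply: eq_bigr => i _.
by rewrite !mxE; ring.
Qed.

Lemma etaE P p : eta P p = kinetic P - (1 + dotv P p) / kinetic p.
Proof.
rewrite /eta grad_kinetic dotvBr (_ : vel p = (kinetic p)^-1 *: p)// !dotvZl (dotvC p P).
have := kinetic_sqr p; have g0 := kinetic_gt0 p => e.
have -> : dotv p p = kinetic p ^+ 2 - 1 by rewrite e addrC addKr.
by field; rewrite gt_eqF.
Qed.

Lemma eta_ge0 P p : 0 <= eta P p.
Proof. by rewrite etaE subr_ge0 ler_pdivrMr ?kinetic_gt0// dotv_kinetic_le. Qed.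

Lemma kinetic_eta P p : dotv P p = kinetic P * kinetic p - 1 - kinetic p * eta P p.
Proof. by rewrite etaE; field; rewrite gt_eqF// kinetic_gt0. Qed.

(** Write [G], [g] for the energies and [X = g * eta P p]. Cauchy-Schwarz for [P] and [p] reads
    [(G - g)^2 <= X (2 (G g - 1) - X)], while the squared distance is [(G - g)^2 + 2 X]. The factor
    [kinetic P] reflects the linear growth of [eta]. *)
Lemma sqr_dist_eta P p : dotv (P - p) (P - p) <= 2 * kinetic p ^+ 2 * kinetic P * eta P p.
Proof.
have sE := kinetic_eta P p; have CS := dotv_CS P p; have eP := kinetic_sqr P; have ep := kinetic_sqr p.
have e0 := eta_ge0 P p; have g1 := kinetic_ge1 p; have G1 := kinetic_ge1 P.
have Gg : 1 <= kinetic P * kinetic p by rewrite -[leLHS]mulr1 ler_pM.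
rewrite !(dotvBl, dotvBr) (dotvC p P).
have ePP : dotv P P = kinetic P ^+ 2 - 1 by rewrite eP addrC addKr.
have epp : dotv p p = kinetic p ^+ 2 - 1 by rewrite ep addrC addKr.
rewrite ePP epp in CS *.
set s := dotv P p in sE CS *; set G := kinetic P in sE CS G1 Gg ePP eP *; set g := kinetic p in sE CS Gg g1 epp ep *.
set X := g * eta P p.
have X0 : 0 <= X by rewrite mulr_ge0//; exact/ltW/kinetic_gt0.
have sX : s = G * g - 1 - X by exact: sE.
have -> : 2 * g ^+ 2 * G * eta P p = 2 * (G * g) * X by rewrite /X; ring.
have H : (G - g) ^+ 2 <= X * (2 * (G * g - 1) - X).
  by move: CS; rewrite sX; nra.
by rewrite sX; nra.
Qed.

(** [kinetic P] times the difference of velocities is [P - p] plus a multiple of [p] of length at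
    most [|kinetic P - kinetic p|], hence at most the distance. The gain is the division by
    [kinetic P ^+ 2]. *)
Lemma sqr_velB_le P p : dotv (vel P - vel p) (vel P - vel p) <= 4 * dotv (P - p) (P - p) / kinetic P ^+ 2.
Proof.
have g0 := kinetic_gt0 p; have G0 := kinetic_gt0 P.
have K2 := sqr_kineticB_le P p; have eP := kinetic_sqr P; have ep := kinetic_sqr p.
set D := dotv (P - p) (P - p) in K2 *.
rewrite ler_pdivlMr ?exprn_gt0//.
have -> : dotv (vel P - vel p) (vel P - vel p) * kinetic P ^+ 2 =
   dotv ((P - p) + ((kinetic p - kinetic P) / kinetic p) *: p) ((P - p) + ((kinetic p - kinetic P) / kinetic p) *: p).
  have -> : (P - p) + ((kinetic p - kinetic P) / kinetic p) *: p = kinetic P *: (vel P - vel p).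
    by apply/rowP => i; rewrite !(vecBE, vecDE, velE, vecZE); field; rewrite !gt_eqF.
  by rewrite dotvZl dotvZr; ring.
set c := _ / _; have c2 : c ^+ 2 * dotv p p <= D.
  apply: le_trans K2; rewrite /c exprMn exprVn -mulrA -[leRHS]mulr1.
  have -> : (kinetic p - kinetic P) ^+ 2 = (kinetic P - kinetic p) ^+ 2 by ring.
  rewrite ler_wpM2l ?sqr_ge0// ler_pdivrMl ?exprn_gt0// mulr1 ep lerDr//.
move: @D K2 c2; generalize (P - p) => e D K2 c2.
have := dotv_ge0 (e - c *: p).
rewrite !(dotvDl, dotvDr, dotvNl, dotvNr, dotvZl, dotvZr) (dotvC p e) -/D; set m := dotv e p; set q := dotv p p in c2 *.
by lra.
Qed.

(** The factor [kinetic P] lost in [sqr_dist_eta] is recovered from [sqr_velB_le], so the constant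
    involves [p] alone. *)
Lemma vel_dist_eta P p i j :
  `|(vel P - vel p) 0 i * (P - p) 0 j| <= 4 * kinetic p ^+ 2 * eta P p.
Proof.
have G0 := kinetic_gt0 P; have e0 := eta_ge0 P p; have g0 := ltW (kinetic_gt0 p).
have h1 := sqr_dist_eta P p; have h2 := sqr_velB_le P p.
rewrite -(@ler_pXn2r _ 2)// ?nnegrE ?mulr_ge0 ?sqr_ge0//.
rewrite real_normK ?num_real// exprMn.
have D0 := dotv_ge0 (P - p).
set D := dotv (P - p) (P - p) in h1 h2 D0 *; set W := dotv _ _ in h2.
apply: (@le_trans _ _ (W * D)).
  by apply: ler_pM; rewrite ?sqr_ge0//; exact: sqr_coord_le.
apply: (@le_trans _ _ (4 * D / kinetic P ^+ 2 * D)); first by rewrite ler_wpM2r.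
rewrite (_ : 4 * D / kinetic P ^+ 2 * D = 4 * (D / kinetic P) ^+ 2); last by field; rewrite gt_eqF.
rewrite (_ : (4 * kinetic p ^+ 2 * eta P p) ^+ 2 = 4 * (2 * kinetic p ^+ 2 * eta P p) ^+ 2); last by ring.
rewrite ler_wpM2l// ler_pXn2r// ?nnegrE ?mulr_ge0 ?sqr_ge0 ?invr_ge0 ?(ltW G0) ?(ltW (kinetic_gt0 p))//.
by rewrite ler_pdivrMr// mulrAC; move: h1; rewrite mulrAC.
Qed.

(** The Taylor remainder of the velocity is exactly the product of the differences of energy and of
    velocity, over [kinetic p], plus [vel p] times [eta P p / kinetic p]. The product is quadratic
    and is controlled as in [vel_dist_eta]. *)
Lemma Hv_vel_eta P p i :
  `|(Hv p (P - p) - (vel P - vel p)) 0 i| <= (4 * kinetic p ^+ 2 + 1) * eta P p.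
Proof.
have g0 := kinetic_gt0 p; have G0 := kinetic_gt0 P; have g1 := kinetic_ge1 p; have e0 := eta_ge0 P p.
have -> : (Hv p (P - p) - (vel P - vel p)) 0 i =
    (kinetic P - kinetic p) / kinetic p * (vel P - vel p) 0 i + vel p 0 i * (eta P p / kinetic p).
  have s : dotv p (P - p) = kinetic P * kinetic p - kinetic p ^+ 2 - kinetic p * eta P p.
    by rewrite dotvBr (dotvC p P) kinetic_eta kinetic_sqr; ring.
  by rewrite !(vecBE, velE, vecZE) s; field; rewrite !gt_eqF.
have ig : (kinetic p)^-1 <= 1 by rewrite invf_le1.
have ig0 : 0 <= (kinetic p)^-1 by rewrite invr_ge0 ltW.
have g0' := ltW g0.
apply: (le_trans (ler_normD _ _)); rewrite [leRHS]mulrDl mul1r; apply: lerD; last first.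
  rewrite normrM -[leRHS]mul1r ler_pM ?vel_coord_le//.
  by rewrite ger0_norm ?mulr_ge0// ler_piMr.
have h1 := sqr_dist_eta P p; have h2 := sqr_velB_le P p; have h3 := sqr_kineticB_le P p.
have D0 := dotv_ge0 (P - p).
set D := dotv (P - p) (P - p) in h1 h2 h3 D0 *; set W := dotv _ _ in h2.
rewrite (_ : _ / kinetic p * _ = ((kinetic P - kinetic p) * (vel P - vel p) 0 i) / kinetic p); last by ring.
rewrite normrM (ger0_norm ig0); apply: (@le_trans _ _ `|(kinetic P - kinetic p) * (vel P - vel p) 0 i|).
  by rewrite ler_piMr.
rewrite -(@ler_pXn2r _ 2)// ?nnegrE ?mulr_ge0 ?sqr_ge0//.
rewrite real_normK ?num_real// exprMn.
apply: (@le_trans _ _ (D * W)).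
  by apply: ler_pM; rewrite ?sqr_ge0//; exact: sqr_coord_le.
apply: (@le_trans _ _ (D * (4 * D / kinetic P ^+ 2))); first by rewrite ler_wpM2l.
rewrite (_ : D * (4 * D / kinetic P ^+ 2) = 4 * (D / kinetic P) ^+ 2); last by field; rewrite gt_eqF.
rewrite (_ : (4 * kinetic p ^+ 2 * eta P p) ^+ 2 = 4 * (2 * kinetic p ^+ 2 * eta P p) ^+ 2); last by ring.
rewrite ler_wpM2l// ler_pXn2r// ?nnegrE ?mulr_ge0 ?sqr_ge0 ?invr_ge0 ?(ltW G0) ?(ltW (kinetic_gt0 p))//.
by rewrite ler_pdivrMr// mulrAC; move: h1; rewrite mulrAC.
Qed.

Lemma Hv_coord_le p (b : vec) c j : 0 <= c -> (forall i, `|b 0 i| <= c) -> `|Hv p b 0 j| <= (1 + d%:R) * c.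
Proof.
move=> c0 bc; have g0 := kinetic_gt0 p; have g1 := kinetic_ge1 p.
have ig : (kinetic p)^-1 <= 1 by rewrite invf_le1.
have ig0 : 0 <= (kinetic p)^-1 by rewrite invr_ge0 ltW.
have -> : Hv p b 0 j = b 0 j / kinetic p - (\sum_i vel p 0 i * b 0 i) * vel p 0 j / kinetic p.
  rewrite vecBE velE !vecZE.
  have -> : \sum_i vel p 0 i * b 0 i = dotv p b / kinetic p.
    by rewrite /dotv mulr_suml; apply: eq_bigr => i _; rewrite velE mulrAC.
  by field; rewrite gt_eqF.
apply: (le_trans (ler_normB _ _)); rewrite [leRHS]mulrDl mul1r; apply: lerD.
  by rewrite normrM (ger0_norm ig0) -[leRHS]mulr1 ler_pM.
rewrite normrM (ger0_norm ig0) -[leRHS]mulr1 ler_pM// normrM -[leRHS]mulr1 ler_pM ?vel_coord_le//.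
apply: (le_trans (ler_norm_sum _ _ _)).
rewrite mulr_natl -[d in leRHS]card_ord -sumr_const; apply: ler_sum => i _.
by rewrite normrM -[leRHS]mul1r ler_pM ?vel_coord_le.
Qed.

Lemma is_derive_eta (V : normedModType R) (f1 f2 : V -> vec) x v (a b : vec) :
  (forall i, is_derive x v (fun y => f1 y 0 i) (a 0 i)) ->
  (forall i, is_derive x v (fun y => f2 y 0 i) (b 0 i)) ->
  is_derive x v (fun y => eta (f1 y) (f2 y))
    (dotv (vel (f1 x) - vel (f2 x)) a - dotv (Hv (f2 x) b) (f1 x - f2 x)).
Proof.
move=> ha hb.
have h1 := is_derive_kinetic ha; have h2 := is_derive_ikinetic hb.
have h3 : is_derive x v (fun y => -1 - dotv (f1 y) (f2 y)) (0 + \sum_i - (f1 x 0 i * b 0 i + f2 x 0 i * a 0 i)).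
  apply: (is_deriveD_fun (is_derive_cst_dir (-1) x v)).
  have hs : is_derive x v (fun y => \sum_i (- (f1 y 0 i * f2 y 0 i))) (\sum_i - (f1 x 0 i * b 0 i + f2 x 0 i * a 0 i)).
    by apply: is_derive_sum_fun => i; apply: is_deriveN; apply: is_deriveM_fun.
  by apply: is_derive_eq hs _ _ => // y; rewrite sumrN.
have h := is_deriveD_fun h1 (is_deriveM_fun h3 h2).
apply: is_derive_eq h _ _ => [y|]; first by rewrite etaE; ring.
have g0 := kinetic_gt0 (f2 x); have e := kinetic_sqr (f2 x).
rewrite sumrN big_split /= -/(dotv (f1 x) b) -/(dotv (f2 x) a).
have vE w : dotv (vel (f2 x)) w = (kinetic (f2 x))^-1 * dotv (f2 x) w by rewrite -dotvZl.
have HE w : dotv (Hv (f2 x) b) w = (kinetic (f2 x))^-1 * dotv b w - dotv (f2 x) b / kinetic (f2 x) ^+ 3 * dotv (f2 x) w.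
  by rewrite dotvBl !dotvZl.
rewrite dotvBl vE HE !dotvBr (dotvC b (f1 x)) (dotvC b (f2 x)) (dotvC (f2 x) (f1 x)).
have -> : dotv (f2 x) (f2 x) = kinetic (f2 x) ^+ 2 - 1 by rewrite e addrC addKr.
set g := kinetic (f2 x) in g0 *; by field; rewrite gt_eqF.
Qed.

End kinematics.

(** * The continuity equation *)

Section mollification_bounds.
Context {R : realType} {d : nat}.
Local Notation vec := 'rV[R]_d.
Local Notation cell := (d.-tuple (measurableTypeR R)).
Local Notation mu := (torus R d).
Local Notation tperiodic := Defs.periodic.
Local Notation conv := Defs.conv.
Implicit Types (k f g u : vec -> R).

Lemma tint_K_reflect n (x : vec) : tint (fun y => K n (x - y)) = 1.
Proof. by rewrite tint_reflect ?tint_K//; [exact: tp_measurable (tp_K n)|exact: tp_periodic (tp_K n)]. Qed.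

Lemma conv_K_ae_bound n g B x : L1 g -> {ae mu, forall y : cell, `|g (pt y)| <= B} ->
  `|conv (K n) g x| <= B.
Proof.
move=> Lg gB; have tk := tp_reflect x (tp_K (R := R) (d := d) n).
apply: (@le_trans _ _ (tint (fun y => B * K n (x - y)))); last first.
  by rewrite tintZ ?tint_K_reflect ?mulr1//; exact: tp_integrable.
apply: ae_norm_tint_le; first exact: tp_conv_integrable (tp_K n) Lg.
  by apply: tintegrableZ; exact: tp_integrable.
by apply: filterS gB => y gy; rewrite normrM ger0_norm ?K_ge0// mulrC ler_wpM2r// K_ge0.
Qed.

Lemma conv_K_lip n f L x y : L1 f -> 0 <= L -> (forall x y, `|f x - f y| <= L * `|x - y|) ->
  `|conv (K n) f x - conv (K n) f y| <= L * `|x - y|.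
Proof.
move=> Lf L0 fL; have tK := tp_K (R := R) (d := d) n.
have Lx z : tintegrable (fun w => f (z - w) * K n w).
  have [c _ kc] := tp_bounded tK.
  apply: (@eq_tintegrable _ _ (fun w => K n w * f (z - w))); first by move=> w; rewrite mulrC.
  exact: tintegrableM (tintegrable_reflect z Lf) (tp_measurable tK) kc.
rewrite !(@tconvC _ _ (K n) f); [|exact: tp_periodic|exact: Lf.1|exact: tp_measurable|exact: L1_measurable|exact: tp_periodic|exact: Lf.1|exact: tp_measurable|exact: L1_measurable].
rewrite /Defs.conv -tintB//.
apply: (@le_trans _ _ (tint (fun w : vec => L * `|x - y| * K n w))); last first.
  by rewrite tintZ ?tint_K ?mulr1//; exact: tp_integrable.
apply: norm_tint_le; [exact: tintegrableB|by apply: tintegrableZ; exact: tp_integrable|].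
move=> w; rewrite -mulrBl normrM (ger0_norm (K_ge0 _ _)) ler_wpM2r ?K_ge0//.
by apply: (le_trans (fL _ _)); rewrite opprB addrA subrK.
Qed.

Lemma derive_norm_le (V W : normedModType R) (f : V -> W) x v c : derivable f x v ->
  (\forall n \near \oo, `|dq f v x n| <= c) -> `|'D_v f x| <= c.
Proof.
move=> df H; have cv : (fun n => `|dq f v x n|) @ \oo --> `|'D_v f x|.
  by apply: cvg_norm; exact: dq_cvg.
rewrite -(cvg_lim _ cv)//.
by apply: limr_le => //; apply/cvg_ex; exists `|'D_v f x|.
Qed.

Lemma lip_dq_le (V W : normedModType R) (f : V -> W) x v L n : 0 <= L ->
  `|f (x + n.+1%:R^-1 *: v) - f x| <= L * `|n.+1%:R^-1 *: v| -> `|dq f v x n| <= L * `|v|.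
Proof.
move=> L0 H; rewrite /dq normrZ ger0_norm// -ler_pdivlMl ?ltr0n//.
by apply: (le_trans H); rewrite normrZ ger0_norm ?invr_ge0// mulrCA.
Qed.

Lemma partial_lip_le f j x L : 0 <= L -> (forall x y, `|f x - f y| <= L * `|x - y|) ->
  derivable f x (evec j) -> `|partial j f x| <= L.
Proof.
move=> L0 fL df; apply: derive_norm_le => //; apply: nearW => n.
by rewrite -[leRHS]mulr1 -(norm_evec j) lip_dq_le// (le_trans (fL _ _))// addrC addKr.
Qed.

Lemma tp_lip_of_partial u B x y : tp u -> 0 <= B -> (forall j x, `|partial j u x| <= B) ->
  `|u x - u y| <= d%:R * B * `|x - y|.
Proof.
move=> tu B0 uB; set v := x - y.
have dv z : 'D_v u z = \sum_j v 0 j * partial j u z.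
  have du : differentiable u z by exact: tp_differentiable.
  rewrite deriveE// {1}(row_sum_delta v) linear_sum; apply: eq_bigr => j _.
  by rewrite linearZ /= /partial deriveE.
have db z : `|'D_v u z| <= d%:R * B * `|v|.
  rewrite dv; apply: (le_trans (ler_norm_sum _ _ _)).
  apply: (@le_trans _ _ (\sum_(j < d) `|v| * B)).
    by apply: ler_sum => j _; rewrite normrM ler_pM// norm_coord_le.
  by rewrite sumr_const card_ord -[leLHS]mulr_natl (mulrC `|v|) mulrA.
pose phi (s : R) := u (s *: v + y).
have dphi (s : R) : is_derive s 1 phi ('D_v u (s *: v + y)).
  have h : is_derive (s *: v + y) v u ('D_v u (s *: v + y)) by apply: tp_is_derive.
  have /is_derive_line h' := h.
  have hs : is_derive s 1 (fun t : R => t - s) (1 : R).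
    by have := is_deriveD_fun (is_derive_id s (1:R)) (is_derive_cstR (- s) s); rewrite addr0.
  have h'' : is_derive ((fun t : R => t - s) s) 1 (fun h : R => u (h *: v + (s *: v + y))) ('D_v u (s *: v + y)).
    by rewrite subrr.
  have := @is_derive1_comp R (fun h : R => u (h *: v + (s *: v + y))) (fun t => t - s) s _ _ h'' hs.
  move=> H; apply: is_deriveW H _ _; last by rewrite mulr1.
  by move=> t /=; rewrite addrA -scalerDl subrK.
have cphi : {within `[0 : R, 1], continuous phi}.
  apply: continuous_subspaceT => s.
  by apply: differentiable_continuous; apply/derivable1_diffP; have [] := dphi s.
have [c _] := MVT (@ltr01 R) (fun s _ => dphi s) cphi.
rewrite subr0 mulr1 /phi scale1r scale0r add0r /v subrK => ->.
exact: db.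
Qed.

(** As the mean is zero, [u x] is the average of [u x - u y]; modulo the lattice both points lie
    within distance 1 of the origin. *)
Lemma tp_bound_of_partial u B x : tp u -> 0 <= B -> (forall j x, `|partial j u x| <= B) ->
  tint u = 0 -> `|u x| <= 2 * d%:R * B.
Proof.
move=> tu B0 uB u0.
have -> : u x = tint (fun y => u x - u y).
  by rewrite tintB ?tint_cst ?u0 ?subr0//; [exact: tintegrable_cst|exact: tp_integrable].
have iu : tintegrable (fun y => u x - u y).
  by apply: tintegrableB; [exact: tintegrable_cst|exact: tp_integrable].
rewrite -[leRHS](@tint_cst _ d); apply: norm_tint_le => //; first exact: tintegrable_cst.
move=> y; have [v xv vi] := vec_reduce x; have [w yw wi] := vec_reduce y.
have -> : u x = u (x - v) by rewrite -[in LHS](subrK v x); apply: periodic_int => //; exact: tp_periodic.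
have -> : u y = u (y - w) by rewrite -[in LHS](subrK w y); apply: periodic_int => //; exact: tp_periodic.
apply: (le_trans (tp_lip_of_partial _ _ tu B0 uB)).
rewrite [leRHS](_ : _ = d%:R * B * 2); last by ring.
rewrite ler_wpM2l ?mulr_ge0//.
by apply: (le_trans (ler_normB _ _)); lra.
Qed.

End mollification_bounds.

Lemma cvg_finsum (R : realType) (I : Type) (s : seq I) (u : I -> nat -> R) (l : I -> R) :
  (forall i, u i @ \oo --> l i) -> (fun n => \sum_(i <- s) u i n) @ \oo --> \sum_(i <- s) l i.
Proof.
move=> ul; elim: s => [|i s IH].
  by under eq_fun do rewrite big_nil; rewrite big_nil; exact: cvg_cst.
under eq_fun do rewrite big_cons; rewrite big_cons; exact: cvgD.
Qed.

(** * Transported densities and their pairings *)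

Section transport.
Context {R : realType} {d : nat}.
Local Notation vec := 'rV[R]_d.
Local Notation cell := (d.-tuple (measurableTypeR R)).
Local Notation mu := (torus R d).
Local Notation leb := (@lebesgue_measure R).
Local Notation tperiodic := Defs.periodic.
Local Notation conv := Defs.conv.
Implicit Types (T L c : R) (k q : vec -> R) (f Phi : R -> vec -> R) (J : 'I_d -> R -> vec -> R).

Definition flux J s q := \sum_j tint (fun x => J j s x * partial j q x).

(** The current [J] is not tied to the density by a velocity. The notion is therefore linear and
    covers the difference of two solutions. *)
Record transported T f J : Prop := {
  tr_L1 : forall t, t \in `[0, T] -> L1 (f t);
  tr_JL1 : forall j t, t \in `[0, T] -> L1 (J j t);
  tr_Jmeas : forall j, tmeas T (J j);
  tr_bound : exists2 c, 0 <= c & forall t, t \in `[0, T] ->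
     tint (fun x => `|f t x|) <= c /\ forall j, tint (fun x => `|J j t x|) <= c;
  tr_evol : forall k t, tp k -> t \in `[0, T] ->
     tint (fun x => k x * f t x) = tint (fun x => k x * f 0 x) + \int[leb]_(s in `[0, t]) flux J s k
}.

Lemma flux_integrable T f J j s q : transported T f J -> s \in `[0, T] -> tp q ->
  tintegrable (fun x => J j s x * partial j q x).
Proof.
move=> tr sT tq; have [c _ qc] := tp_bounded (tp_partial j tq).
apply: (@eq_tintegrable _ _ (fun x => partial j q x * J j s x)); first by move=> x; rewrite mulrC.
exact: tintegrableM (tr_JL1 tr j sT).2 (tp_measurable (tp_partial j tq)) qc.
Qed.

Lemma flux_bound T f J c s q B : transported T f J -> s \in `[0, T] -> tp q ->
  (forall j, tint (fun x => `|J j s x|) <= c) -> (forall j x, `|partial j q x| <= B) -> 0 <= B ->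
  `|flux J s q| <= d%:R * (c * B).
Proof.
move=> tr sT tq Jc qB B0; apply: (le_trans (ler_norm_sum _ _ _)).
apply: (@le_trans _ _ (\sum_(j < d) c * B)); last by rewrite sumr_const card_ord mulr_natl.
apply: ler_sum => j _; have iJ : tintegrable (fun x => `|J j s x|) by exact: tintegrable_norm (tr_JL1 tr j sT).2.
apply: (@le_trans _ _ (tint (fun x => B * `|J j s x|))); last by rewrite tintZ// mulrC ler_wpM2r.
apply: norm_tint_le; [exact: flux_integrable tr sT tq|exact: tintegrableZ|].
by move=> x; rewrite normrM mulrC ler_wpM2r.
Qed.

Lemma flux_lin T f J s (I : finType) (c : I -> R) (a : I -> vec -> R) : transported T f J -> s \in `[0, T] ->
  (forall l, tp (a l)) -> flux J s (fun x => \sum_l c l * a l x) = \sum_l c l * flux J s (a l).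
Proof.
move=> tr sT ta.
transitivity (\sum_j \sum_l c l * tint (fun x => J j s x * partial j (a l) x)).
  apply: eq_bigr => j _.
  rewrite (@eq_tint _ _ _ (fun x => \sum_l c l * (J j s x * partial j (a l) x))).
    rewrite tint_sum => [|l]; last by apply: tintegrableZ; exact: flux_integrable tr sT (ta l).
    by apply: eq_bigr => l _; rewrite tintZ//; exact: flux_integrable tr sT (ta l).
  move=> x; rewrite partial_sum => [|l _]; last exact: tpZ.
  by rewrite mulr_sumr; apply: eq_bigr => l _; rewrite partialZ// mulrCA.
by rewrite exchange_big; apply: eq_bigr => l _; rewrite /flux mulr_sumr.
Qed.

Lemma transported_wevol T f J : 0 < T -> transported T f J -> wevol T f (flux J).
Proof.
move=> T0 tr; split; first exact: tr_L1 tr.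
- move=> k tk; have [c c0 fc] := tr_bound tr.
  have [B [B0 kB]] : exists B, 0 <= B /\ forall j x, `|partial j k x| <= B.
    have H j : exists B, 0 <= B /\ forall x, `|partial j k x| <= B.
      by have [c' c'0 h] := tp_bounded (tp_partial j tk); exists c'.
    have [b hb] := choice H; exists (\sum_j b j); split; first by apply: sumr_ge0 => j _; case: (hb j).
    move=> j x; have [_ /(_ x) h] := hb j; apply: (le_trans h).
    by rewrite (bigD1 j)//= lerDl; apply: sumr_ge0 => i _; case: (hb i).
  split.
  + apply: measurable_sum => j; apply: (@measurable_tint_slice _ _ _ (fun s x => J j s x * partial j k x)).
    by apply: tmeasM; [exact: tr_Jmeas tr j|apply: tmeas_static; apply: tp_measurable; exact: tp_partial].
  + exists (d%:R * (c * B)); first by rewrite !mulr_ge0.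
    move=> s sT; apply: (flux_bound tr sT tk) => // j; by have [_ ->] := fc s sT.
  + by move=> t tT; exact: tr_evol tr k t tk tT.
- by move=> s sT I c a ta; exact: flux_lin tr sT ta.
Qed.

Lemma transportedB T f g J H : transported T f J -> transported T g H ->
  transported T (fun t x => f t x - g t x) (fun j t x => J j t x - H j t x).
Proof.
move=> tf tg.
have tri (u v : vec -> R) c e : L1 u -> L1 v -> tint (fun x => `|u x|) <= c -> tint (fun x => `|v x|) <= e ->
    tint (fun x => `|u x - v x|) <= c + e.
  move=> [_ iu] [_ iv] uc ve.
  apply: (@le_trans _ _ (tint (fun x => `|u x| + `|v x|))).
    apply: le_tint; [by apply: tintegrable_norm; exact: tintegrableB|by apply: tintegrableD; exact: tintegrable_norm|].
    by move=> x; exact: ler_normB.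
  by rewrite tintD ?lerD//; exact: tintegrable_norm.
split.
- by move=> t tT; apply: L1B; [exact: tr_L1 tf t tT|exact: tr_L1 tg t tT].
- by move=> j t tT; apply: L1B; [exact: tr_JL1 tf j t tT|exact: tr_JL1 tg j t tT].
- by move=> j; apply: tmeasB; [exact: tr_Jmeas tf j|exact: tr_Jmeas tg j].
- have [c c0 fc] := tr_bound tf; have [e e0 ge] := tr_bound tg.
  exists (c + e); first by rewrite addr_ge0.
  move=> t tT; have [f1 f2] := fc t tT; have [g1 g2] := ge t tT; split => [|j].
    by apply: tri => //; [exact: tr_L1 tf t tT|exact: tr_L1 tg t tT].
  by apply: tri => //; [exact: tr_JL1 tf j t tT|exact: tr_JL1 tg j t tT].
- move=> k t tk tT; move: (tT); rewrite in_itv/= => /andP[t0 tT'].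
  have o0 : 0 \in `[0, T] by rewrite in_itv/= lexx (le_trans t0).
  have T0 : 0 <= T by exact: le_trans tT'.
  have iM (u : vec -> R) : L1 u -> tintegrable (fun x => k x * u x).
    move=> Lu; have [c _ qc] := tp_bounded tk; exact: tintegrableM Lu.2 (tp_measurable tk) qc.
  have E s : s \in `[0, T] -> tint (fun x => k x * (f s x - g s x)) =
      tint (fun x => k x * f s x) - tint (fun x => k x * g s x).
    move=> sT; rewrite -tintB; [|exact: iM (tr_L1 tf sT)|exact: iM (tr_L1 tg sT)].
    by apply: eq_tint => x; rewrite mulrBr.
  rewrite (E t)// (E 0)// (tr_evol tf tk tT) (tr_evol tg tk tT).
  move: T0; rewrite le_eqVlt => /predU1P[T0|T0].
    have -> : t = 0 by apply/eqP; rewrite eq_le t0 T0 tT'.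
    by rewrite set_itv1 !Rintegral_set1 !addr0.
  have [_ /(_ k tk) pf _] := transported_wevol T0 tf.
  have [_ /(_ k tk) pg _] := transported_wevol T0 tg.
  have -> : \int[leb]_(s in `[0, t]) flux (fun j t x => J j t x - H j t x) s k =
    \int[leb]_(s in `[0, t]) (flux J s k - flux H s k).
    apply: eq_Rintegral => s; rewrite inE/= in_itv/= => /andP[s0 st].
    have sT : s \in `[0, T] by rewrite in_itv/= s0 (le_trans st).
    rewrite /flux -sumrB; apply: eq_bigr => j _.
    rewrite -tintB; [|exact: flux_integrable tf sT tk|exact: flux_integrable tg sT tk].
    by apply: eq_tint => x; rewrite mulrBl.
  rewrite RintegralB//; [|exact: prim_integrable pf tT|exact: prim_integrable pg tT].
  by rewrite opprD addrACA.
Qed.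

Lemma flux_limit T f J s (q : nat -> vec -> R) (g : 'I_d -> vec -> R) B :
  transported T f J -> s \in `[0, T] ->
  (forall n j x, partial j (q n) x = conv (K n) (g j) x) -> (forall j, L1 (g j)) ->
  (forall j, {ae mu, forall y : cell, `|g j (pt y)| <= B}) ->
  (fun n => flux J s (q n)) @ \oo --> \sum_j tint (fun x => J j s x * g j x).
Proof.
move=> tr sT qg Lg gB.
rewrite (_ : (fun n => flux J s (q n)) = fun n => \sum_j tint (fun x => conv (K n) (g j) x * J j s x)); last first.
  by apply/funext => n; apply: eq_bigr => j _; apply: eq_tint => x; rewrite qg mulrC.
rewrite (_ : \sum_j _ = \sum_j tint (fun x => g j x * J j s x)); last first.
  by apply: eq_bigr => j _; apply: eq_tint => x; rewrite mulrC.
apply: cvg_finsum => j; exact: (conv_K_weak (Lg j) (gB j) (tr_JL1 tr j sT)).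
Qed.

Lemma Kopp n : (fun z : vec => K n (- z)) = K n.
Proof. by apply/funext => z; rewrite K_even. Qed.

(* Tested against K_n * Phi, which separates the variables t and x, the
   equation for f reduces to a product rule; then n tends to infinity. *)
Lemma transport_test T f J L Phi dt dx : 0 < T -> transported T f J -> stl T L Phi -> aediff T Phi dt dx ->
  tmeas T f ->
  prim T (fun t => tint (fun x => Phi t x * f t x))
    (fun s => tint (fun x => f s x * dt_ T L Phi s x) + \sum_j tint (fun x => J j s x * dx_ L Phi j s x)).
Proof.
move=> T0 tr sP aP mf; have [L0 _ PL] := sP; have [c c0 fc] := tr_bound tr.
have dtL s x : `|dt_ T L Phi s x| <= L by exact: clsup_bound.
have dxL j s x : `|dx_ L Phi j s x| <= L by exact: clsup_bound.
have mdt s : s \in `[0, T] -> tmeasurable (dt_ T L Phi s) by move=> sT; exact: tmeas_slice (dt_tmeas T0 sP) sT.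
have idt s (u : vec -> R) : s \in `[0, T] -> L1 u -> tintegrable (fun x => u x * dt_ T L Phi s x).
  move=> sT Lu; apply: (@eq_tintegrable _ _ (fun x => dt_ T L Phi s x * u x)); first by move=> x; rewrite mulrC.
  exact: tintegrableM Lu.2 (mdt s sT) (dtL s).
have bdt s (u : vec -> R) e : s \in `[0, T] -> L1 u -> tint (fun x => `|u x|) <= e ->
    `|tint (fun x => u x * dt_ T L Phi s x)| <= e * L.
  move=> sT Lu ue; have iu := tintegrable_norm Lu.2.
  apply: (@le_trans _ _ (tint (fun x => L * `|u x|))); last by rewrite tintZ// mulrC ler_wpM2r.
  apply: norm_tint_le; [exact: idt|exact: tintegrableZ|].
  by move=> x; rewrite normrM mulrC ler_wpM2r.
have Kf n s : s \in `[0, T] -> tint (fun x => `|conv (K n) (f s) x|) <= c.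
  move=> sT; apply: (le_trans (tint_norm_conv_le (tp_L1 (tp_K n)) (tr_L1 tr sT))).
  rewrite (@eq_tint _ _ (fun z => `|K n z|) (K n)); first by rewrite tint_K mul1r; have [] := fc s sT.
  by move=> z; rewrite ger0_norm// K_ge0.
have tq n s : s \in `[0, T] -> tp (conv (K n) (Phi s)).
  by move=> sT; apply: tp_conv (tp_K n) _; exact: stl_L1 sP sT.
have qL n s : s \in `[0, T] -> forall j x, `|partial j (conv (K n) (Phi s)) x| <= L.
  move=> sT j x; apply: partial_lip_le => //; last by apply: tp_derivable; exact: tq.
  by move=> y z; apply: conv_K_lip => //; [exact: stl_L1 sP sT|exact: stl_lip sP sT].
apply: (@prim_limit _ T (fun n t => tint (fun x => conv (K n) (Phi t) x * f t x))
  (fun n s => flux J s (conv (K n) (Phi s)) + tint (fun x => conv (K n) (f s) x * dt_ T L Phi s x))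
  _ _ (d%:R * (c * L) + c * L)).
- by rewrite addr_ge0// !mulr_ge0.
- move=> n; have := wevol_pairing T0 (transported_wevol T0 tr) (wevol_stl T0 sP aP) (tp_K n).
  by rewrite Kopp.
- move=> n s sT; apply: (le_trans (ler_normD _ _)); apply: lerD.
    by apply: (flux_bound tr sT (tq n s sT)) => //; [have [] := fc s sT|exact: qL].
  by apply: bdt => //; [apply: L1_conv_tp (tp_K n) _; exact: tr_L1 tr s sT|exact: Kf].
- move=> t tT; have [B B0 PB] := stl_bounded T0 sP.
  apply: (conv_K_weak (stl_L1 T0 sP tT) _ (tr_L1 tr tT)).
  by apply: aeW => y; exact: PB.
- apply: filterS (stl_ae_cvg T0 sP aP); first exact: (ae_filter_ringOfSetsType leb).
  move=> s Hs sT'; have sT := subset_itv_oo_cc sT'; rewrite [X in _ --> X]addrC.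
  apply: cvgD.
    apply: (flux_limit (B := L) tr sT) => [n j x|j|j].
    + apply: (partial_conv_dq x (tp_K n) (stl_L1 T0 sP sT) L0 (stl_lip sP sT)).
      by apply: filterS (Hs sT') => y [_ h _ _].
    + exact: dx_L1 T0 sP sT.
    + by apply: aeW => y; exact: dxL.
  have Lf := tr_L1 tr sT; apply/cvgrPdist_le => e e0.
  have L1p : 0 < L + 1 by rewrite ltr_wpDl.
  have := conv_K_L1 Lf => /cvgrPdist_lt /(_ _ (divr_gt0 e0 L1p)); apply: filterS => n.
  rewrite sub0r normrN ger0_norm => [Hn|]; last exact: tint_ge0.
  have LKf := L1_conv_tp (tp_K n) Lf.
  rewrite -tintB; [|exact: idt|exact: idt].
  rewrite (@eq_tint _ _ _ (fun x => (f s x - conv (K n) (f s) x) * dt_ T L Phi s x)); last by move=> x; rewrite mulrBl.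
  apply: (@le_trans _ _ (e / (L + 1) * L)); last first.
    by rewrite mulrAC ler_pdivrMr// ler_wpM2l ?lerDl// ltW.
  apply: bdt => //; first exact: L1B.
  by rewrite (@eq_tint _ _ _ (fun x => `|conv (K n) (f s) x - f s x|)) ?(ltW Hn)// => x; rewrite distrC.
- apply: measurable_funD.
    by apply: (@measurable_tint_slice _ _ _ (fun s x => f s x * dt_ T L Phi s x)); apply: tmeasM => //; exact: dt_tmeas.
  apply: measurable_sum => j; apply: (@measurable_tint_slice _ _ _ (fun s x => J j s x * dx_ L Phi j s x)).
  by apply: tmeasM; [exact: tr_Jmeas tr j|exact: dx_tmeas].
- move=> s sT; rewrite addrC; apply: (le_trans (ler_normD _ _)); apply: lerD; last first.
    by apply: bdt => //; [exact: tr_L1 tr s sT|have [] := fc s sT].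
  apply: (le_trans (ler_norm_sum _ _ _)).
  apply: (@le_trans _ _ (\sum_(j < d) c * L)); last by rewrite sumr_const card_ord mulr_natl.
  apply: ler_sum => j _; have LJ := tr_JL1 tr j sT; have iJ := tintegrable_norm LJ.2.
  apply: (@le_trans _ _ (tint (fun x => L * `|J j s x|))).
    apply: norm_tint_le; last by move=> x; rewrite normrM mulrC ler_wpM2r.
      apply: (@eq_tintegrable _ _ (fun x => dx_ L Phi j s x * J j s x)); first by move=> x; rewrite mulrC.
      by apply: tintegrableM LJ.2 (L1_measurable (dx_L1 j T0 sP sT)) (dxL j s).
    exact: tintegrableZ.
  by rewrite tintZ// mulrC ler_wpM2r//; have [_ ->] := fc s sT.
Qed.

Section potential_energy.
Variables (V : vec -> R) (G : vec -> vec).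
Hypotheses (hV : coulomb_potential V) (hG : weak_gradient V G).

(** The kernel [W V n] is even, so the two halves of the product rule coincide, whence the factor 2.
    The bound [B] dominates the rates while [n] tends to infinity. *)
Lemma transport_potential T f J B : 0 < T -> 0 <= B -> transported T f J ->
  (forall s j, s \in `[0, T] -> {ae mu, forall y : cell, `|conv (Gj G j) (f s) (pt y)| <= B}) ->
  (forall s, s \in `[0, T] -> {ae mu, forall y : cell, `|conv V (f s) (pt y)| <= B}) ->
  prim T (fun t => tint (fun x => conv V (f t) x * f t x))
    (fun s => 2 * \sum_j tint (fun x => J j s x * conv (Gj G j) (f s) x)).
Proof.
move=> T0 B0 tr GB VB; have [c c0 fc] := tr_bound tr.
have LG s j : s \in `[0, T] -> L1 (conv (Gj G j) (f s)).
  by move=> sT; have [] := L1_conv (L1_G hG j) (tr_L1 tr sT).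
have LV s : s \in `[0, T] -> L1 (conv V (f s)).
  by move=> sT; have [] := L1_conv (L1_V hV) (tr_L1 tr sT).
have tW n : tp (W V n) by exact: tp_W.
have qE n s j x : s \in `[0, T] -> partial j (conv (W V n) (f s)) x = conv (K n) (conv (Gj G j) (f s)) x.
  move=> sT; rewrite partial_conv//; last exact: tr_L1 tr s sT.
  by rewrite (conv_KG hV hG)//; exact: tr_L1 tr s sT.
have Wopp n : (fun z : vec => W V n (- z)) = W V n by apply/funext => z; rewrite W_even.
have pn n : prim T (fun t => tint (fun x => conv (W V n) (f t) x * f t x))
    (fun s => 2 * flux J s (conv (W V n) (f s))).
  have := wevol_pairing T0 (transported_wevol T0 tr) (transported_wevol T0 tr) (tW n).
  rewrite Wopp => H; apply: eq_prim H _ _ => // s sT; by rewrite mulr_natl mulr2n.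
have bn n s : s \in `[0, T] -> `|2 * flux J s (conv (W V n) (f s))| <= 2 * (d%:R * (c * B)).
  move=> sT; rewrite normrM ger0_norm// ler_wpM2l//.
  apply: (flux_bound tr sT) => //; first by apply: tp_conv (tW n) _; exact: tr_L1 tr s sT.
    by have [] := fc s sT.
  by move=> j x; rewrite qE//; apply: conv_K_ae_bound; [exact: LG|exact: GB].
have cv s : s \in `[0, T] -> (fun n => 2 * flux J s (conv (W V n) (f s))) @ \oo -->
    2 * \sum_j tint (fun x => J j s x * conv (Gj G j) (f s) x).
  move=> sT; apply: cvgM; first exact: cvg_cst.
  apply: (flux_limit (B := B) tr sT) => [n j x|j|j]; [exact: qE|exact: LG|exact: GB].
apply: (@prim_limit _ T (fun n t => tint (fun x => conv (W V n) (f t) x * f t x))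
  (fun n s => 2 * flux J s (conv (W V n) (f s))) _ _ (2 * (d%:R * (c * B)))) => //.
- by rewrite !mulr_ge0.
- move=> t tT; rewrite (_ : (fun n => _) = fun n => tint (fun x => conv (K n) (conv V (f t)) x * f t x)).
    by apply: conv_K_weak; [exact: LV|exact: VB|exact: tr_L1 tr t tT].
  apply/funext => n; apply: eq_tint => x; rewrite (conv_KV hV)//; exact: tr_L1 tr t tT.
- by apply: aeW => s sT; apply: cv; exact: subset_itv_oo_cc sT.
- apply: (measurable_fun_cvg (h := fun n s => 2 * flux J s (conv (W V n) (f s)))).
    by move=> n; have [] := pn n.
  by move=> s sT; exact: cv.
- move=> s sT; have nc : (fun n => `|2 * flux J s (conv (W V n) (f s))|) @ \oo -->
      `|2 * \sum_j tint (fun x => J j s x * conv (Gj G j) (f s) x)| by apply: cvg_norm; exact: cv.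
  rewrite -(cvg_lim _ nc)//.
  apply: limr_le; first by apply/cvg_ex; eexists; exact: nc.
  by apply: nearW => n; exact: bn.
Qed.

End potential_energy.
End transport.

(** * Solutions *)

Section calculus.
Context {R : realType}.
Local Notation leb := (@lebesgue_measure R).

(** By continuity, a violation of the bound at one time would persist on an interval of positive
    length. *)
Lemma lip_ae_bound T (f : R -> R) c B : 0 < T -> 0 <= c -> lip T f c ->
  {ae leb, forall s, s \in `]0, T[ -> `|f s| <= B} ->
  forall t, t \in `[0, T] -> `|f t| <= B.
Proof.
move=> T0 c0 fc [N [mN N0 NB]] t tT; rewrite leNgt; apply/negP => Bt.
have e0 : 0 < `|f t| - B by rewrite subr_gt0.
have c1 : 0 < c + 1 by rewrite ltr_wpDl.
pose del := (`|f t| - B) / (c + 1).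
have del0 : 0 < del by rewrite divr_gt0.
move: (tT); rewrite in_itv/= => /andP[t0 tT'].
pose a := Num.max 0 (t - del); pose b := Num.min T (t + del).
have ab : a < b by rewrite /a /b gt_max !lt_min; apply/andP; split; apply/andP; split; lra.
have IN : `]a, b[%classic `<=` N.
  move=> s; rewrite /= in_itv/= /a /b gt_max lt_min => /andP[/andP[s0 st1] /andP[sT st2]].
  apply: NB => /= H; have sT' : s \in `]0, T[ by rewrite in_itv/= s0 sT.
  have := H sT'; have := fc t s tT (subset_itv_oo_cc sT').
  have d1 : `|t - s| <= del by rewrite ler_norml; apply/andP; split; lra.
  have : c * `|t - s| <= c * del by rewrite ler_wpM2l.
  have d2 : c * del < `|f t| - B.
    by rewrite /del mulrCA gtr_pMr// ltr_pdivrMr// mul1r ltrDl.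
  by have := ler_distD (f s) (f t) 0; rewrite !subr0; lra.
have : (leb `]a, b[%classic <= leb N)%E by apply: le_measure => //; rewrite inE//.
by rewrite N0 lebesgue_measure_itv/= lte_fin ab -EFinD lee_fin leNgt subr_gt0 ab.
Qed.

Lemma is_derive_row (V : normedModType R) d (f : V -> 'rV[R]_d) x v i : derivable f x v ->
  is_derive x v (fun y => f y 0 i) (('D_v f x) 0 i).
Proof.
move=> df; apply: DeriveDef; first by move/derivable_mxP : df => /(_ 0 i).
by rewrite derive_mx// mxE.
Qed.

Lemma differentiable_slices d (W : normedModType R) (F : R * 'rV[R]_d -> W) t x : differentiable F (t, x) ->
  derivable (fun s => F (s, x)) t 1 /\ differentiable (fun y => F (t, y)) x.
Proof.
move=> dF; split.
  apply/derivable1_diffP; apply: (@differentiable_comp _ _ _ _ (fun s => (s, x)) F) => //.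
apply: (@differentiable_comp _ _ _ _ (fun y => (t, y)) F) => //.
Qed.

Lemma near_itv (t T : R) : t \in `]0, T[ -> \forall n \near \oo, t + n.+1%:R^-1 \in `[0, T].
Proof.
rewrite in_itv/= => /andP[s0 sT].
have := @cvg_harmonic R => /cvgrPdist_lt /(_ (T - t)); rewrite subr_gt0 => /(_ sT).
apply: filterS => n /=; rewrite sub0r normrN ger0_norm ?invr_ge0// => ns.
by rewrite in_itv/= addr_ge0 ?invr_ge0 ?(ltW s0)//= addrC -lerBrDr ltW.
Qed.

End calculus.

Section solution.
Context {R : realType} {d : nat}.
Local Notation vec := 'rV[R]_d.
Local Notation cell := (d.-tuple (measurableTypeR R)).
Local Notation mu := (torus R d).
Local Notation leb := (@lebesgue_measure R).
Local Notation tperiodic := Defs.periodic.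
Local Notation conv := Defs.conv.
Local Notation eta := Defs.eta.
Variables (V : vec -> R) (G : vec -> vec).
Hypotheses (hV : coulomb_potential V) (hG : weak_gradient V G).
Variable (T : R).
Hypothesis T0 : 0 < T.

Definition velf (p : R -> vec -> vec) j s x := vel (p s x) 0 j.
Definition momf (rho : R -> vec -> R) (p : R -> vec -> vec) j s x := rho s x * velf p j s x.

Section one_solution.
Variables (rho0 : vec -> R) (p0 : vec -> vec) (rho : R -> vec -> R) (p : R -> vec -> vec).
Hypothesis sol : EP_solution G T rho0 p0 rho p.

Lemma sol_lip : exists2 L, 0 <= L & forall s t x y, s \in `[0, T] -> t \in `[0, T] ->
  `|p s x - p t y| <= L * (`|s - t| + `|x - y|).
Proof.
have [k k0 H] := lipschitz_bound (EP_p_lipschitz sol); exists k => // s t x y sT tT.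
have := H (s, x) (t, y); rewrite /= => /(_ (conj sT Logic.I) (conj tT Logic.I)) h.
apply: (le_trans h); rewrite ler_wpM2l// prod_normE /= ge_max.
by rewrite lerDl lerDr !normr_ge0.
Qed.

Lemma sol_stl (g : vec -> R) c : 0 <= c -> (forall P Q, `|g P - g Q| <= c * `|P - Q|) ->
  exists L, stl T L (fun t x => g (p t x)).
Proof.
move=> c0 gc; have [L L0 pL] := sol_lip; exists (c * L); split; first exact: mulr_ge0.
  by move=> t tT i x; rewrite (EP_p_periodic sol tT).
move=> s t x y sT tT; apply: (le_trans (gc _ _)); rewrite -mulrA ler_wpM2l//; exact: pL.
Qed.

Lemma velf_stl : exists L, forall j, stl T L (velf p j).
Proof.
have [L L0 pL] := sol_lip; exists ((1 + d%:R) * L) => j; split.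
- by rewrite mulr_ge0// addr_ge0.
- by move=> t tT i x; rewrite /velf (EP_p_periodic sol tT).
- move=> s t x y sT tT; apply: (le_trans (vel_coord_lip _ _ _)).
  by rewrite -mulrA ler_wpM2l ?addr_ge0// pL.
Qed.

Lemma velf_le j s x : `|velf p j s x| <= 1. Proof. exact: vel_coord_le. Qed.

Lemma velf_tmeas j : tmeas T (velf p j).
Proof. by have [L sL] := velf_stl; exact: stl_tmeas (sL j). Qed.

Lemma sol_p_bound : exists2 c, 0 <= c & forall s x, s \in `[0, T] -> `|p s x| <= c.
Proof.
have H j : exists c, 0 <= c /\ tbdd T (fun s x => p s x 0 j) c.
  have [L sL] : exists L, stl T L (fun s x => p s x 0 j).
    apply: (@sol_stl (fun P => P 0 j) 1) => // P Q; rewrite mul1r.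
    by have := norm_coord_le (P - Q) j; rewrite vecBE.
  by have [c c0 pc] := stl_bounded T0 sL; exists c.
have [c hc] := choice H; have c0 j : 0 <= c j by case: (hc j).
exists (\sum_j c j); first exact: sumr_ge0.
move=> s x sT; apply: norm_le_coord; first exact: sumr_ge0.
move=> j; have [_ /(_ s x sT) h] := hc j; apply: (le_trans h).
by rewrite (bigD1 j)//= lerDl sumr_ge0.
Qed.

Lemma rho_tmeas : tmeas T rho. Proof. exact: EP_rho_measurable sol. Qed.

Lemma rho_L1 t : t \in `[0, T] -> L1 (rho t).
Proof.
move=> tT; split; first exact: EP_rho_periodic sol t tT.
apply/integrableP; split; first by apply/measurable_EFinP; exact: tmeas_slice rho_tmeas tT.
under eq_integral do rewrite gee0_abs ?lee_fin ?(EP_rho_ge0 sol)//.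
by rewrite (EP_rho_mass sol)// ltry.
Qed.

Lemma tint_rho t : t \in `[0, T] -> tint (rho t) = 1.
Proof. by move=> tT; rewrite /tint /Rintegral (EP_rho_mass sol). Qed.

Lemma tint_norm_rho t : t \in `[0, T] -> tint (fun x => `|rho t x|) = 1.
Proof.
move=> tT; rewrite (@eq_tint _ _ _ (rho t)) ?tint_rho// => x.
by rewrite ger0_norm// (EP_rho_ge0 sol).
Qed.

Lemma momf_L1 j t : t \in `[0, T] -> L1 (momf rho p j t).
Proof.
move=> tT; split.
  by move=> i x; rewrite /momf /velf (EP_rho_periodic sol tT) (EP_p_periodic sol tT).
apply: (@eq_tintegrable _ _ (fun x => velf p j t x * rho t x)); first by move=> x; rewrite mulrC.
by apply: tintegrableM (rho_L1 tT).2 (tmeas_slice (velf_tmeas j) tT) (velf_le j t).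
Qed.

Lemma sol_transported : transported T rho (momf rho p).
Proof.
split.
- exact: rho_L1.
- by move=> j t; exact: momf_L1.
- by move=> j; apply: tmeasM; [exact: rho_tmeas|exact: velf_tmeas].
- exists 1 => // t tT; split=> [|j]; first by rewrite tint_norm_rho.
  rewrite -(tint_norm_rho tT); apply: le_tint.
  + by apply: tintegrable_norm; case: (momf_L1 j tT).
  + by apply: tintegrable_norm; case: (rho_L1 tT).
  + by move=> x; rewrite normrM -[leRHS]mulr1 ler_wpM2l// velf_le.
- move=> k t tk tT.
  have sw (u v : vec -> R) : tint (fun x => u x * v x) = tint (fun x => v x * u x).
    by apply: eq_tint => x; rewrite mulrC.
  rewrite sw (EP_continuity sol (tp_test tk) tT) (sw k); congr (_ + _).
  apply: eq_Rintegral => s; rewrite inE/= in_itv/= => /andP[s0 st].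
  have sT : s \in `[0, T] by rewrite in_itv/= s0 (le_trans st)//; move: tT; rewrite in_itv/= => /andP[].
  rewrite /flux -tint_sum.
    apply: eq_tint => x; rewrite /dotv mulr_sumr; apply: eq_bigr => j _.
    by rewrite /momf /velf mulrA /grad [X in _ * X]mxE.
  move=> j; have [c _ qc] := tp_bounded (tp_partial j tk).
  apply: (@eq_tintegrable _ _ (fun x => partial j k x * momf rho p j s x)); first by move=> x; rewrite mulrC.
  exact: tintegrableM (momf_L1 j sT).2 (tp_measurable (tp_partial j tk)) qc.
Qed.

Lemma convv_coord f x j : convv G f x 0 j = conv (Gj G j) f x.
Proof. by rewrite mxE. Qed.

(* The momentum equation bounds the force by the Lipschitz constant of p. *)
Lemma sol_force_ae_bound : exists2 B, 0 <= B &
  {ae leb, forall s, s \in `]0, T[ -> {ae mu, forall y : cell, forall j, `|conv (Gj G j) (rho s) (pt y)| <= B}}.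
Proof.
have [L L0 pL] := sol_lip; exists (L + L); first by rewrite addr_ge0.
have H : {ae (leb \x mu)%E, forall z : measurableTypeR R * cell, z.1 \in `]0, T[ ->
    forall j, `|conv (Gj G j) (rho z.1) (pt z.2)| <= L + L}.
  apply: filterS (EP_momentum sol) => -[t y] /= H tT j.
  have [dp eqn] := H tT; set x := pt y in dp eqn *.
  have tT' := subset_itv_oo_cc tT.
  have [d1 d2] := differentiable_slices dp.
  have h : `|conv (Gj G j) (rho t) x| <= `|convv G (rho t) x| by rewrite -convv_coord norm_coord_le.
  apply: (le_trans h); rewrite -normrN -eqn; apply: (le_trans (ler_normD _ _)); apply: lerD.
    apply: derive_norm_le => //; apply: filterS (near_itv tT) => n nT.
    rewrite -[leRHS]mulr1 -[X in _ * X](@normr1 R); apply: lip_dq_le => //.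
    have e1 : n.+1%:R^-1 *: (1 : R) = n.+1%:R^-1 by rewrite /GRing.scale /= mulr1.
    rewrite e1; apply: (le_trans (pL _ _ _ _ nT tT')).
    by rewrite subrr normr0 addr0 addrC addKr.
  rewrite -deriveEjacobian//; apply: derive_norm_le; first exact: diff_derivable.
  apply: nearW => n; apply: (@le_trans _ _ (L * `|vel (p t x)|)).
    apply: lip_dq_le => //; apply: (le_trans (pL _ _ _ _ tT' tT')).
    by rewrite subrr normr0 add0r addrC addKr.
  rewrite -[leRHS]mulr1 ler_wpM2l// norm_le_coord// => i; exact: vel_coord_le.
move: (ae_prod_slice H); apply: filterS => s Hs sT; apply: filterS Hs => y; exact.
Qed.

Lemma conv_tp_prim k x : tp k -> prim T (fun t => conv k (rho t) x) (fun s => flux (momf rho p) s (fun y => k (x - y))).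
Proof.
move=> tk; have [_ pk _] := transported_wevol T0 sol_transported.
exact: pk (tp_reflect x tk).
Qed.

(* The force is bounded at almost every time only; mollified, it is continuous in
   time, which extends the bound to every time. *)
Lemma sol_force_bound : exists2 B, 0 <= B & forall s, s \in `[0, T] ->
  (forall j, {ae mu, forall y : cell, `|conv (Gj G j) (rho s) (pt y)| <= B}) /\
  {ae mu, forall y : cell, `|conv V (rho s) (pt y)| <= B}.
Proof.
have [B B0 HB] := sol_force_ae_bound.
have LG s j : s \in `[0, T] -> L1 (conv (Gj G j) (rho s)).
  by move=> sT; have [] := L1_conv (L1_G hG j) (rho_L1 sT).
have LV s : s \in `[0, T] -> L1 (conv V (rho s)).
  by move=> sT; have [] := L1_conv (L1_V hV) (rho_L1 sT).
have tW n : tp (W V n) by exact: tp_W.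
have bW n j x s : s \in `[0, T] -> `|conv (partial j (W V n)) (rho s) x| <= B.
  have pc := conv_tp_prim x (tp_partial j (tW n)); have [c c0 lc] := prim_lip pc.
  move: s; apply: (lip_ae_bound T0 c0 lc).
  apply: filterS HB; first exact: (ae_filter_ringOfSetsType leb).
  move=> s Hs sT; have sT' := subset_itv_oo_cc sT.
  rewrite -(conv_KG hV hG)//; last exact: rho_L1.
  by apply: conv_K_ae_bound; [exact: LG|apply: filterS (Hs sT) => y; exact].
(* [2 * d * B] bounds the potential through its gradient, [B] the force; the sum serves both. *)
exists (2 * d%:R * B + B); first by rewrite !(addr_ge0, mulr_ge0).
move=> s sT; split=> [j|].
  apply: conv_K_bound; first exact: LG.
  move=> n x; rewrite (conv_KG hV hG)//; last exact: rho_L1.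
  by apply: (le_trans (bW n j x s sT)); rewrite lerDr !mulr_ge0.
apply: conv_K_bound; first exact: LV.
move=> n x; rewrite (conv_KV hV)//; last exact: rho_L1.
apply: (@le_trans _ _ (2 * d%:R * B)); last by rewrite lerDl.
apply: tp_bound_of_partial => //.
- by apply: tp_conv => //; exact: rho_L1.
- by move=> j z; rewrite partial_conv//; [exact: bW|exact: rho_L1].
- have [_ _ ->] := L1_conv (tp_L1 (tW n)) (rho_L1 sT).
  by rewrite (tint_W hV) mul0r.
Qed.

End one_solution.

Section two_solutions.
Variables (rho10 rho20 : vec -> R) (p10 p20 : vec -> vec) (rho1 rho2 : R -> vec -> R) (p1 p2 : R -> vec -> vec).
Hypothesis (sol1 : EP_solution G T rho10 p10 rho1 p1) (sol2 : EP_solution G T rho20 p20 rho2 p2).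

Definition etaf s x := eta (p1 s x) (p2 s x).

(** The Lipschitz constant of [eta] in its second argument grows with the first, so the bound [c] on
    [p1] is needed. Writing [eta P q] through [(kinetic q)^-1] and the scalar product of [vel q]
    with [P] reduces the estimate to those of the kinematics. *)
Lemma eta_stl : exists L, stl T L etaf.
Proof.
have [L1 L10 H1] := sol_lip sol1; have [L2 L20 H2] := sol_lip sol2.
have [c c0 pc] := sol_p_bound sol1.
exists (d%:R * L1 + (d%:R * L2 + (d%:R * L1 + d%:R * ((1 + d%:R) * L2 * c)))); split.
- by rewrite !(addr_ge0, mulr_ge0).
- by move=> t tT i x; rewrite /etaf (EP_p_periodic sol1 tT) (EP_p_periodic sol2 tT).
move=> s t x y sT tT; set D := `|s - t| + `|x - y|.
have D0 : 0 <= D by rewrite addr_ge0.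
have h1 := H1 s t x y sT tT; have h2 := H2 s t x y sT tT; rewrite -/D in h1 h2.
have E (P q : vec) : eta P q = kinetic P - ((kinetic q)^-1 + \sum_i vel q 0 i * P 0 i).
  rewrite etaE mulrDl mul1r; congr (_ - (_ + _)).
  by rewrite /dotv mulr_suml; apply: eq_bigr => i _; rewrite velE; ring.
rewrite /etaf; have Pc := pc s x sT; move: (p1 s x) (p1 t y) (p2 s x) (p2 t y) h1 h2 Pc => P Q p q h1 h2 Pc.
have -> : eta P p - eta Q q = (kinetic P - kinetic Q) + (((kinetic q)^-1 - (kinetic p)^-1) +
    \sum_i (vel q 0 i * (Q - P) 0 i + (vel q 0 i - vel p 0 i) * P 0 i)).
  rewrite !E (_ : \sum_i (vel q 0 i * (Q - P) 0 i + (vel q 0 i - vel p 0 i) * P 0 i) =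
    \sum_i vel q 0 i * Q 0 i - \sum_i vel p 0 i * P 0 i); first by ring.
  by rewrite -sumrB; apply: eq_bigr => i _; rewrite vecBE; ring.
rewrite distrC in h1; have h1' := h1; rewrite distrC in h1'; rewrite distrC in h2.
rewrite mulrDl; apply: (le_trans (ler_normD _ _)); apply: lerD.
  by apply: (le_trans (kinetic_lip _ _)); rewrite -mulrA ler_wpM2l.
rewrite mulrDl; apply: (le_trans (ler_normD _ _)); apply: lerD.
  by apply: (le_trans (ikinetic_lip _ _)); rewrite -mulrA ler_wpM2l.
apply: (le_trans (ler_norm_sum _ _ _)).
apply: (@le_trans _ _ (\sum_(i < d) (L1 * D + (1 + d%:R) * L2 * c * D))); last first.
  by rewrite sumr_const card_ord -[leLHS]mulr_natl -mulrDr -mulrDl mulrA.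
apply: ler_sum => i _; apply: (le_trans (ler_normD _ _)); apply: lerD.
  rewrite normrM -[leRHS]mul1r ler_pM ?vel_coord_le//.
  by apply: (le_trans (norm_coord_le _ _)).
rewrite normrM mulrAC ler_pM//; last exact: le_trans (norm_coord_le _ _) Pc.
apply: (le_trans (vel_coord_lip _ _ _)); rewrite -mulrA ler_wpM2l// addr_ge0//.
Qed.

Definition eta_dt s x := dotv (vel (p1 s x) - vel (p2 s x)) ('D_1 (p1 ^~ x) s)
  - dotv (Hv (p2 s x) ('D_1 (p2 ^~ x) s)) (p1 s x - p2 s x).
Definition eta_dx j s x := dotv (vel (p1 s x) - vel (p2 s x)) ('D_(evec j) (p1 s) x)
  - dotv (Hv (p2 s x) ('D_(evec j) (p2 s) x)) (p1 s x - p2 s x).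

(** The momentum equations include joint differentiability of both fields at almost every point of
    space-time; there the chain rule holds in every direction. *)
Lemma eta_aediff : aediff T etaf eta_dt eta_dx.
Proof.
apply: filterS2 (EP_momentum sol1) (EP_momentum sol2) => -[t y] /= H1 H2 tT.
have [dp1 _] := H1 tT; have [dp2 _] := H2 tT; set x := pt y in dp1 dp2 *.
have [a1 b1] := differentiable_slices dp1; have [a2 b2] := differentiable_slices dp2.
have {}a1 : derivable (p1 ^~ x) t 1 by exact: a1.
have {}a2 : derivable (p2 ^~ x) t 1 by exact: a2.
have {}b1 : differentiable (p1 t) x by exact: b1.
have {}b2 : differentiable (p2 t) x by exact: b2.
split=> [|j].
  have h := @is_derive_eta R d _ (p1 ^~ x) (p2 ^~ x) t 1 _ _ (fun i => is_derive_row i a1) (fun i => is_derive_row i a2).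
  exact: (dq_cvg_is_derive h).
have c1 : derivable (p1 t) x (evec j) by exact: diff_derivable.
have c2 : derivable (p2 t) x (evec j) by exact: diff_derivable.
have h := @is_derive_eta R d _ (p1 t) (p2 t) x (evec j) _ _ (fun i => is_derive_row i c1) (fun i => is_derive_row i c2).
exact: (dq_cvg_is_derive h).
Qed.

End two_solutions.
End solution.

(** * The stress estimate *)

Section commutator.
Context {R : realType} {d : nat}.
Local Notation vec := 'rV[R]_d.
Local Notation cell := (d.-tuple (measurableTypeR R)).
Local Notation mu := (torus R d).
Local Notation tperiodic := Defs.periodic.
Local Notation conv := Defs.conv.
Implicit Types (u f g k q : vec -> R).

Lemma tp_partialC f i j x : tp f -> partial i (partial j f) x = partial j (partial i f) x.
Proof.
move=> tf; elim: tf x => [c|k|k|f1 f2 t1 IH1 t2 IH2|f1 f2 t1 IH1 t2 IH2] x.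
- have E l : partial l (fun _ : vec => c) = fun=> 0 by apply/funext => z; rewrite partial_cst.
  by rewrite !E !partial_cst.
- have E l : partial l (fun z : vec => cos (2 * pi * z 0 k)) = fun z => - (2 * pi) * (k == l)%:R * sin (2 * pi * z 0 k).
    by apply/funext => z; rewrite (partial_comp_coord _ (is_derive_cos2pi _)); ring.
  rewrite !E !partialZ; [|exact: tp_sin..].
  by rewrite !(partial_comp_coord _ (is_derive_sin2pi _)); ring.
- have E l : partial l (fun z : vec => sin (2 * pi * z 0 k)) = fun z => (2 * pi) * (k == l)%:R * cos (2 * pi * z 0 k).
    by apply/funext => z; rewrite (partial_comp_coord _ (is_derive_sin2pi _)); ring.
  rewrite !E !partialZ; [|exact: tp_cos..].
  by rewrite !(partial_comp_coord _ (is_derive_cos2pi _)); ring.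
- have E l : partial l (fun z => f1 z + f2 z) = fun z => partial l f1 z + partial l f2 z.
    by apply/funext => z; rewrite partialD.
  by rewrite !E !partialD ?IH1 ?IH2//; exact: tp_partial.
- have E l : partial l (fun z => f1 z * f2 z) = fun z => f1 z * partial l f2 z + f2 z * partial l f1 z.
    by apply/funext => z; rewrite partialM.
  have p1 l := tp_partial l t1; have p2 l := tp_partial l t2.
  rewrite !E [LHS]partialD; [|exact: tp_mul t1 (p2 j)|exact: tp_mul t2 (p1 j)].
  rewrite [RHS]partialD; [|exact: tp_mul t1 (p2 i)|exact: tp_mul t2 (p1 i)].
  rewrite (partialM _ _ t1 (p2 j)) (partialM _ _ t2 (p1 j)) (partialM _ _ t1 (p2 i)) (partialM _ _ t2 (p1 i)).
  rewrite (IH1 x) (IH2 x); move: (f1 x) (f2 x) (partial i f1 x) (partial j f1 x) (partial i f2 x)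
    (partial j f2 x) (partial j (partial i f1) x) (partial j (partial i f2) x) => *; ring.
Qed.

Lemma tint_partial f j : tp f -> tint (partial j f) = 0.
Proof.
move=> tf; have L1c : L1 (fun _ : vec => 1 : R) by exact: tp_L1 (tp_cst 1).
have := @partial_ibp _ _ f (fun=> 1) (fun=> 0) j 0 tf L1c (lexx _).
rewrite (@eq_tint _ _ _ (partial j f)); last by move=> x; rewrite mulr1.
rewrite (@eq_tint _ _ (fun x => f x * 0) (fun=> 0)); last by move=> x; rewrite mulr0.
rewrite tint_cst oppr0; apply; first by move=> y z; rewrite subrr normr0 mul0r.
apply: aeW => y; rewrite (_ : dq _ _ _ = fun=> 0); first exact: cvg_cst.
by apply/funext => n; rewrite /dq subrr scaler0.
Qed.

(** Green's identity, from the vanishing integral of the derivative of [u * partial j u]. In the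
    limit it yields the sign of the potential energy. *)
Lemma tp_dirichlet u : tp u ->
  \sum_j tint (fun x => partial j u x ^+ 2) = tint (fun x => u x * - laplacian u x).
Proof.
move=> tu.
have ti f : tp f -> tintegrable f by exact: tp_integrable.
have E j : tint (fun x => partial j u x ^+ 2) = tint (fun x => u x * - partial j (partial j u) x).
  have t1 := tp_partial j tu; have t2 := tp_partial j t1.
  have := tint_partial j (tp_mul tu t1).
  rewrite (@eq_tint _ _ _ (fun x => partial j u x ^+ 2 - u x * - partial j (partial j u) x)); last first.
    by move=> x; rewrite partialM// expr2; ring.
  rewrite tintB; [by move/eqP; rewrite subr_eq0 => /eqP|apply: ti; exact: tp_exp|].
  by apply: ti; apply: tp_mul => //; exact: tpN.
rewrite (eq_bigr _ (fun j _ => E j)) -tint_sum.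
  by apply: eq_tint => x; rewrite /laplacian -mulr_sumr sumrN.
move=> j; apply: ti; apply: tp_mul => //; apply: tpN; do 2 apply: tp_partial; exact: tu.
Qed.

Lemma dirichlet_ge0 u : tp u -> 0 <= tint (fun x => u x * - laplacian u x).
Proof.
move=> tu; rewrite -tp_dirichlet//; apply: sumr_ge0 => j _; apply: tint_ge0 => x; exact: sqr_ge0.
Qed.

Lemma sum_sum_pair (A : R) (D : 'I_d -> R) :
  \sum_i \sum_j A * (D i + 2 * D j) / 2 = 3 / 2 * A * d%:R * \sum_j D j.
Proof.
rewrite (eq_bigr (fun i => A * d%:R / 2 * D i + A * \sum_j D j)).
  by rewrite big_split /= sumr_const card_ord -mulr_sumr -[_ *+ d]mulr_natr; field.
move=> i _; rewrite (eq_bigr (fun j => A / 2 * D i + A * D j)); last by move=> j _; field.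
by rewrite big_split /= sumr_const card_ord -mulr_sumr -[_ *+ d]mulr_natr; congr (_ + _); field.
Qed.

(* -lap u = - div grad u tested against w . grad u: the second derivatives of
   u only enter through grad |grad u|^2 and are moved onto w. *)
Lemma tp_stress_bound u (w : 'I_d -> vec -> R) (dw : 'I_d -> 'I_d -> vec -> R) L A : tp u -> 0 <= L -> 0 <= A ->
  (forall i, L1 (w i)) -> (forall i y z, `|w i y - w i z| <= L * `|y - z|) ->
  (forall i j, {ae mu, forall y : cell, dq (w i) (evec j) (pt y) @ \oo --> dw j i (pt y)}) ->
  (forall i j, tmeasurable (dw j i)) ->
  (forall i j, {ae mu, forall y : cell, `|dw j i (pt y)| <= A}) ->
  `|\sum_i tint (fun x => w i x * (partial i u x * - laplacian u x))| <=
    2 * d%:R * A * tint (fun x => u x * - laplacian u x).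
Proof.
move=> tu L0 A0 Lw wL wd mdw dwA.
have alg (a b : R) : A / 2 * (a + b) + A / 2 * b = A * (a + 2 * b) / 2 by field.
have ti f : tp f -> tintegrable f by exact: tp_integrable.
have tu1 j := tp_partial j tu; have tu2 i j := tp_partial i (tu1 j).
have iw i q : tp q -> tintegrable (fun x => q x * w i x).
  move=> tq; have [c _ qc] := tp_bounded tq; exact: tintegrableM (Lw i).2 (tp_measurable tq) qc.
have idw i j q : tp q -> tintegrable (fun x => q x * dw j i x).
  move=> tq; apply: (@eq_tintegrable _ _ (fun x => dw j i x * q x)); first by move=> x; rewrite mulrC.
  exact: tintegrableM_ae (ti q tq) (mdw i j) (dwA i j).
pose D j := tint (fun x => partial j u x ^+ 2).
have D0 j : 0 <= D j by apply: tint_ge0 => x; exact: sqr_ge0.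
(* One entry of the stress tensor: [partial i u] times the second derivative along [j] is the
   [j]-derivative of [partial i u * partial j u] minus half the [i]-derivative of [(partial j u)^2],
   because mixed derivatives commute. *)
have E i j : tint (fun x => w i x * (partial i u x * - partial j (partial j u) x)) =
   tint (fun x => partial i u x * partial j u x * dw j i x) - tint (fun x => partial j u x ^+ 2 / 2 * dw i i x).
  have tq : tp (fun x => partial i u x * partial j u x) by exact: tp_mul.
  have tr : tp (fun x => partial j u x ^+ 2 / 2).
    apply: (@eq_tp _ _ (fun x => 2^-1 * partial j u x ^+ 2)); first by move=> x; rewrite mulrC.
    by apply: tpZ; exact: tp_exp.
  have h1 := partial_ibp tq (Lw i) L0 (wL i) (wd i j).
  have h2 := partial_ibp tr (Lw i) L0 (wL i) (wd i i).
  move/(congr1 -%R) : h1; rewrite opprK => <-; move/(congr1 -%R) : h2; rewrite opprK => <-.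
  rewrite opprK addrC -tintB; [|apply: iw; exact: tp_partial..].
  apply: eq_tint => x.
  rewrite (_ : (fun x => partial j u x ^+ 2 / 2) = fun x => 2^-1 * (partial j u x * partial j u x)); last first.
    by apply/funext => z; rewrite mulrC expr2.
  rewrite partialZ; last exact: tp_mul.
  rewrite (partialM _ _ (tu1 j) (tu1 j)) (partialM _ _ (tu1 i) (tu1 j)) (tp_partialC i j x tu).
  move: (partial i u x) (partial j u x) (w i x) (partial j (partial i u) x) (partial j (partial j u) x) => *.
  by field.
have B i j : `|tint (fun x => w i x * (partial i u x * - partial j (partial j u) x))| <= A * (D i + 2 * D j) / 2.
  rewrite E; apply: (le_trans (ler_normB _ _)).
  have b1 : `|tint (fun x => partial i u x * partial j u x * dw j i x)| <= tint (fun x => A * ((partial i u x ^+ 2 + partial j u x ^+ 2) / 2)).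
    apply: ae_norm_tint_le.
    - by apply: idw; exact: tp_mul.
    - apply: ti; apply: tpZ; apply: (@eq_tp _ _ (fun x => 2^-1 * (partial i u x ^+ 2 + partial j u x ^+ 2))).
        by move=> x; rewrite mulrC.
      by apply: tpZ; apply: tp_add; exact: tp_exp.
    - apply: filterS (dwA i j) => y h; rewrite normrM mulrC ler_pM//.
      move: (partial i u (pt y)) (partial j u (pt y)) => a b.
      rewrite ler_pdivlMr// normrM; have := sqr_ge0 (`|a| - `|b|).
      by rewrite -(real_normK (num_real a)) -(real_normK (num_real b)); nra.
  have b2 : `|tint (fun x => partial j u x ^+ 2 / 2 * dw i i x)| <= tint (fun x => A / 2 * partial j u x ^+ 2).
    apply: ae_norm_tint_le.
    - apply: idw; apply: (@eq_tp _ _ (fun x => 2^-1 * partial j u x ^+ 2)); first by move=> x; rewrite mulrC.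
      by apply: tpZ; exact: tp_exp.
    - by apply: ti; apply: tpZ; exact: tp_exp.
    - apply: filterS (dwA i i) => y h; rewrite normrM (ger0_norm (_ : 0 <= _ / 2)) ?divr_ge0 ?sqr_ge0//.
      move: (partial j u (pt y)) (dw i i (pt y)) h => a b h.
      by have := sqr_ge0 a; nra.
  rewrite tintZ in b2; last by apply: ti; exact: tp_exp.
  have e1 : tint (fun x => A * ((partial i u x ^+ 2 + partial j u x ^+ 2) / 2)) = A / 2 * (D i + D j).
    rewrite (@eq_tint _ _ _ (fun x => A / 2 * (partial i u x ^+ 2 + partial j u x ^+ 2))); last by move=> x; ring.
    by rewrite tintZ ?tintD//; try (apply: ti; try apply: tp_add; exact: tp_exp).
  rewrite e1 in b1; apply: (le_trans (lerD b1 b2)); rewrite -/(D j).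
  by rewrite alg.
apply: (@le_trans _ _ (\sum_i \sum_j A * (D i + 2 * D j) / 2)).
  apply: (le_trans (ler_norm_sum _ _ _)); apply: ler_sum => i _.
  rewrite (_ : tint _ = \sum_j tint (fun x => w i x * (partial i u x * - partial j (partial j u) x))).
    by apply: (le_trans (ler_norm_sum _ _ _)); apply: ler_sum => j _; exact: B.
  rewrite -tint_sum.
    by apply: eq_tint => x; rewrite -!mulr_sumr sumrN.
  move=> j; apply: (@eq_tintegrable _ _ (fun x => (partial i u x * - partial j (partial j u) x) * w i x)).
    by move=> x; rewrite mulrC.
  by apply: iw; apply: tp_mul => //; exact: tpN.
rewrite -tp_dirichlet// -/(D _).
rewrite (sum_sum_pair A D).
have S0 : 0 <= \sum_j D j by exact: sumr_ge0.
(* The double sum carries the factor [3 / 2], rounded up to 2. *)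
rewrite -/(\sum_j D j); have : 0 <= A * d%:R * \sum_j D j by rewrite !mulr_ge0.
by lra.
Qed.

(** One factor at a time: the mollified [g] keeps the bound [B], so [m] may replace its
    mollification at a cost that vanishes in the mean; [conv_K_weak] does the rest. *)
Lemma conv_K_weak2 w g m (B c : R) : L1 g -> {ae mu, forall y : cell, `|g (pt y)| <= B} -> L1 m ->
  tperiodic w -> tmeasurable w -> (forall x, `|w x| <= c) -> 0 <= B ->
  (fun n => tint (fun x => w x * (conv (K n) g x * conv (K n) m x))) @ \oo --> tint (fun x => w x * (g x * m x)).
Proof.
move=> Lg gB Lm pw mw wc B0; have c0 : 0 <= c by exact: le_trans (normr_ge0 _) (wc 0).
have Lwm : L1 (fun x => w x * m x) by split; [apply: periodicM => //; exact: Lm.1|exact: tintegrableM Lm.2 mw wc].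
have LKg n := L1_conv_tp (tp_K (R := R) (d := d) n) Lg.
have LKm n := L1_conv_tp (tp_K (R := R) (d := d) n) Lm.
have iM n (h : vec -> R) : L1 h -> tintegrable (fun x => w x * (conv (K n) g x * h x)).
  move=> Lh; apply: (@eq_tintegrable _ _ (fun x => (w x * conv (K n) g x) * h x)); first by move=> x; rewrite mulrA.
  apply: (@tintegrableM _ _ _ _ (c * B)); [exact: Lh.2|by apply: tmeasurableM => //; exact: L1_measurable|].
  by move=> x; rewrite normrM ler_pM//; exact: conv_K_ae_bound.
have cv1 := conv_K_weak Lg gB Lwm.
have cv2 : (fun n => tint (fun x => w x * (conv (K n) g x * (conv (K n) m x - m x)))) @ \oo --> (0 : R).
  apply/cvgrPdist_le => e e0; have p1 : 0 < c * B + 1 by rewrite ltr_wpDl// mulr_ge0.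
  have := conv_K_L1 Lm => /cvgrPdist_lt /(_ _ (divr_gt0 e0 p1)); apply: filterS => n.
  rewrite !sub0r !normrN ger0_norm => [Hn|]; last exact: tint_ge0.
  have Ld := L1B (LKm n) Lm; have id := tintegrable_norm Ld.2.
  apply: (@le_trans _ _ (tint (fun x => c * B * `|conv (K n) m x - m x|))).
    apply: norm_tint_le; [exact: (iM n _ Ld)|exact: tintegrableZ|].
    move=> x; rewrite !normrM mulrA ler_wpM2r// ler_pM//; exact: conv_K_ae_bound.
  rewrite tintZ//; apply: (@le_trans _ _ (c * B * (e / (c * B + 1)))).
    by rewrite ler_wpM2l ?mulr_ge0// ltW.
  by rewrite mulrCA ger_pMr// ler_pdivrMr// mul1r lerDl.
have e1 : tint (fun x => g x * (w x * m x)) = tint (fun x => w x * (g x * m x)).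
  by apply: eq_tint => x; rewrite mulrCA.
rewrite -e1 -[X in _ --> X]add0r.
rewrite (_ : (fun n => _) = fun n => tint (fun x => w x * (conv (K n) g x * (conv (K n) m x - m x))) +
  tint (fun x => conv (K n) g x * (w x * m x))); first by apply: cvgD; [exact: cv2|exact: cv1].
apply/funext => n.
rewrite -tintD; [|exact: (iM n _ (L1B (LKm n) Lm))|].
  by apply: eq_tint => x; rewrite mulrBr mulrBr; ring.
apply: (@eq_tintegrable _ _ (fun x => w x * (conv (K n) g x * m x))); first by move=> x; rewrite mulrCA.
exact: (iM n _ Lm).
Qed.

Variables (V : vec -> R) (G : vec -> vec).
Hypotheses (hV : coulomb_potential V) (hG : weak_gradient V G).

(** The constant in [laplacian_W] disappears because [m] has mean zero. *)
Lemma laplacian_W_conv n m x : L1 m -> tint m = 0 -> - laplacian (conv (W V n) m) x = conv (K n) m x.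
Proof.
move=> Lm m0; rewrite laplacian_conv//; last exact: tp_W.
rewrite /Defs.conv (@eq_tint _ _ _ (fun y => m y - K n (x - y) * m y)).
  by rewrite tintB ?m0 ?sub0r ?opprK//; [exact: Lm.2|exact: tp_conv_integrable (tp_K n) Lm].
by move=> y; rewrite (laplacian_W hV); ring.
Qed.

(** Limit of [tp_stress_bound] for [u = conv (W V n) m]. The bound [B] justifies the passage to the
    limit and leaves no trace in the conclusion. *)
Lemma stress_bound m (w : 'I_d -> vec -> R) (dw : 'I_d -> 'I_d -> vec -> R) L A B c : 0 <= L -> 0 <= A -> 0 <= B ->
  L1 m -> tint m = 0 ->
  (forall j, {ae mu, forall y : cell, `|conv (Gj G j) m (pt y)| <= B}) ->
  {ae mu, forall y : cell, `|conv V m (pt y)| <= B} ->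
  (forall i, L1 (w i)) -> (forall i x, `|w i x| <= c) -> (forall i y z, `|w i y - w i z| <= L * `|y - z|) ->
  (forall i j, {ae mu, forall y : cell, dq (w i) (evec j) (pt y) @ \oo --> dw j i (pt y)}) ->
  (forall i j, tmeasurable (dw j i)) ->
  (forall i j, {ae mu, forall y : cell, `|dw j i (pt y)| <= A}) ->
  `|\sum_i tint (fun x => w i x * (conv (Gj G i) m x * m x))| <= 2 * d%:R * A * tint (fun x => conv V m x * m x)
  /\ 0 <= tint (fun x => conv V m x * m x).
Proof.
move=> L0 A0 B0 Lm m0 GB VB Lw wc wL wd mdw dwA.
have tu n : tp (conv (W V n) m) by apply: tp_conv Lm; exact: tp_W.
have LG j : L1 (conv (Gj G j) m) by have [] := L1_conv (L1_G hG j) Lm.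
have LV : L1 (conv V m) by have [] := L1_conv (L1_V hV) Lm.
have uE n x : conv (W V n) m x = conv (K n) (conv V m) x by rewrite (conv_KV hV).
have duE n j x : partial j (conv (W V n) m) x = conv (K n) (conv (Gj G j) m) x.
  by rewrite partial_conv ?(conv_KG hV hG)//; exact: tp_W.
have cD : (fun n => tint (fun x => conv (W V n) m x * - laplacian (conv (W V n) m) x)) @ \oo --> tint (fun x => conv V m x * m x).
  have := @conv_K_weak2 (fun=> 1) _ m B 1 LV VB Lm.
  rewrite [X in _ --> X](@eq_tint _ _ _ (fun x => conv V m x * m x)); last by move=> x; rewrite mul1r.
  rewrite (_ : (fun n => tint (fun x => 1 * _)) = fun n => tint (fun x => conv (W V n) m x * - laplacian (conv (W V n) m) x)).
    by apply => //; [exact: tmeasurable_cst|move=> x; rewrite normr1].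
  by apply/funext => n; apply: eq_tint => x; rewrite mul1r uE laplacian_W_conv.
have cN : (fun n => \sum_i tint (fun x => w i x * (partial i (conv (W V n) m) x * - laplacian (conv (W V n) m) x))) @ \oo -->
    \sum_i tint (fun x => w i x * (conv (Gj G i) m x * m x)).
  rewrite (_ : (fun n => _) = fun n => \sum_i tint (fun x => w i x * (conv (K n) (conv (Gj G i) m) x * conv (K n) m x))).
    apply: cvg_finsum => i; exact: (conv_K_weak2 (LG i) (GB i) Lm (Lw i).1 (L1_measurable (Lw i)) (wc i) B0).
  apply/funext => n; apply: eq_bigr => i _; apply: eq_tint => x.
  by rewrite duE laplacian_W_conv.
split.
  apply: (ler_cvg_to (cvg_norm cN) (cvgM (cvg_cst (2 * d%:R * A)) cD)); apply: nearW => n /=.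
  exact: tp_stress_bound (tu n) L0 A0 Lw wL wd mdw dwA.
rewrite -(cvg_lim _ cD)//; apply: limr_ge; first by apply/cvg_ex; eexists; exact: cD.
by apply: nearW => n; exact: dirichlet_ge0.
Qed.

End commutator.

(** * Boundedness of the force *)

Section force.
Context {R : realType} {d : nat}.
Local Notation vec := 'rV[R]_d.
Local Notation cell := (d.-tuple (measurableTypeR R)).
Local Notation mu := (torus R d).
Local Notation tperiodic := Defs.periodic.
Local Notation conv := Defs.conv.
Implicit Types (u f g k q r : vec -> R).

Lemma tp_conv_ae_norm_le k g b x : tp k -> L1 g -> {ae mu, forall y : cell, `|g (pt y)| <= b} ->
  `|conv k g x| <= tint (fun y => `|k y|) * b.
Proof.
move=> tk Lg gb; have ik := tintegrable_norm (tp_integrable tk).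
have pk : tperiodic (fun y => `|k y|) by move=> i y; rewrite (tp_periodic tk).
have mk := tmeasurable_norm (tp_measurable tk).
rewrite -(tint_reflect x mk pk) mulrC -tintZ; last by apply: tintegrable_norm; apply: tp_integrable; exact: tp_reflect.
apply: ae_norm_tint_le; first exact: tp_conv_integrable.
  by apply: tintegrableZ; apply: tintegrable_norm; apply: tp_integrable; exact: tp_reflect.
by apply: filterS gb => y gy; rewrite normrM mulrC ler_wpM2r.
Qed.

(** Above the level [lam] the power [s]^ (1 - a)[is at most]lam [^ (1 - a)]. It replaces Hölder's
    inequality. *)
Lemma split_level a (s lam : R) : 1 < a -> 0 < lam -> 0 <= s -> s <= lam + s `^ a * lam `^ (1 - a).
Proof.
move=> a1 l0 s0; have [sl|ls] := lerP s lam.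
  by rewrite (le_trans sl)// lerDl mulr_ge0// powR_ge0.
have s_gt0 : 0 < s by exact: lt_trans ls.
apply: (@le_trans _ _ (s `^ a * lam `^ (1 - a))); last by rewrite lerDr ltW.
have -> : s = s `^ a * s `^ (1 - a).
  by rewrite -powRD ?(gt_eqF s_gt0) ?implybT// addrCA subrr addr0 powRr1.
rewrite -powRD ?(gt_eqF s_gt0) ?implybT// addrCA subrr addr0 powRr1//.
rewrite [leLHS](_ : s = s `^ a * s `^ (1 - a)); last first.
  by rewrite -powRD ?(gt_eqF s_gt0) ?implybT// addrCA subrr addr0 powRr1.
rewrite ler_wpM2l ?powR_ge0// -(opprB a 1) !powRN lef_pV2 ?posrE ?powR_gt0//.
by rewrite ge0_ler_powR ?nnegrE ?(ltW l0) ?(ltW s_gt0) ?(ltW ls)// subr_ge0 ltW.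
Qed.

(** The part of the density below [lam] is paired with the L1 norm of the kernel, the part above
    with its maximum; [lam] is left free. *)
Lemma conv_split_le k r a lam e1 e2 Na x : 1 < a -> 0 < lam -> tp k -> 0 <= e2 ->
  tint (fun y => `|k y|) <= e1 -> (forall y, `|k y| <= e2) ->
  L1 r -> (forall y, 0 <= r y) -> tintegrable (fun y => r y `^ a) -> tint (fun y => r y `^ a) <= Na ->
  `|conv k r x| <= lam * e1 + e2 * (lam `^ (1 - a) * Na).
Proof.
move=> a1 l0 tk e20 ke1 ke2 Lr r0 ira rNa.
have pk : tperiodic (fun y => `|k y|) by move=> i y; rewrite (tp_periodic tk).
have mk := tmeasurable_norm (tp_measurable tk).
have ik : tintegrable (fun y => `|k (x - y)|).
  by apply: tintegrable_norm; apply: tp_integrable; exact: tp_reflect.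
apply: (@le_trans _ _ (tint (fun y => lam * `|k (x - y)| + e2 * (lam `^ (1 - a) * r y `^ a)))).
  apply: norm_tint_le; first exact: tp_conv_integrable.
    by apply: tintegrableD; [exact: tintegrableZ|apply: tintegrableZ; exact: tintegrableZ].
  move=> y; rewrite normrM (ger0_norm (r0 y)).
  apply: (@le_trans _ _ (`|k (x - y)| * (lam + r y `^ a * lam `^ (1 - a)))).
    by rewrite ler_wpM2l// split_level.
  rewrite mulrDr [lam * _]mulrC lerD2l [lam `^ _ * _]mulrC ler_wpM2r// mulr_ge0// powR_ge0//.
rewrite tintD; [|exact: tintegrableZ|apply: tintegrableZ; exact: tintegrableZ].
rewrite !tintZ//; last exact: tintegrableZ.
rewrite (tint_reflect x mk pk); apply: lerD; first by rewrite ler_wpM2l// ltW.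
by rewrite ler_wpM2l// ler_wpM2l// powR_ge0.
Qed.

(** Discrete form of the integral of [x^(-1-e)]: with [x = n + 2] it amounts to
    [(1 - 1/x)^(-e) >= 1 + e/x], from [expR u >= 1 + u] and [ln (1 + u) <= u]. *)
Lemma powR_telescope (e : R) n : 0 < e ->
  n.+2%:R `^ (- (1 + e)) <= e^-1 * (n.+1%:R `^ (- e) - n.+2%:R `^ (- e)).
Proof.
move=> e0; rewrite ler_pdivlMl//.
set x : R := n.+2%:R; have x0 : 0 < x by rewrite ltr0n.
have xn : n.+1%:R = x * (1 - x^-1).
  by rewrite mulrBr mulr1 mulfV ?gt_eqF// /x -[n.+2%:R]natr1 addrK.
have i1 : x^-1 < 1 by rewrite invf_lt1// ltr1n.
have y0 : 0 < 1 - x^-1 by rewrite subr_gt0.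
rewrite xn powRM ?(ltW x0) ?(ltW y0)//.
rewrite opprD powRD ?(gt_eqF x0) ?implybT// powR_inv1 ?(ltW x0)//.
have H : e * x^-1 <= (1 - x^-1) `^ (- e) - 1.
  rewrite lerBrDr /powR gt_eqF//; apply: le_trans (expR_ge1Dx _).
  rewrite addrC lerD2l mulNr -mulrN ler_wpM2l ?(ltW e0)// lerNr.
  by apply: (le_trans (le_ln1Dx _)); rewrite ?ltrN2.
have := ler_wpM2l (powR_ge0 x (- e)) H; rewrite mulrBr mulr1; apply: le_trans.
by rewrite mulrC -mulrA mulrC -mulrA.
Qed.

Lemma inv_sqr_telescope n : ((n.+2%:R : R) ^+ 2)^-1 <= n.+1%:R^-1 - n.+2%:R^-1.
Proof.
have -> : n.+1%:R^-1 - n.+2%:R^-1 = (n.+1%:R * n.+2%:R : R)^-1.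
  have := ltr0n R n.+1; rewrite ltnS leq0n -[n.+2%:R]natr1; move: (n.+1%:R : R) => y y0.
  by field; rewrite !gt_eqF// addr_gt0.
by rewrite lef_pV2 ?posrE ?exprn_gt0 ?mulr_gt0 ?ltr0n// expr2 ler_wpM2r// ler_nat.
Qed.

Variable a : R.
Hypotheses (d2 : (2 <= d)%N) (ha : d%:R < a).

(** The increments of the mollified force decay like [n^(-1-eps)] up to an error of order [1 / n^2].
    Positivity of [eps], which makes them summable, is the condition [a > d]. *)
Let eps : R := 2^-1 - d%:R / (2 * a).

Lemma a_gt1 : 1 < a.
Proof. by apply: le_lt_trans ha; rewrite -[1]/(1%:R) ler_nat; case: d d2. Qed.

Lemma eps_gt0 : 0 < eps.
Proof.
have a1 := a_gt1; have a0 : 0 < a by exact: lt_trans a1.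
by rewrite /eps subr_gt0 ltr_pdivrMr ?mulr_gt0// mulrA mulVf ?mul1r// pnatr_eq0.
Qed.

(** The derivative of [K n.+1] has L1 norm of order [N^(1/2)] and maximum of order [N^((d+1)/2)];
    the prefactor is of order [N^(-2)]. Both terms of [conv_split_le] then become multiples of the
    same power of [N]. *)
Lemma kernel_step_le n j r Na x : 0 <= Na -> L1 r -> (forall y, 0 <= r y) ->
  tintegrable (fun y => r y `^ a) -> tint (fun y => r y `^ a) <= Na ->
  (4 * pi ^+ 2 * n.+1%:R ^+ 2)^-1 * `|conv (partial j (K n.+1)) r x| <=
  2 ^+ d * (1 + Na) * n.+1%:R `^ (- (1 + eps)).
Proof.
have alg1 (M l s p : R) : M != 0 -> p != 0 ->
  (4 * p ^+ 2 * M ^+ 2)^-1 * (l * (2 * p * s)) = (2 * p)^-1 * ((M ^+ 2)^-1 * (l * s)).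
  by move=> M0 p0; field; rewrite M0 p0.
have alg2 (M b s l p e : R) : M != 0 -> p != 0 ->
  (4 * p ^+ 2 * M ^+ 2)^-1 * (4 * p * M * (b * s) * (l * e)) = b / p * e * ((M ^+ 2)^-1 * (M * s * l)).
  by move=> M0 p0; field; rewrite M0 p0.
move=> Na0 Lr r0 ira rNa; set N : R := n.+1%:R.
have N0 : 0 < N by rewrite ltr0n.
have N_neq0 : N != 0 by rewrite gt_eqF.
have a1 := a_gt1; have a0 : 0 < a by exact: lt_trans a1.
have a_neq0 : a != 0 by rewrite gt_eqF.
have pi0 := @pi_gt0 R; have pi2 : 2 <= pi :> R by exact: pi_ge2.
(* The level at which the two terms have the same order: both exponents equal
   [-3/2 + d/(2a) = -(1 + eps)]. *)
pose lam := N `^ (d%:R / (2 * a)).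
have l0 : 0 < lam by rewrite powR_gt0.
have s0 : 0 <= Num.sqrt N by exact: sqrtr_ge0.
have tpK := tp_partial j (tp_K (R := R) (d := d) n.+1).
have e20 : 0 <= 4 * pi * N * (2 * Num.sqrt N) ^+ d.-1.
  by rewrite !mulr_ge0 ?exprn_ge0 ?mulr_ge0// ltW.
have := conv_split_le x a1 l0 tpK e20 (tint_norm_partial_K n j) (norm_partial_K_le n j) Lr r0 ira rNa.
set c := `|conv _ _ _| => H.
have c4 : 0 < 4 * pi ^+ 2 * N ^+ 2 by rewrite !mulr_gt0 ?exprn_gt0.
have PD s t : N `^ (s + t) = N `^ s * N `^ t by rewrite powRD// N_neq0 implybT.
pose P := N `^ (- (1 + eps)).
have P0 : 0 < P by rewrite powR_gt0.
have sqrtE : Num.sqrt N = N `^ (2^-1) by rewrite powR12_sqrt// ltW.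
have N2 : (N ^+ 2)^-1 = N `^ (- 2%:R) by rewrite powR_invn// ltW.
have E1 : (N ^+ 2)^-1 * (lam * Num.sqrt N) = P.
  rewrite N2 sqrtE /lam -!PD /P /eps; congr (_ `^ _); field; exact: a_neq0.
have dE : d%:R = 1 + d.-1%:R :> R by rewrite -[1]/(1%:R) -natrD; case: d d2.
have E2 : (N ^+ 2)^-1 * (N * Num.sqrt N ^+ d.-1 * lam `^ (1 - a)) = P.
  rewrite N2 sqrtE -powR_mulrn ?powR_ge0// -powRrM /lam -powRrM.
  rewrite -{2}(powRr1 (ltW N0)) -!PD /P /eps; congr (_ `^ _).
  by rewrite dE; field; exact: a_neq0.
apply: (@le_trans _ _ ((2 * pi)^-1 * P + 2 ^+ d.-1 / pi * Na * P)).
  apply: (@le_trans _ _ ((4 * pi ^+ 2 * N ^+ 2)^-1 * (lam * (2 * pi * Num.sqrt N) + 4 * pi * N * (2 * Num.sqrt N) ^+ d.-1 * (lam `^ (1 - a) * Na)))).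
    by rewrite ler_wpM2l// invr_ge0 ltW.
  rewrite mulrDr exprMn le_eqVlt; apply/orP; left; apply/eqP; congr (_ + _).
    by rewrite -E1; apply: alg1; rewrite ?gt_eqF.
  by rewrite -E2; apply: alg2; rewrite ?gt_eqF.
have -> : 2 ^+ d * (1 + Na) * P = 2 ^+ d * P + 2 ^+ d * Na * P by ring.
have d20 : 1 <= 2 ^+ d :> R by rewrite exprn_ege1// ler1n.
apply: lerD.
  rewrite ler_wpM2r ?(ltW P0)//; apply: le_trans d20.
  by rewrite invf_le1 ?mulr_gt0//; lra.
rewrite -!mulrA ler_pM ?exprn_ge0 ?mulr_ge0 ?invr_ge0 ?(ltW pi0) ?(ltW P0)//.
  by rewrite ler_eXn2l// ?ltr1n// leq_pred.
by rewrite ler_piMl ?mulr_ge0 ?(ltW P0)// invf_le1//; lra.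
Qed.

Variables (V : vec -> R) (G : vec -> vec).
Hypotheses (hV : coulomb_potential V) (hG : weak_gradient V G).

(** All derivatives are moved onto [k], so that the Laplacian meets the potential; of
    [tint (partial j k) - partial j k] only the second term remains. *)
Lemma conv_laplacian_G j k x : tp k -> conv (laplacian k) (Gj G j) x = - partial j k x.
Proof.
move=> tk; have LV := L1_V hV.
rewrite -(conv_partial_V hV hG)//; last exact: tp_laplacian.
have -> : partial j (laplacian k) = laplacian (partial j k).
  apply/funext => z; rewrite /laplacian partial_sum => [|i _]; last by do 2 apply: tp_partial.
  apply: eq_bigr => i _; rewrite (tp_partialC _ _ _ (tp_partial i tk)).
  have -> : partial j (partial i k) = partial i (partial j k) by apply/funext => y; exact: (tp_partialC j i y tk).
  by [].
rewrite -laplacian_conv//; last exact: tp_partial.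
by rewrite (laplacian_conv_V hV) ?tint_partial ?sub0r//; exact: tp_partial.
Qed.

(* kap_n - kap_{n+1} is a multiple of kap_{n+1}'', and K_{n+1} * laplacian V only
   differs from - K_{n+1} by a constant: the leading part of this increment is
   (4 pi^2 (n+1)^2)^-1 d_j K_{n+1} * r, which sees r only. *)
Lemma conv_KG_step n j r Na b x : 0 <= Na -> 0 <= b -> L1 r -> (forall y, 0 <= r y) ->
  tintegrable (fun y => r y `^ a) -> tint (fun y => r y `^ a) <= Na ->
  {ae mu, forall y : cell, `|conv (Gj G j) r (pt y)| <= b} ->
  `|conv (K n) (conv (Gj G j) r) x - conv (K n.+1) (conv (Gj G j) r) x| <=
    4 ^+ d.+1 * b * (n.+1%:R ^+ 2)^-1 + 2 ^+ d * (1 + Na) * n.+1%:R `^ (- (1 + eps)).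
Proof.
move=> Na0 b0 Lr r0 ira rNa gb; set g := conv (Gj G j) r.
have Lg : L1 g by have [] := L1_conv (L1_G hG j) Lr.
pose c : R := (4 * pi ^+ 2 * n.+1%:R ^+ 2)^-1.
have c0 : 0 <= c by rewrite invr_ge0 !mulr_ge0 ?exprn_ge0// pi_ge0.
have tK m := tp_K (R := R) (d := d) m.
have tl := tp_laplacian (tK n.+1).
have tk : tp (fun y : vec => K n y - K n.+1 y - c * laplacian (K n.+1) y) by exact: (tpB (tpB (tK n) (tK n.+1)) (tpZ c tl)).
have E : conv (K n) g x - conv (K n.+1) g x =
    conv (fun y : vec => K n y - K n.+1 y - c * laplacian (K n.+1) y) g x - c * conv (partial j (K n.+1)) r x.
  have -> : c * conv (partial j (K n.+1)) r x = - (c * conv (laplacian (K n.+1)) g x).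
    have [e _ le] := tp_bounded tl.
    rewrite (conv_assoc (tp_periodic tl) (tp_measurable tl) le x (L1_G hG j) Lr).
    rewrite (_ : conv (laplacian (K n.+1)) (Gj G j) = fun y => -1 * partial j (K n.+1) y); last first.
      by apply/funext => y; rewrite conv_laplacian_G ?mulN1r.
    rewrite -mulrN; congr (_ * _); rewrite -mulN1r /Defs.conv -tintZ.
      by apply: eq_tint => y; ring.
    apply: (@eq_tintegrable _ _ (fun y => -1 * (partial j (K n.+1) (x - y) * r y))).
      by move=> y; rewrite mulrA.
    by apply: tintegrableZ; apply: tp_conv_integrable Lr; exact: tp_partial.
  rewrite opprK /Defs.conv -tintZ; last exact: tp_conv_integrable.
  rewrite -tintB; [|exact: tp_conv_integrable (tK n) Lg|exact: tp_conv_integrable (tK n.+1) Lg].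
  rewrite -tintD; [|exact: (tp_conv_integrable x tk Lg)|by apply: tintegrableZ; exact: tp_conv_integrable].
  by apply: eq_tint => y; ring.
rewrite E; apply: (le_trans (ler_normB _ _)); apply: lerD.
  apply: (le_trans (tp_conv_ae_norm_le x tk Lg gb)).
  by rewrite mulrAC ler_wpM2r// tint_norm_K_sub_lap.
rewrite normrM (ger0_norm c0); exact: kernel_step_le.
Qed.

(* Sum the increments from n0 = 2 * 4^(d+1) on: the error terms add up to b / 2. *)
Lemma conv_KG_bound j : exists2 A : R -> R, (forall Na, 0 <= Na -> 0 <= A Na) &
  forall r Na b n x, 0 <= Na -> 0 <= b -> L1 r -> (forall y, 0 <= r y) -> tint r = 1 ->
  tintegrable (fun y => r y `^ a) -> tint (fun y => r y `^ a) <= Na ->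
  {ae mu, forall y : cell, `|conv (Gj G j) r (pt y)| <= b} ->
  `|conv (K n) (conv (Gj G j) r) x| <= A Na + b / 2.
Proof.
have tW n : tp (partial j (W V n)) by apply: tp_partial; exact: tp_W.
have H n : exists c, 0 <= c /\ forall x, `|partial j (W V n) x| <= c.
  by have [c c0 hc] := tp_bounded (tW n); exists c.
have [c hc] := choice H; have c0 n : 0 <= c n by case: (hc n).
(* It is [n0.+1] that equals [2 * 4^(d+1)]: the error terms from that index on telescope to at most
   [4^(d+1) * b / n0.+1]. *)
pose n0 := (2 * 4 ^ d.+1).-1.
have n0E : (n0.+1%:R : R) = 2 * 4 ^+ d.+1.
  by rewrite /n0 prednK ?muln_gt0 ?expn_gt0// natrM natrX.
(* The finitely many initial indices: [partial j (W V n)] is bounded and [r] has integral 1. *)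
pose c1 := \sum_(i < n0.+2) c i.
have c10 : 0 <= c1 by apply: sumr_ge0.
have e0 := eps_gt0.
exists (fun Na => c1 + 2 ^+ d * (1 + Na) * eps^-1).
  by move=> Na Na0; rewrite addr_ge0// !mulr_ge0 ?invr_ge0 ?exprn_ge0 ?(ltW e0)// addr_ge0.
move=> r Na b n x Na0 b0 Lr r0 r1 ira rNa gb; set g := conv (Gj G j) r.
have ie0 : 0 <= eps^-1 by rewrite invr_ge0 ltW.
set C2 := 2 ^+ d * (1 + Na); have C20 : 0 <= C2 by rewrite mulr_ge0 ?exprn_ge0 ?addr_ge0.
have small m : (m <= n0.+1)%N -> `|conv (K m) g x| <= c1.
  move=> mn; rewrite (conv_KG hV hG)//.
  have [_ cm] := hc m; apply: (le_trans (conv_bounded_norm (tp_measurable (tW m)) cm x Lr)).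
  rewrite (@eq_tint _ _ _ r) ?r1 ?mulr1; last by move=> y; rewrite ger0_norm.
  have mn' : (m < n0.+2)%N by rewrite ltnS.
  by rewrite /c1 (bigD1 (Ordinal mn'))//= lerDl sumr_ge0.
have triR (u v : R) : `|v| <= `|u| + `|u - v| by rewrite -[in leLHS](subKr u v) ler_normB.
(* The bound obtained by telescoping the increments between [n0.+1] and [m]. *)
pose Q (m : nat) := c1 + C2 * (eps^-1 * (n0.+1%:R `^ (- eps) - m%:R `^ (- eps))) + 4 ^+ d.+1 * b * (n0.+1%:R^-1 - m%:R^-1).
have large (k : nat) : `|conv (K (n0.+1 + k)) g x| <= Q (n0.+1 + k)%N.
  elim: k => [|k IH].
    by rewrite addn0 /Q !subrr !mulr0 !addr0; exact: small.
  rewrite addnS addSn; rewrite addSn in IH; set m := (n0 + k)%N in IH *.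
  have st := conv_KG_step m.+1 x Na0 b0 Lr r0 ira rNa gb; rewrite -/g in st.
  have t1 : C2 * m.+2%:R `^ (- (1 + eps)) <= C2 * (eps^-1 * (m.+1%:R `^ (- eps) - m.+2%:R `^ (- eps))).
    by rewrite ler_wpM2l// powR_telescope.
  have t2 : 4 ^+ d.+1 * b * (m.+2%:R ^+ 2)^-1 <= 4 ^+ d.+1 * b * (m.+1%:R^-1 - m.+2%:R^-1).
    by rewrite ler_wpM2l ?mulr_ge0 ?exprn_ge0// inv_sqr_telescope.
  have tri : `|conv (K m.+2) g x| <= `|conv (K m.+1) g x| + `|conv (K m.+1) g x - conv (K m.+2) g x|.
    exact: triR.
  have -> : Q m.+2 = Q m.+1 + (4 ^+ d.+1 * b * (m.+1%:R^-1 - m.+2%:R^-1) +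
     C2 * (eps^-1 * (m.+1%:R `^ (- eps) - m.+2%:R `^ (- eps)))) by rewrite /Q; ring.
  apply: (le_trans tri); apply: lerD => //; apply: (le_trans st); exact: lerD.
have [ns|nl] := leqP n n0.+1.
  apply: (le_trans (small n ns)); rewrite -addrA lerDl addr_ge0//; first exact: mulr_ge0.
  exact: divr_ge0.
rewrite -(subnKC (ltnW nl)); apply: (le_trans (large _)); rewrite /Q; set m := (_ + _)%N.
have p1 : n0.+1%:R `^ (- eps) <= 1 :> R.
  have h : (n0.+1%:R : R) `^ 0 <= n0.+1%:R `^ eps by apply: ler_powR; rewrite ?ler1n// ltW.
  by rewrite powRr0 in h; rewrite powRN invf_le1 ?powR_gt0 ?ltr0n.
have p2 : 0 <= (m%:R : R) `^ (- eps) by exact: powR_ge0.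
apply: lerD.
  rewrite lerD2l ler_wpM2l// -[leRHS]mulr1 ler_wpM2l//; lra.
apply: (@le_trans _ _ (4 ^+ d.+1 * b * n0.+1%:R^-1)).
  by rewrite ler_wpM2l ?mulr_ge0 ?exprn_ge0// gerBl invr_ge0.
rewrite n0E le_eqVlt; apply/orP; left; apply/eqP; field.
by rewrite expf_neq0// pnatr_eq0.
Qed.

(* The bound b is halved at each use of conv_KG_bound, so it disappears in the
   limit; only its finiteness is used. *)
Lemma force_bound j : exists2 A : R -> R, (forall Na, 0 <= Na -> 0 <= A Na) &
  forall r Na b, 0 <= Na -> 0 <= b -> L1 r -> (forall y, 0 <= r y) -> tint r = 1 ->
  tintegrable (fun y => r y `^ a) -> tint (fun y => r y `^ a) <= Na ->
  {ae mu, forall y : cell, `|conv (Gj G j) r (pt y)| <= b} ->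
  {ae mu, forall y : cell, `|conv (Gj G j) r (pt y)| <= A Na}.
Proof.
have [A A0 H] := conv_KG_bound j; exists (fun Na => 2 * A Na).
  by move=> Na /A0 h; rewrite mulr_ge0.
move=> r Na b Na0 b0 Lr r0 r1 ira rNa gb.
have Lg : L1 (conv (Gj G j) r) by have [] := L1_conv (L1_G hG j) Lr.
apply: conv_K_bound => // n x.
have A0' := A0 _ Na0.
(* From the bound [2 A + b / 2^k] the next one is [A + (2 A + b / 2^k) / 2], of the same form with
   [k + 1]; [2 A] is the fixed point. *)
have it (k : nat) : {ae mu, forall y : cell, `|conv (Gj G j) r (pt y)| <= 2 * A Na + b / 2 ^+ k}.
  elim: k => [|k IH].
    by apply: filterS gb => y h; rewrite expr0 divr1 (le_trans h)// lerDr mulr_ge0.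
  have bk : 0 <= 2 * A Na + b / 2 ^+ k by rewrite addr_ge0 ?mulr_ge0 ?invr_ge0 ?exprn_ge0.
  have := conv_K_bound Lg (fun m z => H r Na _ m z Na0 bk Lr r0 r1 ira rNa IH).
  apply: filterS => y h; apply: (le_trans h); rewrite exprS invfM.
  by rewrite le_eqVlt; apply/orP; left; apply/eqP; field; rewrite expf_neq0// pnatr_eq0.
have bd (k : nat) : `|conv (K n) (conv (Gj G j) r) x| <= 2 * A Na + b / 2 ^+ k by exact: conv_K_ae_bound (it k).
have cv : (fun k : nat => 2 * A Na + b / 2 ^+ k) @ \oo --> 2 * A Na.
  rewrite -[X in _ --> X]addr0 -[X in _ --> _ + X](mulr0 b).
  apply: cvgD; first exact: cvg_cst.
  apply: cvgM; first exact: cvg_cst.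
  rewrite (_ : (fun k : nat => _) = fun k : nat => 2^-1 ^+ k); last by apply/funext => k; rewrite exprVn.
  by apply: cvg_expr; rewrite ger0_norm// invf_lt1// ltr1n.
rewrite -(cvg_lim _ cv)//; apply: limr_ge; first by apply/cvg_ex; eexists; exact: cv.
exact: nearW.
Qed.

End force.

(** * The energy estimate *)

Section pointwise.
Context {R : realType} {d : nat}.
Local Notation vec := 'rV[R]_d.
Local Notation eta := Defs.eta.
Implicit Types (P p a b g u w v : vec).

Lemma dotv_mulmxl v (A : 'M[R]_d) u : dotv (v *m A) u = \sum_i v 0 i * dotv (row i A) u.
Proof.
rewrite /dotv; under eq_bigr do rewrite mxE mulr_suml.
rewrite exchange_big; apply: eq_bigr => i _; rewrite mulr_sumr.
by apply: eq_bigr => j _; rewrite !mxE mulrA.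
Qed.

Lemma dotv_HvC p b u : dotv (Hv p b) u = dotv b (Hv p u).
Proof.
rewrite /Hv dotvBl dotvBr !dotvZl !dotvZr (dotvC b p); ring.
Qed.

(** [A] and [B] stand for the Jacobians of the two momenta and [C] for that of [vel \o p2]. The left
    side is the derivative of [eta] along the flow of [vel P], but [p] is transported by [vel p]:
    the discrepancy [(vel P - vel p) *m B] is what produces the Jacobian term, as the Hessian [Hv p]
    is symmetric. *)
Lemma eta_rate_algebra P p a b g1 g2 (A B C : 'M[R]_d) : a + vel P *m A = - g1 -> b + vel p *m B = - g2 ->
  (forall i j, C i j = Hv p (row i B) 0 j) ->
  (dotv (vel P - vel p) a - dotv (Hv p b) (P - p)) +
    \sum_j vel P 0 j * (dotv (vel P - vel p) (row j A) - dotv (Hv p (row j B)) (P - p)) =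
  dotv g2 (Hv p (P - p) - (vel P - vel p)) - dotv (vel P - vel p) (g1 - g2)
    - dotv (vel P - vel p) ((P - p) *m C^T).
Proof.
move=> hA hB hC; set w := vel P - vel p; set q := Hv p (P - p).
have -> : dotv w ((P - p) *m C^T) = dotv (w *m B) q.
  rewrite dotv_mulmxl; apply: eq_bigr => i _; rewrite -dotv_HvC; congr (_ * _).
  by rewrite mxE; apply: eq_bigr => j _; rewrite [X in _ * X]mxE hC mulrC.
have -> : \sum_j vel P 0 j * (dotv w (row j A) - dotv (Hv p (row j B)) (P - p)) =
    dotv w (vel P *m A) - dotv (vel P *m B) q.
  rewrite (dotvC w) !dotv_mulmxl -sumrB; apply: eq_bigr => j _.
  by rewrite dotv_HvC (dotvC w) mulrBr.
rewrite dotv_HvC -/q (_ : vel P *m B = vel p *m B + w *m B); last by rewrite -mulmxDl addrC subrK.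
have e1 : dotv w a = - dotv w g1 - dotv w (vel P *m A) by rewrite -dotvNr -hA dotvDr addrK.
have e2 : dotv b q = - dotv g2 q - dotv (vel p *m B) q by rewrite -dotvNl -hB dotvDl addrK.
rewrite e1 e2 (dotvDl (vel p *m B)) (dotvBr g2 q w) (dotvBr w g1) (dotvC g2 w).
by move: (dotv w g1) (dotv w g2) (dotv g2 q) => *; ring.
Qed.

Lemma differentiable_sum_fun (V : normedModType R) (W : normedModType R) (n : nat) (f : 'I_n -> V -> W) x :
  (forall i, differentiable (f i) x) -> differentiable (fun y => \sum_i f i y) x.
Proof.
move=> df; have := differentiable_sum df; congr (differentiable _ x).
by apply/funext => y; rewrite fct_sumE.
Qed.

Lemma differentiable_vel (V : normedModType R) (f : V -> vec) x : differentiable f x ->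
  differentiable (fun y => vel (f y)) x.
Proof.
move=> df.
have dc i : differentiable (fun y => f y 0 i) x.
  by apply: (@differentiable_comp _ _ _ _ f (fun z : vec => z 0 i)) => //; exact: differentiable_coord.
have dk : differentiable (fun y => kinetic (f y)) x.
  apply: (@differentiable_comp _ _ _ _ (fun y => 1 + dotv (f y) (f y)) Num.sqrt).
    apply: differentiableD; first exact: differentiable_cst.
    by apply: differentiable_sum_fun => i; apply: differentiableM.
  apply/derivable1_diffP; have p0 : 0 < 1 + dotv (f x) (f x) by rewrite ltr_wpDr// dotv_ge0.
  by have [] := is_derive1_sqrt p0.
rewrite (_ : (fun y => vel (f y)) = fun y => \sum_j (vel (f y) 0 j *: delta_mx 0 j)); last first.
  by apply/funext => y; exact: row_sum_delta.
apply: differentiable_sum_fun => j; apply: differentiableZl.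
rewrite (_ : (fun y => _) = (fun y => f y 0 j) * (fun y => (kinetic (f y))^-1)); last first.
  by apply/funext => y; rewrite velE.
by apply: differentiableM => //; apply: differentiableV => //; rewrite gt_eqF// kinetic_gt0.
Qed.

Lemma row_jacobian (f : vec -> vec) x i : differentiable f x -> row i ('J f x) = 'D_(evec i) f x.
Proof. by move=> df; rewrite rowE -deriveEjacobian. Qed.

Lemma jacobian_vel (f : vec -> vec) x i j : differentiable f x ->
  'J (vel \o f) x i j = Hv (f x) (row i ('J f x)) 0 j.
Proof.
move=> df; have dv : differentiable (vel \o f) x by exact: differentiable_vel df.
have dve : derivable (vel \o f) x (evec i) by exact: diff_derivable.
have dfe : derivable f x (evec i) by exact: diff_derivable.
have r1 := row_jacobian i dv; have r2 := row_jacobian i df.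
have -> : 'J (vel \o f) x i j = ('D_(evec i) (vel \o f) x) 0 j by rewrite -r1 [RHS]mxE.
rewrite r2; have [_ h1] := is_derive_row j dve.
have [_ h2] := is_derive_vel j (fun k => is_derive_row k dfe).
exact: (etrans (esym h1) h2).
Qed.

Lemma norm_row_jacobian_le (A : 'M[R]_d) i j : `|A i j| <= `|A|.
Proof. by rewrite [leRHS]mx_normrE; exact: (le_bigmax _ (fun ij : 'I_d * 'I_d => `|A ij.1 ij.2|) (i, j)). Qed.

End pointwise.

(** * Bounds extracted from the norms *)

Section norms.
Context {R : realType} {d : nat}.
Local Notation vec := 'rV[R]_d.
Local Notation cell := (d.-tuple (measurableTypeR R)).
Local Notation mu := (torus R d).
Local Notation leb := (@lebesgue_measure R).

Lemma Loo_time_ae T (N : R -> \bar R) : {ae leb, forall t, t \in `]0, T[ -> (N t <= Loo_time T N)%E}.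
Proof.
have := ess_sup_ge leb (N \_ `[0, T]); apply: filterS => t Ht tT.
apply: le_trans Ht; rewrite patchE mem_set//=; exact: subset_itv_oo_cc tT.
Qed.

Lemma Lnormoo_ae (f : cell -> R) : {ae mu, forall y, (`|f y|%:E <= Lnorm mu +oo%E (fun y => (f y)%:E))%E}.
Proof.
rewrite unlock (_ : (0 < mu [set: cell])%E); last by rewrite probability_setT lte01.
by have := ess_sup_ge mu (abse \o (fun y => (f y)%:E)); apply: filterS => y.
Qed.

Lemma W1oo_norm_ae (w : vec -> vec) m : (W1oo_norm w <= m%:E)%E ->
  {ae mu, forall y : cell, `|w (pt y)| <= m /\ `|'J w (pt y)| <= m}.
Proof.
rewrite /W1oo_norm ge_max => /andP[h1 h2].
apply: filterS2 (Lnormoo_ae (fun y => `|w (pt y)|)) (Lnormoo_ae (fun y => `|'J w (pt y)|)) => y e1 e2.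
by rewrite -2!lee_fin; split; [apply: le_trans h1; rewrite normr_id in e1|apply: le_trans h2; rewrite normr_id in e2].
Qed.

Lemma La_norm_integral a (f : vec -> R) m : 0 < a -> 0 <= m -> tmeasurable f -> (forall x, 0 <= f x) ->
  (La_norm a f <= m%:E)%E -> tintegrable (fun x => f x `^ a) /\ tint (fun x => f x `^ a) <= m `^ a.
Proof.
move=> a0 m0 mf f0; rewrite /La_norm unlock => H.
have mfa : tmeasurable (fun x => f x `^ a).
  by apply: (measurableT_comp (measurable_powR a)).
set I := (\int[mu]_x _)%E in H.
have IE : I = (\int[mu]_y (f (pt y) `^ a)%:E)%E.
  by apply: eq_integral => y _; rewrite gee0_abs ?lee_fin// poweR_EFin.
have I0 : (0 <= I)%E by apply: integral_ge0 => y _; exact: poweR_ge0.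
have Im : (I <= (m `^ a)%:E)%E.
  have -> : I = ((I `^ a^-1) `^ a)%E by rewrite -poweRrM mulVf ?gt_eqF// poweRe1.
  by rewrite -poweR_EFin; apply: gt0_ler_poweR; [exact: ltW|by rewrite in_itv/= poweR_ge0 leey
    |by rewrite in_itv/= lee_fin m0 leey|exact: H].
have it : tintegrable (fun x => f x `^ a).
  apply/integrableP; split; first exact/measurable_EFinP.
  under eq_integral do rewrite gee0_abs ?lee_fin ?powR_ge0//.
  by rewrite -IE (le_lt_trans Im)// ltry.
split => //; rewrite -lee_fin /tint /Rintegral fineK; last exact: integrable_fin_num.
by rewrite -IE.
Qed.

End norms.

(** * The rate of the energy at a fixed time *)

Section energy_estimate.
Context {R : realType} {d : nat}.
Local Notation vec := 'rV[R]_d.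
Local Notation cell := (d.-tuple (measurableTypeR R)).
Local Notation mu := (torus R d).
Local Notation leb := (@lebesgue_measure R).
Local Notation tperiodic := Defs.periodic.
Local Notation conv := Defs.conv.
Local Notation eta := Defs.eta.

Lemma sumr_const_ord n (x : R) : \sum_(i < n) x = n%:R * x.
Proof. by rewrite sumr_const card_ord mulr_natl. Qed.

Lemma conv_sub_ae (k f g : vec -> R) : L1 k -> L1 f -> L1 g ->
  {ae mu, forall y : cell, conv k (fun x => f x - g x) (pt y) = conv k f (pt y) - conv k g (pt y)}.
Proof.
move=> Lk Lf Lg; have [_ h1 _] := L1_conv Lk Lf; have [_ h2 _] := L1_conv Lk Lg.
by apply: filterS2 h1 h2 => y i1 i2; exact: conv_subr.
Qed.

Lemma tintegrable_prod3 (w g r : vec -> R) (c B : R) : tmeasurable w -> (forall x, `|w x| <= c) ->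
  L1 g -> {ae mu, forall y : cell, `|g (pt y)| <= B} -> L1 r -> tintegrable (fun x => w x * (g x * r x)).
Proof.
move=> mw wc Lg gB Lr; apply: (tintegrableM _ mw wc).
exact: tintegrableM_ae Lr.2 (L1_measurable Lg) gB.
Qed.

Variables (V : vec -> R) (G : vec -> vec).
Hypotheses (hV : coulomb_potential V) (hG : weak_gradient V G).
Variable (T : R).
Hypothesis T0 : 0 < T.

Section one.
Variables (rho0 : vec -> R) (p0 : vec -> vec) (rho : R -> vec -> R) (p : R -> vec -> vec).
Hypothesis sol : EP_solution G T rho0 p0 rho p.

Definition velf_dt i s x := Hv (p s x) ('D_1 (p ^~ x) s) 0 i.
Definition velf_dx i j s x := Hv (p s x) ('D_(evec j) (p s) x) 0 i.

Lemma velf_aediff i : aediff T (velf p i) (velf_dt i) (velf_dx i).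
Proof.
apply: filterS (EP_momentum sol) => -[t y] /= H tT.
have [dp _] := H tT; set x := pt y in dp *.
have [a b] := differentiable_slices dp.
have {}a : derivable (p ^~ x) t 1 by exact: a.
have {}b : differentiable (p t) x by exact: b.
split=> [|j].
  have h := @is_derive_vel R d _ (p ^~ x) t 1 _ i (fun k => is_derive_row k a).
  exact: (dq_cvg_is_derive h).
have c : derivable (p t) x (evec j) by exact: diff_derivable.
have h := @is_derive_vel R d _ (p t) x (evec j) _ i (fun k => is_derive_row k c).
exact: (dq_cvg_is_derive h).
Qed.

Lemma momentum_slice : {ae leb, forall s, s \in `]0, T[ -> {ae mu, forall y : cell,
  differentiable (p s) (pt y) /\
  'D_1 (p ^~ (pt y)) s + vel (p s (pt y)) *m 'J (p s) (pt y) = - convv G (rho s) (pt y)}}.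
Proof.
have H : {ae (leb \x mu)%E, forall z : measurableTypeR R * cell, z.1 \in `]0, T[ ->
    differentiable (p z.1) (pt z.2) /\
    'D_1 (p ^~ (pt z.2)) z.1 + vel (p z.1 (pt z.2)) *m 'J (p z.1) (pt z.2) = - convv G (rho z.1) (pt z.2)}.
  apply: filterS (EP_momentum sol) => -[t y] /= H tT; have [dp e] := H tT; split => //.
  by have [_ ] := differentiable_slices dp.
move: (ae_prod_slice H); apply: filterS => s Hs sT; apply: filterS Hs => y; exact.
Qed.

Lemma p_tmeasurable s i : s \in `[0, T] -> tmeasurable (fun x => p s x 0 i).
Proof.
have [L sL] : exists L, stl T L (fun s x => p s x 0 i).
  apply: (sol_stl sol (g := fun P => P 0 i) (c := 1)) => // P Q; rewrite mul1r.
  by have := norm_coord_le (P - Q) i; rewrite vecBE.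
by move=> sT; apply: tmeas_slice (stl_tmeas T0 sL) sT.
Qed.

Lemma velf_tmeasurable s i : s \in `[0, T] -> tmeasurable (velf p i s).
Proof. by move=> sT; exact: tmeas_slice (velf_tmeas T0 sol i) sT. Qed.

Lemma ikinetic_tmeasurable s : s \in `[0, T] -> tmeasurable (fun x => (kinetic (p s x))^-1).
Proof.
have [L sL] : exists L, stl T L (fun s x => (kinetic (p s x))^-1).
  by apply: (sol_stl sol (g := fun P => (kinetic P)^-1) (c := d%:R)) => // P Q; exact: ikinetic_lip.
by move=> sT; apply: tmeas_slice (stl_tmeas T0 sL) sT.
Qed.

End one.

Variables (rho10 rho20 : vec -> R) (p10 p20 : vec -> vec) (rho1 rho2 : R -> vec -> R) (p1 p2 : R -> vec -> vec).
Hypothesis (sol1 : EP_solution G T rho10 p10 rho1 p1) (sol2 : EP_solution G T rho20 p20 rho2 p2).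

Let m s x := rho1 s x - rho2 s x.
Let J j s x := momf rho1 p1 j s x - momf rho2 p2 j s x.
Let et := etaf p1 p2.

Lemma m_L1 s : s \in `[0, T] -> L1 (m s).
Proof. by move=> sT; apply: L1B; [exact: rho_L1 sol1 _ sT|exact: rho_L1 sol2 _ sT]. Qed.

Lemma tint_m s : s \in `[0, T] -> tint (m s) = 0.
Proof.
move=> sT; rewrite tintB ?(tint_rho sol1 sT) ?(tint_rho sol2 sT) ?subrr//.
  exact: (rho_L1 sol1 sT).2.
exact: (rho_L1 sol2 sT).2.
Qed.

Lemma m_force_bound : exists2 B, 0 <= B & forall s, s \in `[0, T] ->
  (forall j, {ae mu, forall y : cell, `|conv (Gj G j) (m s) (pt y)| <= B}) /\
  {ae mu, forall y : cell, `|conv V (m s) (pt y)| <= B}.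
Proof.
have [B1 B10 H1] := sol_force_bound hV hG T0 sol1; have [B2 B20 H2] := sol_force_bound hV hG T0 sol2.
exists (B1 + B2); first exact: addr_ge0.
move=> s sT; have [g1 v1] := H1 s sT; have [g2 v2] := H2 s sT.
have L1s := rho_L1 sol1 sT; have L2s := rho_L1 sol2 sT.
split=> [j|].
  apply: filterS3 (conv_sub_ae (L1_G hG j) L1s L2s) (g1 j) (g2 j) => y -> h1 h2.
  by apply: (le_trans (ler_normB _ _)); exact: lerD.
apply: filterS3 (conv_sub_ae (L1_V hV) L1s L2s) v1 v2 => y -> h1 h2.
by apply: (le_trans (ler_normB _ _)); exact: lerD.
Qed.

(** The rate as delivered by the product rules, with measurable derivatives defined at every time.
    It is identified with [energy_rate] at almost every time. *)
Definition rate_rep L s :=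
  2 * (tint (fun x => rho1 s x * dt_ T L et s x) + \sum_j tint (fun x => momf rho1 p1 j s x * dx_ L et j s x))
  + 2 * \sum_j tint (fun x => J j s x * conv (Gj G j) (m s) x).

Lemma energy_prim L : stl T L et -> prim T (energy V rho1 rho2 p1 p2) (rate_rep L).
Proof.
move=> sE; have [B B0 HB] := m_force_bound.
apply: primD.
  apply: primZ; apply: (transport_test T0 (sol_transported T0 sol1) sE (eta_aediff sol1 sol2)).
  exact: rho_tmeas sol1.
apply: (transport_potential hV hG T0 B0 (transportedB (sol_transported T0 sol1) (sol_transported T0 sol2))).
  by move=> s j sT; have [h _] := HB s sT; exact: h.
by move=> s sT; have [_ h] := HB s sT.
Qed.

Section slice.
Variables (s L : R).
Hypotheses (d0 : (0 < d)%N) (sT' : s \in `]0, T[) (sE : stl T L et).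
Let sT : s \in `[0, T] := subset_itv_oo_cc sT'.
Let gm j x := conv (Gj G j) (m s) x.
(** [I1], [Ib] and [Ic] are the three integrands of [energy_rate], and [Xf] is the rate of the
    kinetic part. [Ia] is the work of the force difference, which appears with opposite signs in the
    kinetic and the potential part and cancels. *)
Let Ia x := rho1 s x * dotv (vel (p1 s x) - vel (p2 s x)) (convv G (m s) x).
Let Ib x := rho1 s x * dotv (vel (p1 s x) - vel (p2 s x)) ((p1 s x - p2 s x) *m ('J (vel \o p2 s) x)^T).
Let Ic x := rho1 s x * dotv (convv G (rho2 s) x)
  ((p1 s x - p2 s x) *m hessian kinetic (p2 s x) - (grad kinetic (p1 s x) - grad kinetic (p2 s x))).
Let I1 x := dotv (vel (p2 s x)) (convv G (m s) x) * m s x.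
Let Xf x := rho1 s x * dt_ T L et s x + \sum_j momf rho1 p1 j s x * dx_ L et j s x.

Hypothesis Hder : {ae mu, forall y : cell,
  dt_ T L et s (pt y) = eta_dt p1 p2 s (pt y) /\ forall j, dx_ L et j s (pt y) = eta_dx p1 p2 j s (pt y)}.
Hypothesis Hmom1 : {ae mu, forall y : cell, differentiable (p1 s) (pt y) /\
  'D_1 (p1 ^~ (pt y)) s + vel (p1 s (pt y)) *m 'J (p1 s) (pt y) = - convv G (rho1 s) (pt y)}.
Hypothesis Hmom2 : {ae mu, forall y : cell, differentiable (p2 s) (pt y) /\
  'D_1 (p2 ^~ (pt y)) s + vel (p2 s (pt y)) *m 'J (p2 s) (pt y) = - convv G (rho2 s) (pt y)}.

Lemma Xf_ae : {ae mu, forall y : cell, Ib (pt y) = Ic (pt y) - Ia (pt y) - Xf (pt y)}.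
Proof.
have L1s := rho_L1 sol1 sT; have L2s := rho_L1 sol2 sT.
have Hsub : {ae mu, forall y : cell, convv G (m s) (pt y) = convv G (rho1 s) (pt y) - convv G (rho2 s) (pt y)}.
  have : {ae mu, forall y : cell, forall j, conv (Gj G j) (m s) (pt y) = conv (Gj G j) (rho1 s) (pt y) - conv (Gj G j) (rho2 s) (pt y)}.
    by apply: filter_forall => j; exact: conv_sub_ae (L1_G hG j) L1s L2s.
  by apply: filterS => y h; apply/rowP => j; rewrite vecBE !convv_coord h.
apply: filterS2 (filterI Hder Hsub) (filterI Hmom1 Hmom2) => y [[e1 e2] e3] [[d1 m1] [d2 m2]].
set x := pt y in e1 e2 e3 d1 d2 m1 m2 *.
have := eta_rate_algebra m1 m2 (fun i j => jacobian_vel i j d2).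
rewrite /Ib /Ic /Ia /Xf e1 mul_hessian_kinetic !grad_kinetic e3.
set w := vel (p1 s x) - vel (p2 s x).
have -> : \sum_j momf rho1 p1 j s x * dx_ L et j s x =
  rho1 s x * \sum_j vel (p1 s x) 0 j * (dotv w (row j ('J (p1 s) x)) - dotv (Hv (p2 s x) (row j ('J (p2 s) x))) (p1 s x - p2 s x)).
  rewrite mulr_sumr; apply: eq_bigr => j _.
  have r1 := row_jacobian j d1; have r2 := row_jacobian j d2.
  have -> : momf rho1 p1 j s x = rho1 s x * vel (p1 s x) 0 j by [].
  have e2j := e2 j; rewrite /eta_dx -r1 -r2 -/w in e2j; rewrite e2j.
  exact: (esym (mulrA _ _ _)).
rewrite -mulrDr /eta_dt -/w => ->.
by rewrite -!mulrBr; congr (_ * _); ring.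
Qed.

Hypothesis Hforce : exists2 B, 0 <= B &
  [/\ forall j, {ae mu, forall y : cell, `|conv (Gj G j) (m s) (pt y)| <= B},
      {ae mu, forall y : cell, `|conv V (m s) (pt y)| <= B} &
      forall j, {ae mu, forall y : cell, `|conv (Gj G j) (rho2 s) (pt y)| <= B}].

Lemma gm_L1 j : L1 (gm j).
Proof. by have [] := L1_conv (L1_G hG j) (m_L1 sT). Qed.

Lemma Ia_integrable : tintegrable Ia.
Proof.
have [B B0 [HB _ _]] := Hforce.
apply: (@eq_tintegrable _ _ (fun x => \sum_j (velf p1 j s x - velf p2 j s x) * (gm j x * rho1 s x))).
  move=> x; rewrite /Ia /dotv mulr_sumr; apply: eq_bigr => j _.
  by rewrite vecBE convv_coord /velf /gm; ring.
apply: tintegrable_sum => j.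
apply: (tintegrable_prod3 (c := 1 + 1) _ _ (gm_L1 j) (HB j) (rho_L1 sol1 sT)).
  by apply: tmeasurableB; [exact: velf_tmeasurable sol1 _ j sT|exact: velf_tmeasurable sol2 _ j sT].
by move=> x; apply: (le_trans (ler_normB _ _)); rewrite lerD// velf_le.
Qed.

Lemma I1E x : I1 x = \sum_j velf p2 j s x * (gm j x * m s x).
Proof.
rewrite /I1 /dotv mulr_suml; apply: eq_bigr => j _.
by rewrite convv_coord /velf /gm mulrA.
Qed.

Lemma I1_term_integrable j : tintegrable (fun x => velf p2 j s x * (gm j x * m s x)).
Proof.
have [B B0 [HB _ _]] := Hforce.
apply: (tintegrable_prod3 (c := 1) _ _ (gm_L1 j) (HB j) (m_L1 sT)).
  exact: velf_tmeasurable sol2 _ j sT.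
by move=> x; exact: velf_le.
Qed.

Lemma I1_integrable : tintegrable I1.
Proof.
apply: (@eq_tintegrable _ _ (fun x => \sum_j velf p2 j s x * (gm j x * m s x))).
  by move=> x; rewrite I1E.
by apply: tintegrable_sum => j; exact: I1_term_integrable.
Qed.

Lemma Ic_integrable : tintegrable Ic.
Proof.
have [B B0 [_ _ HB]] := Hforce.
have [c1 c10 pc1] := sol_p_bound T0 sol1; have [c2 c20 pc2] := sol_p_bound T0 sol2.
have Lg j : L1 (conv (Gj G j) (rho2 s)) by have [] := L1_conv (L1_G hG j) (rho_L1 sol2 sT).
pose q j x := Hv (p2 s x) (p1 s x - p2 s x) 0 j - (velf p1 j s x - velf p2 j s x).
apply: (@eq_tintegrable _ _ (fun x => \sum_j q j x * (conv (Gj G j) (rho2 s) x * rho1 s x))).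
  move=> x; rewrite /Ic /dotv mulr_sumr; apply: eq_bigr => j _.
  rewrite mul_hessian_kinetic !grad_kinetic convv_coord (vecBE (Hv _ _)) (vecBE (vel _)) /q /velf; ring.
apply: tintegrable_sum => j.
have mp1 i : tmeasurable (fun x => p1 s x 0 i) by exact: (p_tmeasurable sol1 i sT).
have mp2 i : tmeasurable (fun x => p2 s x 0 i) by exact: (p_tmeasurable sol2 i sT).
have mk := ikinetic_tmeasurable sol2 sT.
have mB i : tmeasurable (fun x => p1 s x 0 i - p2 s x 0 i) by exact: tmeasurableB.
apply: (tintegrable_prod3 (c := (1 + d%:R) * (c1 + c2) + (1 + 1)) _ _ (Lg j) (HB j) (rho_L1 sol1 sT)).
  apply: tmeasurableB; last by apply: tmeasurableB; [exact: velf_tmeasurable sol1 _ j sT|exact: velf_tmeasurable sol2 _ j sT].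
  rewrite (_ : (fun x => _) = fun x => (kinetic (p2 s x))^-1 * (p1 s x 0 j - p2 s x 0 j) -
     ((\sum_i p2 s x 0 i * (p1 s x 0 i - p2 s x 0 i)) * ((kinetic (p2 s x))^-1 * ((kinetic (p2 s x))^-1 * (kinetic (p2 s x))^-1))) * p2 s x 0 j).
    apply: tmeasurableB; first exact: tmeasurableM.
    apply: tmeasurableM => //; apply: tmeasurableM; last by do 2 apply: tmeasurableM => //.
    by apply: tmeasurable_sum => i; exact: tmeasurableM.
  apply/funext => x; rewrite /Hv vecBE !vecZE vecBE.
  have -> : dotv (p2 s x) (p1 s x - p2 s x) = \sum_i p2 s x 0 i * (p1 s x 0 i - p2 s x 0 i).
    by apply: eq_bigr => i _; rewrite vecBE.
  congr (_ - _ * _ * _); move: (kinetic _) => k.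
  by rewrite -!invfM -expr2 -exprS.
move=> x; apply: (le_trans (ler_normB _ _)); apply: lerD; last first.
  by apply: (le_trans (ler_normB _ _)); rewrite lerD// velf_le.
apply: Hv_coord_le; first exact: addr_ge0.
move=> i; rewrite vecBE; apply: (le_trans (ler_normB _ _)); apply: lerD.
  exact: le_trans (norm_coord_le _ _) (pc1 _ _ sT).
exact: le_trans (norm_coord_le _ _) (pc2 _ _ sT).
Qed.

Lemma dt_term_integrable : tintegrable (fun x => rho1 s x * dt_ T L et s x).
Proof.
apply: (@eq_tintegrable _ _ (fun x => dt_ T L et s x * rho1 s x)); first by move=> x; rewrite mulrC.
apply: (tintegrableM (rho_L1 sol1 sT).2 (tmeas_slice (dt_tmeas T0 sE) sT) (c := L)).
by move=> x; apply: clsup_bound; case: sE.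
Qed.

Lemma dx_term_integrable j : tintegrable (fun x => momf rho1 p1 j s x * dx_ L et j s x).
Proof.
apply: (@eq_tintegrable _ _ (fun x => dx_ L et j s x * momf rho1 p1 j s x)); first by move=> x; rewrite mulrC.
apply: (tintegrableM (momf_L1 T0 sol1 j sT).2 (L1_measurable (dx_L1 j T0 sE sT)) (c := L)).
by move=> x; apply: clsup_bound; case: sE.
Qed.

Lemma Xf_integrable : tintegrable Xf.
Proof.
apply: tintegrableD; first exact: dt_term_integrable.
by apply: tintegrable_sum => j; exact: dx_term_integrable.
Qed.

(* The Jacobian of v(p_2) is not known to be measurable; along the equations the
   integrand agrees almost everywhere with an integrable function. *)
Lemma Ib_repr : exists h, [/\ tintegrable h, {ae mu, forall y : cell, Ib (pt y) = h (pt y)} &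
  tint h = tint Ic - tint Ia - tint Xf].
Proof.
have iA := Ia_integrable; have iC := Ic_integrable; have iX := Xf_integrable.
exists (fun x => Ic x - Ia x - Xf x); split; last by rewrite !tintB//; exact: tintegrableB.
  by apply: tintegrableB => //; exact: tintegrableB.
exact: Xf_ae.
Qed.

Lemma rate_repE : rate_rep L s = energy_rate G rho1 rho2 p1 p2 s.
Proof.
have iA := Ia_integrable; have iC := Ic_integrable; have iX := Xf_integrable; have i1 := I1_integrable.
have [B B0 [HB _ _]] := Hforce.
have [h [ih hb he]] := Ib_repr.
have eX : tint Xf = tint (fun x => rho1 s x * dt_ T L et s x) + \sum_j tint (fun x => momf rho1 p1 j s x * dx_ L et j s x).
  rewrite tintD; [|exact: dt_term_integrable|by apply: tintegrable_sum => j; exact: dx_term_integrable].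
  by rewrite tint_sum//; exact: dx_term_integrable.
(* The difference of currents is [rho1 (v1 - v2) + (rho1 - rho2) v2]. *)
have eJ : \sum_j tint (fun x => J j s x * gm j x) = tint Ia + tint I1.
  rewrite -tintD// -tint_sum.
    apply: eq_tint => x; rewrite I1E /Ia /dotv mulr_sumr -big_split; apply: eq_bigr => j _.
    rewrite /J /momf /velf convv_coord /gm (vecBE (vel _)) /m /=; ring.
  move=> j; apply: (@eq_tintegrable _ _ (fun x => gm j x * J j s x)); first by move=> x; rewrite mulrC.
  apply: (tintegrableM_ae _ (L1_measurable (gm_L1 j)) (HB j)).
  by apply: tintegrableB; [exact: (momf_L1 T0 sol1 j sT).2|exact: (momf_L1 T0 sol2 j sT).2].
rewrite /rate_rep -eX eJ /energy_rate -/I1.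
rewrite -[tint (fun x => rho1 s x * dotv (vel (p1 s x) - _) _)]/(tint Ib) (ae_eq_tint hb) he.
rewrite -[tint (fun x => dotv _ _ * _)]/(tint I1) -[X in _ = _ + 2 * X]/(tint Ic).
by move: (tint I1) (tint Ia) (tint Ic) (tint Xf) => *; ring.
Qed.

(** The leading 1 only ensures positivity. The other terms bound [I1], [Ib] and [Ic] in this order:
    [(1 + d) M] bounds the Jacobian of [v(p2)], [1 + d M^2] the square of [kinetic p2], and [F] the
    force of [rho2]. *)
Definition rate_const (F M : R) : R :=
  1 + 4 * d%:R * ((1 + d%:R) * M) + d%:R ^+ 2 * ((1 + d%:R) * M) * (4 * (1 + d%:R * M ^+ 2))
    + d%:R * F * (4 * (1 + d%:R * M ^+ 2) + 1).

Variables (F M : R).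
Hypotheses (F0 : 0 <= F) (M0 : 0 <= M).
Hypothesis HM : {ae mu, forall y : cell, `|p2 s (pt y)| <= M /\ `|'J (p2 s) (pt y)| <= M}.
Hypothesis HF : forall j, {ae mu, forall y : cell, `|conv (Gj G j) (rho2 s) (pt y)| <= F}.
Hypothesis Hvel : exists2 Lv, forall j, stl T Lv (velf p2 j) &
  forall i, {ae mu, forall y : cell, forall j,
    dq (velf p2 i s) (evec j) (pt y) @ \oo --> dx_ Lv (velf p2 i) j s (pt y) /\
    dx_ Lv (velf p2 i) j s (pt y) = velf_dx p2 i j s (pt y)}.

Lemma eta_integrable : tintegrable (fun x => et s x * rho1 s x).
Proof.
have [c c0 ec] := stl_bounded T0 sE.
apply: (tintegrableM (rho_L1 sol1 sT).2 (tmeas_slice (stl_tmeas T0 sE) sT) (c := c)).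
by move=> x; exact: ec.
Qed.

Lemma kinetic_sqr_le : {ae mu, forall y : cell, kinetic (p2 s (pt y)) ^+ 2 <= 1 + d%:R * M ^+ 2}.
Proof.
apply: filterS HM => y [h _]; rewrite kinetic_sqr lerD2l; apply: (le_trans (ler_norm _)).
apply: (le_trans (dotv_norm_le _ _)); rewrite ler_wpM2l// expr2 ler_pM//.
Qed.

(** Each of the [d^2] entries is a product estimated by [vel_dist_eta], times an entry of the
    Jacobian. The integrand is first replaced by the integrable [h] of [Ib_repr]. *)
Lemma Ib_bound : `|tint Ib| <= d%:R ^+ 2 * ((1 + d%:R) * M) * (4 * (1 + d%:R * M ^+ 2)) * tint (fun x => et s x * rho1 s x).
Proof.
have [h [ih hb _]] := Ib_repr; rewrite (ae_eq_tint hb) -tintZ; last exact: eta_integrable.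
apply: ae_norm_tint_le => //; first by apply: tintegrableZ; exact: eta_integrable.
apply: filterS2 (filterI hb HM) (filterI kinetic_sqr_le Hmom2) => y [<- [h1 h2]] [h3 [dp _]].
set x := pt y in h1 h2 h3 dp *; rewrite /Ib.
have r0 := EP_rho_ge0 sol1 x sT; have e0 := eta_ge0 (p1 s x) (p2 s x).
rewrite normrM (ger0_norm r0) mulrC [leRHS]mulrA ler_wpM2r//.
rewrite (_ : dotv _ _ = \sum_i \sum_j (vel (p1 s x) - vel (p2 s x)) 0 i * (p1 s x - p2 s x) 0 j * 'J (vel \o p2 s) x i j); last first.
  rewrite /dotv; apply: eq_bigr => i _; rewrite [X in _ * X]mxE mulr_sumr; apply: eq_bigr => j _.
  by rewrite [X in _ * (_ * X)]mxE mulrA.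
apply: (@le_trans _ _ (\sum_(i < d) \sum_(j < d) (4 * (1 + d%:R * M ^+ 2) * et s x) * ((1 + d%:R) * M))).
  apply: (le_trans (ler_norm_sum _ _ _)); apply: ler_sum => i _.
  apply: (le_trans (ler_norm_sum _ _ _)); apply: ler_sum => j _.
  rewrite normrM ler_pM//.
    apply: (le_trans (vel_dist_eta _ _ _ _)); rewrite ler_wpM2r//.
    by rewrite ler_wpM2l.
  rewrite jacobian_vel//; apply: Hv_coord_le => // k; rewrite mxE.
  exact: le_trans (norm_row_jacobian_le _ _ _) h2.
rewrite !sumr_const_ord /et; move: (1 + d%:R * M ^+ 2) ((1 + d%:R) * M) (etaf p1 p2 s x) => u v e.
by rewrite le_eqVlt; apply/orP; left; apply/eqP; ring.
Qed.

Lemma Ic_bound : `|tint Ic| <= d%:R * F * (4 * (1 + d%:R * M ^+ 2) + 1) * tint (fun x => et s x * rho1 s x).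
Proof.
rewrite -tintZ; last exact: eta_integrable.
apply: ae_norm_tint_le; [exact: Ic_integrable|by apply: tintegrableZ; exact: eta_integrable|].
have HF' : {ae mu, forall y : cell, forall j, `|conv (Gj G j) (rho2 s) (pt y)| <= F} by apply: filter_forall.
apply: filterS2 HF' kinetic_sqr_le => y h1 h3; set x := pt y in h1 h3 *; rewrite /Ic.
have r0 := EP_rho_ge0 sol1 x sT; have e0 := eta_ge0 (p1 s x) (p2 s x).
rewrite normrM (ger0_norm r0) mulrC [leRHS]mulrA ler_wpM2r// mul_hessian_kinetic !grad_kinetic.
apply: (le_trans (ler_norm_sum _ _ _)).
apply: (@le_trans _ _ (\sum_(j < d) F * ((4 * (1 + d%:R * M ^+ 2) + 1) * et s x))); last first.
  by rewrite sumr_const_ord !mulrA.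
apply: ler_sum => j _; rewrite normrM convv_coord ler_pM//.
apply: (le_trans (Hv_vel_eta _ _ _)); rewrite ler_wpM2r// lerD2r ler_wpM2l//.
Qed.

(** The stress term is charged to the potential energy, the two others to the kinetic part. Both
    parts are nonnegative, so the constants may be added. *)
Lemma energy_rate_le : energy_rate G rho1 rho2 p1 p2 s <= rate_const F M * energy V rho1 rho2 p1 p2 s.
Proof.
have [B B0 [HB HV HB2]] := Hforce; have [Lv sv Hdx] := Hvel; have LV0 : 0 <= Lv by case: (sv (Ordinal d0)).
set Et := tint (fun x => et s x * rho1 s x); set P := tint (fun x => conv V (m s) x * m s x).
have [Hst P0] : `|tint I1| <= 2 * d%:R * ((1 + d%:R) * M) * P /\ 0 <= P.
  have -> : tint I1 = \sum_i tint (fun x => velf p2 i s x * (conv (Gj G i) (m s) x * m s x)).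
    rewrite -tint_sum; last by move=> j; exact: I1_term_integrable.
    by apply: eq_tint => x; rewrite I1E.
  apply: (stress_bound hV hG (w := fun i => velf p2 i s) (dw := fun j i => dx_ Lv (velf p2 i) j s) (L := Lv) (B := B) (c := 1)) => //.
  - by rewrite mulr_ge0// addr_ge0.
  - exact: m_L1.
  - exact: tint_m.
  - by move=> i; exact: stl_L1 T0 (sv i) sT.
  - by move=> i x; exact: velf_le.
  - by move=> i y z; exact: stl_lip (sv i) sT y z.
  - by move=> i j; apply: filterS (Hdx i) => y /(_ j) [].
  - by move=> i j; exact: L1_measurable (dx_L1 j T0 (sv i) sT).
  - move=> i j; apply: filterS3 (Hdx i) HM Hmom2 => y /(_ j) [_ ->] [_ h] [dp _].
    apply: Hv_coord_le => // k; rewrite -(row_jacobian j dp) mxE.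
    exact: le_trans (norm_row_jacobian_le _ _ _) h.
have Et0 : 0 <= Et by apply: tint_ge0 => x; rewrite mulr_ge0 ?eta_ge0// (EP_rho_ge0 sol1).
have b1 := Ib_bound; have b2 := Ic_bound; rewrite -/Et in b1 b2.
have -> : energy_rate G rho1 rho2 p1 p2 s = 2 * tint I1 - 2 * tint Ib + 2 * tint Ic by [].
have -> : energy V rho1 rho2 p1 p2 s = 2 * Et + P by [].
rewrite /rate_const; set c1 := (1 + d%:R) * M in Hst b1 *; set c2 := 4 * _ in b1 b2 *.
have n1 := ler_norm (tint I1); have n2 := ler_norm (- tint Ib); have n3 := ler_norm (tint Ic); rewrite normrN in n2.
have c10 : 0 <= c1 by rewrite mulr_ge0// addr_ge0.
have c20 : 0 <= c2 by rewrite mulr_ge0// addr_ge0// mulr_ge0// sqr_ge0.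
set cb := d%:R ^+ 2 * c1 * c2 in b1 *; set cc := d%:R * F * (c2 + 1) in b2 *.
have cb0 : 0 <= cb by exact: mulr_ge0 (mulr_ge0 (sqr_ge0 _) c10) c20.
have cc0 : 0 <= cc by exact: mulr_ge0 (mulr_ge0 (ler0n _ _) F0) (addr_ge0 c20 ler01).
have ca0 : 0 <= d%:R * c1 by rewrite mulr_ge0.
have -> : 4 * d%:R * c1 = 4 * (d%:R * c1) by rewrite mulrA.
have e1 : 2 * d%:R * c1 * P = 2 * ((d%:R * c1) * P) by rewrite !mulrA.
rewrite e1 in Hst; move: (d%:R * c1) ca0 Hst => ca ca0 Hst.
have f1 := mulr_ge0 ca0 Et0; have f2 := mulr_ge0 cb0 P0; have f3 := mulr_ge0 cc0 P0.
by move: (tint I1) (tint Ib) (tint Ic) n1 n2 n3 Hst b1 b2 => i1 ib ic; nra.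
Qed.

End slice.
End energy_estimate.

(** * Almost every time, and the conclusion *)

Section assembly.
Context {R : realType} {d : nat}.
Local Notation vec := 'rV[R]_d.
Local Notation cell := (d.-tuple (measurableTypeR R)).
Local Notation mu := (torus R d).
Local Notation leb := (@lebesgue_measure R).
Local Notation conv := Defs.conv.

Lemma Loo_time_fine_ae T (N : R -> \bar R) : (forall s, 0 <= N s)%E -> (Loo_time T N < +oo)%E ->
  {ae leb, forall s, s \in `]0, T[ -> (N s <= (`|fine (Loo_time T N)|)%:E)%E}.
Proof.
move=> N0 Noo; have aeF := ae_filter_ringOfSetsType leb; have := Loo_time_ae T N; apply: filterS => s H sT; have {H} Hs := H sT.
apply: (le_trans Hs); have h0 := le_trans (N0 s) Hs.
have f : Loo_time T N \is a fin_num by rewrite ge0_fin_numE.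
by rewrite -{1}(fineK f) lee_fin ler_norm.
Qed.

Lemma W1oo_norm_ge0 (w : vec -> vec) : (0 <= W1oo_norm w)%E.
Proof. by rewrite /W1oo_norm le_max Lnorm_ge0. Qed.

Variables (V : vec -> R) (G : vec -> vec) (a : R).
Hypotheses (d2 : (2 <= d)%N) (hV : coulomb_potential V) (hG : weak_gradient V G) (ha : d%:R < a).

Lemma uniform_force_bound : exists2 A : R -> R, (forall Na, 0 <= Na -> 0 <= A Na) &
  forall j r Na b, 0 <= Na -> 0 <= b -> L1 r -> (forall y, 0 <= r y) -> tint r = 1 ->
  tintegrable (fun y => r y `^ a) -> tint (fun y => r y `^ a) <= Na ->
  {ae mu, forall y : cell, `|conv (Gj G j) r (pt y)| <= b} ->
  {ae mu, forall y : cell, `|conv (Gj G j) r (pt y)| <= A Na}.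
Proof.
have H j : exists A : R -> R, (forall Na, 0 <= Na -> 0 <= A Na) /\
  forall r Na b, 0 <= Na -> 0 <= b -> L1 r -> (forall y, 0 <= r y) -> tint r = 1 ->
  tintegrable (fun y => r y `^ a) -> tint (fun y => r y `^ a) <= Na ->
  {ae mu, forall y : cell, `|conv (Gj G j) r (pt y)| <= b} ->
  {ae mu, forall y : cell, `|conv (Gj G j) r (pt y)| <= A Na}.
  by have [A A0 HA] := force_bound d2 ha hV hG j; exists A.
have [A HA] := choice H.
have A0 j Na : 0 <= Na -> 0 <= A j Na by have [h _] := HA j; exact: h.
exists (fun Na => \sum_j A j Na).
  by move=> Na Na0; apply: sumr_ge0 => j _; exact: A0.
move=> j r Na b Na0 b0 Lr r0 r1 ira rNa gb.
have [_ h] := HA j; have := h r Na b Na0 b0 Lr r0 r1 ira rNa gb; apply: filterS => y hy.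
by apply: (le_trans hy); rewrite (bigD1 j)//= lerDl sumr_ge0// => i _; exact: A0.
Qed.

Lemma rate_const_gt0 (F M : R) : 0 <= F -> 0 <= M -> 0 < rate_const (d := d) F M.
Proof.
move=> F0 M0; have M2 : 0 <= 4 * (1 + d%:R * M ^+ 2).
  by apply: mulr_ge0 => //; apply: addr_ge0 => //; apply: mulr_ge0 => //; exact: sqr_ge0.
have c0 : 0 <= (1 + d%:R) * M by apply: mulr_ge0 => //; exact: addr_ge0.
rewrite /rate_const -!addrA ltr_pwDl//; apply: addr_ge0; first by apply: mulr_ge0 => //; exact: mulr_ge0.
apply: addr_ge0; first by apply: mulr_ge0 => //; apply: mulr_ge0 => //; exact: sqr_ge0.
by apply: mulr_ge0; [exact: mulr_ge0|exact: addr_ge0].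
Qed.

Variable (T : R).
Hypothesis T0 : 0 < T.
Variables (rho10 rho20 : vec -> R) (p10 p20 : vec -> vec) (rho1 rho2 : R -> vec -> R) (p1 p2 : R -> vec -> vec).
Hypothesis (sol1 : EP_solution G T rho10 p10 rho1 p1) (sol2 : EP_solution G T rho20 p20 rho2 p2).

Lemma slice_force_bound s : s \in `[0, T] -> exists2 B, 0 <= B &
  [/\ forall j, {ae mu, forall y : cell, `|conv (Gj G j) (fun x => rho1 s x - rho2 s x) (pt y)| <= B},
      {ae mu, forall y : cell, `|conv V (fun x => rho1 s x - rho2 s x) (pt y)| <= B} &
      forall j, {ae mu, forall y : cell, `|conv (Gj G j) (rho2 s) (pt y)| <= B}].
Proof.
move=> sT; have [B1 B10 H1] := m_force_bound hV hG T0 sol1 sol2.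
have [B2 B20 H2] := sol_force_bound hV hG T0 sol2.
have [g1 v1] := H1 s sT; have [g2 _] := H2 s sT.
exists (B1 + B2); first exact: addr_ge0.
split=> [j||j].
- by move: (g1 j); apply: filterS => y /le_trans; apply; rewrite lerDl.
- by move: v1; apply: filterS => y /le_trans; apply; rewrite lerDl.
- by move: (g2 j); apply: filterS => y /le_trans; apply; rewrite lerDr.
Qed.

Lemma rate_repE_ae L : stl T L (etaf p1 p2) -> {ae leb, forall s, s \in `]0, T[ ->
  rate_rep G T rho1 rho2 p1 p2 L s = energy_rate G rho1 rho2 p1 p2 s}.
Proof.
move=> sE; have h := stl_ae_cvg T0 sE (eta_aediff sol1 sol2).
have aeF := ae_filter_ringOfSetsType leb.
apply: filterS3 h (momentum_slice sol1) (momentum_slice sol2) => s Hs M1 M2 sT.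
have sT' := subset_itv_oo_cc sT.
apply: (rate_repE hG T0 sol1 sol2 sT sE _ (M1 sT) (M2 sT) (slice_force_bound sT')).
by have := Hs sT; apply: filterS => y [_ _ -> e]; split.
Qed.

(** The finite bound from [sol_force_bound] only feeds the hypothesis of [HA]. What enters the
    constant is [A] at the [a]-th power of [No], hence a function of the norms. *)
Lemma rate_bound_ae (A : R -> R) (Mo No : R) : (forall Na, 0 <= Na -> 0 <= A Na) ->
  (forall j r Na b, 0 <= Na -> 0 <= b -> L1 r -> (forall y, 0 <= r y) -> tint r = 1 ->
  tintegrable (fun y => r y `^ a) -> tint (fun y => r y `^ a) <= Na ->
  {ae mu, forall y : cell, `|conv (Gj G j) r (pt y)| <= b} ->
  {ae mu, forall y : cell, `|conv (Gj G j) r (pt y)| <= A Na}) ->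
  0 <= Mo -> 0 <= No ->
  {ae leb, forall s, s \in `]0, T[ -> (W1oo_norm (p2 s) <= Mo%:E)%E} ->
  {ae leb, forall s, s \in `]0, T[ -> (La_norm a (rho2 s) <= No%:E)%E} ->
  {ae leb, forall s, s \in `]0, T[ ->
    energy_rate G rho1 rho2 p1 p2 s <= rate_const (d := d) (A (No `^ a)) Mo * energy V rho1 rho2 p1 p2 s}.
Proof.
move=> A0 HA Mo0 No0 HMo HNo.
have [L sE] := eta_stl T0 sol1 sol2; have [Lv sv] := velf_stl sol2.
have aeF := ae_filter_ringOfSetsType leb.
have h := stl_ae_cvg T0 sE (eta_aediff sol1 sol2).
have hv : {ae leb, forall s, forall i, s \in `]0, T[ -> {ae mu, forall y : cell,
    [/\ dq (fun t => velf p2 i (clip T t) (pt y)) 1 s @ \oo --> dt_ T Lv (velf p2 i) s (pt y),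
      forall j, dq (velf p2 i s) (evec j) (pt y) @ \oo --> dx_ Lv (velf p2 i) j s (pt y),
      dt_ T Lv (velf p2 i) s (pt y) = velf_dt p2 i s (pt y) &
      forall j, dx_ Lv (velf p2 i) j s (pt y) = velf_dx p2 i j s (pt y)]}}.
  by apply: filter_forall => i; exact: stl_ae_cvg T0 (sv i) (velf_aediff sol2 i).
apply: filterS2 (filterI (filterI h hv) (filterI HMo HNo)) (filterI (momentum_slice sol1) (momentum_slice sol2)).
move=> s [[Hs Hv] [HM HN]] [M1 M2] sT; have sT' := subset_itv_oo_cc sT.
have a0 : 0 < a by apply: le_lt_trans ha.
apply: (energy_rate_le hV hG T0 sol1 sol2 (ltnW d2) sT sE _ (M1 sT) (M2 sT) (slice_force_bound sT') _ Mo0 (W1oo_norm_ae (HM sT))).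
- by have := Hs sT; apply: filterS => y [_ _ -> e]; split.
- by apply: A0; exact: powR_ge0.
- move=> j; have [B B0 HB] := sol_force_bound hV hG T0 sol2; have [gB _] := HB s sT'.
  have L1s := rho_L1 sol2 sT'.
  have [i1 i2] := La_norm_integral a0 No0 (L1_measurable L1s) (fun x => EP_rho_ge0 sol2 x sT') (HN sT).
  exact: (HA j _ _ B (powR_ge0 _ _) B0 L1s (fun x => EP_rho_ge0 sol2 x sT') (tint_rho sol2 sT') i1 i2 (gB j)).
- exists Lv => // i; have := Hv i sT; apply: filterS => y [_ e1 _ e2] j; split; [exact: e1|exact: e2].
Qed.

End assembly.

(** The momentum equation holds almost everywhere, so the derivative of the energy is identified at
    almost every time. Lipschitz continuity is part of the conclusion because with it this amounts
    to the integrated identity. The function [C] is chosen before [T] and the solutions. *)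
Theorem theorem1p2 (R : realType) (d : nat) (hd : (2 <= d)%N)
    (V : 'rV[R]_d -> R) (hV : coulomb_potential V)
    (gradV : 'rV[R]_d -> 'rV[R]_d) (hgradV : weak_gradient V gradV)
    (a : R) (ha : d%:R < a) :
  exists C : R -> R -> R, (forall M N, 0 < C M N) /\
  forall (T : R) (rho10 rho20 : 'rV[R]_d -> R) (p10 p20 : 'rV[R]_d -> 'rV[R]_d)
    (rho1 rho2 : R -> 'rV[R]_d -> R) (p1 p2 : R -> 'rV[R]_d -> 'rV[R]_d),
  0 < T ->
  EP_solution gradV T rho10 p10 rho1 p1 ->
  EP_solution gradV T rho20 p20 rho2 p2 ->
  let M := Loo_time T (fun t => W1oo_norm (p2 t)) in
  let N := Loo_time T (fun t => La_norm a (rho2 t)) in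
  (M < +oo)%E -> (N < +oo)%E ->
  let E := energy V rho1 rho2 p1 p2 in
  [/\ [lipschitz E t | t in (`[0, T] : set R)],
      {ae lebesgue_measure, forall t : R, t \in `]0, T[ ->
        is_derive t 1 E (energy_rate gradV rho1 rho2 p1 p2 t)} &
      forall t : R, t \in `[0, T] ->
        E t <= expR (C (fine M) (fine N) * t) * E 0].
Proof.
have [A A0 HA] := uniform_force_bound hd hV hgradV ha.
(* [C] is a function of two arbitrary reals; the absolute values keep it positive at negative
   arguments as well. *)
exists (fun M N => rate_const (d := d) (A (`|N| `^ a)) `|M|); split.
  by move=> M N; apply: rate_const_gt0 => //; apply: A0; exact: powR_ge0.
move=> T rho10 rho20 p10 p20 rho1 rho2 p1 p2 T0 sol1 sol2 M N Moo Noo E.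
have [L sE] := eta_stl T0 sol1 sol2.
have pE : prim T E (rate_rep gradV T rho1 rho2 p1 p2 L) by apply: (energy_prim hV hgradV T0 sol1 sol2); exact: sE.
have rE := rate_repE_ae hV hgradV T0 sol1 sol2 sE.
have aeF := ae_filter_ringOfSetsType (@lebesgue_measure R).
split.
- have [c _ Ec] := prim_lip pE; apply: (@bound_lipschitz _ _ _ c) => x y xT yT.
  exact: Ec xT yT.
- by apply: filterS2 (prim_derive pE) rE => s h e sT; rewrite -(e sT); exact: h.
- apply: (gronwall T0 pE).
  have rb := rate_bound_ae hd hV hgradV ha T0 sol1 sol2 A0 HA (normr_ge0 (fine M)) (normr_ge0 (fine N))
    (Loo_time_fine_ae (fun s => W1oo_norm_ge0 (p2 s)) Moo) (Loo_time_fine_ae (fun s => Lnorm_ge0 _ _ _) Noo).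
  by apply: filterS2 rE rb => s e h sT; rewrite (e sT); exact: h.
Qed.
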